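(* Fix $R\ge1$, $K>1$, $k\ge1$ and $K_0>0$. Let $f_1,\dots,f_K:\mathbb N\to\mathbb Z$ be multiplicative functions and $W_{i,v}\in\mathbb Z[T]$ ($1\le i\le K$, $1\le v\le k$) with $f_i(p^v)=W_{i,v}(p)$ for all primes $p$, $i\le K$, $v\le k$. Assume $W_{1,k},\dots,W_{K-1,k}$ are multiplicatively independent with $\sum_{i=1}^{K-1}\deg W_{i,k}>1$, and $W_{K,k}=\prod_{i=1}^{K-1}W_{i,k}^{\lambda_i}$ for some nonnegative integers $(\lambda_1,\dots,\lambda_{K-1})\ne(0,\dots,0)$. Then there exists a constant $C=C(W_{1,k},\dots,W_{K-1,k})>0$ such that $$\#\{n\le x: P_{Rk}(n)>q,\ f_i(n)\equiv a_i\ (\mathrm{mod}\ q)\ \forall i\in\{1,\dots,K\}\}\gg\frac1{\phi(q)^{K-1}}\cdot\frac{x^{1/k}(\log\log x)^{R-2}}{\log x}$$ as $x\to\infty$, uniformly in $k$-admissible $q\le(\log x)^{K_0}$ all of whose prime factors $\ell$ satisfy $\ell>C$ and $\gcd(\ell-1,\beta(W_{1,k},\dots,W_{K-1,k}))=1$, and in $a_1,\dots,a_K\in U_q$ with $a_K\equiv\prod_{i=1}^{K-1}a_i^{\lambda_i}\pmod q$.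
   Context: $U_q=(\mathbb Z/q\mathbb Z)^\times$. Put $W_v=\prod_{i=1}^KW_{i,v}$ and $R_v(q)=\{u\in U_q:\gcd(W_v(u),q)=1\}$; $q$ is $k$-admissible if $R_k(q)\ne\emptyset$ and $R_v(q)=\emptyset$ for all $v<k$. Polynomials $F_1,\dots,F_m\in\mathbb Z[T]$ are multiplicatively independent if no nonzero integer tuple $(c_i)$ makes $\prod_iF_i^{c_i}$ constant in $\mathbb Q(T)$. For nonconstant $F_1,\dots,F_m$, write $F_i=r_i\prod_{j\le M}G_j^{\mu_{ij}}$ ($r_i\in\mathbb Z$, $G_j$ pairwise coprime primitive irreducibles in $\mathbb Z[T]$, each occurring with positive exponent in some $F_i$); $\beta(F_1,\dots,F_m)$ is the last invariant factor $\beta_{\min\{M,m\}}$ of the Smith normal form of the $M\times m$ matrix $(\mu_{ij})$. $P_j(n)$ denotes the $j$-th largest prime factor of $n$ counted with multiplicity ($1$ if $n$ has fewer than $j$ prime factors). Implied constants depend only on the fixed data. *)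

(* Defs.v *)
From HB Require Import structures.
From mathcomp Require Import all_boot all_order all_algebra.
From mathcomp Require Import boolp classical_sets reals exp.

Set Implicit Arguments.
Unset Strict Implicit.
Unset Printing Implicit Defensive.

Import Order.TTheory GRing.Theory Num.Theory.

Local Open Scope ring_scope.

Definition arith_multiplicative (f : nat -> int) : Prop :=
  f 1%N = 1 /\
  forall m n : nat, (0 < m)%N -> (0 < n)%N -> coprime m n ->
    f (m * n)%N = f m * f n.

Definition mult_independent (m : nat) (F : 'I_m -> {poly int}) : Prop :=
  forall c : 'I_m -> int, (exists i, c i != 0) ->
    ~ exists a : rat,
        \prod_i (tofrac (map_poly intr (F i)) : {fraction {poly rat}}) ^ c i
        = tofrac a%:P.

(* Least residues: this is correct for q = 1 too, where 0 is the only unit. *)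
Definition U (q : nat) : {set 'I_q} := [set u : 'I_q | coprime u q]%SET.

Definition Wprod (K : nat) (W : 'I_K -> nat -> {poly int}) (v : nat) :
  {poly int} := \prod_i W i v.

Definition Rset (K : nat) (W : 'I_K -> nat -> {poly int}) (v q : nat) :
  {set 'I_q} := [set u in U q | coprimez (Wprod W v).[u%:Z] q%:Z]%SET.

Definition admissible (K : nat) (W : 'I_K -> nat -> {poly int}) (k q : nat) :
  Prop :=
  Rset W k q != finset.set0 /\
  forall v : nat, (0 < v < k)%N -> Rset W v q = finset.set0.

(* j is 1-based. *)
Definition largest_prime (j n : nat) : nat :=
  nth 1%N
    (sort geq (flatten [seq nseq pe.2 pe.1 | pe <- prime_decomp n])) j.-1.

(* MathComp's irreducible_poly ignores constant factors (it amounts to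
   irreducibility over the fraction field), hence this definition. *)
Definition irreducible_elt (D : idomainType) (x : D) : Prop :=
  [/\ x != 0, x \isn't a GRing.unit &
      forall a b : D, x = a * b -> a \is a GRing.unit \/ b \is a GRing.unit].

(* zcontents carries the sign of the leading coefficient. *)
Definition primitive (p : {poly int}) : Prop := `|zcontents p| = 1.

Definition factorization (m M : nat) (F : 'I_m -> {poly int})
    (r : 'I_m -> int) (G : 'I_M -> {poly int}) (mu : 'I_m -> 'I_M -> nat) :
  Prop :=
  [/\ forall i, F i = r i *: \prod_j G j ^+ mu i j,
      forall j, primitive (G j) /\ irreducible_elt (G j),
      forall j j', j != j' -> coprimep (G j) (G j') &
      forall j, exists i, (0 < mu i j)%N].

(* d 0, ..., d (minn M m).-1 are the (nonnegative) invariant factors of A. *)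
Definition smith_form (M m : nat) (A : 'M[int]_(M, m)) (d : nat -> nat) :
  Prop :=
  (forall i, (i.+1 < minn M m)%N -> (d i %| d i.+1)%N) /\
  exists (P : 'M[int]_M) (Q : 'M[int]_m),
    [/\ P \in unitmx, Q \in unitmx &
        P *m A *m Q = \matrix_(i, j) ((d i)%:Z *+ (i == j :> nat))].

Definition is_beta (m : nat) (F : 'I_m -> {poly int}) (b : nat) : Prop :=
  exists (M : nat) (r : 'I_m -> int) (G : 'I_M -> {poly int})
         (mu : 'I_m -> 'I_M -> nat) (d : nat -> nat),
    [/\ factorization F r G mu,
        smith_form (\matrix_(j, i) (mu i j)%:Z) d &
        b = d (minn M m).-1].

(* The default 0 is never taken for nonzero polynomials: see betaP. *)
Definition beta (m : nat) (F : 'I_m -> {poly int}) : nat :=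
  xget 0%N (is_beta F).

Lemma zcontentsC (c : int) : zcontents c%:P = c.
Proof.

by rewrite -alg_polyC zcontentsZ zcontents_monic ?monic1 ?mulr1.
Qed.

Lemma poly_int_unitE (p : {poly int}) : p \is a GRing.unit = (size p == 1%N) && (zcontents p \is a GRing.unit).
Proof.
rewrite poly_unitE; case: eqP => //= /eqP /size_poly1P [c c0 ->].
by rewrite zcontentsC coefC.
Qed.

Lemma primitive_factors_ex n (p : {poly int}) : (size p <= n)%N -> p != 0 ->
  exists s : seq {poly int}, (forall g, g \in s -> zcontents g = 1 /\ irreducible_elt g)
    /\ p = zcontents p *: \prod_(g <- s) g.
Proof.
elim: n p => [|n IH] p sp p0; first by move: sp; rewrite leqn0 size_poly_eq0 (negbTE p0).
pose P := zprimitive p; have P0 : P != 0 by rewrite zprimitive_eq0.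
have cP : zcontents P = 1 by rewrite zcontents_primitive p0.
have sP : size P = size p by rewrite size_zprimitive.
suff [s [hs eP]] : exists s : seq {poly int}, (forall g, g \in s -> zcontents g = 1 /\ irreducible_elt g)
    /\ P = \prod_(g <- s) g.
  by exists s; split=> //; rewrite -eP -zpolyEprim.
have [/size_poly1P [c c0 Pc]|s1] := boolP (size P == 1%N).
  exists [::]; split=> //; rewrite big_nil Pc; move: cP; rewrite Pc zcontentsC => ->; by [].
have [irr|nirr] := pselect (irreducible_elt P).
  by exists [:: P]; split=> [g|]; rewrite ?inE ?big_seq1// => /eqP ->.
have [[a b] [ab /negP au /negP bu]] : exists ab : {poly int} * {poly int},
    [/\ P = ab.1 * ab.2, ~ ab.1 \is a GRing.unit & ~ ab.2 \is a GRing.unit].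
  apply: contrapT => H; apply: nirr; split=> //; first by rewrite poly_int_unitE (negbTE s1).
  move=> a b ab; case: (boolP (a \is a GRing.unit)); [by left|move=> /negP au].
  case: (boolP (b \is a GRing.unit)); [by right|move=> /negP bu].
  by case: H; exists (a, b).
move: ab au bu => /= ab au bu.
have cab : zcontents a * zcontents b = 1 by rewrite -zcontentsM -ab.
have ca : zcontents a \is a GRing.unit by apply/unitrPr; exists (zcontents b).
have cb : zcontents b \is a GRing.unit by apply/unitrPr; exists (zcontents a); rewrite mulrC.
move: P0; rewrite ab mulf_eq0 negb_or => /andP[a0 b0].
move: au bu; rewrite !poly_int_unitE ca cb !andbT => sa sb.
have sab : (size p).+1 = (size a + size b)%N.
  rewrite -sP ab size_mul// prednK//; by rewrite addn_gt0 size_poly_gt0 a0.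
have {}sa : (1 < size a)%N by rewrite ltn_neqAle eq_sym sa size_poly_gt0.
have {}sb : (1 < size b)%N by rewrite ltn_neqAle eq_sym sb size_poly_gt0.
have la : (size a <= n)%N.
  rewrite -ltnS; apply: leq_trans sp; rewrite -ltnS sab -addn2 leq_add2l //.
have lb : (size b <= n)%N.
  rewrite -ltnS; apply: leq_trans sp; rewrite -ltnS sab addnC -addn2 leq_add2l //.
have [s [hs es]] := IH a la a0; have [t [ht et]] := IH b lb b0.
exists (s ++ t); split=> [g|]; first by rewrite mem_cat => /orP[/hs|/ht].
by rewrite es et big_cat /= -scalerAl -scalerAr scalerA cab scale1r.
Qed.

Lemma irreducible_eq (p q : {poly int}) : zcontents p = 1 -> irreducible_elt p -> zcontents q = 1 -> irreducible_elt q ->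
  ~~ coprimep p q -> p = q.
Proof.
move=> cp [p0 _ ip] cq [q0 _ iq]; rewrite /coprimep => sd.
have d0 : gcdp p q != 0 by rewrite gcdp_eq0 negb_and p0.
have key r : r != 0 -> zcontents r = 1 -> (forall a b, r = a * b -> a \is a GRing.unit \/ b \is a GRing.unit) ->
   gcdp p q %| r -> r = zprimitive (gcdp p q).
  move=> r0 cr ir /dvdpP_int [t rt].
  have [] := ir _ _ rt; first by rewrite poly_int_unitE size_zprimitive (negbTE sd).
  rewrite poly_int_unitE => /andP[/size_poly1P [c c0 tc] _].
  move: cr; rewrite {1}rt zcontentsM zcontents_primitive d0 mul1r tc zcontentsC => c1.
  by rewrite rt tc c1 mulr1.
by rewrite (key p)// ?dvdp_gcdl// -(key q)// dvdp_gcdr.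
Qed.

Lemma prod_count_mem (s L : seq {poly int}) : uniq L -> {subset s <= L} ->
  \prod_(g <- s) g = \prod_(g <- L) g ^+ count_mem g s.
Proof.
move=> uL; elim: s => [|x s IH] sL; first by rewrite big_nil big1.
rewrite big_cons IH; last by move=> g gs; apply: sL; rewrite inE gs orbT.
have xL : x \in L by apply: sL; rewrite inE eqxx.
rewrite (bigD1_seq x)//= [RHS](bigD1_seq x)//= eqxx exprS mulrA; congr (_ * _).
by apply: eq_bigr => g gx; rewrite eq_sym (negbTE gx).
Qed.

Lemma factorization_ex m (F : 'I_m -> {poly int}) : (forall i, F i != 0) ->
  exists M r (G : 'I_M -> _) mu, factorization F r G mu.
Proof.
move=> F0.
have /choice [s hs] : forall i, exists s : seq {poly int}, (forall g, g \in s -> zcontents g = 1 /\ irreducible_elt g)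
    /\ F i = zcontents (F i) *: \prod_(g <- s) g by move=> i; exact: (primitive_factors_ex (leqnn _) (F0 i)).
pose L := undup (flatten [seq s i | i <- enum 'I_m]).
have hL g : g \in L -> exists i, g \in s i.
  by rewrite mem_undup => /flatten_mapP [i _ gi]; exists i.
have gG (j : 'I_(size L)) : nth 0 L j \in L by apply: mem_nth.
exists (size L), (fun i => zcontents (F i)), (fun j => nth 0 L j),
  (fun i j => count_mem (nth 0 L j) (s i)); split.
- move=> i; rewrite {1}(hs i).2; congr (_ *: _).
  rewrite (@prod_count_mem _ L) ?undup_uniq//; last first.
    move=> g gs; rewrite mem_undup; apply/flatten_mapP; exists i => //; by rewrite mem_enum.
  by rewrite (big_nth 0) big_mkord.
- move=> j; have [i] := hL _ (gG j); case/(hs i).1 => c1 ir; split=> //.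
  by rewrite /primitive c1.
- move=> j j' jj'; apply: contraNT jj' => H; apply/eqP/val_inj/eqP => /=.
  rewrite -(@nth_uniq _ 0 L j j' (ltn_ord _) (ltn_ord _) (undup_uniq _)).
  have [i] := hL _ (gG j); case/(hs i).1 => c1 ir.
  have [i'] := hL _ (gG j'); case/(hs i').1 => c1' ir'.
  by apply/eqP; apply: irreducible_eq.
- move=> j; have [i hi] := hL _ (gG j); exists i; by rewrite -has_count has_pred1.
Qed.

Lemma smith_form_ex M m (A : 'M[int]_(M,m)) : exists d, smith_form A d.
Proof.
have [L uL [Q uQ [d sd ->]]] := int_Smith_normal_form A.
exists (fun i => absz (nth 0 d i)); split.
  move=> i _; have [h|h] := ltnP i.+1 (size d); last by rewrite (nth_default _ h) dvdn0.
  by have := (sortedP 0 sd) => /(_ i h).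
pose S : 'rV[int]_M := \row_i (if d`_i < 0 then -1 else 1).
exists (diag_mx S *m invmx L), (invmx Q); split.
- rewrite unitmx_mul unitmx_inv uL andbT.
  suff : diag_mx S *m diag_mx S = 1%:M by move/mulmx1_unit => [].
  apply/matrixP => i j; rewrite mul_diag_mx !mxE; case: (i == j); rewrite ?mulr0// !mulr1n.
  by case: ifP.
- by rewrite unitmx_inv.
- rewrite !mulmxA mulmxKV// mulmxK//.
  apply/matrixP => i j; rewrite mul_diag_mx !mxE; case: (_ == _); rewrite ?mulr0// !mulr1n.
  by rewrite abszE; case: ifPn => h; rewrite ?mulN1r ?mul1r ?(ltr0_norm h)// ger0_norm// leNgt.
Qed.

Lemma betaP m (F : 'I_m -> {poly int}) : (forall i, F i != 0) -> is_beta F (beta F).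
Proof.
move=> /factorization_ex [M [r [G [mu fa]]]].
have [d sd] := smith_form_ex (\matrix_(j, i) (mu i j)%:Z).
by apply: (xgetPex 0%N); exists (d (minn M m).-1), M, r, G, mu, d.
Qed.

Definition count_solutions (R : realType) (K r k q : nat)
    (f : 'I_K -> nat -> int) (a : 'I_K -> 'I_q) (x : R) : nat :=
  #|[set n : 'I_(Num.truncn x).+1 |
      [&& (0 < n)%N, (q < largest_prime (r * k) n)%N &
          [forall i, (f i n == (a i)%:Z %[mod q])%Z]]]%SET|.

(* Main.v *)
(** We count only [n = N ^ k] with [N] a product of [s] distinct primes greater than [q], where [s] is of order [log log log x]: for such [n] the congruences only say that the residues of these primes mod [q] solve [prod_j F_i(u_j) = a_i].
The number of solutions [u] in [U_q ^ s] is governed by the local counts at the primes [l | q].  Stepanov's method bounds the proportion of points where a product of characters of the [F_i] is constant; it gives a uniform gap for the character sums mod [l] (a constant factor, not a square-root saving), so that after [s] convolutions the solutions are equidistributed; the condition on [beta] makes all the characters nontrivial, and Hensel lifting passes to prime powers.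
It remains to find primes in every class mod [q <= (log x) ^ A].  This is done without complex analysis: finite differences in [k] of truncated sums [L(1 + k + it)], bounded below through a truncated Euler product, the inequality 3-4-1 and Siegel's theorem, control the sums of [Lam n * chi n / n] against the weights [n ^ (- k) * (1 - n ^ (- k)) ^ J], and a trigonometric polynomial localizes them to windows [V - T <= log n <= V + T]. *)
Require Import Defs.
From HB Require Import structures.
From mathcomp Require Import algC cyclotomic cyclic classfun character finfield closed_field.
From mathcomp Require Import all_boot all_order all_algebra all_fingroup complex.
From mathcomp Require Import boolp classical_sets reals topology normedtype sequences derive realfun exp trigo.
From mathcomp Require Import ring lra zify.

Set Implicit Arguments.
Unset Strict Implicit.
Unset Printing Implicit Defensive.

Import Order.TTheory GRing.Theory Num.Theory.
Import numFieldNormedType.Exports.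

Local Open Scope ring_scope.

Implicit Types (R : realType) (gT : finGroupType) (E : fieldType).

(** The obstacle is uniformity in [q]. The number of primes dividing [q] can be of order
    [log log x], and a gap that is only a constant factor leaves a deviation [(1 - del) ^ s] at each
    of them; these add up to at most 1/2 only when [s] exceeds a multiple of [log log log x]. So the
    number of primes in [N] must grow, and long products must lose nothing. Each prime of [N] costs
    a product of factors [1 - O(1) / l] over [l | q], at least a constant times
    [(log log x) ^ (- 1/4)] because every [l] exceeds [C]. Each prime but the last brings, after
    multiplication by [phi(q)], a sum of [1 / p] over its own window, of size about
    [(log log x) / s]. The net factor is at least [(log log x) ^ (1/2)], so [2 R + 1] windows are
    ample. The windows lie between [(log x) ^ (1/3)] and [(log x) ^ (1/2)] on the scale of [log p],
    hence [q] is at most a fixed power of [log p]; as this power is arbitrary, Siegel's theorem is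
    called for. *)

Lemma eq_ler (R : numDomainType) (x y : R) : x = y -> x <= y.
Proof. by move=> ->. Qed.
Create HintDb nneg.
#[local] Hint Extern 0 (is_true (_ <= expR _)) => apply: expR_ge0 : nneg.
#[local] Hint Extern 0 (is_true (_ < expR _)) => apply: expR_gt0 : nneg.
#[local] Hint Extern 0 (is_true (_ <= _ `^ _)) => apply: powR_ge0 : nneg.
#[local] Hint Extern 0 (is_true (_ <= `|_|)) => apply: normr_ge0 : nneg.
#[local] Hint Extern 0 (is_true (_ <= Num.sqrt _)) => apply: sqrtr_ge0 : nneg.
#[local] Hint Extern 0 (is_true (_ <= _%:R)) => apply: ler0n : nneg.
#[local] Hint Extern 0 (is_true (_ < _%:R)) => by rewrite ltr0n : nneg.
#[local] Hint Extern 0 (is_true (_ <= 1)) => apply: ler01 : nneg.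
#[local] Hint Extern 0 (is_true (_ < 1)) => apply: ltr01 : nneg.
(** Sign conditions arise at almost every rewriting. [sgn] descends through products, sums, inverses
    and powers, and the hints that follow let [//] close such goals. *)
Ltac sgn :=
 first
 [ assumption
 | match goal with
  | |- is_true (@Order.le _ _ (@GRing.zero _) ?t) =>
   match t with
   | @GRing.mul _ _ _ => apply: mulr_ge0; sgn
   | @GRing.add _ _ _ => apply: addr_ge0; sgn
   | @GRing.inv _ _ => rewrite invr_ge0; sgn
   | @GRing.exp _ _ _ => first [apply: exprn_ge0; sgn | apply: sqr_ge0]
   | @bigop.body _ _ _ _ _ => apply: sumr_ge0 => ? _; sgn
   end
  | |- is_true (@Order.lt _ _ (@GRing.zero _) ?t) =>
   match t with
   | @GRing.mul _ _ _ => apply: mulr_gt0; sgn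
   | @GRing.inv _ _ => rewrite invr_gt0; sgn
   | @GRing.exp _ _ _ => apply: exprn_gt0; sgn
   | @GRing.add _ _ _ => apply: addr_gt0; sgn
   end
  | |- is_true (~~ (@eq_op _ _ (@GRing.zero _))) => apply: lt0r_neq0; sgn
  | |- is_true (~~ (@eq_op _ _ (@GRing.zero _)) && _) => apply/andP; split; sgn
  | |- is_true (@Order.le _ _ (@GRing.zero _) _) => apply: ltW; assumption
  end
 | solve [trivial with nneg nocore] ].
#[local] Hint Extern 0 (is_true (@Order.le _ _ (@GRing.zero _) _)) => solve [sgn] : core.
#[local] Hint Extern 0 (is_true (@Order.lt _ _ (@GRing.zero _) _)) => solve [sgn] : core.
#[local] Hint Extern 0 (is_true (~~ (@eq_op _ _ (@GRing.zero _)))) => solve [sgn] : core.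
#[local] Hint Extern 0 (is_true (~~ (@eq_op _ _ (@GRing.zero _)) && _)) => solve [sgn] : core.

(** * Modulus and unit complex numbers *)

Notation cn := (@Normc.normc _).
Notation "x %:C" := (real_complex _ x) : ring_scope.
Definition cis R (x : R) : R[i] := Complex (cos x) (sin x).

Lemma cnM R (x y : R[i]) : cn (x * y) = cn x * cn y.
Proof. exact: Normc.normcM. Qed.
Lemma cnD R (x y : R[i]) : cn (x + y) <= cn x + cn y.
Proof. exact: le_normcD. Qed.
Lemma cnN R (x : R[i]) : cn (- x) = cn x.
Proof. exact: normcN. Qed.
Lemma cn0 R : cn (0 : R[i]) = 0.
Proof. exact: Normc.normc0. Qed.
Lemma cn1 R : cn (1 : R[i]) = 1.
Proof. exact: Normc.normc1. Qed.
Lemma cnV R (x : R[i]) : cn x^-1 = (cn x)^-1.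
Proof. exact: Normc.normcV. Qed.
Lemma cnE R (x : R[i]) : cn x = Num.sqrt (complex.Re x ^+ 2 + complex.Im x ^+ 2).
Proof. by case: x. Qed.
Lemma cn_ge0 R (x : R[i]) : 0 <= cn x.
Proof. by rewrite cnE. Qed.
Lemma cn_eq0 R (x : R[i]) : cn x = 0 -> x = 0.
Proof. exact: Normc.eq0_normc. Qed.
Lemma cnB R (x y : R[i]) : cn (x - y) <= cn x + cn y.
Proof. by rewrite -(cnN y); exact: cnD. Qed.
Lemma cnBC R (x y : R[i]) : cn (x - y) = cn (y - x).
Proof. by rewrite -cnN opprB. Qed.
Lemma cn_sqr R (x : R[i]) : cn x ^+ 2 = complex.Re x ^+ 2 + complex.Im x ^+ 2.
Proof. by rewrite cnE sqr_sqrtr//. Qed.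
Lemma cn_real R (x : R) : cn x%:C = `|x|.
Proof. by rewrite cnE expr0n addr0 sqrtr_sqr. Qed.
Lemma cnX R (x : R[i]) n : cn (x ^+ n) = cn x ^+ n.
Proof. by elim: n => [|n IH]; rewrite ?cn1// !exprS cnM IH. Qed.
Lemma cn_sum R (I : Type) (r : seq I) (P : pred I) (F : I -> R[i]) :
 cn (\sum_(i <- r | P i) F i) <= \sum_(i <- r | P i) cn (F i).
Proof.
elim/big_rec2: _ => [|i y x _ h]; first by rewrite cn0.
by apply: le_trans (cnD _ _) _; rewrite lerD2l.
Qed.
Lemma cn_prod R (I : Type) (r : seq I) (P : pred I) (F : I -> R[i]) :
 cn (\prod_(i <- r | P i) F i) = \prod_(i <- r | P i) cn (F i).
Proof. by elim/big_rec2: _ => [|i y x _ <-]; rewrite ?cn1// cnM. Qed.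
Lemma Re_le_cn R (x : R[i]) : `|complex.Re x| <= cn x.
Proof.
by rewrite -(ler_pXn2r (n:=2)) ?nnegrE ?cn_ge0// cn_sqr -normrX ger0_norm// lerDl.
Qed.
Lemma Re_sum R (I : Type) (r : seq I) (P : pred I) (F : I -> R[i]) :
 complex.Re (\sum_(i <- r | P i) F i) = \sum_(i <- r | P i) complex.Re (F i).
Proof. by elim/big_rec2: _ => [//|i y x _ <-]; rewrite raddfD. Qed.
Lemma cisD R (x y : R) : cis (x + y) = cis x * cis y.
Proof.
rewrite /cis cosD sinD; apply/eqP; rewrite eq_complex /=.
by apply/andP; split; apply/eqP; ring.
Qed.
Lemma cis0 R : cis 0 = 1 :> R[i].
Proof. by rewrite /cis cos0 sin0. Qed.
Lemma cn_cis R (x : R) : cn (cis x) = 1.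
Proof. by rewrite cnE cos2Dsin2 sqrtr1. Qed.
Lemma cisMn R (x : R) n : cis (x *+ n) = cis x ^+ n.
Proof. by elim: n => [|n IH]; rewrite ?cis0// mulrS exprS cisD IH. Qed.
Lemma abs_sin_le R (x : R) : `|sin x| <= `|x|.
Proof.
wlog x0 : x / 0 <= x.
 move=> H; have [/H//|x0] := leP 0 x.
 by rewrite -normrN -sinN -(normrN x); apply: H; lra.
have [->|xn0] := eqVneq x 0; first by rewrite sin0.
have xp : 0 < x by lra.
have [c _] := MVT xp (fun y _ => is_derive_sin y) (continuous_subspaceT (@continuous_sin R)).
rewrite sin0 !subr0 => ->; rewrite normrM; apply: ler_piMl => //.
by rewrite cos_max.
Qed.
Lemma cn_cis_sub1 R (x : R) : cn (cis x - 1) = `|2 * sin (x / 2)|.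
Proof.
apply/eqP; rewrite -(eqrXn2 (n:=2)) ?cn_ge0// cn_sqr/= real_normK ?num_real// subr0.
have [y ->] : exists y, x = y + y by exists (x / 2); field.
have -> : (y + y) / 2 = y by field.
rewrite cosD sinD; have := cos2Dsin2 y; set c := cos _; set s := sin _ => h; apply/eqP.
have -> : c * c = 1 - s * s by lra.
have -> : (1 - s * s - s * s - 1) ^+ 2 + (s * c + c * s) ^+ 2 = 4 * s ^+ 2 * (c ^+ 2 + s ^+ 2) by ring.
by rewrite h; ring.
Qed.
Lemma cn_cis_sub R (x y : R) : cn (cis x - cis y) <= `|x - y|.
Proof.
have -> : cis x - cis y = cis y * (cis (x - y) - 1).
 by rewrite mulrBr -cisD mulr1 subrKC.
rewrite cnM cn_cis cn_cis_sub1 normrM ger0_norm//.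
have := abs_sin_le ((x-y)/2); rewrite normrM [X in _ <= _ * X]ger0_norm; lra.
Qed.
Lemma cos_ge_half R (x : R) : `|x| <= 1 -> 1 / 2 <= cos x.
Proof.
move=> x1; have [y e] : exists y, x = y + y by exists (x / 2); field.
have hy : `|y| <= 1/2 by move: x1; rewrite e -mulr2n normrMn; lra.
rewrite e cosD; have := cos2Dsin2 y; have hs := le_trans (abs_sin_le y) hy.
set s := sin _ in hs *; set c := cos _ => h.
have : `|s| ^+ 2 <= (1/2)^+2 by rewrite ler_pXn2r ?nnegrE//; lra.
rewrite real_normK ?num_real// => h2.
by move: h2; lra.
Qed.
Lemma sin_ge_half R (x : R) : 0 <= x <= 1 -> x / 2 <= sin x.
Proof.
move=> /andP[x0 x1].
have [->|xn0] := eqVneq x 0; first by rewrite sin0 mul0r.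
have xp : 0 < x by lra.
have [c] := MVT xp (fun y _ => is_derive_sin y) (continuous_subspaceT (@continuous_sin R)).
rewrite in_itv/= => /andP[c0 cx]; rewrite sin0 !subr0 => ->.
have : 1/2 <= cos c by apply: cos_ge_half; rewrite ger0_norm; lra.
nra.
Qed.
Lemma cn_cis_sub1_ge R (x : R) : `|x| <= 2 -> `|x| / 2 <= cn (cis x - 1).
Proof.
move=> x2; rewrite cn_cis_sub1 normrM ger0_norm//.
wlog x0 : x x2 / 0 <= x.
 move=> H; have [/(H _ x2)//|x0] := leP 0 x.
 have := H (- x); rewrite normrN mulNr sinN normrN => H'; lra.
rewrite (ger0_norm x0) in x2 *.
have h : x/2/2 <= sin (x/2) by apply: sin_ge_half; lra.
rewrite ger0_norm; lra.
Qed.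

(** * Elementary bounds for logarithms and powers *)

Lemma lnS_sub R (n : nat) : (0 < n)%N -> ln n.+1%:R - ln n%:R <= (n%:R : R)^-1.
Proof.
move=> n0; have p : 0 < n%:R by [].
rewrite -ln_div ?posrE//.
have -> : n.+1%:R / n%:R = 1 + n%:R^-1 :> R by rewrite -natr1; field.
by apply: le_ln1Dx; apply: lt_trans (_ : 0 < _); rewrite//; lra.
Qed.
Lemma lnS_sub_ge R (n : nat) : (0 < n)%N -> (n.+1%:R : R)^-1 <= ln n.+1%:R - ln n%:R.
Proof.
move=> n0; have p : 0 < n%:R :> R by [].
have p1 : 0 < n.+1%:R :> R by [].
rewrite -opprB -ln_div//.
have -> : n%:R / n.+1%:R = 1 + - n.+1%:R^-1 :> R by rewrite -natr1 in p1 *; field.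
rewrite -[leLHS]opprK lerN2; apply: le_ln1Dx.
by rewrite ltrN2 invf_lt1// ltr1n.
Qed.
Lemma ln_ge0n R (n : nat) : 0 <= ln (n%:R : R).
Proof. by case: n => [|n]; [rewrite ln0|rewrite ln_ge0// ler1n]. Qed.
Lemma harmonic_le R (Z : nat) : (0 < Z)%N ->
 \sum_(1 <= n < Z.+1) (n%:R : R)^-1 <= 1 + ln Z%:R.
Proof.
elim: Z => // -[|Z] IH _; first by rewrite big_nat1 ln1 invr1 addr0.
rewrite big_nat_recr//=; apply: le_trans (lerD (IH isT) (@lnS_sub_ge R Z.+1 isT)) _.
by lra.
Qed.
Lemma expRN_sub R (x y : R) : 0 <= x -> x <= y -> expR (- x) - expR (- y) <= y - x.
Proof.
move=> x0 xy; have -> : - y = - x + (x - y) by ring.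
rewrite expRD.
have h1 : expR (- x) <= 1 by rewrite expR_le1 oppr_le0.
have h2 := expR_ge1Dx (x - y); have h3 : expR (x - y) <= 1 by rewrite expR_le1; lra.
have h4 := expR_ge0 (- x); nra.
Qed.
Lemma powR_expR R (x : R) j : 0 <= x -> x ^+ j <= j`!%:R * expR x.
Proof.
move=> x0; case: j => [|j]; first by rewrite mul1r -[leLHS]expR0 ler_expR.
have := expR_ge1Dxn j x0; have f0 : 0 < (j.+1`!)%:R :> R by rewrite ltr0n fact_gt0.
move=> h; rewrite mulrC -ler_pdivrMr; lra.
Qed.

(** The shift to [n.+1] lets one quantity dominate both [ln n] and [ln (n + 1)]; the summand 1 makes
    its powers increase with the exponent. *)
Definition ell R (n : nat) : R := 1 + ln n.+1%:R.
Lemma ell_ge1 R n : 1 <= ell R n.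
Proof. by rewrite lerDl ln_ge0n. Qed.
Lemma ell_ge0 R n : 0 <= ell R n.
Proof. by rewrite (le_trans _ (ell_ge1 _ _)). Qed.
Lemma ell_mono R m n : (m <= n)%N -> ell R m <= ell R n.
Proof. by move=> mn; rewrite lerD2l ler_ln ?posrE// ler_nat. Qed.
Lemma ln_le_ell R n : ln n%:R <= ell R n.
Proof.
case: n => [|n]; first by rewrite ln0// (le_trans _ (ell_ge1 _ _)).
rewrite /ell; apply: (@le_trans _ _ (ln n.+2%:R)); last by lra.
by rewrite ler_ln ?posrE// ler_nat.
Qed.
(** The inequality [y ^ j <= j! * expR y] at [y = eta * ell n] turns a power of the logarithm into a
    small power of [n]; the factor [expR (2 * eta)] pays for [ell n <= 2 + ln n]. *)
Lemma ell_pow_le R (j : nat) (eta : R) : 0 < eta -> exists C : R, 0 < C /\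
 forall n, (0 < n)%N -> ell R n ^+ j <= C * n%:R `^ eta.
Proof.
move=> e0; exists (eta^-1 ^+ j * j`!%:R * expR (2 * eta)); split.
 by rewrite !mulr_gt0 ?ltr0n ?fact_gt0.
move=> n n0; have L : ell R n <= 2 + ln n%:R.
 have := lnS_sub R n0; rewrite /ell.
 have : (n%:R : R)^-1 <= 1 by rewrite invf_le1// ler1n.
 lra.
have -> : n%:R `^ eta = expR (eta * ln n%:R) by rewrite /powR pnatr_eq0 gtn_eqF.
rewrite -[leRHS]mulrA -expRD -mulrA.
have h : (eta * ell R n) ^+ j <= j`!%:R * expR (2 * eta + eta * ln n%:R).
 apply: le_trans (powR_expR _ _) _; first by rewrite mulr_ge0 ?(le_trans _ (ell_ge1 R n))//.
 by rewrite ler_wpM2l// ler_expR; nra.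
by rewrite exprVn ler_pdivlMl// -exprMn.
Qed.

Lemma powR_ge1 R (a x : R) : 1 <= a -> 0 <= x -> 1 <= a `^ x.
Proof. by move=> a1 x0; rewrite -[leLHS](powRr0 a) ler_powR. Qed.
Lemma RcB R (x y : R) : (x - y)%:C = x%:C - y%:C.
Proof. exact: rmorphB. Qed.
Lemma RcM R (x y : R) : (x * y)%:C = x%:C * y%:C.
Proof. exact: rmorphM. Qed.
Lemma RcX R (x : R) n : (x ^+ n)%:C = x%:C ^+ n.
Proof. exact: rmorphXn. Qed.
#[local] Hint Extern 0 (is_true (_ <= cn _)) => apply: cn_ge0 : nneg.
#[local] Hint Extern 0 (is_true (_ <= ell _ _)) => apply: ell_ge0 : nneg.
#[local] Hint Extern 0 (is_true (_ <= ln _%:R)) => apply: ln_ge0n : nneg.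

(** * Slowly varying weights, and oscillating sums weighted by 1/n *)

Definition tame R (p : nat -> R[i]) (P : R) (j : nat) :=
 forall n, (0 < n)%N -> [/\ cn (p n) <= P * ell R n ^+ j, cn (p n.+1) <= P * ell R n ^+ j &
  cn (p n.+1 - p n) <= P * ell R n ^+ j / n%:R].

Lemma tame_ext R (p p' : nat -> R[i]) P j : (forall n, p n = p' n) -> tame p P j -> tame p' P j.
Proof. by move=> e h n n0; rewrite -!e; exact: h. Qed.
(** [tame] is what Abel summation against [1 / n] asks for: size and increments controlled up to
    powers of the logarithm. The class is stable under products, the exponents of the logarithm
    adding up, so all weights used later are assembled from a few elementary ones. *)
Lemma tameM R (p p' : nat -> R[i]) P P' j j' : 0 <= P -> 0 <= P' ->
 tame p P j -> tame p' P' j' -> tame (fun n => p n * p' n) (2 * P * P') (j + j').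
Proof.
move=> P0 P0' h h' n n0; have [a1 a2 a3] := h n n0; have [b1 b2 b3] := h' n n0.
set e := ell R n in a1 a2 a3 b1 b2 b3 *.
have e1 : 1 <= e := ell_ge1 R n; have e0 : 0 <= e by lra.
have -> : 2 * P * P' * e ^+ (j + j') = 2 * ((P * e ^+ j) * (P' * e ^+ j')) by rewrite exprD; ring.
have hh x y : cn x <= P * e ^+ j -> cn y <= P' * e ^+ j' -> cn (x * y) <= P * e ^+ j * (P' * e ^+ j').
 by move=> *; rewrite cnM ler_pM.
have EE0 : 0 <= P * e ^+ j * (P' * e ^+ j') by [].
split.
- by apply: le_trans (hh _ _ a1 b1) _; lra.
- by apply: le_trans (hh _ _ a2 b2) _; lra.
- have -> : p n.+1 * p' n.+1 - p n * p' n = (p n.+1 - p n) * p' n + p n.+1 * (p' n.+1 - p' n) by ring.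
 apply: le_trans (cnD _ _) _; rewrite !cnM.
 have k1 := ler_pM (cn_ge0 _) (cn_ge0 _) a3 b1.
 have k2 := ler_pM (cn_ge0 _) (cn_ge0 _) a2 b3.
 apply: le_trans (lerD k1 k2) _.
 by apply: eq_ler; field.
Qed.
Lemma tame_cis R (t : R) : tame (fun n => cis (- (t * ln n%:R))) (1 + `|t|) 0.
Proof.
move=> n n0; rewrite !cn_cis mulr1; split; [by rewrite lerDl|by rewrite lerDl|].
apply: le_trans (cn_cis_sub _ _) _.
have -> : - (t * ln n.+1%:R) - - (t * ln n%:R) = - t * (ln n.+1%:R - ln n%:R) by ring.
rewrite normrM normrN (ger0_norm (_ : 0 <= ln n.+1%:R - ln n%:R)); last first.
 by apply: le_trans (lnS_sub_ge R n0).
by apply: ler_pM => //; [rewrite subr_ge0 ler_ln ?posrE// ler_nat|rewrite lerDr|exact: lnS_sub].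
Qed.
Lemma lnS_sub_ge0 R n : (0 : R) <= ln n.+1%:R - ln n%:R.
Proof.
case: n => [|n]; first by rewrite (ln0 (lexx 0)) subr0.
by rewrite subr_ge0 ler_ln ?posrE// ler_nat.
Qed.
Lemma tame_exp R (k : R) : 0 <= k <= 1 -> tame (fun n => (expR (- (k * ln n%:R)))%:C) 1 0.
Proof.
move=> /andP[k0 k1] n n0; rewrite -RcB !cn_real mulr1 !(ger0_norm (expR_ge0 _)).
have L := lnS_sub_ge0 R n; have l0 := ln_ge0n R n; have l1 := ln_ge0n R n.+1.
split; [by rewrite expR_le1 oppr_le0|by rewrite expR_le1 oppr_le0|].
have m : k * ln n%:R <= k * ln n.+1%:R by rewrite ler_wpM2l// -subr_ge0.
rewrite ler0_norm; last by rewrite subr_le0 ler_expR lerN2.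
rewrite opprB; apply: le_trans (expRN_sub _ m) _ => //.
rewrite -mulrBr mul1r; apply: le_trans (lnS_sub R n0); exact: ler_piMl.
Qed.
(** The constant is [k], not 1: each factor [1 - n ^ (- k)] gains [k] at the price of one logarithm.
    This is the gain that the finite differences exploit. *)
Lemma tame_1mexp R (k : R) : 0 <= k -> tame (fun n => (1 - expR (- (k * ln n%:R)))%:C) k 1.
Proof.
move=> k0 n n0; rewrite -RcB !cn_real.
have L := lnS_sub_ge0 R n; have l0 := ln_ge0n R n; have l1 := ln_ge0n R n.+1.
have m : k * ln n%:R <= k * ln n.+1%:R by rewrite ler_wpM2l// -subr_ge0.
have hh x y : 0 <= x -> x <= y -> `|1 - expR (- (k * x))| <= k * y.
 move=> x0 xy; rewrite ger0_norm ?subr_ge0 ?expR_le1 ?oppr_le0//.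
 apply: (@le_trans _ _ (k * x)); last exact: ler_wpM2l.
 by have := expR_ge1Dx (- (k * x)); lra.
split; [by apply: hh => //; exact: ln_le_ell|by apply: hh => //; rewrite /ell; lra|].
have -> : 1 - expR (- (k * ln n.+1%:R)) - (1 - expR (- (k * ln n%:R))) = expR (- (k * ln n%:R)) - expR (- (k * ln n.+1%:R)) by ring.
rewrite ger0_norm; last by rewrite subr_ge0 ler_expR lerN2.
apply: le_trans (expRN_sub _ m) _ => //.
rewrite -mulrBr -mulrA ler_wpM2l//; apply: le_trans (lnS_sub R n0) _.
by rewrite ler_peMl// ell_ge1.
Qed.
Lemma tame_ln R : tame (fun n => (ln n%:R : R)%:C) 1 1.
Proof.
move=> n n0; rewrite -RcB !cn_real mul1r !ger0_norm ?lnS_sub_ge0//.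
split; [exact: ln_le_ell|by rewrite /ell; lra|].
apply: le_trans (lnS_sub R n0) _.
by rewrite ler_peMl// ell_ge1.
Qed.
(** The same gain with [|t|] in place of [k]: it will make the L-sums Lipschitz in [t]. *)
Lemma tame_cisB R (t : R) : tame (fun n => cis (- (t * ln n%:R)) - 1) `|t| 1.
Proof.
move=> n n0.
have L := lnS_sub_ge0 R n; have l0 := ln_ge0n R n; have l1 := ln_ge0n R n.+1.
have hh x y : 0 <= x -> x <= y -> cn (cis (- (t * x)) - 1) <= `|t| * y.
 move=> x0 xy; rewrite -cis0; apply: le_trans (cn_cis_sub _ _) _.
 by rewrite subr0 normrN normrM (ger0_norm x0) ler_wpM2l.
split; [by apply: hh => //; exact: ln_le_ell|by apply: hh => //; rewrite /ell; lra|].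
rewrite opprB addrA subrK; apply: le_trans (cn_cis_sub _ _) _.
have -> : - (t * ln n.+1%:R) - - (t * ln n%:R) = - t * (ln n.+1%:R - ln n%:R) by ring.
rewrite normrM normrN (ger0_norm L) -mulrA ler_wpM2l//; apply: le_trans (lnS_sub R n0) _.
by rewrite ler_peMl// ell_ge1.
Qed.
Lemma tameX R (p : nat -> R[i]) P j i : 0 <= P ->
 tame p P j -> tame (fun n => p n ^+ i) (2 ^+ i * P ^+ i) (i * j).
Proof.
move=> P0 h; elim: i => [|i IH].
 move=> n n0; rewrite !mulr1 subrr cn0 cn1; split=> //.
have := tameM P0 (_ : 0 <= 2 ^+ i * P ^+ i) h IH; rewrite mulSn => H.
apply: (@tame_ext _ (fun n => p n * p n ^+ i)); first by move=> n; rewrite exprS.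
by rewrite !exprS (_ : 2 * 2 ^+ i * _ = 2 * P * (2 ^+ i * P ^+ i)); [apply: H; rewrite mulr_ge0|ring].
Qed.

Lemma abel_sum (A : comNzRingType) (b w : nat -> A) (Z N : nat) : (Z <= N)%N ->
 \sum_(Z <= n < N) b n * w n = (\sum_(Z <= i < N) b i) * w N +
  \sum_(Z <= n < N) (\sum_(Z <= i < n.+1) b i) * (w n - w n.+1).
Proof.
elim: N => [|N IH]; first by rewrite leqn0 => /eqP ->; rewrite !big_nil mul0r addr0.
rewrite leq_eqVlt => /predU1P[<-|ZN]; first by rewrite !big_geq// mul0r addr0.
rewrite ltnS in ZN; rewrite !big_nat_recr//= IH//.
by ring.
Qed.

(** Telescoping against [6 / sqrt n]: consecutive square roots satisfy [(c - a) * (c + a) = 1] and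
    [c <= 2 a], whence [a * c * (a + c) <= 6 * a ^ 3]. *)
Lemma sum_inv32 R (Z N : nat) : (0 < Z)%N -> (Z <= N)%N ->
 \sum_(Z <= n < N) (n%:R * Num.sqrt n%:R : R)^-1 <= 6 / Num.sqrt Z%:R - 6 / Num.sqrt N%:R.
Proof.
move=> Z0; elim: N => [|N IH]; first by rewrite leqn0 => /eqP Z1; rewrite Z1 in Z0.
rewrite leq_eqVlt => /predU1P[<-|ZN]; first by rewrite big_geq// subrr.
rewrite ltnS in ZN; rewrite big_nat_recr//=.
have N0 : (0 < N)%N := leq_trans Z0 ZN.
have {IH}h := IH ZN; suff : (N%:R * Num.sqrt N%:R)^-1 <= 6 / Num.sqrt N%:R - 6 / Num.sqrt N.+1%:R :> R by lra.
set a : R := Num.sqrt N%:R; set c : R := Num.sqrt N.+1%:R.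
have a0 : 0 < a by rewrite sqrtr_gt0.
have c0 : 0 < c by rewrite sqrtr_gt0.
have a2 : N%:R = a ^+ 2 by rewrite sqr_sqrtr.
have c2 : c ^+ 2 = a ^+ 2 + 1 by rewrite -a2 natr1 sqr_sqrtr.
have a1 : 1 <= a ^+ 2 by rewrite -a2 ler1n.
have c2a : c <= 2 * a by rewrite -(@ler_pXn2r _ 2) ?nnegrE//; lra.
have -> : 6 / a - 6 / c = 6 / (a * c * (a + c)).
 have : (c - a) * (c + a) = 1 by rewrite (_ : (c - a) * (c + a) = c ^+ 2 - a ^+ 2); [rewrite c2; ring|ring].
 move=> e; have -> : 6 / a - 6 / c = 6 * (c - a) / (a * c) by field.
 by rewrite -[X in _ = X / _]mulr1 -e; field.
rewrite a2 -ler_pdivrMl// -invfM lef_pV2 ?posrE ?mulr_gt0 ?addr_gt0//; nra.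
Qed.

(** The sum is cut at [Q ^ 2]. Below, the trivial bound costs powers of [log Q], absorbed by
    [Q ^ eta]. Above, the increments of the weight are [O(n ^ (- 3/2))]; their tail past [Q ^ 2] is
    [O(1 / Q)], which cancels the bound [Q] on the partial sums of [b]. *)
Lemma L_bound R (j : nat) (eta : R) : 0 < eta -> exists C : R, 0 < C /\
 forall (Q : nat) (b p : nat -> R[i]) (P : R) (N : nat), (0 < Q)%N -> 0 <= P ->
 (forall n, cn (b n) <= 1) -> (forall m n, cn (\sum_(m <= i < n) b i) <= Q%:R) ->
 tame p P j -> cn (\sum_(1 <= n < N) b n * (p n * (n%:R : R)^-1%:C)) <= C * P * Q%:R `^ eta.
Proof.
move=> e0.
have [C1 [C10 h1]] := @ell_pow_le R j (2^-1) ltac:(lra).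
have [C2 [C20 h2]] := @ell_pow_le R j.+1 (eta / 2) ltac:(lra).
exists (C2 + 13 * C1); split; first lra.
move=> Q b p P N Q0 P0 b1 bQ tp.
have Q1 : 1 <= Q%:R `^ eta by rewrite powR_ge1// ?ler1n// ltW.
have head Z : (Z <= (Q ^ 2).+1)%N -> cn (\sum_(1 <= n < Z) b n * (p n * (n%:R : R)^-1%:C)) <= C2 * P * Q%:R `^ eta.
 case: Z => [|Z] ZQ; first by rewrite big_geq// cn0 !mulr_ge0 ?powR_ge0// ltW.
 case: Z ZQ => [|Z] ZQ; first by rewrite big_geq// cn0 ?powR_ge0//.
 apply: le_trans (cn_sum _ _ _) _.
 apply: (@le_trans _ _ (\sum_(1 <= n < Z.+2) P * ell R (Q ^ 2) ^+ j * n%:R^-1)).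
  rewrite big_nat_cond [leRHS]big_nat_cond; apply: ler_sum => n /andP[/andP[n1 nZ] _].
  have [a _ _] := tp n n1; rewrite !cnM cn_real ger0_norm ?invr_ge0//.
  rewrite -[leRHS]mul1r; apply: ler_pM; rewrite ?cn_ge0 ?invr_ge0//.
  rewrite ler_wpM2r//; apply: le_trans a _; rewrite ler_wpM2l//.
  apply: lerXn2r; rewrite ?nnegrE ?ell_ge0//.
  by apply: ell_mono; rewrite -ltnS (leq_trans nZ).
 rewrite -mulr_sumr.
 have hz : \sum_(1 <= n < Z.+2) (n%:R : R)^-1 <= ell R (Q ^ 2).
  apply: le_trans (@harmonic_le R Z.+1 isT) _; rewrite /ell lerD2l ler_ln ?posrE ?ltr0n// ler_nat.
  by rewrite (leq_trans _ ZQ)//.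
 have E0 : 0 <= ell R (Q ^ 2) by [].
 apply: le_trans (ler_wpM2l (mulr_ge0 P0 (exprn_ge0 _ E0)) hz) _.
 rewrite -mulrA -exprSr [C2 * P]mulrC -mulrA ler_wpM2l//.
 have Q2 : (0 < Q ^ 2)%N by rewrite expn_gt0 Q0.
 apply: le_trans (h2 _ Q2) _; rewrite natrX -powR_mulrn// -powRrM.
 by rewrite (_ : 2%:R * (eta / 2) = eta)//; field.
have [NQ|QN] := leqP N (Q ^ 2).+1.
 apply: le_trans (head _ NQ) _; rewrite -!mulrA ler_wpM2r ?mulr_ge0 ?powR_ge0//; lra.
rewrite (big_cat_nat (n := (Q^2).+1))//=; last exact: ltnW.
apply: le_trans (cnD _ _) _; rewrite !mulrDl lerD ?head//.
rewrite abel_sum; last exact: ltnW.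
set w := fun n => p n * (n%:R : R)^-1%:C.
have sq n : (0 < n)%N -> (n%:R : R)`^2^-1 = Num.sqrt n%:R by move=> _; rewrite powR12_sqrt.
have wN n : (0 < n)%N -> cn (w n) <= P * C1 / Num.sqrt n%:R.
 move=> n0; have [a _ _] := tp n n0; rewrite cnM cn_real ger0_norm ?invr_ge0//.
 have := h1 n n0; rewrite sq// => h.
 have s0 : 0 < Num.sqrt (n%:R : R) by rewrite sqrtr_gt0.
 have -> : P * C1 / Num.sqrt n%:R = P * (C1 * Num.sqrt n%:R) * n%:R^-1.
  by rewrite -[in n%:R^-1](@sqr_sqrtr _ (n%:R : R))//; field.
 rewrite ler_wpM2r ?invr_ge0//; apply: le_trans a _; exact: ler_wpM2l.
have dw n : (0 < n)%N -> cn (w n - w n.+1) <= 2 * P * C1 * (n%:R * Num.sqrt n%:R)^-1.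
 move=> n0; have [_ a2 a3] := tp n n0.
 have := h1 n n0; rewrite sq// => h.
 have s0 : 0 < Num.sqrt (n%:R : R) by rewrite sqrtr_gt0.
 have p0 : 0 < n%:R :> R by rewrite ltr0n.
 have p1 : 0 < n.+1%:R :> R by [].
 have -> : w n - w n.+1 = - ((p n.+1 - p n) * (n%:R^-1)%:C) + p n.+1 * (n%:R^-1 - n.+1%:R^-1)%:C.
  by rewrite /w; ring.
 apply: le_trans (cnD _ _) _; rewrite cnN !cnM !cn_real.
 have -> : (n%:R^-1 - n.+1%:R^-1) = (n%:R * n.+1%:R)^-1 :> R.
  by rewrite -natr1 in p1 *; field.
 rewrite !ger0_norm ?mulr_ge0//.
 have E := ler_wpM2l P0 h.
 have k1 : cn (p n.+1 - p n) * n%:R^-1 <= P * (C1 * Num.sqrt n%:R) / n%:R * n%:R^-1.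
  by rewrite ler_wpM2r//; apply: le_trans a3 _; rewrite ler_wpM2r.
 have k2 : cn (p n.+1) / (n%:R * n.+1%:R) <= P * (C1 * Num.sqrt n%:R) * (n%:R^-1 * n%:R^-1).
  apply: ler_pM; rewrite//; first exact: le_trans a2 _.
  by rewrite invfM ler_wpM2l// lef_pV2// ler_nat.
 have -> : 2 * P * C1 * (n%:R * Num.sqrt n%:R)^-1 = P * (C1 * Num.sqrt n%:R) / n%:R * n%:R^-1 + P * (C1 * Num.sqrt n%:R) * (n%:R^-1 * n%:R^-1).
  have := @sqr_sqrtr _ n%:R (ltW p0); set s := Num.sqrt _ => es.
  by rewrite -es; field.
 exact: lerD.
have N0 : (0 < N)%N by apply: leq_ltn_trans QN.
have qs : Num.sqrt ((Q ^ 2)%:R : R) = Q%:R by rewrite natrX sqrtr_sqr ger0_norm.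
have t1 : cn ((\sum_((Q ^ 2).+1 <= i < N) b i) * w N) <= P * C1.
 rewrite cnM; apply: le_trans (ler_pM (cn_ge0 _) (cn_ge0 _) (bQ _ _) (wN _ N0)) _.
 have PC0 : 0 <= P * C1 by [].
 by rewrite mulrCA ler_piMr// ler_pdivrMr ?sqrtr_gt0// mul1r -qs ler_sqrt ?ler_nat// ltnW// ltnW.
have t2 : cn (\sum_((Q ^ 2).+1 <= n < N) (\sum_((Q ^ 2).+1 <= i < n.+1) b i) * (w n - w n.+1)) <= 12 * P * C1.
 apply: le_trans (cn_sum _ _ _) _.
 apply: (@le_trans _ _ (\sum_((Q ^ 2).+1 <= n < N) Q%:R * (2 * P * C1 * (n%:R * Num.sqrt n%:R)^-1))).
  apply: ler_sum_nat => n /andP[n1 nZ].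
  by rewrite cnM ler_pM ?dw//; apply: leq_ltn_trans n1.
 rewrite -2!mulr_sumr.
 have := @sum_inv32 R (Q^2).+1 N isT (ltnW QN).
 have : 0 <= 6 / Num.sqrt (N%:R : R) by [].
 have : 6 / Num.sqrt ((Q^2).+1%:R : R) <= 6 / Q%:R.
  by rewrite ler_pM2l// lef_pV2 ?posrE ?sqrtr_gt0// -qs ler_sqrt ?ler_nat.
 set S := \sum_(_ <= _ < _) _ => u1 u2 u3.
 have u : S <= 6 / Q%:R by lra.
 have PC0 : 0 <= Q%:R * (2 * P * C1) by [].
 rewrite mulrA; apply: le_trans (ler_wpM2l PC0 u) _.
 by apply: eq_ler; field.
apply: le_trans (cnD _ _) _.
have PC0 : 0 <= 13 * C1 * P by [].
have := ler_peMr PC0 Q1; lra.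
Qed.

(** * Characters of finite abelian groups *)

Definition Dual gT : {set {ffun gT -> 'Z_#|gT|}} :=
 [set k : {ffun gT -> 'Z_#|gT|} | [forall x, forall y, k (x * y)%g == k x + k y]].
Definition zeta R (n : nat) : R[i] := cis (2 * pi / n%:R).
(** Characters are stored as additive maps into ['Z_#|gT|], so that the dual is a finite set. The
    carrier of ['Z_n] has [(Zp_trunc n).+2] elements, that is [n] except for the trivial group;
    taking this number as the order of the root of unity avoids a case distinction. *)
Definition chi R gT (k : {ffun gT -> 'Z_#|gT|}) (x : gT) : R[i] :=
 zeta R (Zp_trunc #|gT|).+2 ^+ (k x).

Lemma zetaX R n : (0 < n)%N -> zeta R n ^+ n = 1.
Proof.
move=> n0; rewrite -cisMn -[_ *+ n]mulr_natr divfK -?lt0n//.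
by rewrite /cis mulr_natl cos2pi sin2pi.
Qed.
Lemma zeta_neq1 R n a : (0 < a < n)%N -> zeta R n ^+ a != 1.
Proof.
move=> /andP[a0 an]; apply/eqP => h.
have n0 : (0 < n)%N by apply: leq_trans an.
have : cn (zeta R n ^+ a - 1) = 0 by rewrite h subrr cn0.
rewrite -cisMn cn_cis_sub1 => /eqP; rewrite normr_eq0 mulf_eq0 pnatr_eq0 => /eqP.
have : 0 < sin (2 * pi / n%:R *+ a / 2 : R).
 apply: sin_gt0_pi; rewrite -mulr_natr.
 have -> : 2 * pi / n%:R * a%:R / 2 = pi * (a%:R / n%:R) :> R by lra.
 by rewrite mulr_gt0 ?pi_gt0//= gtr_pMr ?pi_gt0// ltr_pdivrMr// mul1r ltr_nat.
by lra.
Qed.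
Lemma DualP gT (k : {ffun gT -> 'Z_#|gT|}) :
 reflect (forall x y, k (x * y)%g = k x + k y) (k \in Dual gT).
Proof.
rewrite inE; apply: (iffP forallP) => h x; first by move=> y; apply/eqP; move/forallP: (h x).
by apply/forallP => y; rewrite h.
Qed.
(** Existence comes from character theory over the algebraic numbers: an irreducible character whose
    kernel does not contain [g] is linear, the group being abelian. Only the exponents of its values
    on a primitive root are kept, and these can be read in [R[i]]. *)
Lemma Dual_sep gT (g : gT) : abelian [set: gT] -> g != 1%g ->
 exists2 k, k \in Dual gT & k g != 0.
Proof.
move=> ab g1.
have N1 : (1 < #|gT|)%N.
 rewrite -cardsT; apply: leq_trans (_ : #|[set g; 1%g]| <= _)%N; first by rewrite cards2 g1.
 exact: subset_leq_card (finset.subsetT _).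
have [i hi] : exists i : Iirr [set: gT], g \notin cfker 'chi_i.
 apply/existsP; apply: contraNT g1 => /existsPn H.
 have : g \in (\bigcap_(i : Iirr [set: gT]) cfker 'chi_i).
  by apply/bigcapP => i _; have := H i; rewrite negbK.
 by rewrite TI_cfker_irr inE.
have lin : 'chi_i \is a linear_char by apply/char_abelianP.
have [z zp] := C_prim_root_exists (ltnW N1).
have hX x : 'chi_i x ^+ #|gT| = 1.
 by rewrite -lin_charX// -cardsT (_ : x ^+ #|[set: gT]| = 1)%g ?lin_char1//; apply: (@expg_cardG _ [set: gT]%G); rewrite inE.
have /choice [k hk] : forall x, exists k : 'I_#|gT|, 'chi_i x = z ^+ k.
 by move=> x; have [k ->] := prim_rootP zp (hX x); exists k.
have nE : (Zp_trunc #|gT|).+2 = #|gT| by rewrite Zp_cast.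
pose f := [ffun x => inZp (k x) : 'Z_#|gT|].
have fE x : z ^+ (f x) = 'chi_i x by rewrite hk ffunE/= nE -[in RHS](expr_mod _ (prim_expr_order zp)).
exists f.
 apply/DualP => x y; apply/val_inj => /=.
 have : z ^+ (f (x * y)%g) = z ^+ (f x + f y)%N by rewrite exprD !fE lin_charM.
 move/eqP; rewrite (eq_prim_root_expr zp) => /eqP h.
 transitivity ((f x + f y) %% #|gT|)%N; last by congr (_ %% _)%N.
 rewrite -h modn_small//; apply: leq_trans (ltn_ord _) _; exact: eq_leq nE.
apply: contraNneq hi => f0.
have := fE g; rewrite f0 => e.
by rewrite cfkerEchar ?irr_char// inE inE -e lin_char1// eqxx.
Qed.
Lemma chiM R gT k (x y : gT) : k \in Dual gT ->
 chi R k (x * y)%g = chi R k x * chi R k y.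
Proof.
move=> /DualP h; rewrite /chi h -exprD.
exact: expr_mod (zetaX R (ltn0Sn _)).
Qed.
Lemma chiD R gT (k k' : {ffun gT -> 'Z_#|gT|}) (x : gT) :
 chi R (k + k') x = chi R k x * chi R k' x.
Proof. by rewrite /chi ffunE -exprD -[in RHS](expr_mod _ (zetaX R (ltn0Sn _))). Qed.
Lemma cn_chi R gT k (x : gT) : cn (chi R k x) = 1.
Proof. by rewrite cnX cn_cis expr1n. Qed.
Lemma chi_neq0 R gT k (x : gT) : chi R k x != 0.
Proof. by apply/eqP => h; move: (cn_chi R k x); rewrite h cn0 => /eqP; rewrite eq_sym oner_eq0. Qed.
Lemma chi_eq1 R gT k (x : gT) : (chi R k x == 1) = (k x == 0).
Proof.
apply/idP/idP => [/eqP h|/eqP h]; last by rewrite /chi h.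
apply: contraTT isT => h0.
have kx : (0 < k x < (Zp_trunc #|gT|).+2)%N by rewrite ltn_ord andbT lt0n.
by have := zeta_neq1 R kx; rewrite -/(chi R k x) h eqxx.
Qed.
Lemma chi1 R gT k : k \in Dual gT -> chi R k 1%g = 1.
Proof.
move=> kD; have := chiM R 1%g 1%g kD; rewrite mulg1 -{1}[chi R k 1%g]mulr1.
by move=> /(mulfI (chi_neq0 _ _ _)).
Qed.
Lemma chiV R gT k (x : gT) : k \in Dual gT -> chi R k x^-1%g = (chi R k x)^-1.
Proof.
by move=> kD; apply: (mulIf (chi_neq0 R k x)); rewrite -chiM// mulVg chi1// mulVf ?chi_neq0.
Qed.
Lemma Dual0 gT : (0 : {ffun gT -> 'Z_#|gT|}) \in Dual gT.
Proof. by apply/DualP => x y; rewrite !ffunE addr0. Qed.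
Lemma DualD gT (k k' : {ffun gT -> 'Z_#|gT|}) : k \in Dual gT -> k' \in Dual gT -> k + k' \in Dual gT.
Proof. by move=> /DualP h /DualP h'; apply/DualP => x y; rewrite !ffunE h h' addrACA. Qed.
Lemma DualN gT (k : {ffun gT -> 'Z_#|gT|}) : k \in Dual gT -> - k \in Dual gT.
Proof. by move=> /DualP h; apply/DualP => x y; rewrite !ffunE h opprD. Qed.
Lemma chi_sum_group R gT k : k \in Dual gT -> k != 0 -> \sum_(x : gT) chi R k x = 0.
Proof.
move=> kD k0; have [g hg] : exists g, chi R k g != 1.
 apply: contrapT => H; case/negP: k0; apply/eqP/ffunP => x; rewrite ffunE; apply/eqP; rewrite -(chi_eq1 R).
 by apply: contrapT => /negP h; apply: H; exists x.
set S := \sum_x _; have : chi R k g * S = S.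
 rewrite mulr_sumr [RHS](reindex_inj (mulgI g)).
 by apply: eq_bigr => x _; rewrite chiM.
move/eqP; rewrite -subr_eq0 -{2}[S]mul1r -mulrBl mulf_eq0 subr_eq0 (negbTE hg) => /eqP; exact.
Qed.
Lemma chi_sum_dual R gT (g : gT) : abelian [set: gT] -> g != 1%g ->
 \sum_(k in Dual gT) chi R k g = 0.
Proof.
move=> ab /(Dual_sep ab)[k0 k0D kg]; set S := \sum_(k in _) _; have : chi R k0 g * S = S.
 rewrite mulr_sumr [RHS](reindex_inj (addrI k0)).
 apply: eq_big => [k|k _]; last by rewrite chiD.
 by apply/idP/idP => [/(DualD k0D)//|/(DualD (DualN k0D))]; rewrite addKr.
move/eqP; rewrite -subr_eq0 -{2}[S]mul1r -mulrBl mulf_eq0 subr_eq0 chi_eq1 (negbTE kg) => /eqP; exact.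
Qed.
(** Double counting of the sum of all [chi k x]: each of the two orthogonality relations leaves a
    single term. *)
Lemma card_Dual gT R : abelian [set: gT] -> #|Dual gT| = #|gT|.
Proof.
move=> ab; apply/eqP; rewrite -(eqr_nat (R[i])).
have e : \sum_(x : gT) \sum_(k in Dual gT) chi R k x = \sum_(k in Dual gT) \sum_(x : gT) chi R k x.
 exact: exchange_big.
move: e; rewrite (bigD1 1%g)//= [X in _ + X]big1 => [|x x1]; last exact: chi_sum_dual.
rewrite [RHS](bigD1 (0 : {ffun gT -> 'Z_#|gT|})) ?Dual0//= [X in _ = _ + X]big1 => [|k /andP[kD k0]]; last exact: chi_sum_group.
rewrite !addr0 (eq_bigr (fun=> 1)) => [|k kD]; last exact: chi1.
rewrite sumr_const => ->; rewrite (eq_bigr (fun=> 1)) => [|x _]; last by rewrite /chi ffunE.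
by rewrite sumr_const.
Qed.
Lemma chi_orth R gT (g u : gT) : abelian [set: gT] ->
 \sum_(k in Dual gT) chi R k g * (chi R k u)^-1 = (#|gT| * (g == u))%:R.
Proof.
move=> ab; transitivity (\sum_(k in Dual gT) chi R k (g * u^-1)%g).
 by apply: eq_bigr => k kD; rewrite chiM// chiV.
have [->|gu] := eqVneq g u.
 rewrite mulgV (eq_bigr (fun=> 1)) => [|k kD]; last exact: chi1.
 by rewrite sumr_const (card_Dual R ab) muln1.
by rewrite chi_sum_dual ?muln0// -eq_mulgV1.
Qed.

(** * Von Mangoldt function, Chebyshev and Mertens bounds *)

Definition Lam R (n : nat) : R :=
 \sum_(1 <= p < n.+1 | prime p) \sum_(1 <= k < n.+1 | (n == p ^ k)%N) ln p%:R.

Lemma Lam_ge0 R n : 0 <= Lam R n.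
Proof. by apply: sumr_ge0 => p _. Qed.
(** An equality [n = p ^ k] forces [p] and [k] to be at most [n], so every [n < N] can use the same
    ranges; this is what allows the sums to be exchanged. *)
Lemma LamE R n N : (n < N)%N ->
 Lam R n = \sum_(1 <= p < N | prime p) \sum_(1 <= k < N | (n == p ^ k)%N) ln p%:R.
Proof.
move=> nN; rewrite /Lam (big_nat_widen _ _ N)//.
rewrite [RHS](bigID (fun p => p < n.+1)%N) [X in _ = _ + X]big1_seq ?addr0; last first.
 move=> p /andP[/andP[pp np] _]; rewrite big1_seq// => k /andP[/eqP e].
 rewrite mem_index_iota => /andP[k1 _]; move: np; rewrite e ltnS.
 by rewrite -{1}(expn1 p) leq_exp2l ?prime_gt1// k1.
apply: eq_bigr => p /andP[pp _].
rewrite (big_nat_widen _ _ N)//; apply: eq_bigl => k.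
by case: eqP => //= e; rewrite ltnS e ltnW// ltn_expl// prime_gt1.
Qed.
Lemma sum_Lam R N (F : nat -> R) :
 \sum_(1 <= n < N) Lam R n * F n =
 \sum_(1 <= p < N | prime p) \sum_(1 <= k < N | (p ^ k < N)%N) ln p%:R * F (p ^ k)%N.
Proof.
rewrite (eq_big_nat _ _ (F2 := fun n => \sum_(1 <= p < N | prime p) \sum_(1 <= k < N | n == (p ^ k)%N) ln p%:R * F n)); last first.
 move=> n /andP[_ nN]; rewrite (LamE R nN) mulr_suml; apply: eq_bigr => p _; by rewrite mulr_suml.
rewrite exchange_big; apply: eq_bigr => p pp; rewrite (exchange_big_dep xpredT)//= [RHS]big_mkcond.
apply: eq_bigr => k _; case: ifP => pk.
 by rewrite big_nat1_eq pk expn_gt0 prime_gt0.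
rewrite big1_seq// => n /andP[/eqP -> ]; by rewrite mem_index_iota pk andbF.
Qed.
Lemma sum_Lam_dvd R n : (0 < n)%N -> \sum_(1 <= d < n.+1 | (d %| n)%N) Lam R d = ln n%:R.
Proof.
move=> n0; rewrite big_mkcond.
rewrite (eq_bigr (fun d => Lam R d * (d %| n)%:R)) => [|d _]; last by case: ifP; rewrite ?mulr1 ?mulr0.
rewrite sum_Lam.
transitivity (ln ((\prod_(0 <= p < n.+1 | prime p) p ^ logn p n)%N%:R : R)); last first.
 congr (ln _%:R); rewrite -[RHS](partnT n0) [RHS](bigID prime)/= [X in (_ * X)%N]big1 ?muln1// => p np.
 by rewrite lognE (negbTE np).
rewrite natr_prod.
have lnprod r : ln (\prod_(p <- r | prime p) ((p ^ logn p n)%N%:R : R)) = \sum_(p <- r | prime p) (ln p%:R *+ logn p n).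
 have [] // : ln (\prod_(p <- r | prime p) ((p ^ logn p n)%N%:R : R)) = \sum_(p <- r | prime p) (ln p%:R *+ logn p n) /\ 0 < \prod_(p <- r | prime p) ((p ^ logn p n)%N%:R : R).
 elim/big_rec2: _ => [|p y x pp [<- x0]]; first by rewrite ln1.
 have q0 : 0 < ((p ^ logn p n)%N%:R : R) by [].
 by rewrite mulr_gt0// lnM// natrX lnXn// ltr0n prime_gt0.
rewrite lnprod [RHS]big_ltn_cond//=; apply: eq_bigr => p pp.
transitivity (\sum_(1 <= k < n.+1 | (k <= logn p n)%N) (ln p%:R : R)).
 rewrite big_mkcond [RHS]big_mkcond; apply: eq_bigr => k _; rewrite -(pfactor_dvdn k pp n0).
 case: (boolP (p ^ k %| n)%N) => h; first by rewrite ltnS dvdn_leq// mulr1.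
 by rewrite mulr0 if_same.
have ln : (logn p n < n.+1)%N by rewrite ltnS ltnW// (leq_trans (ltn_expl _ (prime_gt1 pp)))// dvdn_leq// pfactor_dvdnn.
rewrite// -(big_nat_widen 1 (logn p n).+1 n.+1 xpredT)//.
by rewrite sumr_const_nat subn1.
Qed.

Lemma sum_dvd1 d N : (0 < d)%N -> (\sum_(1 <= m < N.+1 | d %| m) 1 = N %/ d)%N.
Proof.
move=> d0; elim: N => [|N IH]; first by rewrite big_geq// div0n.
rewrite big_mkcond big_nat_recr//= -big_mkcond IH divnS; by case: (d %| _)%N; rewrite ?addn1 ?addn0.
Qed.
Definition psi R N : R := \sum_(1 <= n < N.+1) Lam R n.
Definition lnfact R N : R := \sum_(1 <= n < N.+1) ln n%:R.
Lemma lnfactE R N M : (N <= M)%N -> lnfact R N = \sum_(1 <= n < M.+1) Lam R n * (N %/ n)%:R.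
Proof.
move=> NM; rewrite /lnfact.
rewrite (eq_big_nat _ _ (F2 := fun m => \sum_(1 <= d < M.+1 | (d %| m)%N) Lam R d)); last first.
 move=> m /andP[m0 mN]; rewrite -(sum_Lam_dvd R m0) (big_nat_widen _ _ M.+1) ?ltnS ?(leq_trans _ NM)//.
 apply: eq_bigl => d; rewrite andb_idr//; exact: dvdn_leq.
rewrite (eq_bigr (fun m => \sum_(1 <= d < M.+1) Lam R d * (d %| m)%:R)) => [|m _]; last first.
 by rewrite big_mkcond; apply: eq_bigr => d _; case: ifP; rewrite ?mulr1 ?mulr0.
rewrite exchange_big [LHS]big_nat_cond [RHS]big_nat_cond; apply: eq_bigr => d /andP[/andP[d0 _] _].
rewrite -mulr_sumr -natr_sum; congr (_ * _%:R); rewrite -(sum_dvd1 N d0) [RHS]big_mkcond.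
by [].
Qed.
Lemma ln2_ge R : 1 / 2 <= ln (2 : R).
Proof.
have := @le_ln1Dx R (- (1/2)) ltac:(lra).
have -> : 1 + - (1 / 2) = 2^-1 :> R by field.
rewrite lnV ?posrE; lra.
Qed.
Lemma ln_natM R a b : (0 < a)%N -> (0 < b)%N -> ln (a * b)%N%:R = ln a%:R + ln b%:R :> R.
Proof. by move=> a0 b0; rewrite natrM lnM ?posrE. Qed.
Lemma lnfactS R N : lnfact R N.+1 = lnfact R N + ln N.+1%:R.
Proof. by rewrite /lnfact big_nat_recr. Qed.
(** Induction on [M] takes the place of Stirling's formula: the increment is
    [ln 2 + ln (2 M + 1) - ln (M + 1)], between [ln 2] and [2 * ln 2]. *)
Lemma cheb_D R M : M%:R * ln 2 <= lnfact R (2 * M) - 2 * lnfact R M <= M%:R * 3.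
Proof.
elim: M => [|M]; first by rewrite /lnfact big_geq// mulr0 !mul0r subrr lexx.
rewrite (_ : (2 * M.+1 = (2 * M).+2)%N); last by lia.
set D := lnfact R (2 * M) - _.
have -> : lnfact R (2 * M).+2 - 2 * lnfact R M.+1 = D + (ln (2 * M).+1%:R + ln (2 * M).+2%:R - 2 * ln M.+1%:R).
 by rewrite /D !lnfactS; ring.
have -> : ln (2 * M).+2%:R = ln 2 + ln M.+1%:R :> R.
 by rewrite (_ : ((2 * M).+2 = 2 * M.+1)%N); [rewrite ln_natM|lia].
have a : ln M.+1%:R <= ln (2 * M).+1%:R :> R by rewrite ler_ln ?posrE// ler_nat; lia.
have b : ln (2 * M).+1%:R <= ln 2 + ln M.+1%:R :> R by rewrite -ln_natM// ler_ln ?posrE// ler_nat; lia.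
have c : ln 2 <= 1 :> R by have := @le_ln1Dx R 1 ltac:(lra).
rewrite -natr1 => /andP[h1 h2]; apply/andP; split; lra.
Qed.
Lemma psi_mono R M N : (M <= N)%N -> psi R M <= psi R N.
Proof.
move=> MN; rewrite [leRHS](big_cat_nat (n := M.+1))//= lerDl; apply: sumr_ge0 => n _; exact: Lam_ge0.
Qed.
(** In integer quotients, the coefficient [(2 M) / n - 2 (M / n)] of [Lam n] is 0 or 1, and it is 1
    for [M < n <= 2 M]. *)
Lemma psi_D R M : psi R (2 * M) - psi R M <= lnfact R (2 * M) - 2 * lnfact R M <= psi R (2 * M).
Proof.
have M2 : (M <= 2 * M)%N by lia.
rewrite (lnfactE R (leqnn (2 * M))) (lnfactE R M2) mulr_sumr -sumrB.
have key n : (0 < n)%N -> [/\ (2 * (M %/ n) <= (2 * M) %/ n)%N, ((2 * M) %/ n <= 2 * (M %/ n) + 1)%N & (M < n <= 2 * M)%N -> (2 * (M %/ n) < (2 * M) %/ n)%N].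
 move=> n0; have e := divn_eq M n; have l := ltn_pmod M n0; split.
 - by rewrite leq_divRL//; move: e; set a := (M %/ n)%N; set b := (M %% n)%N; nia.
 - by rewrite -ltnS ltn_divLR//; move: e l; set a := (M %/ n)%N; set b := (M %% n)%N; nia.
 - by move=> /andP[a b]; rewrite (divn_small a) divn_gt0.
apply/andP; split.
 rewrite /psi (big_cat_nat (n := M.+1) (p := (2 * M).+1))//= addrAC subrr add0r [leRHS](big_cat_nat (n := M.+1))//= -[leLHS]add0r lerD//.
  rewrite big_nat_cond; apply: sumr_ge0 => n /andP[/andP[n0 _] _]; have [a _ _] := key n n0.
  by rewrite mulrCA -mulrBr mulr_ge0 ?Lam_ge0// subr_ge0 -natrM ler_nat.
 apply: ler_sum_nat => n /andP[nM n2].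
 have [_ _ c] := key n (leq_trans (ltn0Sn _) nM).
 by rewrite mulrCA -mulrBr -[leLHS]mulr1 ler_wpM2l ?Lam_ge0// lerBrDr -natrM addrC natr1 ler_nat c// nM.
rewrite big_nat_cond [leRHS]big_nat_cond; apply: ler_sum => n /andP[/andP[n0 _] _].
have [_ b _] := key n n0.
by rewrite mulrCA -mulrBr -[leRHS]mulr1 ler_wpM2l ?Lam_ge0// lerBlDr -natrM addrC natr1 ler_nat -[leqRHS]addn1.
Qed.
Lemma psi_le R N : psi R N <= 6 * N%:R.
Proof.
elim/ltn_ind: N => N IH; case: (posnP N) => [->|N0]; first by rewrite /psi big_geq//.
have [M [b eN]] : exists M, exists b : bool, (N = 2 * M + b)%N.
 exists N./2, (odd N); lia.
case: (posnP M) => [M0|M0].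
 subst; case: b N0 IH => // _ _; rewrite /psi big_nat1.
 by rewrite /Lam big_ltn_cond//= big_geq//.
have h2 : psi R (2 * M) <= 6 * M%:R + 3 * M%:R.
 have /andP[h _] := psi_D R M; have /andP[_ h'] := cheb_D R M.
 have := IH M; rewrite eN => /(_ ltac:(lia)); lra.
have M1 : 1 <= M%:R :> R by rewrite ler1n.
rewrite eN; case: b eN => eN; last by rewrite addn0; lra.
rewrite addn1 /psi big_nat_recr//= -/(psi R (2 * M)).
have : Lam R (2 * M).+1 <= ln (2 * M).+1%:R.
 rewrite -(sum_Lam_dvd R (ltn0Sn (2 * M))) [leRHS]big_mkcond big_nat_recr//= dvdnn lerDr.
 by apply: sumr_ge0 => i _; case: ifP => // _; exact: Lam_ge0.
have : ln (2 * M).+1%:R <= 2 * M%:R :> R.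
 rewrite -natr1 addrC -natrM; apply: le_ln1Dx.
 by lra.
by rewrite -natr1; lra.
Qed.
Lemma psi_ge R N : (N%:R - 1) / 4 <= psi R N.
Proof.
have h : psi R (2 * N./2) <= psi R N by apply: psi_mono; lia.
have /andP[_ h1] := psi_D R N./2; have /andP[h2 _] := cheb_D R N./2; have h3 := ln2_ge R.
have k : N%:R <= 1 + 2 * (N./2)%:R :> R.
 have : (N <= 1 + 2 * N./2)%N by lia.
 by rewrite -(ler_nat R) natrD natrM.
have m0 : 0 <= (N./2)%:R :> R by [].
nra.
Qed.
(** Comes from [lnfact N <= N * ln N]: dropping the integer parts in [lnfactE] costs at most
    [psi N]. *)
Lemma mertens_le R N : (0 < N)%N -> \sum_(1 <= n < N.+1) Lam R n / n%:R <= ln N%:R + 6.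
Proof.
move=> N0; have Np : 0 < N%:R :> R by [].
have h1 : lnfact R N <= N%:R * ln N%:R.
 rewrite /lnfact; apply: (@le_trans _ _ (\sum_(1 <= n < N.+1) ln N%:R)).
  apply: ler_sum_nat => n /andP[n0 nN].
  by rewrite ler_ln ?posrE// ler_nat.
 by rewrite sumr_const_nat subn1 mulr_natl.
have h2 : N%:R * \sum_(1 <= n < N.+1) Lam R n / n%:R - psi R N <= lnfact R N.
 rewrite (lnfactE R (leqnn N)) mulr_sumr -sumrB big_nat_cond [leRHS]big_nat_cond.
 apply: ler_sum => n /andP[/andP[n0 nN] _].
 by rewrite mulrCA -[X in _ - X]mulr1 -mulrBr ler_wpM2l ?Lam_ge0// lerBlDr natr1 ler_pdivrMr// -natrM ler_nat ltnW// ltn_ceil.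
have h3 := psi_le R N.
rewrite -(ler_pM2l Np); lra.
Qed.

(** * Dirichlet convolution *)

Definition conv (A : comNzRingType) (u v : nat -> A) (n : nat) : A :=
 \sum_(1 <= a < n.+1) \sum_(1 <= b < n.+1 | (a * b == n)%N) u a * v b.
Lemma convE (A : comNzRingType) (u v : nat -> A) n N : (0 < n < N)%N ->
 conv u v n = \sum_(1 <= a < N) \sum_(1 <= b < N | (a * b == n)%N) u a * v b.
Proof.
move=> /andP[n0 nN]; rewrite [RHS](big_cat_nat (n := n.+1))//= [X in _ = _ + X]big1_seq ?addr0; last first.
 move=> a /andP[_]; rewrite mem_index_iota => /andP[na _]; rewrite big1_seq// => b /andP[/eqP e].
 by rewrite mem_index_iota => /andP[b0 _]; move: na; rewrite -{1}e; nia.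
apply: eq_big_nat => a /andP[a0 _].
rewrite [LHS](big_nat_widen _ _ N)//; apply: eq_bigl => b; case: eqP => //= e.
by rewrite ltnS -e leq_pmull.
Qed.
Lemma sum_conv (A : comNzRingType) (u v w : nat -> A) N :
 \sum_(1 <= n < N) conv u v n * w n =
 \sum_(1 <= a < N) \sum_(1 <= b < N | (a * b < N)%N) u a * v b * w (a * b)%N.
Proof.
rewrite (eq_big_nat _ _ (F2 := fun n => \sum_(1 <= a < N) \sum_(1 <= b < N | (a * b == n)%N) u a * v b * w n)); last first.
 move=> n h; rewrite (convE u v h) mulr_suml; apply: eq_bigr => a _; by rewrite mulr_suml.
rewrite exchange_big [LHS]big_nat_cond [RHS]big_nat_cond; apply: eq_bigr => a /andP[/andP[a0 _] _].
rewrite (exchange_big_dep xpredT)//= [RHS]big_mkcond big_nat_cond [RHS]big_nat_cond.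
apply: eq_bigr => b /andP[/andP[b0 _] _]; case: ifP => ab.
 rewrite (eq_bigl (fun n => n == (a * b)%N)) => [|n] => //.
 by rewrite big_nat1_eq ab muln_gt0 a0 b0.
rewrite big1_seq// => n /andP[/eqP <-]; by rewrite mem_index_iota ab andbF.
Qed.
#[local] Hint Extern 0 (is_true (_ <= Lam _ _)) => apply: Lam_ge0 : nneg.

(** * Finite differences of products and inverses *)

Definition fdiff R (u : nat -> R[i]) (j : nat) : R[i] := u j - u j.+1.
(** Discrete form of derivatives of order [i] bounded by [X / V ^ i]. The sequences in view are
    truncated L-sums at [1 + (j + 1) / V + it], so that a difference in [j] acts as a derivative in
    the real part at scale [1 / V]. *)
Definition fsmooth R (u : nat -> R[i]) (V X : R) (J : nat) :=
 forall i j, (i + j <= J)%N -> cn (iter i (@fdiff R) u j) <= X / V ^+ i.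

Lemma iter_fdiff_ext R (u v : nat -> R[i]) i j :
 (forall l, (j <= l <= i + j)%N -> u l = v l) -> iter i (@fdiff R) u j = iter i (@fdiff R) v j.
Proof.
elim: i j => [|i IH] j h; first by apply: h; rewrite leqnn.
by rewrite/= /fdiff !IH// => l hl; apply: h; lia.
Qed.
Lemma iter_fdiffD R (u v : nat -> R[i]) i j :
 iter i (@fdiff R) (fun l => u l + v l) j = iter i (@fdiff R) u j + iter i (@fdiff R) v j.
Proof. by elim: i j => [//|i IH] j; rewrite/= /fdiff !IH opprD addrACA. Qed.
Lemma iter_fdiffN R (u : nat -> R[i]) i j :
 iter i (@fdiff R) (fun l => - u l) j = - iter i (@fdiff R) u j.
Proof. by elim: i j => [//|i IH] j; rewrite/= /fdiff !IH opprD. Qed.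
Lemma iter_fdiffS R (u : nat -> R[i]) i j :
 iter i (@fdiff R) (fun l => u l.+1) j = iter i (@fdiff R) u j.+1.
Proof. by elim: i j => [//|i IH] j; rewrite/= /fdiff !IH. Qed.
(** Leibniz rule by induction on the order, one difference being split as [fdiff u * v] plus a shift
    of [u] times [fdiff v]. The auxiliary statement keeps the starting index [j] in its hypotheses
    because the shift moves it. *)
Lemma fsmoothM R (u v : nat -> R[i]) (V X Y : R) J : 0 < V -> 0 <= X -> 0 <= Y ->
 fsmooth u V X J -> fsmooth v V Y J -> fsmooth (fun j => u j * v j) V (2 ^+ J * (X * Y)) J.
Proof.
move=> V0 X0 Y0 hu hv.
suff H : forall i (u v : nat -> R[i]) X Y j, 0 <= X -> 0 <= Y ->
  (forall i' j', (i' + j' <= i + j)%N -> (j <= j')%N -> cn (iter i' (@fdiff R) u j') <= X / V ^+ i') ->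
  (forall i' j', (i' + j' <= i + j)%N -> (j <= j')%N -> cn (iter i' (@fdiff R) v j') <= Y / V ^+ i') ->
  cn (iter i (@fdiff R) (fun j => u j * v j) j) <= 2 ^+ i * (X * Y) / V ^+ i.
 move=> i j ij; apply: le_trans (H i u v X Y j X0 Y0 _ _) _.
 - by move=> i' j' h1 h2; apply: hu; lia.
 - by move=> i' j' h1 h2; apply: hv; lia.
 rewrite ler_wpM2r// ler_wpM2r// ler_eXn2l ?ltr1n; lia.
elim => [|i IH] {hu hv}u v' {X0 Y0}X0 Y0 j x0 y0 hu hv.
 by rewrite mul1r invr1 !mulr1 cnM ler_pM//;
  [have := hu 0%N j; rewrite invr1 mulr1; apply|have := hv 0%N j; rewrite invr1 mulr1; apply].
rewrite iterSr.
have -> : iter i (@fdiff R) (fdiff (fun j => u j * v' j)) j =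
  iter i (@fdiff R) (fun j => fdiff u j * v' j) j + iter i (@fdiff R) (fun j => u j.+1 * fdiff v' j) j.
 rewrite -iter_fdiffD; apply: iter_fdiff_ext => l _; rewrite /fdiff; ring.
have VV i' Z : Z / V ^+ i'.+1 = Z / V / V ^+ i' by rewrite exprS invfM mulrA.
have h1 : cn (iter i (@fdiff R) (fun j => fdiff u j * v' j) j) <= 2 ^+ i * (X0 / V * Y0) / V ^+ i.
 apply: IH => //.
 - by move=> i' j' a b; rewrite -iterSr -VV; apply: hu; lia.
 - by move=> i' j' a b; apply: hv; lia.
have h2 : cn (iter i (@fdiff R) (fun j => u j.+1 * fdiff v' j) j) <= 2 ^+ i * (X0 * (Y0 / V)) / V ^+ i.
 apply: IH => //.
 - by move=> i' j' a b; rewrite iter_fdiffS; apply: hu; lia.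
 - by move=> i' j' a b; rewrite -iterSr -VV; apply: hv; lia.
apply: le_trans (cnD _ _) _; apply: le_trans (lerD h1 h2) _.
by apply: eq_ler; rewrite VV exprS; field.
Qed.
Lemma fsmooth_le R (u : nat -> R[i]) (V X X' : R) J J' : 0 < V -> X <= X' -> (J' <= J)%N ->
 fsmooth u V X J -> fsmooth u V X' J'.
Proof.
move=> V0 XX JJ h i j ij; apply: le_trans (h i j _) _; first by lia.
by rewrite ler_wpM2r//.
Qed.
(* the exponent of B doubles at each order because D(1/u) = - Du * (1/u) * S(1/u) *)
Lemma fsmoothV R J : exists e : nat, exists K : R, 0 < K /\
 forall (u : nat -> R[i]) (V B : R), 0 < V -> 1 <= B ->
 fsmooth u V B J -> (forall j, (j <= J)%N -> B^-1 <= cn (u j)) ->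
 fsmooth (fun j => (u j)^-1) V (K * B ^+ e) J.
Proof.
elim: J => [|J [e [K [K0 IH]]]].
 exists 1%N, 1; split=> // u V B V0 B1 _ h i j; rewrite leqn0 addn_eq0 => /andP[/eqP -> /eqP ->].
 rewrite invr1 mulr1 mul1r cnV -[B]invrK lef_pV2 ?posrE ?invr_gt0 ?h//; last lra.
 by apply: lt_le_trans (h 0%N _); rewrite ?invr_gt0//; lra.
pose K' := 2 ^+ J * (1 * (2 ^+ J * (K * K))) + K + 1.
exists (1 + 2 * e)%N, K'; split; first by rewrite !addr_gt0.
move=> u V B V0 B1 hu hB.
have B0 : 0 < B by lra.
have u0 j : (j <= J.+1)%N -> u j != 0.
 move=> /hB h; apply/eqP => e0; move: h; rewrite e0 cn0 leNgt invr_gt0 B0//.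
have w1 : fsmooth (fun j => (u j)^-1) V (K * B ^+ e) J.
 by apply: IH => //; [apply: fsmooth_le hu|move=> j jJ; apply: hB; lia].
have w2 : fsmooth (fun j => (u j.+1)^-1) V (K * B ^+ e) J.
 apply: (IH (fun j => u j.+1)) => //; last by move=> j jJ; apply: hB; lia.
 by move=> i j ij; rewrite iter_fdiffS; apply: hu; lia.
have KB0 : 0 <= K * B ^+ e by [].
have du : fsmooth (fdiff u) V (B / V) J.
 by move=> i j ij; rewrite -iterSr -mulrA -invfM -exprS; apply: hu; lia.
have BV0 : 0 <= B / V by [].
have P1 := fsmoothM V0 KB0 KB0 w1 w2.
have P2 := fsmoothM V0 BV0 (_ : 0 <= _) du P1.
have {}P2 : fsmooth (fun j => fdiff u j * ((u j)^-1 * (u j.+1)^-1)) V (2 ^+ J * (B / V * (2 ^+ J * (K * B ^+ e * (K * B ^+ e))))) J.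
 by apply: P2.
move=> [|i] j ij.
 rewrite invr1 mulr1 cnV; apply: (@le_trans _ _ B).
  rewrite -[leRHS]invrK lef_pV2 ?posrE ?hB//.
  by apply: lt_le_trans (hB j ij).
 rewrite exprD mulrCA ler_peMr//.
 apply: mulr_ege1; last by rewrite exprn_ege1.
 by rewrite lerDr.
rewrite iterSr (@iter_fdiff_ext _ _ (fun j => - (fdiff u j * ((u j)^-1 * (u j.+1)^-1)))); last first.
 move=> l hl; rewrite /fdiff; have a := u0 l ltac:((clear - ij hl; lia)); have b := u0 l.+1 ltac:((clear - ij hl; lia)).
 by field.
rewrite iter_fdiffN cnN; apply: le_trans (P2 i j _) _ => //.
have -> : 2 ^+ J * (B / V * (2 ^+ J * (K * B ^+ e * (K * B ^+ e)))) / V ^+ i =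
  2 ^+ J * (1 * (2 ^+ J * (K * K))) * B ^+ (1 + 2 * e) / V ^+ i.+1.
 rewrite exprD mul2n -addnn exprD expr1 exprS; field; rewrite ?expf_neq0 lt0r_neq0//.
by rewrite ler_wpM2r// ler_wpM2r// /K' -addrA lerDl//.
Qed.

(** * Truncated Euler products *)

Definition nk R (k : R) (n : nat) : R := expR (- (k * ln n%:R)).
Lemma nk_gt0 R (k : R) n : 0 < nk k n. Proof. exact: expR_gt0. Qed.
Lemma nkM R (k : R) m n : (0 < m)%N -> (0 < n)%N -> nk k (m * n) = nk k m * nk k n.
Proof. by move=> m0 n0; rewrite /nk -expRD ln_natM//; congr expR; ring. Qed.
Lemma nk_le1 R (k : R) n : 0 <= k -> nk k n <= 1.
Proof. by move=> k0; rewrite expR_le1 oppr_le0//. Qed.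
Lemma nk_anti R (k : R) m n : 0 <= k -> (0 < m)%N -> (m <= n)%N -> nk k n <= nk k m.
Proof.
move=> k0 m0 mn; rewrite ler_expR lerN2 ler_wpM2l// ler_ln ?posrE ?ltr0n ?ler_nat//.
exact: leq_trans mn.
Qed.
(** The increment of [k^-1 * (1 - n ^ (- k))] dominates the term [n ^ (- 1 - k)]; this replaces the
    comparison with an integral. *)
Lemma zeta_le R (k : R) N : 0 < k <= 1 -> \sum_(1 <= n < N.+1) nk k n / n%:R <= 1 + k^-1.
Proof.
move=> /andP[k0 k1]; case: N => [|N]; first by rewrite big_geq//.
suff : \sum_(1 <= n < N.+2) nk k n / n%:R <= 1 + k^-1 * (1 - nk k N.+1).
 move=> h; apply: le_trans h _; rewrite lerD2l ler_piMr//.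
 by rewrite gerBl ltW ?nk_gt0.
elim: N => [|N IH].
 by rewrite big_nat1 /nk ln1 mulr0 oppr0 expR0 subrr mulr0 addr0 divr1.
rewrite big_nat_recr//=.
suff h : nk k N.+2 / N.+2%:R <= k^-1 * (nk k N.+1 - nk k N.+2).
 by apply: le_trans (lerD IH h) _; rewrite -addrA -mulrDr addrA subrK.
rewrite ler_pdivlMl//.
have -> : nk k N.+1 = nk k N.+2 * expR (k * (ln N.+2%:R - ln N.+1%:R)).
 by rewrite -expRD; congr expR; ring.
have h := expR_ge1Dx (k * (ln N.+2%:R - ln N.+1%:R)).
have h2 := @lnS_sub_ge R N.+1 isT; have h3 := nk_gt0 k N.+2.
have h4 : k / N.+2%:R <= k * (ln N.+2%:R - ln N.+1%:R) by rewrite ler_pM2l.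
rewrite mulrCA -[X in _ <= _ - X]mulr1 -mulrBr ler_pM2l//.
by apply: le_trans h4 _; rewrite lerBrDl.
Qed.

Definition rough (y n : nat) := all (leq y) (primes n).
Lemma roughS y n : (0 < n)%N -> rough y.+1 n = rough y n && ~~ (prime y && (y %| n)%N).
Proof.
move=> n0; apply/idP/idP.
 move=> /allP h; apply/andP; split; first by apply/allP => p /h /ltnW.
 apply/negP => /andP[py yn]; have : y \in primes n by rewrite mem_primes py n0.
 by move/h; rewrite ltnn.
move=> /andP[/allP h k]; apply/allP => p pn; rewrite ltn_neqAle (h _ pn) andbT.
apply: contraNneq k => ->; by move: pn; rewrite mem_primes => /and3P[-> _ ->].
Qed.
Lemma roughM y p m : prime p -> (y <= p)%N -> (0 < m)%N -> rough y (p * m) = rough y m.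
Proof.
move=> pp yp m0; have p0 := prime_gt0 pp; apply/allP/allP => h r.
 by move=> rm; apply: h; rewrite primesM// rm orbT.
by rewrite primesM// => /orP[|/h//]; rewrite primes_prime// inE => /eqP ->.
Qed.
Lemma rough_ge y n : (0 < n < y)%N -> rough y n -> n = 1%N.
Proof.
move=> /andP[n0 ny] /allP h; case: (ltngtP n 1%N) => //; first by rewrite ltnNge n0.
move=> n1; have : pdiv n \in primes n by rewrite mem_primes pdiv_prime// n0 pdiv_dvd.
move/h => hy; have := pdiv_leq n0; lia.
Qed.
Definition cmul R (z : nat -> R[i]) :=
 z 1%N = 1 /\ forall m n, (0 < m)%N -> (0 < n)%N -> z (m * n)%N = z m * z n.

(** The primes are sifted out one at a time. For a finite sum, removing the multiples of [y] leaves
    over the terms with [N < y * m], called [E] below; together with [z y] they carry a factor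
    [nk k N]. Errors from earlier steps are multiplied by the bound of each new Euler factor. *)
Lemma euler_sieve R (z : nat -> R[i]) (k : R) N : cmul z -> 0 <= k ->
 (forall n, (0 < n)%N -> cn (z n) <= nk k n / n%:R) -> forall y,
 cn ((\sum_(1 <= n < N.+1) z n) * \prod_(1 <= p < y | prime p) (1 - z p) - \sum_(1 <= n < N.+1 | rough y n) z n)
 <= nk k N * (\sum_(1 <= n < N.+1) n%:R^-1) * (\sum_(1 <= p < y | prime p) p%:R^-1) * \prod_(1 <= p < y | prime p) (1 + nk k p / p%:R).
Proof.
move=> [z1 zM] k0 hz; set L := \sum_(1 <= n < N.+1) z n; set H : R := \sum_(1 <= n < N.+1) _.
have H0 : 0 <= H by apply: sumr_ge0 => n _.
have E0 y : (y <= 1)%N -> cn (L * \prod_(1 <= p < y | prime p) (1 - z p) - \sum_(1 <= n < N.+1 | rough y n) z n) = 0.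
 move=> y1; rewrite big_geq// mulr1 /L.
 rewrite (eq_bigl (rough y)) ?subrr ?cn0// => n; apply/esym/allP => p; rewrite mem_primes => /and3P[pp _ _].
 exact: leq_trans y1 (prime_gt0 pp).
have nkn n : 0 <= nk k n := ltW (nk_gt0 k n).
have R0 y : 0 <= nk k N * H * (\sum_(1 <= p < y | prime p) p%:R^-1) * \prod_(1 <= p < y | prime p) (1 + nk k p / p%:R).
 rewrite mulr_ge0//.
 by apply: prodr_ge0 => p _.
elim=> [|y IH]; first by rewrite E0.
case: (posnP y) => [->|y0]; first by rewrite E0.
have recS : \sum_(1 <= p < y.+1 | prime p) p%:R^-1 = \sum_(1 <= p < y | prime p) (p%:R : R)^-1 + (if prime y then y%:R^-1 else 0).
 by rewrite big_mkcond big_nat_recr//= -big_mkcond.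
have recP (f : nat -> R) : \prod_(1 <= p < y.+1 | prime p) f p = (\prod_(1 <= p < y | prime p) f p) * (if prime y then f y else 1).
 by rewrite big_mkcond big_nat_recr//= -big_mkcond.
have recC : \prod_(1 <= p < y.+1 | prime p) (1 - z p) = (\prod_(1 <= p < y | prime p) (1 - z p)) * (if prime y then 1 - z y else 1).
 by rewrite big_mkcond big_nat_recr//= -big_mkcond.
rewrite recS recP recC; case: ifP => py; last first.
 suff -> : \sum_(1 <= n < N.+1 | rough y.+1 n) z n = \sum_(1 <= n < N.+1 | rough y n) z n by rewrite addr0 !mulr1.
 rewrite big_nat_cond [RHS]big_nat_cond; apply: eq_bigl => n.
 by case: (boolP (1 <= n < N.+1)%N) => //= /andP[n0 _]; rewrite roughS// py andbT.
set Pr := \prod_(1 <= p < y | prime p) (1 - z p) in IH *; set S := \sum_(1 <= n < N.+1 | rough y n) z n in IH *.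
set Pk := \prod_(1 <= p < y | prime p) (1 + _) in IH *; set Sp := \sum_(1 <= p < y | prime p) _ in IH *.
set E := \sum_(1 <= m < N.+1 | rough y m && (N < y * m)%N) z m.
have SE : \sum_(1 <= n < N.+1 | rough y.+1 n) z n = S * (1 - z y) + z y * E.
 set A := \sum_(1 <= n < N.+1 | rough y.+1 n) z n.
 pose B := \sum_(1 <= n < N.+1 | rough y n && (y %| n)%N) z n.
 have eSA : S = A + B.
  rewrite /S (bigID (fun n => (y %| n)%N)) addrC; congr (_ + _).
  rewrite big_nat_cond [RHS]big_nat_cond; apply: eq_bigl => n.
  by case: (boolP (1 <= n < N.+1)%N) => //= /andP[n0 _]; rewrite roughS// py.
 have eB : B = z y * (S - E).
  have -> : B = \sum_(1 <= m < N.+1 | rough y m && (y * m <= N)%N) z y * z m.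
   rewrite /B big_mkcond [RHS]big_mkcond/= (eq_big_nat _ _ (F2 := fun n => \sum_(1 <= m < N.+1 | (y * m == n)%N) if rough y m then z y * z m else 0)).
    rewrite (exchange_big_dep xpredT)//= big_nat_cond [RHS]big_nat_cond; apply: eq_bigr => m /andP[/andP[m0 mN] _].
    rewrite (eq_bigl (fun n => n == (y * m)%N)) => [|n]; last by [].
    rewrite big_nat1_eq muln_gt0 y0 m0 ltnS; by case: (rough y m); case: (y * m <= N)%N.
   move=> n /andP[n0 nN]; case: (boolP (y %| n)%N) => [/dvdnP[m e]|yn]; last first.
    rewrite andbF big1// => m /eqP e; by case/negP: yn; rewrite -e dvdn_mulr.
   have m0 : (0 < m)%N by case: m e => // e; rewrite e in n0.
   rewrite (eq_bigl (fun m' => m' == m)) => [|m']; last by rewrite e mulnC eqn_pmul2r.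
   have mN : (m < N.+1)%N by move: nN; rewrite e; nia.
   by rewrite big_nat1_eq m0 mN e mulnC roughM// andbT zM.
  rewrite -mulr_sumr; congr (_ * _); apply/eqP; rewrite -subr_eq0 opprB addrA subr_eq0; apply/eqP.
  rewrite [RHS](bigID (fun m => (y * m <= N)%N)); congr (_ + _).
  by apply: eq_bigl => m; rewrite ltnNge.
 by rewrite -[LHS](addrK B) -eSA eB; ring.
have -> : L * (Pr * (1 - z y)) - \sum_(1 <= n < N.+1 | rough y.+1 n) z n = (L * Pr - S) * (1 - z y) - z y * E.
 by rewrite SE; ring.
apply: le_trans (cnB _ _) _; rewrite !cnM.
have zy := hz y y0.
have t1 : cn (1 - z y) <= 1 + nk k y / y%:R by apply: le_trans (cnB _ _) _; rewrite cn1 lerD2l.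
have t2 : cn (z y) * cn E <= nk k N * H * y%:R^-1.
 apply: (@le_trans _ _ (nk k y / y%:R * \sum_(1 <= m < N.+1 | rough y m && (N < y * m)%N) nk k m / m%:R)).
  apply: ler_pM; rewrite//; apply: le_trans (cn_sum _ _ _) _.
  by rewrite big_nat_cond [leRHS]big_nat_cond; apply: ler_sum => m /andP[/andP[m0 _] _]; exact: hz.
 rewrite mulr_sumr [X in _ <= X * _](_ : _ = \sum_(1 <= m < N.+1) nk k N * m%:R^-1); last by rewrite -mulr_sumr.
 rewrite mulr_suml big_mkcond big_nat_cond [leRHS]big_nat_cond; apply: ler_sum => m /andP[/andP[m0 mN] _].
 case: ifP => [/andP[_ ym]|_]//.
 have -> : nk k y / y%:R * (nk k m / m%:R) = nk k (y * m) * m%:R^-1 * y%:R^-1 by rewrite nkM//; ring.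
 rewrite !ler_wpM2r//; apply: nk_anti => //; [by lia|exact: ltnW].
have := ler_pM (cn_ge0 _) (cn_ge0 _) IH t1 => t3.
apply: le_trans (lerD t3 t2) _.
have a1 : 1 <= 1 + nk k y / y%:R by rewrite lerDl//.
have P1 : 1 <= Pk.
 rewrite /Pk; elim/big_ind: _ => // [u v u1 v1|p _]; first exact: mulr_ege1.
 by rewrite lerDl//.
have a2 : 1 <= Pk * (1 + nk k y / y%:R) by exact: mulr_ege1.
have -> : nk k N * H * (Sp + y%:R^-1) * (Pk * (1 + nk k y / y%:R)) =
  nk k N * H * Sp * Pk * (1 + nk k y / y%:R) + nk k N * H / y%:R * (Pk * (1 + nk k y / y%:R)) by ring.
by rewrite lerD2l ler_peMr//.
Qed.

Definition Lk R (xi : nat -> R[i]) (k : R) (N : nat) : R[i] :=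
 \sum_(1 <= n < N.+1) xi n * ((nk k n)%:C * (n%:R^-1)%:C).
Definition Ek R (xi : nat -> R[i]) (k : R) (N : nat) : R :=
 \sum_(1 <= p < N.+1 | prime p) complex.Re (xi p) * (nk k p / p%:R).

(** The upper bound is [1 + x <= expR x] applied to the squared modulus. The lower bound uses the
    upper one at [- z], through [(1 - z) * (1 + z) = 1 - z ^ 2]. *)
Lemma prime_factor_bound R (z : R[i]) : cn z <= 1/2 ->
 expR (- complex.Re z - 5/2 * cn z ^+ 2) <= cn (1 - z) <= expR (- complex.Re z + cn z ^+ 2 / 2).
Proof.
move=> h; have c0 := cn_ge0 z; set c := cn z in h c0 *.
have c2 : c ^+ 2 <= 1/4 by rewrite expr2; nra.
have sq (w : R[i]) a : 0 < a -> cn w ^+ 2 <= a ^+ 2 -> cn w <= a.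
 by move=> a0; rewrite ler_pXn2r ?nnegrE.
have e2 a : expR a ^+ 2 = expR (2 * a) by rewrite -expRM_natl.
have E1 (w : R[i]) : cn (1 - w) <= expR (- complex.Re w + cn w ^+ 2 / 2).
 apply: sq => //.
 rewrite e2; apply: le_trans (expR_ge1Dx _); rewrite cn_sqr cn_sqr; case: w => a b /=; lra.
apply/andP; split => //.
have u0 : 0 < cn (1 - z).
 rewrite lt_def cn_ge0 andbT; apply/eqP => /cn_eq0/eqP; rewrite subr_eq0 => /eqP e.
 by move: h; rewrite /c -e cn1; lra.
have F1 : cn (1 + z) <= expR (complex.Re z + c ^+ 2 / 2).
 by have := E1 (- z); rewrite opprK cnN -/c; case: (z) => a b; rewrite opprK.
have F2 : cn (1 - z) * cn (1 + z) = cn (1 - z ^+ 2) by rewrite -cnM; congr cn; ring.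
have F3 : expR (- (2 * c ^+ 2)) <= cn (1 - z ^+ 2).
 apply: (@le_trans _ _ (1 - c ^+ 2)).
  have : expR (- (2 * c ^+ 2)) * (1 + 2 * c ^+ 2) <= 1.
   rewrite -[leRHS](expR0) -(addNr (2 * c ^+ 2)) expRD ler_pM2l// expR_ge1Dx//.
  have := expR_gt0 (- (2 * c ^+ 2)); have : 0 <= c ^+ 2 by [].
  move: c2; move: (c ^+ 2) (expR _) => x y x4 x0 y0 xy.
  have g : 0 < 1 + 2 * x by lra.
  by rewrite -(ler_pM2r g); apply: le_trans xy _; nra.
 have := cnD (1 - z ^+ 2) (z ^+ 2); rewrite subrK cn1 cnX -/c; lra.
have g0 := expR_gt0 (complex.Re z + c ^+ 2 / 2).
rewrite -(ler_pM2r g0) -expRD; apply: (@le_trans _ _ (cn (1 - z ^+ 2))).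
 by apply: le_trans F3; rewrite ler_expR; lra.
by rewrite -F2 ler_pM2l.
Qed.
Lemma sum_inv2 R N : \sum_(1 <= p < N.+1 | prime p) (p%:R^-1 : R) ^+ 2 <= 1.
Proof.
have h : forall M, \sum_(2 <= p < M.+2) (p%:R^-1 : R) ^+ 2 <= 1 - M.+1%:R^-1.
 elim=> [|M IH]; first by rewrite big_geq// invr1 subrr.
 rewrite big_nat_recr//=; have a0 : 0 < M.+1%:R :> R by [].
 have b0 : 0 < M.+2%:R :> R by [].
 suff h : (M.+2%:R^-1 : R) ^+ 2 <= M.+1%:R^-1 - M.+2%:R^-1.
  by apply: le_trans (lerD IH h) _; rewrite addrA subrK.
 have -> : M.+1%:R^-1 - M.+2%:R^-1 = (M.+1%:R)^-1 * M.+2%:R^-1 :> R.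
  by field; apply/andP; split; lra.
 by rewrite ler_pM2r// lef_pV2// ler_nat.
case: N => [|N]; first by rewrite big_geq.
rewrite big_ltn_cond//=; case: N => [|N]; first by rewrite big_geq.
apply: (@le_trans _ _ (\sum_(2 <= p < N.+3) p%:R^-1 ^+ 2)).
 by rewrite big_mkcond; apply: ler_sum => p _; case: ifP => // _.
by apply: le_trans (h _) _; rewrite gerBl.
Qed.
(** Makes the error of [euler_sieve] at most 1/2: the two harmonic sums are at most [1 + ln N] and
    the product of the [1 + nk k p / p] is at most [expR (1 + k^-1)]. *)
Definition trunc_ok R (k : R) (N : nat) :=
 nk k N * (1 + ln N%:R) ^+ 2 * expR (1 + k^-1) <= 1 / 2.

(** After sifting by all primes up to [N] only [n = 1] is left, so [Lk] times the product of the
    [1 - z p] is within 1/2 of 1. The constant 4 collects this error and the squares of the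
    [cn (z p)], whose sum is at most 1. *)
Lemma euler_bounds R (xi : nat -> R[i]) (k : R) N : cmul xi -> (forall n, cn (xi n) <= 1) ->
 0 < k <= 1 -> (0 < N)%N -> trunc_ok k N ->
 expR (Ek xi k N - 4) <= cn (Lk xi k N) <= expR (Ek xi k N + 4).
Proof.
move=> [x1 xM] xb /andP[k0 k1] N0 tr; have k0' := ltW k0.
pose z n := xi n * ((nk k n)%:C * (n%:R^-1)%:C).
have zc : cmul z.
 split; first by rewrite /z /nk ln1 mulr0 oppr0 expR0 invr1 !mulr1.
 move=> m n m0 n0; rewrite /z xM// nkM// natrM invfM !RcM; ring.
have zb n : (0 < n)%N -> cn (z n) <= nk k n / n%:R.
 move=> n0; rewrite /z !cnM !cn_real !ger0_norm ?invr_ge0 ?(ltW (nk_gt0 _ _))//.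
 by rewrite ler_piMl// divr_ge0// (ltW (nk_gt0 _ _)).
have zb2 n : (0 < n)%N -> cn (z n) <= n%:R^-1.
 by move=> n0; apply: le_trans (zb n n0) _; rewrite ler_piMl ?invr_ge0// nk_le1.
have := euler_sieve N zc k0' zb N.+1.
have -> : \sum_(1 <= n < N.+1 | rough N.+1 n) z n = 1.
 rewrite big_nat_cond (eq_bigl (fun n => (1 <= n < N.+1)%N && (n == 1%N))); last first.
  move=> n; case: (boolP (1 <= n < N.+1)%N) => //= h; apply/idP/eqP; first exact: rough_ge.
  by move=> ->.
 by rewrite -big_nat_cond big_nat1_eq/= ltnS N0 zc.1.
set Pr := \prod_(1 <= p < N.+1 | prime p) (1 - z p); rewrite -/(Lk xi k N); set L := Lk xi k N.
set H : R := \sum_(1 <= n < N.+1) _; set Sp : R := \sum_(1 <= p < N.+1 | prime p) _; set Pk := \prod_(1 <= p < N.+1 | prime p) _.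
move=> he.
have Hle : H <= 1 + ln N%:R by exact: harmonic_le.
have H0 : 0 <= H by apply: sumr_ge0 => n _; rewrite invr_ge0.
have Sp0 : 0 <= Sp by apply: sumr_ge0 => n _; rewrite invr_ge0.
have SpH : Sp <= H.
 by rewrite /Sp big_mkcond; apply: ler_sum => p _; case: ifP => // _; rewrite invr_ge0.
have Pk0 : 0 <= Pk by apply: prodr_ge0 => p _; rewrite addr_ge0// divr_ge0// ltW ?nk_gt0.
have PkE : Pk <= expR (1 + k^-1).
 apply: (@le_trans _ _ (expR (\sum_(1 <= p < N.+1 | prime p) nk k p / p%:R))).
  rewrite expR_sum; apply: ler_prod => p _; rewrite expR_ge1Dx andbT addr_ge0// divr_ge0// ltW ?nk_gt0//.
 rewrite ler_expR; apply: le_trans (@zeta_le R k N _); last by lra.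
 by rewrite big_mkcond; apply: ler_sum => p _; case: ifP => // _; rewrite divr_ge0// ltW ?nk_gt0.
have hal : cn (L * Pr - 1) <= 1/2.
 apply: le_trans he _; apply: le_trans tr; apply: ler_pM => //.
  by rewrite !mulr_ge0// ltW ?nk_gt0.
 rewrite -mulrA ler_pM2l ?nk_gt0// expr2; apply: ler_pM => //; exact: le_trans Hle.
have up : cn L * cn Pr <= 3/2.
 by rewrite -cnM; have := cnD (L * Pr - 1) 1; rewrite subrK cn1; lra.
have lo : 1/2 <= cn L * cn Pr.
 by rewrite -cnM; have := cnD (1 - L * Pr) (L * Pr); rewrite subrK cn1 cnBC; lra.
have zp p : prime p -> cn (z p) <= 1/2.
 move=> pp; apply: le_trans (zb2 p (prime_gt0 pp)) _.
 by rewrite div1r lef_pV2 ?posrE ?ltr0n ?prime_gt0// ler_nat prime_gt1.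
have zs : \sum_(1 <= p < N.+1 | prime p) cn (z p) ^+ 2 <= 1.
 apply: le_trans (sum_inv2 R N); apply: ler_sum => p pp.
 by rewrite ler_pXn2r ?nnegrE// zb2// prime_gt0.
have ReE : \sum_(1 <= p < N.+1 | prime p) complex.Re (z p) = Ek xi k N.
 by apply: eq_bigr => p _; rewrite /z; case: (xi p) => a b /=; ring.
have Pup : cn Pr <= expR (- Ek xi k N + 1/2).
 rewrite cn_prod; apply: (@le_trans _ _ (expR (\sum_(1 <= p < N.+1 | prime p) (- complex.Re (z p) + cn (z p) ^+ 2 / 2)))).
  by rewrite expR_sum; apply: ler_prod => p pp; rewrite cn_ge0; have /andP[] := prime_factor_bound (zp p pp).
 rewrite ler_expR big_split sumrN ReE lerD2l -mulr_suml; lra.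
have Plo : expR (- Ek xi k N - 5/2) <= cn Pr.
 rewrite /Pr cn_prod; apply: (@le_trans _ _ (expR (\sum_(1 <= p < N.+1 | prime p) (- complex.Re (z p) - 5/2 * cn (z p) ^+ 2)))).
  by rewrite ler_expR sumrB sumrN ReE -mulr_sumr; clear - zs; lra.
 by rewrite expR_sum; apply: ler_prod => p pp; rewrite expR_ge0; have /andP[] := prime_factor_bound (zp p pp).
have Pr0 : 0 < cn Pr by apply: lt_le_trans Plo; exact: expR_gt0.
have e1 : 2 <= expR (1 : R) by have := expR_ge1Dx (1 : R); clear; lra.
have e1m : expR (-1 : R) <= 1/2 by rewrite expRN div1r lef_pV2 ?posrE.
apply/andP; split.
 rewrite -(ler_pM2r Pr0); apply: le_trans lo; apply: le_trans e1m.
 apply: le_trans (ler_wpM2l (expR_ge0 _) Pup) _; rewrite -expRD ler_expR; lra.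
rewrite -(ler_pM2r Pr0); apply: (@le_trans _ _ (expR 1)); first lra.
apply: le_trans (ler_wpM2l (expR_ge0 _) Plo); rewrite -expRD ler_expR; lra.
Qed.

Lemma aux341 R (a b n : R) : a ^+ 2 + b ^+ 2 <= 1 -> 0 <= n ->
 0 <= 3 * (1 * n) + 4 * (a * n) + (a * a - b * b) * n.
Proof.
move=> ab n0; rewrite (_ : _ + _ = (3 + 4 * a + (a * a - b * b)) * n); last ring.
by rewrite mulr_ge0; have := sqr_ge0 (1 + a); lra.
Qed.
(** For [|u| <= 1] the sum [3 + 4 * Re u + Re (u ^ 2)] is nonnegative; it is summed over the primes
    with [u = xi p]. Each of the eight factors loses [expR 4] in [euler_bounds], whence
    [expR (-32)]. *)
Lemma three_four_one R (xi : nat -> R[i]) (k : R) N : cmul xi -> (forall n, cn (xi n) <= 1) ->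
 0 < k <= 1 -> (0 < N)%N -> trunc_ok k N ->
 expR (-32) <= (1 + k^-1) ^+ 3 * cn (Lk xi k N) ^+ 4 * cn (Lk (fun n => xi n ^+ 2) k N).
Proof.
move=> xc xb kk N0 tr; have [k0 k1] := andP kk.
have xc2 : cmul (fun n => xi n ^+ 2).
 by case: xc => a b; split=> [|m n m0 n0]; [rewrite a expr1n|rewrite b// exprMn].
have xb2 n : cn (xi n ^+ 2) <= 1 by rewrite cnX exprn_ile1//.
have oc : cmul (fun=> 1 : R[i]) by split=> // *; rewrite mulr1.
have ob (n : nat) : cn (1 : R[i]) <= 1 by rewrite cn1.
have /andP[h0' _] := euler_bounds oc ob kk N0 tr.
have /andP[h1 _] := euler_bounds xc xb kk N0 tr.
have /andP[h2 _] := euler_bounds xc2 xb2 kk N0 tr.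
have z : cn (Lk (fun=> 1) k N) <= 1 + k^-1.
 apply: le_trans (zeta_le N kk); apply: le_trans (cn_sum _ _ _) _.
 apply: ler_sum => n _; rewrite mul1r -RcM cn_real ger0_norm// divr_ge0// ltW ?nk_gt0//.
set e0 := Ek _ k N in h0'; set e1 := Ek xi k N in h1; set e2 := Ek _ k N in h2.
have e : 0 <= 3 * e0 + 4 * e1 + e2.
 rewrite !mulr_sumr -!big_split; apply: sumr_ge0 => p _.
 have := xb p; have := cn_sqr (xi p); have c0 := cn_ge0 (xi p); case: (xi p) c0 => a b c0 s l1.
 have s1 : a ^+ 2 + b ^+ 2 <= 1 by rewrite -s exprn_ile1.
 have n0 : 0 <= nk k p / p%:R by rewrite divr_ge0// ltW ?nk_gt0.
 exact: aux341.
have X4 a n : expR a ^+ n = expR (n%:R * a) by rewrite -expRM_natl.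
have H0 : expR (e0 - 4) ^+ 3 <= (1 + k^-1) ^+ 3 by rewrite ler_pXn2r ?nnegrE//; exact: le_trans z.
have H1 : expR (e1 - 4) ^+ 4 <= cn (Lk xi k N) ^+ 4 by rewrite ler_pXn2r ?nnegrE.
have p0 (a : R) n : 0 <= expR a ^+ n by [].
have := ler_pM (mulr_ge0 (p0 _ _) (p0 _ _)) (expR_ge0 _) (ler_pM (p0 _ _) (p0 _ _) H0 H1) h2.
clear ob; rewrite !X4 -!expRD; apply: le_trans; rewrite ler_expR; lra.
Qed.
(** At [k0] the 3-4-1 inequality yields the lower bound [2 * D * k0], because [(2 / k0) ^ 3 * (2 * D
    * k0) ^ 4 = 128 * D ^ 4 * k0]; moving from [k0] to [k] loses at most [D * k0]. *)
Lemma L_lower R (xi : nat -> R[i]) (k0 X D k : R) N : cmul xi -> (forall n, cn (xi n) <= 1) ->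
 0 < k0 <= 1 -> (0 < N)%N -> trunc_ok k0 N -> 1 <= X -> 1 <= D ->
 cn (Lk (fun n => xi n ^+ 2) k0 N) <= X -> cn (Lk xi k N - Lk xi k0 N) <= D * k0 ->
 k0 <= expR (-32) / (128 * D ^+ 4 * X) -> D * k0 <= cn (Lk xi k N).
Proof.
move=> xc xb kk N0 tr X1 D1 hX hD hk; have [k00 k01] := andP kk.
have := three_four_one xc xb kk N0 tr; set L := cn (Lk xi k0 N) => h.
have L0 : 0 <= L := cn_ge0 _.
have i1 : 1 <= k0^-1 by rewrite invf_ge1.
have h2 : expR (-32) <= (2 / k0) ^+ 3 * L ^+ 4 * X.
 apply: le_trans h _; apply: ler_pM; rewrite//.
 by rewrite ler_wpM2r ?exprn_ge0//; apply: lerXn2r; rewrite ?nnegrE ?divr_ge0 ?(ltW k00)//; lra.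
have DX : 0 < 128 * D ^+ 4 * X by rewrite !mulr_gt0; clear - X1 D1; lra.
move: hk; rewrite ler_pdivlMr// => hk.
have h3 : (2 * D * k0) ^+ 4 <= L ^+ 4.
 have : k0 * (128 * D ^+ 4 * X) <= (2 / k0) ^+ 3 * L ^+ 4 * X by exact: le_trans h2.
 rewrite mulrA ler_pM2r; last lra.
 move=> hh; rewrite -(ler_pM2l (_ : 0 < (2 / k0) ^+ 3))//.
 by rewrite (_ : (2 / k0) ^+ 3 * (2 * D * k0) ^+ 4 = k0 * (128 * D ^+ 4))//; field.
have h4 : 2 * D * k0 <= L by move: h3; rewrite ler_pXn2r ?nnegrE ?mulr_ge0//; lra.
have := cnD (Lk xi k0 N - Lk xi k N) (Lk xi k N); rewrite subrK -/L cnBC.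
lra.
Qed.
#[local] Hint Extern 0 (is_true (_ <= nk _ _)) => exact: ltW (nk_gt0 _ _) : nneg.
#[local] Hint Extern 0 (is_true (_ < nk _ _)) => apply: nk_gt0 : nneg.

(** * Power sums and Dirichlet series on the real line *)

Lemma bernoulli R (a x : R) : 0 <= a <= 1 -> -1 < x -> expR (a * ln (1 + x)) <= 1 + a * x.
Proof.
move=> /andP[a0 a1] x1; have x0 : 0 < 1 + x by lra.
set l := ln (1 + x); have el : expR l = 1 + x by rewrite lnK//.
have h1 : expR (a * l) * (1 + (1 - a) * l) <= 1 + x.
 rewrite -el; apply: le_trans (ler_wpM2l (expR_ge0 _) (expR_ge1Dx ((1 - a) * l))) _.
 by rewrite -expRD (_ : a * l + _ = l)//; ring.
have h2 : expR (a * l) * (1 - a * l) <= 1.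
 apply: le_trans (ler_wpM2l (expR_ge0 _) (expR_ge1Dx (- (a * l)))) _.
 by rewrite -expRD addrN expR0.
(* The combination with weights [a] and [1 - a] makes the terms in [l] cancel. *)
have : a * (expR (a * l) * (1 + (1 - a) * l)) + (1 - a) * (expR (a * l) * (1 - a * l)) <= a * (1 + x) + (1 - a) * 1.
 by apply: lerD; apply: ler_wpM2l => //; lra.
lra.
Qed.
Lemma pw_step R (a : R) n : 0 < a <= 1 -> (0 < n)%N ->
 nk (1 - a) n.+1 <= (nk (- a) n.+1 - nk (- a) n) / a <= nk (1 - a) n.
Proof.
move=> /andP[a0 a1] n0.
have p0 : 0 < n%:R :> R by [].
have p1 : 0 < n.+1%:R :> R by [].
have aa : 0 <= a <= 1 by lra.
have nkE (m : nat) : (0 < m)%N -> nk (1 - a) m = nk (- a) m / m%:R.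
 move=> m0; rewrite /nk -{3}(lnK (_ : m%:R \is Num.pos)) ?posrE// -expRN -expRD; congr expR; ring.
have e1 : nk (- a) n.+1 = nk (- a) n * expR (a * ln (1 + n%:R^-1)).
 rewrite (_ : 1 + n%:R^-1 = n.+1%:R / n%:R); last by rewrite -natr1; field.
 rewrite ln_div// -expRD; congr expR; ring.
have e2 : nk (- a) n = nk (- a) n.+1 * expR (a * ln (1 + - n.+1%:R^-1)).
 rewrite (_ : 1 + - n.+1%:R^-1 = n%:R / n.+1%:R); last by rewrite -natr1 in p1 *; field.
 rewrite ln_div// -expRD; congr expR; ring.
have i1 : -1 < n%:R^-1 :> R by apply: lt_trans (_ : 0 < _); rewrite//; lra.
have i2 : -1 < - n.+1%:R^-1 :> R by rewrite ltrN2 invf_lt1// ltr1n.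
have b1 := bernoulli aa i1; have b2 := bernoulli aa i2.
apply/andP; split; rewrite nkE//.
 rewrite ler_pdivlMr// lerBrDr e2.
 apply: le_trans (_ : nk (- a) n.+1 / n.+1%:R * a + nk (- a) n.+1 * (1 + a * - n.+1%:R^-1) <= _); first by rewrite lerD2l ler_pM2l.
 by apply: eq_ler; ring.
rewrite ler_pdivrMr// lerBlDr e1.
apply: le_trans (_ : nk (- a) n * (1 + a * n%:R^-1) <= _); first by rewrite ler_pM2l.
by apply: eq_ler; ring.
Qed.
(** The value of a series is obtained as a number separating explicit lower bounds from explicit
    upper bounds, which gives the rate of convergence at once. *)
Lemma nested_sup R (l u : nat -> R) : (forall m n, l m <= u n) -> exists L, forall n, l n <= L <= u n.
Proof.
move=> h; exists (sup (range l)) => n; apply/andP; split.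
 apply: ub_le_sup => //.
 by exists (u 0%N) => _ [m _ <-].
apply: ge_sup; first by exists (l 0%N); exists 0%N.
by move=> _ [m _ <-].
Qed.
Definition zs R (s : R) N : R := \sum_(1 <= n < N.+1) nk s n.
Lemma nk1n R (s : R) : nk s 1 = 1.
Proof. by rewrite /nk ln1 mulr0 oppr0 expR0. Qed.
(** [z] is the value of the zeta function at [1 - a]. The difference between the sum and [u ^ a / a]
    decreases, and it increases once its last term is subtracted, by [pw_step]. *)
Lemma zeta_asym R (a : R) : 0 < a <= 1 -> exists z : R, - a^-1 <= z <= 0 /\
 forall u, (0 < u)%N -> `|zs (1 - a) u - (nk (- a) u / a + z)| <= nk (1 - a) u.
Proof.
move=> aa; have [a0 a1] := andP aa.
pose f n := zs (1 - a) n.+1 - nk (- a) n.+1 / a.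
have st n : f n - nk (1 - a) n.+1 <= f n.+1 - nk (1 - a) n.+2 /\ f n.+1 <= f n.
 have /andP[h1 h2] := @pw_step R a n.+1 aa isT.
 have e : f n.+1 = f n + nk (1 - a) n.+2 - (nk (- a) n.+2 - nk (- a) n.+1) / a.
  by rewrite /f /zs (big_nat_recr n.+2)//=; ring.
 by rewrite e; split; clear - h1 h2; lra.
have dec m n : (m <= n)%N -> f n <= f m.
 by elim: n => [|n IH]; [rewrite leqn0 => /eqP ->|rewrite leq_eqVlt => /predU1P[->//|/IH h]; apply: le_trans (st n).2 h].
have inc m n : (m <= n)%N -> f m - nk (1 - a) m.+1 <= f n - nk (1 - a) n.+1.
 by elim: n => [|n IH]; [rewrite leqn0 => /eqP ->|rewrite leq_eqVlt => /predU1P[->//|/IH h]; apply: le_trans h (st n).1].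
have [z hz] : exists z, forall n, f n - nk (1 - a) n.+1 <= z <= f n.
 apply: nested_sup => m n; apply: le_trans (inc m (maxn m n) (leq_maxl _ _)) _.
 apply: le_trans (_ : f (maxn m n) <= _); last exact: dec (leq_maxr _ _).
 by rewrite gerBl.
exists z; split.
 have := hz 0%N; rewrite /f /zs big_nat1 !nk1n.
 have : 1 <= a^-1 by rewrite invf_ge1.
 lra.
move=> [//|u] _; have /andP[h1 h2] := hz u; rewrite ler_distlC; rewrite /f in h1 h2; apply/andP; split; lra.
Qed.

Definition bsum R (a : nat -> R) (Q : R) := forall m n, `|\sum_(m <= i < n) a i| <= Q.
Lemma abel_mono R (a w : nat -> R) (Q : R) Z N : bsum a Q -> (Z <= N)%N ->
 (forall n, (Z <= n <= N)%N -> 0 <= w n) -> (forall n, (Z <= n < N)%N -> w n.+1 <= w n) ->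
 `|\sum_(Z <= n < N) a n * w n| <= Q * w Z.
Proof.
move=> bs ZN w0 wd; rewrite abel_sum//; apply: le_trans (ler_normD _ _) _.
have -> : w Z = w N + \sum_(Z <= n < N) (w n - w n.+1).
 have := telescope_sumr w ZN; rewrite -[X in X = _ -> _]opprK -sumrN.
 under eq_bigr do rewrite opprB.
 by lra.
rewrite mulrDr lerD//.
 by rewrite normrM (ger0_norm (w0 N _)) ?ZN ?leqnn// ler_wpM2r ?w0 ?ZN ?leqnn.
rewrite mulr_sumr; apply: le_trans (ler_norm_sum _ _ _) _.
rewrite big_nat_cond [leRHS]big_nat_cond; apply: ler_sum => n /andP[zn _].
rewrite normrM ler_pM//; rewrite ger0_norm ?subr_ge0 ?wd//.
Qed.
Definition Sx R (a : nat -> R) (s : R) N : R := \sum_(1 <= n < N.+1) a n * nk s n.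
Lemma Sx_diff R (a : nat -> R) (Q s : R) M N : bsum a Q -> 0 <= s -> (M <= N)%N ->
 `|Sx a s N - Sx a s M| <= Q * nk s M.+1.
Proof.
move=> bs s0 MN; rewrite /Sx (big_cat_nat (n := M.+1) (p := N.+1))//= addrAC subrr add0r.
by apply: abel_mono => // n /andP[nM _]; apply: nk_anti => //; exact: leq_trans nM.
Qed.
(** The value of the Dirichlet series at [s], characterized by its rate of convergence; the case
    [N = 0] contains the bound [|L| <= Q]. *)
Definition isL R (a : nat -> R) (Q s L : R) := forall N, `|Sx a s N - L| <= Q * nk s N.+1.
Lemma L_exists R (a : nat -> R) (Q s : R) : bsum a Q -> 0 <= s -> exists L, isL a Q s L.
Proof.
move=> bs s0; have Q0 : 0 <= Q := le_trans (normr_ge0 _) (bs 0%N 0%N).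
have [L hL] : exists L, forall n, Sx a s n - Q * nk s n.+1 <= L <= Sx a s n + Q * nk s n.+1.
 apply: nested_sup => m n.
 have q0 k : 0 <= Q * nk s k by [].
 have [mn|nm] := leqP m n.
  have := Sx_diff bs s0 mn; rewrite ler_distl => /andP[h1 _]; have := q0 n.+1; lra.
 have := Sx_diff bs s0 (ltnW nm); rewrite ler_distl => /andP[_ h2]; have := q0 m.+1; lra.
by exists L => n; rewrite ler_distl; have /andP[h1 h2] := hL n; apply/andP; split; lra.
Qed.
Lemma nk_small R (s e : R) : 0 < s -> 0 < e -> exists N, forall n, (N <= n)%N -> nk s n <= e.
Proof.
move=> s0 e0; exists (Num.truncn (expR (- ln e / s))).+1 => n Nn.
have n0 : (0 < n)%N by apply: leq_trans Nn.
rewrite -[leRHS]lnK// ler_expR lerNl -ler_pdivrMl// mulrC -[leLHS]expRK ler_ln ?posrE//.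
apply: le_trans (ltW (truncnS_gt _)) _; by rewrite ler_nat.
Qed.
Lemma isL_unique R (a : nat -> R) (Q Q' s L L' : R) : 0 < s -> isL a Q s L -> isL a Q' s L' -> L = L'.
Proof.
move=> s0 h h'; apply/eqP; rewrite -subr_eq0 -normr_le0; apply/ler_addgt0Pl => e e0.
have K0 : 0 < `|Q| + `|Q'| + 1 by rewrite ltr_wpDl.
have [N hN] := @nk_small R s (e / (`|Q| + `|Q'| + 1)) s0 ltac:(exact: divr_gt0).
have := hN N.+1 (leqnSn N); rewrite ler_pdivlMr// => hk.
have h1 := h N; have h2 := h' N; have k0 := nk_gt0 s N.+1.
have -> : L - L' = (Sx a s N - L') - (Sx a s N - L) by ring.
apply: le_trans (ler_normB _ _) _.
have := ler_norm Q; have := ler_norm Q'; nra.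
Qed.

(** * Convolution identities and positivity *)

Lemma conv_comm (A : comNzRingType) (u v : nat -> A) n : conv u v n = conv v u n.
Proof.
rewrite /conv (exchange_big_dep xpredT)//=; apply: eq_bigr => b _; apply: eq_big => [a|a _]; first by rewrite mulnC.
by rewrite mulrC.
Qed.
Lemma conv_ext (A : comNzRingType) (u v u' v' : nat -> A) n : (forall k, (0 < k)%N -> u k = u' k) ->
 (forall k, (0 < k)%N -> v k = v' k) -> conv u v n = conv u' v' n.
Proof.
move=> hu hv; rewrite /conv big_nat_cond [RHS]big_nat_cond; apply: eq_bigr => a /andP[/andP[a0 _] _].
rewrite big_nat_cond [RHS]big_nat_cond; apply: eq_bigr => b /andP[/andP[b0 _] _]; by rewrite hu// hv.
Qed.
Lemma convA (A : comNzRingType) (u v w : nat -> A) n : conv (conv u v) w n = conv u (conv v w) n.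
Proof.
case: n => [|n]; first by rewrite /conv !big_geq.
set N := n.+2.
have H (x y z : nat -> A) : conv (conv x y) z n.+1 = \sum_(1 <= a < N) \sum_(1 <= b < N) \sum_(1 <= c < N) (if (a * b * c == n.+1)%N then x a * y b * z c else 0).
 transitivity (\sum_(1 <= d < N) \sum_(1 <= c < N) \sum_(1 <= a < N) \sum_(1 <= b < N) (if (a * b == d)%N && (d * c == n.+1)%N then x a * y b * z c else 0)).
  rewrite /conv big_nat_cond [RHS]big_nat_cond; apply: eq_bigr => d /andP[/andP[d0 dN] _].
  rewrite big_mkcond; apply: eq_bigr => c _; case: ifP => dc; last first.
   by apply/esym; rewrite big1// => a _; rewrite big1// => b _; rewrite andbF.
  rewrite (_ : \sum_(1 <= a < d.+1) _ = conv x y d)// (@convE _ x y d N) ?d0// mulr_suml; apply: eq_bigr => a _; rewrite big_mkcond mulr_suml; apply: eq_bigr => b _.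
  by rewrite andbT; case: ifP => _; rewrite ?mul0r.
 under eq_bigr do rewrite exchange_big.
 rewrite exchange_big big_nat_cond [RHS]big_nat_cond; apply: eq_bigr => a /andP[/andP[a0 aN] _].
 under eq_bigr do rewrite exchange_big.
 rewrite exchange_big big_nat_cond [RHS]big_nat_cond; apply: eq_bigr => b /andP[/andP[b0 bN] _].
 rewrite exchange_big big_nat_cond [RHS]big_nat_cond; apply: eq_bigr => c /andP[/andP[c0 cN] _].
 rewrite (eq_bigr (fun d => if (d == a * b)%N then (if (a * b * c == n.+1)%N then x a * y b * z c else 0) else 0)).
  rewrite -big_mkcond big_nat1_eq; case: ifP => // /negbT.
  case: eqP => // e; have : (a * b <= a * b * c)%N by rewrite leq_pmulr.
  by rewrite e; lia.
 by move=> d _; rewrite eq_sym; case: eqP => [->|].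
rewrite H conv_comm.
transitivity (\sum_(1 <= b < N) \sum_(1 <= c < N) \sum_(1 <= a < N) (if (b * c * a == n.+1)%N then v b * w c * u a else 0)) => //.
rewrite exchange_big; apply: eq_bigr => b _; rewrite exchange_big; apply: eq_bigr => c _.
apply: eq_bigr => a _; rewrite (_ : a * b * c = b * c * a)%N; last by lia.
by case: ifP => // _; ring.
Qed.
Lemma convDr (A : comNzRingType) (u v w : nat -> A) n : conv u (fun k => v k + w k) n = conv u v n + conv u w n.
Proof.
rewrite -big_split; apply: eq_bigr => a _; rewrite -big_split; apply: eq_bigr => b _; exact: mulrDr.
Qed.
Lemma conv_ln R (u v : nat -> R) n : conv u v n * ln n%:R =
 conv (fun k => u k * ln k%:R) v n + conv u (fun k => v k * ln k%:R) n.
Proof.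
rewrite mulr_suml -big_split/= big_nat_cond [RHS]big_nat_cond; apply: eq_bigr => a /andP[/andP[a0 _] _].
rewrite mulr_suml -big_split/= big_nat_cond [RHS]big_nat_cond; apply: eq_bigr => b /andP[/andP[b0 _] /eqP e].
by rewrite -e ln_natM//; ring.
Qed.
Definition rcm R (u : nat -> R) := u 1%N = 1 /\ forall m n, (0 < m)%N -> (0 < n)%N -> u (m * n)%N = u m * u n.
Lemma rcm_ln R (u : nat -> R) n : rcm u -> u n * ln n%:R = conv u (fun k => u k * Lam R k) n.
Proof.
move=> [_ uM]; case: n => [|n]; first by rewrite /conv big_geq// (ln0 (lexx 0)) mulr0.
rewrite conv_comm -(sum_Lam_dvd R (ltn0Sn n)) mulr_sumr big_mkcond big_nat_cond [RHS]big_nat_cond.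
apply: eq_bigr => a /andP[/andP[a0 aN] _]; case: ifP => [/dvdnP[b e]|na].
 have b0 : (0 < b)%N by case: b e.
 rewrite (eq_bigl (fun b' => b' == b)) => [|b']; last by rewrite e mulnC eqn_pmul2r.
 rewrite big_nat1_eq b0 ifT; last by rewrite ltnS e leq_pmulr.
 by rewrite e uM//; ring.
rewrite big1// => b /eqP e; by rewrite -e dvdn_mulr in na.
Qed.
Lemma conv2_ln R (u v : nat -> R) n : rcm u -> rcm v ->
 conv u v n * ln n%:R = conv (conv u v) (fun k => u k * Lam R k + v k * Lam R k) n.
Proof.
move=> hu hv; rewrite conv_ln convDr; congr (_ + _).
 rewrite (@conv_ext _ _ v (conv u (fun k => u k * Lam R k)) v)// => [|k _]; last exact: rcm_ln.
 rewrite convA [RHS]convA; apply: conv_ext => // k _; exact: conv_comm.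
rewrite (@conv_ext _ u _ u (conv v (fun k => v k * Lam R k)))// => [|k _]; last exact: rcm_ln.
by rewrite convA.
Qed.
(** Positivity is read off the logarithmic derivative [g]: for [n > 1], [f n * ln n] is a sum of
    terms [f a * g b], and those with [a = n] vanish because [g 1 = 0]. This replaces a discussion
    of Euler factors. *)
Lemma conv_nonneg R (f g : nat -> R) : 0 <= f 1%N -> (forall n, 0 <= g n) -> g 1%N = 0 ->
 (forall n, f n * ln n%:R = conv f g n) -> forall n, (0 < n)%N -> 0 <= f n.
Proof.
move=> f1 g0 g1 h; elim/ltn_ind => n IH n0; case: (ltngtP n 1%N) => [|n1|->//]; first by lia.
have l0 : 0 < ln n%:R :> R by rewrite ln_gt0// ltr1n.
rewrite -(pmulr_lge0 _ l0) h /conv big_nat_cond; apply: sumr_ge0 => a /andP[/andP[a0 an] _].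
rewrite big_nat_cond; apply: sumr_ge0 => b /andP[/andP[b0 bn] /eqP e].
have [->|b1] := eqVneq b 1%N; first by rewrite g1 mulr0.
by rewrite mulr_ge0// IH//; nia.
Qed.
Lemma Lam1 R : Lam R 1 = 0.
Proof. by rewrite /Lam big_ltn_cond//= big_geq. Qed.
Lemma conv_1 (A : comNzRingType) (u v : nat -> A) : conv u v 1 = u 1%N * v 1%N.
Proof. by rewrite /conv big_nat1 big_ltn_cond//= big_geq// addr0. Qed.
Lemma conv2_nonneg R (u v : nat -> R) n : rcm u -> rcm v ->
 (forall n, -1 <= u n + v n - 1) -> (0 < n)%N -> 0 <= conv u v n.
Proof.
move=> hu hv uv n0; apply: (@conv_nonneg R (conv u v) (fun k => u k * Lam R k + v k * Lam R k)) => //.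
- by rewrite conv_1 hu.1 hv.1.
- by move=> k; rewrite -mulrDl mulr_ge0//; have := uv k; lra.
- by rewrite Lam1 !mulr0 addr0.
- by move=> k; exact: conv2_ln.
Qed.

(** * Hyperbola method *)

Lemma nkD R (s t : R) n : nk s n * nk t n = nk (s + t) n.
Proof. by rewrite /nk -expRD; congr expR; ring. Qed.
Lemma nk_anti_s R (s t : R) n : s <= t -> nk t n <= nk s n.
Proof. by move=> st; rewrite /nk ler_expR lerN2 ler_wpM2r. Qed.
Lemma nk1E R n : (0 < n)%N -> nk (1 : R) n = n%:R^-1.
Proof. by move=> n0; rewrite /nk mul1r expRN lnK// posrE ltr0n. Qed.
Lemma nkN_mono R (s : R) m n : 0 <= s -> (0 < m)%N -> (m <= n)%N -> nk (- s) m <= nk (- s) n.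
Proof.
move=> s0 m0 mn; rewrite /nk ler_expR !mulNr !opprK ler_wpM2l// ler_ln ?posrE ?ltr0n ?ler_nat//.
exact: leq_trans mn.
Qed.
Lemma nk_ge0 R (s : R) n : 0 <= nk s n. Proof. exact: ltW (nk_gt0 s n). Qed.

Lemma hyper R (u v : nat -> R) D y : (D * D <= y < D.+1 * D.+1)%N ->
 \sum_(1 <= n < y.+1) conv u v n = \sum_(1 <= d < D.+1) u d * (\sum_(1 <= e < (y %/ d).+1) v e) +
  \sum_(1 <= e < D.+1) v e * (\sum_(D.+1 <= d < (y %/ e).+1) u d).
Proof.
move=> /andP[Dy yD]; have Dy1 : (D <= y)%N by nia.
transitivity (\sum_(1 <= n < y.+1) conv u v n * 1); first by apply: eq_bigr => n _; rewrite mulr1.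
rewrite (sum_conv u v (fun=> 1)) (big_cat_nat (n := D.+1))//=; congr (_ + _).
 apply: eq_big_nat => a /andP[a0 aD].
 rewrite mulr_sumr [RHS](big_nat_widen _ _ y.+1); last by rewrite ltnS leq_div.
 apply: eq_big => [b|b _]; last by lra.
 by rewrite !ltnS leq_divRL// mulnC.
rewrite (exchange_big_dep xpredT)//= (big_cat_nat (n := D.+1))//= [X in _ + X]big1_seq ?addr0; last first.
 move=> b /andP[_]; rewrite mem_index_iota => /andP[bD _]; rewrite big1_seq// => a /andP[ab].
 rewrite mem_index_iota => /andP[aD _]; nia.
apply: eq_big_nat => b /andP[b0 bD].
rewrite mulr_sumr [RHS](big_nat_widen _ _ y.+1); last by rewrite ltnS leq_div.
apply: eq_big => [a|a _]; last by lra.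
by rewrite !ltnS leq_divRL.
Qed.
Lemma conv_nk R (u v : nat -> R) (s : R) n :
 conv u v n * nk s n = conv (fun k => u k * nk s k) (fun k => v k * nk s k) n.
Proof.
rewrite /conv mulr_suml big_nat_cond [RHS]big_nat_cond; apply: eq_bigr => a /andP[/andP[a0 _] _].
rewrite mulr_suml big_nat_cond [RHS]big_nat_cond; apply: eq_bigr => b /andP[/andP[b0 _] /eqP e].
by rewrite -e nkM//; ring.
Qed.
(** Replaces the integer quotient by the real one in [(y / d) ^ a / a]; the loss is a single step of
    [pw_step]. *)
Lemma floor_pw R (a : R) d y : 0 < a <= 1 -> (0 < d <= y)%N ->
 0 <= nk (- a) y * nk a d / a - nk (- a) (y %/ d) / a <= nk (1 - a) (y %/ d).
Proof.
move=> aa /andP[d0 dy]; have [a0 a1] := andP aa.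
set u := (y %/ d)%N; have u0 : (0 < u)%N by rewrite divn_gt0.
have y0 : (0 < y)%N by apply: leq_trans dy.
have ud : (u * d <= y)%N by rewrite leq_trunc_div.
have ud2 : (y < u.+1 * d)%N by rewrite ltn_ceil.
have e (m : nat) : (0 < m)%N -> nk (- a) m * nk a m = 1 by move=> _; rewrite nkD addNr /nk mul0r oppr0 expR0.
have lo : nk (- a) u <= nk (- a) y * nk a d.
 rewrite -[leLHS]mulr1 -(e d d0) mulrA -nkM// ler_wpM2r//; apply: nkN_mono => //; by rewrite muln_gt0 u0.
have hi : nk (- a) y * nk a d <= nk (- a) u.+1.
 rewrite -[leRHS]mulr1 -(e d d0) mulrA -nkM// ler_wpM2r//; apply: nkN_mono => //; exact: ltnW.
have /andP[_ st] := pw_step aa u0.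
rewrite -mulrBl; apply/andP; split; first by rewrite divr_ge0 ?subr_ge0// ltW.
by apply: le_trans st; rewrite ler_wpM2r// lerD2r.
Qed.
Lemma zfloor R (a z : R) d y : 0 < a <= 1 -> 
 (forall u, (0 < u)%N -> `|zs (1 - a) u - (nk (- a) u / a + z)| <= nk (1 - a) u) ->
 (0 < d <= y)%N -> `|zs (1 - a) (y %/ d) - (nk (- a) y * nk a d / a + z)| <= 4 * (nk (1 - a) y / nk (1 - a) d).
Proof.
move=> aa hz dd; have [d0 dy] := andP dd; have [a0 a1] := andP aa.
set u := (y %/ d)%N; have u0 : (0 < u)%N by rewrite divn_gt0.
set s := 1 - a; have s0 : 0 <= s by rewrite /s; lra.
have B : nk s u <= 2 * (nk s y / nk s d).
 rewrite mulrA ler_pdivlMr// -nkM//.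
 have h : nk s (2 * (u * d)) <= nk s y by apply: nk_anti => //; nia.
 have h2 : 1/2 <= nk s 2.
  apply: le_trans (nk_anti_s 2 (_ : s <= 1)); last by rewrite /s; lra.
  by rewrite nk1E// div1r.
 move: h; rewrite nkM ?muln_gt0 ?u0//; have := nk_gt0 s (u * d); nra.
have T := floor_pw aa dd; rewrite -/s -/u in T.
have := hz u u0; case/andP: T => T1 T2; rewrite -/s !ler_distl => /andP[h1 h2]; apply/andP; split; clear - B T1 T2 h1 h2; lra.
Qed.
Lemma zs_le R (a : R) D : 0 < a <= 1 -> (0 < D)%N -> zs (1 - a) D <= 2 * nk (- a) D / a.
Proof.
move=> aa D0; have [z [/andP[_ z0] hz]] := zeta_asym aa; have [a0 a1] := andP aa.
have := hz D D0; rewrite ler_distl => /andP[_ h]; apply: le_trans h _.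
have : nk (1 - a) D <= 1 by apply: nk_le1; lra.
have : 1 <= nk (- a) D / a.
 rewrite ler_pdivlMr// mul1r; apply: le_trans a1 _; rewrite -[leLHS](nk1n (- a)).
 by apply: nkN_mono => //; lra.
rewrite -mulrA; lra.
Qed.
Lemma tail_char R (c : nat -> R) (Q s : R) D y : bsum c Q -> 0 <= Q -> 0 <= s ->
 `|\sum_(D.+1 <= d < y.+1) c d * nk s d| <= Q * nk s D.+1.
Proof.
move=> bs Q0 s0; have [Dy|yD] := leqP D y; last by rewrite big_geq ?normr0// ltnW.
by apply: abel_mono => // n /andP[nM _]; apply: nk_anti => //; exact: leq_trans nM.
Qed.
(** The small [d] give the main terms through [zeta_asym], the sums [Sx] being then completed to
    [L1] and [Ls]; the large [d] are negligible because [c] has bounded partial sums. Analytically,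
    the first main term is the residue at the pole of zeta and the second the value of zeta times
    the L-series at [1 - a]. *)
Lemma rsum_asym R (c : nat -> R) (Q a z L1 Ls : R) D y : 0 < a <= 1/2 ->
 - a^-1 <= z <= 0 -> (forall u, (0 < u)%N -> `|zs (1 - a) u - (nk (- a) u / a + z)| <= nk (1 - a) u) ->
 bsum c Q -> 1 <= Q -> (forall n, `|c n| <= 1) -> isL c Q 1 L1 -> isL c Q (1 - a) Ls ->
 (0 < D)%N -> (D * D <= y < D.+1 * D.+1)%N ->
 `|\sum_(1 <= n < y.+1) conv c (fun=> 1) n * nk (1 - a) n - (L1 * nk (- a) y / a + z * Ls)| <= 8 * Q / a * nk (1 - 2 * a) D.
Proof.
move=> /andP[a0 a12] /andP[zl z0] hz bs Q1 c1 hL1 hLs D0 Dy; set s := 1 - a.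
have [Dy1 Dy2] := andP Dy; have Dley : (D <= y)%N by nia.
have y0 : (0 < y)%N by apply: leq_trans Dley.
have aa : 0 < a <= 1 by rewrite a0; lra.
have s0 : 0 <= s by rewrite /s; lra.
have Q0 : 0 <= Q by lra.
have i0 : 0 < a^-1 by rewrite invr_gt0.
rewrite (eq_bigr (conv (fun k => c k * nk s k) (fun k => 1 * nk s k))) => [|n _]; last by rewrite conv_nk.
rewrite (hyper _ _ Dy).
set X := nk (1 - 2 * a) D; have X0 : 0 <= X := nk_ge0 _ _.
have F1 : `|\sum_(1 <= d < D.+1) c d * nk s d * (\sum_(1 <= e < (y %/ d).+1) 1 * nk s e) - (nk (- a) y / a * Sx c 1 D + z * Sx c s D)| <= 4 * X.
 rewrite /Sx !mulr_sumr -big_split /= -sumrB; apply: le_trans (ler_norm_sum _ _ _) _.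
 apply: (@le_trans _ _ (\sum_(1 <= d < D.+1) 4 * nk s y)).
  apply: ler_sum_nat => d /andP[d0 dD].
  have dy : (0 < d <= y)%N by rewrite d0 (leq_trans _ Dley).
  have := zfloor aa hz dy; rewrite -/s => h.
  have -> : \sum_(1 <= e < (y %/ d).+1) 1 * nk s e = zs s (y %/ d) by apply: eq_bigr => e _; rewrite mul1r.
  have -> : c d * nk s d * zs s (y %/ d) - (nk (- a) y / a * (c d * nk 1 d) + z * (c d * nk s d)) = c d * nk s d * (zs s (y %/ d) - (nk (- a) y * nk a d / a + z)).
   rewrite (_ : nk 1 d = nk s d * nk a d); last by rewrite nkD /s subrK.
   ring.
  rewrite !normrM (ger0_norm (nk_ge0 _ _)) -mulrA; apply: le_trans (ler_piMl _ (c1 d)) _; first by [].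
  apply: le_trans (ler_wpM2l (nk_ge0 _ _) h) _.
  by apply: eq_ler; field; rewrite lt0r_neq0 ?nk_gt0.
 rewrite sumr_const_nat subn1 /= -[_ *+ _]mulr_natr -mulrA ler_pM2l//.
 apply: (@le_trans _ _ (nk s (D * D) * D%:R)); first by rewrite ler_wpM2r// nk_anti// muln_gt0 D0.
 have -> : D%:R = nk (-1) D :> R by rewrite /nk mulN1r opprK lnK// posrE ltr0n.
 by rewrite nkM// !nkD (_ : s + s + -1 = 1 - 2 * a)//; rewrite /s; ring.
have DX : nk s D.+1 <= X.
 apply: le_trans (nk_anti s0 D0 (leqnSn D)) _; apply: nk_anti_s; rewrite /s; lra.
have F2 : `|nk (- a) y / a * Sx c 1 D - L1 * nk (- a) y / a| <= Q / a * X.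
 have -> : nk (- a) y / a * Sx c 1 D - L1 * nk (- a) y / a = nk (- a) y / a * (Sx c 1 D - L1) by ring.
 rewrite normrM ger0_norm//.
 apply: le_trans (ler_wpM2l _ (hL1 D)) _; first by rewrite divr_ge0 ?nk_ge0 ?(ltW a0).
 have h : nk (- a) y * nk 1 D.+1 <= X.
  have h1 : nk (- a) y <= nk (- a) (D.+1 * D.+1) by apply: nkN_mono => //; exact: ltnW.
  apply: le_trans (ler_wpM2r (nk_ge0 _ _) h1) _; rewrite nkM// !nkD.
  have -> : - a + - a + 1 = 1 - 2 * a by ring.
  by apply: nk_anti => //; lra.
 have QA : 0 <= Q / a by [].
 have := ler_wpM2l QA h; lra.
have F3 : `|z * Sx c s D - z * Ls| <= Q / a * X.
 rewrite -mulrBr normrM; apply: le_trans (ler_pM (normr_ge0 _) (normr_ge0 _) (_ : _ <= a^-1) (hLs D)) _.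
  by rewrite ler_norml; lra.
 have := ler_wpM2l (mulr_ge0 (ltW i0) Q0) DX; rewrite -/s; lra.
have F4 : `|\sum_(1 <= e < D.+1) 1 * nk s e * (\sum_(D.+1 <= d < (y %/ e).+1) c d * nk s d)| <= 2 * Q / a * X.
 apply: le_trans (ler_norm_sum _ _ _) _.
 apply: (@le_trans _ _ (\sum_(1 <= e < D.+1) nk s e * (Q * nk s D.+1))).
  apply: ler_sum => e _; rewrite mul1r normrM (ger0_norm (nk_ge0 _ _)) ler_wpM2l//.
  exact: tail_char.
 rewrite -mulr_suml -/(zs s D).
 apply: le_trans (ler_wpM2r _ (zs_le aa D0)) _; first by rewrite mulr_ge0 ?nk_ge0.
 have h : nk (- a) D * nk s D.+1 <= X.
  apply: le_trans (ler_wpM2l (nk_ge0 _ _) (nk_anti s0 D0 (leqnSn D))) _; rewrite nkD.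
  by rewrite (_ : - a + s = 1 - 2 * a)// /s; ring.
 have QA : 0 <= 2 * Q / a by [].
 have := ler_wpM2l QA h; lra.
have Qa1 : 1 <= Q / a by rewrite ler_pdivlMr//; lra.
have := ler_wpM2r X0 Qa1; move: F1 F2 F3 F4; rewrite -/s; set A1 := \sum_(1 <= d < D.+1) _; set A2 := \sum_(1 <= e < D.+1) _.
rewrite -!mulrA; move: (Q * (a^-1 * X)) => W; rewrite !ler_norml => /andP[h1 h2] /andP[h3 h4] /andP[h5 h6] /andP[h7 h8] h9.
apply/andP; split; clear - h1 h2 h3 h4 h5 h6 h7 h8 h9; lra.
Qed.
Lemma isL_bound R (c : nat -> R) (Q s L : R) : isL c Q s L -> `|L| <= Q.
Proof. by move=> h; have := h 0%N; rewrite /Sx big_geq// sub0r normrN nk1n mulr1. Qed.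
(** With two oscillating factors there is no pole, so the only main term is the product of the
    values. *)
Lemma wsum_asym R (c c' : nat -> R) (Q s L L' : R) D y : 3/4 <= s <= 1 ->
 bsum c Q -> bsum c' Q -> 1 <= Q -> (forall n, `|c n| <= 1) -> (forall n, `|c' n| <= 1) -> isL c Q s L -> isL c' Q s L' ->
 (0 < D)%N -> (D * D <= y < D.+1 * D.+1)%N ->
 `|\sum_(1 <= n < y.+1) conv c c' n * nk s n - L * L'| <= 10 * Q ^+ 2 * nk (1/2) D.
Proof.
move=> /andP[sl s1] bs bs' Q1 c1 c1' hL hL' D0 Dy.
have [Dy1 Dy2] := andP Dy; have Dley : (D <= y)%N by nia.
have y0 : (0 < y)%N by apply: leq_trans Dley.
have s0 : 0 <= s by lra.
have Q0 : 0 <= Q by lra.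
rewrite (eq_bigr (conv (fun k => c k * nk s k) (fun k => c' k * nk s k))) => [|n _]; last by rewrite conv_nk.
rewrite (hyper _ _ Dy).
set X := nk (1/2) D; have X0 : 0 <= X := nk_ge0 _ _.
have F1 : `|\sum_(1 <= d < D.+1) c d * nk s d * (\sum_(1 <= e < (y %/ d).+1) c' e * nk s e) - Sx c s D * L'| <= Q * X.
 rewrite /Sx mulr_suml -sumrB; apply: le_trans (ler_norm_sum _ _ _) _.
 apply: (@le_trans _ _ (\sum_(1 <= d < D.+1) Q * nk s y)).
  apply: ler_sum_nat => d /andP[d0 dD].
  rewrite -mulrBr !normrM (ger0_norm (nk_ge0 _ _)) -mulrA; apply: le_trans (ler_piMl _ (c1 d)) _; first by [].
  apply: le_trans (ler_wpM2l (nk_ge0 _ _) (hL' _)) _; rewrite mulrCA ler_wpM2l// -nkM//.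
  by apply: nk_anti => //; rewrite mulnC ltnW// ltn_ceil.
 rewrite sumr_const_nat subn1 -[_ *+ _]mulr_natr -mulrA ler_wpM2l//.
 apply: (@le_trans _ _ (nk s (D * D) * D%:R)); first by rewrite ler_wpM2r// nk_anti// muln_gt0 D0.
 have -> : D%:R = nk (-1) D :> R by rewrite /nk mulN1r opprK lnK// posrE ltr0n.
 by rewrite nkM// !nkD; apply: nk_anti_s; lra.
have F2 : `|Sx c s D * L' - L * L'| <= Q * Q * X.
 rewrite -mulrBl normrM mulrC; apply: le_trans (ler_pM (normr_ge0 _) (normr_ge0 _) (isL_bound hL') (hL D)) _.
 rewrite mulrA ler_wpM2l//; apply: le_trans (nk_anti s0 D0 (leqnSn D)) _; apply: nk_anti_s; lra.
have F4 : `|\sum_(1 <= e < D.+1) c' e * nk s e * (\sum_(D.+1 <= d < (y %/ e).+1) c d * nk s d)| <= 8 * Q * X.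
 apply: le_trans (ler_norm_sum _ _ _) _.
 apply: (@le_trans _ _ (\sum_(1 <= e < D.+1) nk (1 - 1/4) e * (Q * nk (3/4) D))).
  apply: ler_sum => e _; rewrite !normrM (ger0_norm (nk_ge0 _ _)); apply: ler_pM; rewrite ?mulr_ge0 ?nk_ge0//.
   apply: le_trans (ler_piMl (nk_ge0 _ _) (c1' e)) _; apply: nk_anti_s; lra.
  apply: le_trans (tail_char _ _ bs Q0 s0) _; rewrite ler_wpM2l//.
  apply: le_trans (nk_anti s0 D0 (leqnSn D)) _; apply: nk_anti_s; lra.
 rewrite -mulr_suml -/(zs (1 - 1/4) D).
 have a4 : 0 < (1/4 : R) <= 1 by apply/andP; split; clear; lra.
 apply: le_trans (ler_wpM2r _ (zs_le a4 D0)) _; first by [].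
 have e12 : - (1/4) + 3/4 = 1/2 :> R by lra.
 have -> : X = nk (- (1/4)) D * nk (3/4) D by rewrite nkD e12.
 by apply: eq_ler; field.
have QX : 0 <= Q * X by [].
have QQ : Q * X <= Q * Q * X by rewrite -mulrA ler_peMl.
move: F1 F2 F4; set A1 := \sum_(1 <= d < D.+1) _; set A2 := \sum_(1 <= e < D.+1) _.
rewrite expr2 -[10 * _ * _]mulrA; move: QQ QX; rewrite -[8 * Q * X]mulrA; move: (Q * X) (Q * Q * X) => W W2 ? ?; rewrite !ler_norml.
move=> /andP[? ?] /andP[? ?] /andP[? ?]; apply/andP; split; lra.
Qed.

(** * Periodic sequences; divergence of the sum of 1/p *)

Lemma per_mod (V : Type) (x : nat -> V) q n : (forall n, x (n + q)%N = x n) -> x (n %% q)%N = x n.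
Proof.
move=> h; rewrite {2}(divn_eq n q); elim: (n %/ q)%N => [|k IH] => //.
by rewrite -addnA addnC h.
Qed.
Lemma per_window (V : zmodType) (x : nat -> V) q m : (forall n, x (n + q)%N = x n) ->
 \sum_(m <= i < m + q) x i = \sum_(0 <= i < q) x i.
Proof.
move=> h; elim: m => [|m IH] => //.
rewrite -IH; apply: (addrI (x m)); rewrite -big_ltn; last by lia.
by rewrite big_nat_recr ?h ?leq_addr// addrC.
Qed.
Lemma per_red (V : zmodType) (x : nat -> V) q m n : (0 < q)%N -> (forall n, x (n + q)%N = x n) ->
 \sum_(0 <= i < q) x i = 0 -> exists m', (n - m' <= q)%N /\ \sum_(m <= i < n) x i = \sum_(m' <= i < n) x i.
Proof.
move=> q0 h z; move: {2}(n - m)%N (leqnn (n - m)) => k; elim: k m => [|k IH] m mk.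
 by exists m; split=> //; lia.
have [le|lt] := leqP (n - m) q; first by exists m.
have [m' [h1 h2]] := IH (m + q)%N ltac:(lia); exists m'; split=> //.
rewrite (big_cat_nat (n := m + q))/=; [|lia|lia].
by rewrite per_window// z add0r.
Qed.
Lemma per_bound R (x : nat -> R) q : (0 < q)%N -> (forall n, x (n + q)%N = x n) ->
 \sum_(0 <= i < q) x i = 0 -> (forall n, `|x n| <= 1) -> bsum x q%:R.
Proof.
move=> q0 h z x1 m n; have [m' [h1 ->]] := per_red m n q0 h z.
apply: le_trans (ler_norm_sum _ _ _) _; apply: le_trans (ler_sum _ (fun i _ => x1 i)) _.
by rewrite sumr_const_nat ler_nat.
Qed.
Lemma per_cbound R (x : nat -> R[i]) q : (0 < q)%N -> (forall n, x (n + q)%N = x n) ->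
 \sum_(0 <= i < q) x i = 0 -> (forall n, cn (x n) <= 1) -> forall m n, cn (\sum_(m <= i < n) x i) <= q%:R.
Proof.
move=> q0 h z x1 m n; have [m' [h1 ->]] := per_red m n q0 h z.
apply: le_trans (cn_sum _ _ _) _; apply: le_trans (ler_sum _ (fun i _ => x1 i)) _.
by rewrite sumr_const_nat ler_nat.
Qed.
Lemma mulmod_inj q n0 i j : (0 < q)%N -> coprime n0 q -> (i < q)%N -> (j < q)%N -> (i * n0 = j * n0 %[mod q])%N -> i = j.
Proof.
move=> q0 cop; wlog ji : i j / (j <= i)%N.
 by move=> H iq jq e; case: (leqP j i) => h; [exact: H|apply/esym; apply: H => //; exact: ltnW].
move=> iq jq /eqP; rewrite eqn_mod_dvd; last by rewrite leq_mul2r ji orbT.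
rewrite -mulnBl Gauss_dvdl; last by rewrite coprime_sym.
case: (posnP (i - j)) => [|p /(dvdn_leq p)]; lia.
Qed.
Lemma char_sum0 (A : idomainType) (x : nat -> A) q n0 : (0 < q)%N -> (forall n, x (n + q)%N = x n) ->
 (forall m n, x (m * n)%N = x m * x n) -> coprime n0 q -> x n0 != 1 -> \sum_(0 <= i < q) x i = 0.
Proof.
move=> q0 h xM cop xn; rewrite big_mkord; set S := \sum_(i < q) _.
have : (x n0 - 1) * S = 0.
 rewrite mulrBl mul1r; apply/eqP; rewrite subr_eq0; apply/eqP.
 pose f (i : 'I_q) := Ordinal (ltn_pmod (i * n0) q0).
 have fi : injective f.
  move=> i j /(congr1 val) e; apply: val_inj; exact: (mulmod_inj q0 cop (ltn_ord i) (ltn_ord j) e).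
 rewrite [RHS](reindex_inj fi) mulr_sumr; apply: eq_bigr => i _.
 by rewrite per_mod// mulrC.
by move/eqP; rewrite mulf_eq0 subr_eq0 (negbTE xn) => /eqP.
Qed.
Lemma sum_map_le (R : realDomainType) (I T : eqType) (s : seq I) (f : I -> T) (t : seq T) (g : T -> R) :
 uniq (map f s) -> uniq t -> {subset map f s <= t} -> (forall n, n \in t -> 0 <= g n) ->
 \sum_(i <- s) g (f i) <= \sum_(n <- t) g n.
Proof.
move=> u1 u2 sub g0; rewrite -(big_map f xpredT g) [leRHS](bigID (mem (map f s))) -[leLHS]addr0.
apply: lerD; last by rewrite big_seq_cond; apply: sumr_ge0 => n /andP[/g0].
rewrite -[leRHS]big_filter; apply: eq_ler; apply: perm_big.
apply: uniq_perm => //; first exact: filter_uniq.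
by move=> n; rewrite mem_filter; apply/idP/andP => [h|[]//]; split=> //; exact: sub.
Qed.
Lemma trunc_ex R (k : R) : 0 < k -> exists N0, forall N, (N0 <= N)%N -> trunc_ok k N.
Proof.
move=> k0; have [C [C0 hC]] := @ell_pow_le R 2 (k / 2) ltac:(lra).
have [N0 hN] := @nk_small R (k / 2) (1 / 2 / (C * expR (1 + k^-1))) ltac:(lra) ltac:(by rewrite//; lra).
exists (maxn N0 1) => N; rewrite geq_max => /andP[/hN h N1].
rewrite /trunc_ok; move: h; rewrite ler_pdivlMr// mulrA => h; apply: le_trans h; rewrite ler_wpM2r//.
have kk : k / 2 + k / 2 = k by field.
rewrite -[X in nk X N * _]kk -nkD -mulrA ler_wpM2l//.
apply: (@le_trans _ _ (nk (k / 2) N * (ell R N ^+ 2))).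
 rewrite ler_wpM2l//; apply: lerXn2r; rewrite ?nnegrE//.
 rewrite lerD2l ler_ln ?posrE// ler_nat//.
apply: le_trans (ler_wpM2l (nk_ge0 _ _) (hC N N1)) _.
have -> : N%:R `^ (k / 2) = expR (k / 2 * ln N%:R) by rewrite /powR pnatr_eq0 gtn_eqF.
by rewrite mulrCA -expRD addNr expR0 mulr1.
Qed.
Lemma ln_le_harmonic R M : ln M.+1%:R <= \sum_(1 <= n < M.+1) (n%:R : R)^-1.
Proof.
elim: M => [|M IH]; first by rewrite ln1.
rewrite big_nat_recr//=; have h1 := @lnS_sub R M.+1 isT.
by rewrite -[leLHS](subrK (ln M.+1%:R)) addrC lerD.
Qed.
(** [euler_bounds] for the constant sequence: with [k] of size [1 / ln M] the terms up to [M]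
    already give half of a harmonic sum, so [Ek], and with it the sum of [1 / p], is unbounded. *)
Lemma prime_recip_div R (B : R) : exists N, B <= \sum_(1 <= p < N.+1 | prime p) (p%:R : R)^-1.
Proof.
pose M := (Num.truncn (expR (2 * expR (B + 4)))).+1.
have lM : 2 * expR (B + 4) <= ln M.+1%:R.
 rewrite -[leLHS]expRK ler_ln ?posrE//; apply: le_trans (ltW (truncnS_gt _)) _.
 by rewrite ler_nat.
pose k : R := (2 * (1 + ln M%:R))^-1.
have l0 := ln_ge0n R M.
have k0 : 0 < k by rewrite invr_gt0; lra.
have k1 : k <= 1 by rewrite invf_le1; lra.
have [N0 hN0] := trunc_ex k0.
pose N := maxn N0 M.
have tr : trunc_ok k N by apply: hN0; exact: leq_maxl.
have Np : (0 < N)%N by apply: leq_trans (leq_maxr _ _).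
have kM : 1/2 <= nk k M.
 rewrite /nk; have := expR_ge1Dx (- (k * ln M%:R)); have : k * ln M%:R <= 1/2.
  rewrite mulrC ler_pdivrMr; lra.
 lra.
exists N.
have xc : cmul (fun _ : nat => 1 : R[i]) by split=> // *; rewrite mulr1.
have cb n : cn ((fun _ : nat => 1 : R[i]) n) <= 1 by rewrite cn1.
have kk : 0 < k <= 1 by rewrite k0.
have /andP[_ ub] := euler_bounds xc cb kk Np tr; clear cb.
have lb : expR (B + 4) <= cn (Lk (fun=> 1) k N).
 apply: le_trans (le_trans (ler_norm _) (Re_le_cn _)); rewrite Re_sum.
 apply: (@le_trans _ _ (\sum_(1 <= n < N.+1) nk k n / n%:R)); last first.
  by apply: ler_sum => n _; rewrite mul1r -RcM.
 rewrite (big_cat_nat (n := M.+1))//=; last by rewrite ltnS leq_maxr.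
 have t0 : 0 <= \sum_(M.+1 <= n < N.+1) nk k n / n%:R by [].
 have : \sum_(1 <= n < M.+1) 1/2 * n%:R^-1 <= \sum_(1 <= n < M.+1) nk k n / n%:R.
  apply: ler_sum_nat => n /andP[n0 nM].
  rewrite ler_wpM2r//; apply: le_trans kM _; apply: nk_anti => //.
 rewrite -mulr_sumr; have := ln_le_harmonic R M; lra.
have := le_trans lb ub; rewrite ler_expR lerD2r => h; apply: le_trans h _; rewrite /Ek.
rewrite big_mkcond [leRHS]big_mkcond; apply: ler_sum => p _; case: ifP => // _.
by rewrite mul1r ler_piMl// nk_le1//.
Qed.

(** * Real characters: positivity at 1 and zeros *)

Definition realchar R (q : nat) (x : nat -> R) :=
 [/\ (0 < q)%N, rcm x, forall n, x (n + q)%N = x n, forall n, coprime n q -> x n ^+ 2 = 1 & forall n, ~~ coprime n q -> x n = 0].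
Definition nonprinc R (x : nat -> R) := exists n, x n = -1.
(** An argument 0 can be replaced by the period [q], which is positive. *)
Lemma per_rcmM (A : pzRingType) (x : nat -> A) q : (0 < q)%N -> (forall n, x (n + q)%N = x n) ->
 (forall m n, (0 < m)%N -> (0 < n)%N -> x (m * n)%N = x m * x n) -> forall m n, x (m * n)%N = x m * x n.
Proof.
move=> q0 h xM m n.
have h0 : x q = x 0%N by rewrite -(h 0%N).
have hk k : x (k * q)%N = x 0%N by elim: k => [|k IH]; rewrite// mulSn addnC h.
case: (posnP m) => [->|m0]; case: (posnP n) => [->|n0]; last exact: xM.
- by rewrite -h0 -xM// h0.
- by rewrite -h0 -xM// mulnC h0.
- by rewrite muln0 -h0 -xM// h0.
Qed.
Lemma rc_val R q (x : nat -> R) n : realchar q x -> [\/ x n = 1, x n = -1 | x n = 0].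
Proof.
move=> [q0 xr xp x1 x0]; case: (boolP (coprime n q)) => h; last by apply: Or33; exact: x0.
have /eqP := x1 n h; rewrite -[X in _ == X](expr1n R 2) eqf_sqr => /orP[/eqP->|/eqP->]; [exact: Or31|exact: Or32].
Qed.
Lemma rc_norm R q (x : nat -> R) n : realchar q x -> `|x n| <= 1.
Proof. by move=> /(rc_val n) [->|->|->]; rewrite ?normrN ?normr1 ?normr0. Qed.
Lemma rc_bsum R q (x : nat -> R) : realchar q x -> nonprinc x -> bsum x q%:R.
Proof.
move=> rx [n0 xn]; have [q0 xr xp x1 x0] := rx; apply: per_bound => //; last by move=> n; exact: rc_norm rx.
apply: (@char_sum0 _ x q n0) => //; first exact: per_rcmM q0 xp xr.2.
- apply: contraT => /x0; rewrite xn => /eqP; rewrite oppr_eq0 oner_eq0//.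
- by rewrite xn; lra.
Qed.
Lemma conv1E (A : comNzRingType) (u : nat -> A) n : (0 < n)%N -> conv u (fun=> 1) n = \sum_(1 <= a < n.+1 | (a %| n)%N) u a.
Proof.
move=> n0; rewrite [RHS]big_mkcond; apply: eq_big_nat => a /andP[a0 an].
case: ifP => [/dvdnP[b e]|na].
 have b0 : (0 < b)%N by case: b e n0 => // ->.
 rewrite (eq_bigl (fun b' => b' == b)) => [|b']; last by rewrite e mulnC eqn_pmul2r.
 rewrite big_nat1_eq b0 ?mulr1// ltnS e leq_pmulr//.
by rewrite big1// => b /eqP e; rewrite -e dvdn_mulr in na.
Qed.
Lemma sqrt_ex y : (0 < y)%N -> exists D, (0 < D)%N /\ (D * D <= y < D.+1 * D.+1)%N.
Proof.
elim: y => // -[|y] IH _; first by exists 1%N.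
have [D [D0 /andP[h1 h2]]] := IH isT.
have [h|h] := ltnP y.+2 (D.+1 * D.+1); first by exists D; split=> //; lia.
by exists D.+1; split=> //; nia.
Qed.
Lemma rcm1 R : rcm (fun=> 1 : R). Proof. by split=> // *; rewrite mulr1. Qed.
Lemma rc_conv_ge0 R q (x : nat -> R) n : realchar q x -> (0 < n)%N -> 0 <= conv x (fun=> 1) n.
Proof.
move=> rx n0; have [q0 xr _ _ _] := rx; apply: conv2_nonneg => //; first exact: rcm1.
by move=> k; case: (rc_val k rx) => ->; lra.
Qed.
(** For [a = 1/2] the error in [rsum_asym] is bounded, so if [L1 <= 0] the sums of [conv x 1]
    weighted by [n ^ (- 1/2)] stay bounded above. The squares of primes contradict this: the
    coefficient at [p ^ 2] is [1 + x p + (x p) ^ 2 >= 1], and the sum of [1 / p] diverges. *)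
Lemma L1_pos R q (x : nat -> R) (L1 : R) : realchar q x -> nonprinc x -> isL x q%:R 1 L1 -> 0 < L1.
Proof.
move=> rx nx hL1; have [q0 xr xp x1 x0] := rx; have bs := rc_bsum rx nx.
have Q1 : 1 <= q%:R :> R by rewrite ler1n.
rewrite ltNge; apply/negP => L10.
have a12 : 0 < (1/2 : R) <= 1/2 by apply/andP; split; lra.
have [z [zb hz]] := @zeta_asym R (1/2) ltac:(by apply/andP; split; lra).
have [Ls hLs] := @L_exists R x q%:R (1 - 1/2) bs ltac:(lra).
have [D hD] := prime_recip_div (z * Ls + 16 * q%:R + 1).
have {}hD : z * Ls + 16 * q%:R + 1 <= \sum_(1 <= p < D.+2 | prime p) (p%:R : R)^-1.
 apply: le_trans hD _; rewrite [leRHS]big_mkcond big_nat_recr//= -big_mkcond /= lerDl.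
 by case: ifP => // _; rewrite invr_ge0.
have Dy : (D.+1 * D.+1 <= D.+1 * D.+1 < D.+2 * D.+2)%N by lia.
have := rsum_asym a12 zb hz bs Q1 (fun n => rc_norm n rx) hL1 hLs (ltn0Sn D) Dy.
rewrite ler_distl => /andP[_].
have -> : nk (1 - 2 * (1/2)) D.+1 = 1 :> R by rewrite (_ : 1 - 2 * (1/2) = 0) ?/nk ?mul0r ?oppr0 ?expR0//; field.
set S := \sum_(_ <= _ < _) _ => hS.
have : \sum_(1 <= p < D.+2 | prime p) (p%:R : R)^-1 <= S.
 pose g n := conv x (fun=> 1) n * nk (1 - 1/2) n.
 apply: (@le_trans _ _ (\sum_(p <- [seq p <- index_iota 1 D.+2 | prime p]) g (p * p)%N)).
  rewrite big_filter; apply: ler_sum => p pp.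
  have p0 := prime_gt0 pp; rewrite /g nkM// nkD.
  have -> : 1 - 1/2 + (1 - 1/2) = 1 :> R by field.
  rewrite nk1E// ler_peMl ?invr_ge0// conv1E ?muln_gt0 ?p0//.
  have -> : \sum_(1 <= a < (p * p).+1 | (a %| p * p)%N) x a = \sum_(a <- [:: 1; p; p * p]%N) x a.
   rewrite -big_filter; apply: perm_big; apply: uniq_perm.
   - by rewrite filter_uniq ?iota_uniq.
   - rewrite /= !inE !andbT; have := prime_gt1 pp; nia.
   move=> a; rewrite mem_filter mem_index_iota !inE; apply/andP/idP.
    move=> [+ _]; rewrite -[X in (_ %| X * X)%N]expn1 -expnD => /(dvdn_pfactor _ _ pp) [[|[|[|e]]] // le ->].
    - by rewrite expn0 eqxx.
    - by rewrite expn1 eqxx orbT.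
    - by rewrite (_ : 1 + 1 = 2)%N// eqxx !orbT.
   case/or3P => /eqP ->; (split; [by rewrite ?dvd1n ?dvdnn// ?dvdn_mulr|by have := prime_gt1 pp; nia]).
  rewrite !big_cons big_nil addr0 xr.1 lerDl xr.2//.
  by case: (rc_val p rx) => ->; lra.
 apply: (@sum_map_le R _ _ _ (fun p => p * p)%N (index_iota 1 (D.+1 * D.+1).+1) g).
 - rewrite map_inj_in_uniq ?filter_uniq ?iota_uniq// => a b _ _ /eqP; by rewrite !mulnn eqn_sqr => /eqP.
 - exact: iota_uniq.
 - move=> n /mapP [p]; rewrite mem_filter !mem_index_iota => /andP[_ /andP[p0 pD]] ->; nia.
 - move=> n; rewrite mem_index_iota => /andP[n0 _]; rewrite mulr_ge0 ?nk_ge0//; exact: rc_conv_ge0 rx n0.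
have : L1 * nk (- (1/2)) (D.+1 * D.+1) / (1/2) <= 0.
 rewrite pmulr_lle0 ?invr_gt0; last lra.
 by rewrite pmulr_lle0 ?nk_gt0.
lra.
Qed.

Lemma nk_lip R (s s' : R) n : 0 <= s -> 0 <= s' -> `|nk s n - nk s' n| <= `|s - s'| * ln n%:R.
Proof.
wlog ss : s s' / s <= s'.
 move=> H s0 s0'; case: (leP s s') => h; first exact: H.
 by rewrite distrC (distrC s); apply: H => //; exact: ltW.
move=> s0 s0'; have l0 := ln_ge0n R n.
have m : s * ln n%:R <= s' * ln n%:R by rewrite ler_wpM2r.
rewrite (ger0_norm (_ : 0 <= nk s n - nk s' n)); last by rewrite subr_ge0 nk_anti_s.
rewrite ler0_norm; last lra.
rewrite opprB mulrBl; apply: expRN_sub => //.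
Qed.
Lemma L_cont R (a : nat -> R) (Q s e : R) : bsum a Q -> (forall n, `|a n| <= 1) -> 1/2 <= s -> 0 < e ->
 exists2 d : R, 0 < d & forall s' L L', 1/2 <= s' -> `|s - s'| <= d -> isL a Q s L -> isL a Q s' L' -> `|L - L'| <= e.
Proof.
move=> bs a1 s12 e0; have Q0 : 0 <= Q := le_trans (normr_ge0 _) (bs 0%N 0%N).
have [N hN] := @nk_small R (1/2) (e / (4 * (Q + 1))) ltac:(lra) ltac:(by rewrite divr_gt0; lra).
have := hN N.+1 (leqnSn N); rewrite ler_pdivlMr; last lra.
have P0 : 0 <= N%:R * ln N%:R :> R by [].
exists (e / (4 * (1 + N%:R * ln N%:R))); first by rewrite divr_gt0; lra.
move=> s' L L' s12'; rewrite ler_pdivlMr; last lra.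
move=> hd hL hL'.
have h1 := hL N; have h2 := hL' N.
have b1 : Q * nk s N.+1 <= e / 4.
 have : nk s N.+1 <= nk (1/2) N.+1 by apply: nk_anti_s.
 have := nk_gt0 (1/2 : R) N.+1; have := nk_gt0 s N.+1; nra.
have b2 : Q * nk s' N.+1 <= e / 4.
 have : nk s' N.+1 <= nk (1/2) N.+1 by apply: nk_anti_s.
 have := nk_gt0 (1/2 : R) N.+1; have := nk_gt0 s' N.+1; nra.
have b3 : `|Sx a s N - Sx a s' N| <= e / 4.
 rewrite /Sx -sumrB; apply: le_trans (ler_norm_sum _ _ _) _.
 apply: (@le_trans _ _ (\sum_(1 <= n < N.+1) `|s - s'| * ln N%:R)).
  apply: ler_sum_nat => n /andP[n0 nN].
  rewrite -mulrBr normrM; apply: le_trans (ler_piMl (normr_ge0 _) (a1 n)) _.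
  apply: le_trans (nk_lip _ _ _) _; [(clear - s12 s12'; lra)|(clear - s12 s12'; lra)|]; rewrite ler_wpM2l// ler_ln ?posrE ?ltr0n ?ler_nat//.
  exact: leq_trans n0 nN.
 rewrite sumr_const_nat subn1 -[_ *+ _]mulr_natr.
 have t0 : 0 <= `|s - s'| := normr_ge0 _; lra.
have -> : L - L' = (Sx a s N - Sx a s' N) - (Sx a s N - L) + (Sx a s' N - L') by ring.
apply: le_trans (ler_normD _ _) _; apply: le_trans (lerD (ler_normB _ _) (lexx _)) _; lra.
Qed.
(** Intermediate value theorem by a supremum. [Lf] is only a pointwise choice of values; [L_cont]
    provides its continuity and [isL_unique] its values at the ends. *)
Lemma L_zero R (x : nat -> R) (Q a L1 La : R) : bsum x Q -> (forall n, `|x n| <= 1) -> 0 < a <= 1/2 ->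
 isL x Q 1 L1 -> isL x Q (1 - a) La -> 0 < L1 -> La < 0 -> exists2 b : R, 0 < b < a & isL x Q (1 - b) 0.
Proof.
move=> bs x1 /andP[a0 a12] hL1 hLa L10 La0.
have /choice [Lf hLf] : forall s : R, exists L, 1/2 <= s -> isL x Q s L.
 move=> s; case: (leP (1/2) s) => h; last by exists 0.
 by have [L hL] := @L_exists R x Q s bs ltac:(lra); exists L.
have Lf1 : Lf 1 = L1 by apply: (isL_unique ltr01 (hLf 1 _) hL1); lra.
have Lfa : Lf (1 - a) = La by apply: (isL_unique _ (hLf (1 - a) _) hLa); lra.
pose S := [set s : R | 1 - a <= s <= 1 /\ Lf s <= 0]%classic.
have S0 : S (1 - a) by split; [apply/andP; split; lra|rewrite Lfa ltW].
have hS : has_sup S by split; [exists (1 - a)|exists 1 => s [/andP[_ h] _]].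
set t := sup S.
have t1 : t <= 1 by apply: ge_sup; [exists (1 - a)|move=> s [/andP[_ h] _]].
have ta : 1 - a <= t by apply: ub_le_sup S0; exact: hS.2.
have t12 : 1/2 <= t by lra.
have Lt : Lf t = 0.
 apply/eqP; rewrite eq_le; apply/andP; split; rewrite leNgt; apply/negP => h.
  have [d d0 hd] := @L_cont R x Q t (Lf t / 2) bs x1 t12 ltac:(lra).
  have [s Ss ts] := sup_adherent d0 hS; rewrite -/t in ts; have {}ts : t - d < s := ts.
  have st : s <= t by apply: ub_le_sup Ss; exact: hS.2.
  have [/andP[s1 _] s0] := Ss; have s12 : 1/2 <= s by lra.
  have hh : `|Lf t - Lf s| <= Lf t / 2.
   apply: (hd s) => //; [rewrite ger0_norm; lra|exact: hLf|exact: hLf].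
  by move: hh; rewrite ler_norml; lra.
 have [d d0 hd] := @L_cont R x Q t (- Lf t / 2) bs x1 t12 ltac:(lra).
 have t1' : t < 1 by rewrite lt_neqAle t1 andbT; apply/eqP => e; rewrite e in h; lra.
 pose s := Num.min (t + d) 1.
 have ts : t < s by rewrite /s lt_min; apply/andP; split; lra.
 have sd : s <= t + d by rewrite /s ge_min lexx.
 have s1 : s <= 1 by rewrite /s ge_min lexx orbT.
 have s12 : 1/2 <= s by lra.
 have hh : `|Lf t - Lf s| <= - Lf t / 2.
  apply: (hd s) => //; [|exact: hLf|exact: hLf].
  rewrite ler0_norm; lra.
 have : S s by split; [apply/andP; split; lra|move: hh; rewrite ler_norml; lra].
 by move/(ub_le_sup hS.2); rewrite -/t; lra.
exists (1 - t).
 apply/andP; split.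
  rewrite subr_gt0 lt_neqAle t1 andbT; apply/eqP => e; rewrite e in Lt; lra.
 suff : t != 1 - a by move=> /negP ne; lra.
 by apply/eqP => e; rewrite e in Lt; lra.
by rewrite opprB addrC subrK -Lt; exact: hLf.
Qed.

(** * Siegel's theorem *)

Lemma hyper_gen R (u v : nat -> R) z x : (z <= x)%N ->
 \sum_(1 <= n < x.+1) conv u v n = \sum_(1 <= m < z.+1) u m * (\sum_(1 <= n < (x %/ m).+1) v n) +
  \sum_(1 <= n < x.+1) v n * (\sum_(z.+1 <= m < (x %/ n).+1) u m).
Proof.
move=> zx; transitivity (\sum_(1 <= n < x.+1) conv u v n * 1); first by apply: eq_bigr => n _; rewrite mulr1.
rewrite (sum_conv u v (fun=> 1)) (big_cat_nat (n := z.+1))//=; congr (_ + _).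
 apply: eq_big_nat => a /andP[a0 aD].
 rewrite mulr_sumr [RHS](big_nat_widen _ _ x.+1); last by rewrite ltnS leq_div.
 apply: eq_big => [b|b _]; last by lra.
 by rewrite !ltnS leq_divRL// mulnC.
rewrite (exchange_big_dep xpredT)//=.
apply: eq_big_nat => b /andP[b0 bD].
rewrite mulr_sumr [RHS](big_nat_widen _ _ x.+1); last by rewrite ltnS leq_div.
apply: eq_big => [a|a _]; last by lra.
by rewrite !ltnS leq_divRL.
Qed.
Lemma nkX R (s : R) z n : (0 < z)%N -> nk s (z ^ n) = nk (n%:R * s) z.
Proof. by move=> z0; rewrite /nk natrX lnXn// -mulr_natl; congr expR; ring. Qed.
Lemma sqrt_nk R (s : R) D y : 0 <= s <= 1/2 -> (0 < D)%N -> (0 < y)%N -> (y < D.+1 * D.+1)%N -> nk (2 * s) D <= 2 * nk s y.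
Proof.
move=> /andP[s0 s1] D0 y0 yD.
have h : nk s (2 * 2 * (D * D)) <= nk s y by apply: nk_anti => //; nia.
have h4 : 1/2 <= nk s (2 * 2).
 apply: le_trans (nk_anti_s _ s1); rewrite nkM// nkD (_ : 1/2 + 1/2 = 1); last by field.
 by rewrite nk1E// div1r.
move: h; rewrite nkM ?muln_gt0 ?D0//; rewrite (nkM _ D0 D0) nkD (_ : s + s = 2 * s); last by ring.
have := nk_gt0 (2 * s) D; nra.
Qed.
(** At a zero [1 - b] of the series the second main term of [rsum_asym] disappears. *)
Lemma R_zero R (c : nat -> R) (Q b L1 : R) y : 0 < b <= 1/8 -> bsum c Q -> 1 <= Q -> (forall n, `|c n| <= 1) ->
 isL c Q 1 L1 -> isL c Q (1 - b) 0 -> (0 < y)%N ->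
 `|\sum_(1 <= n < y.+1) conv c (fun=> 1) n * nk (1 - b) n - L1 * nk (- b) y / b| <= 16 * Q / b * nk (3/8) y.
Proof.
move=> /andP[b0 b8] bs Q1 c1 hL1 hL0 y0; have [D [D0 hD]] := sqrt_ex y0.
have [z [zb hz]] := @zeta_asym R b ltac:(by apply/andP; split; lra).
have := rsum_asym (_ : 0 < b <= 1/2) zb hz bs Q1 c1 hL1 hL0 D0 hD.
rewrite mulr0 addr0 => /(_ _)/le_trans; apply; first by rewrite b0; lra.
have qb : 0 <= 8 * Q / b by rewrite divr_ge0; lra.
have e16 : 16 * Q / b * nk (3/8) y = 8 * Q / b * (2 * nk (3/8) y) by ring.
rewrite e16 ler_wpM2l//; case/andP: hD => _ hD.
apply: le_trans (sqrt_nk _ D0 y0 hD); last by apply/andP; split; lra.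
by apply: nk_anti_s; lra.
Qed.
Lemma W_asym R (c c' : nat -> R) (Q s L L' : R) y : 3/4 <= s <= 1 ->
 bsum c Q -> bsum c' Q -> 1 <= Q -> (forall n, `|c n| <= 1) -> (forall n, `|c' n| <= 1) -> isL c Q s L -> isL c' Q s L' ->
 (0 < y)%N -> `|\sum_(1 <= n < y.+1) conv c c' n * nk s n - L * L'| <= 20 * Q ^+ 2 * nk (1/4) y.
Proof.
move=> hs bs bs' Q1 c1 c1' hL hL' y0; have [D [D0 hD]] := sqrt_ex y0; have Q0 : 0 <= Q by lra.
apply: le_trans (wsum_asym hs bs bs' Q1 c1 c1' hL hL' D0 hD) _.
have e20 : 20 * Q ^+ 2 * nk (1/4) y = 10 * Q ^+ 2 * (2 * nk (1/4) y) by ring.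
rewrite e20 ler_wpM2l//; case/andP: hD => _ hD.
apply: le_trans (sqrt_nk _ D0 y0 hD); last by apply/andP; split; lra.
by apply: nk_anti_s; lra.
Qed.
Lemma conv_le R (u v : nat -> R) n : (0 < n)%N -> (forall n, `|u n| <= 1) -> (forall n, `|v n| <= 1) -> `|conv u v n| <= n%:R.
Proof.
move=> n0 u1 v1; apply: (@le_trans _ _ (conv (fun=> 1) (fun=> 1) n)).
 rewrite /conv; apply: le_trans (ler_norm_sum _ _ _) _; apply: ler_sum => a _.
 apply: le_trans (ler_norm_sum _ _ _) _; apply: ler_sum => b _.
 by rewrite normrM mulr1 -[leRHS]mulr1 ler_pM.
rewrite conv1E// big_mkcond; apply: (@le_trans _ _ (\sum_(1 <= a < n.+1) 1)); first by apply: ler_sum => a _; case: ifP.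
by rewrite sumr_const_nat subn1.
Qed.
(** Evaluates at [1 - b] the sum up to [x = z ^ 16] of the nonnegative coefficients of the
    convolution of [c2], [c12], [c1] and 1. The factor [w] is cut at [z]; for the other factor the
    zero leaves only the main term [l1 * y ^ b / b]. The exponent 16 lets the error of the long sums
    beat the trivial bound [m] on [w m], and [b <= 1/256] keeps [x ^ b] below [z ^ (1/16)]. *)
Lemma caseA R (c1 c2 c12 : nat -> R) (Q b l1 L2 L12 : R) (z : nat) : 0 < b <= 1/256 -> 1 <= Q ->
 bsum c1 Q -> bsum c2 Q -> bsum c12 Q -> (forall n, `|c1 n| <= 1) -> (forall n, `|c2 n| <= 1) -> (forall n, `|c12 n| <= 1) ->
 isL c1 Q 1 l1 -> isL c1 Q (1 - b) 0 -> isL c2 Q 1 L2 -> isL c12 Q 1 L12 ->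
 (forall n, (0 < n)%N -> 0 <= conv c1 (fun=> 1) n) ->
 (forall n, (0 < n)%N -> 0 <= conv (conv c2 c12) (conv c1 (fun=> 1)) n) ->
 conv (conv c2 c12) (conv c1 (fun=> 1)) 1 = 1 -> (0 < z)%N -> 1440 * Q ^+ 3 / b <= nk (- (3/16)) z ->
 1/2 <= l1 / b * nk (- (16 * b)) z * (L2 * L12).
Proof.
move=> /andP[b0 b1] Q1 bs1 bs2 bs12 n1 n2 n12 hl1 hl0 hL2 hL12 r0 f0 f1 z0 hz.
have b8 : 0 < b <= 1/8 by rewrite b0; clear - b1; lra.
have bb : 0 < b <= 1 by rewrite b0; clear - b1; lra.
set s := 1 - b; have [x xE] : exists x, x = (z ^ 16)%N by exists (z ^ 16)%N.
have x0 : (0 < x)%N by rewrite xE expn_gt0 z0.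
have zx : (z <= x)%N by rewrite xE -[leqLHS]expn1 leq_pexp2l.
have s34 : 3/4 <= s <= 1 by apply/andP; split; rewrite /s; clear - b0 b1; lra.
have s0 : 0 <= s by rewrite /s; clear - b0 b1; lra.
have [Ls hLs] := @L_exists R c2 Q s bs2 s0; have [Ls' hLs'] := @L_exists R c12 Q s bs12 s0.
pose w := conv c2 c12; pose r := conv c1 (fun=> 1).
pose u m := w m * nk s m; pose v n := r n * nk s n.
have Q0 : 0 <= Q by clear - Q1; lra.
have i0 : 0 < b^-1 by rewrite invr_gt0.
have i1 : 1 <= b^-1 by rewrite invf_ge1//; clear - b1; lra.
pose e : R := nk (3/16) z; have e0 : 0 < e := nk_gt0 _ _.
set Y := nk (- b) x; have Y0 : 0 <= Y := nk_ge0 _ _.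
have YE : Y = nk (- (16 * b)) z by rewrite /Y xE nkX// mulrN.
have n14 : nk (1/4) z <= e by apply: nk_anti_s; clear; lra.
have Yn14 : Y * nk (1/4) z <= e by rewrite YE nkD; apply: nk_anti_s; clear - b0 b1; lra.
have lQ : `|l1| <= Q := isL_bound hl1.
have T1 : 1 <= \sum_(1 <= n < x.+1) conv w r n * nk s n.
 rewrite big_ltn// f1 nk1n mulr1 lerDl big_nat_cond; apply: sumr_ge0 => n /andP[/andP[n0 _] _].
 by rewrite mulr_ge0 ?nk_ge0// f0//; exact: leq_trans n0.
have Te : \sum_(1 <= n < x.+1) conv w r n * nk s n = \sum_(1 <= m < z.+1) u m * (\sum_(1 <= n < (x %/ m).+1) v n) +
  \sum_(1 <= n < x.+1) v n * (\sum_(z.+1 <= m < (x %/ n).+1) u m).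
 by rewrite -hyper_gen//; apply: eq_bigr => n _; rewrite conv_nk.
have P1 : `|\sum_(1 <= m < z.+1) u m * (\sum_(1 <= n < (x %/ m).+1) v n) - l1 / b * Y * \sum_(1 <= m < z.+1) w m * nk 1 m| <= 17 * Q / b * nk 3 z.
 rewrite mulr_sumr -sumrB; apply: le_trans (ler_norm_sum _ _ _) _.
 apply: (@le_trans _ _ (\sum_(1 <= m < z.+1) z%:R * (17 * Q / b * nk 5 z))).
  rewrite big_nat_cond [leRHS]big_nat_cond; apply: ler_sum => m /andP[/andP[m0 mz] _].
  set y := (x %/ m)%N; have yz : (z ^ 15 <= y)%N by rewrite leq_divRL// xE [(z ^ 16)%N]expnSr leq_mul2l -ltnS mz orbT.
  have z15 : (0 < z ^ 15)%N by rewrite expn_gt0 z0.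
  have y0 : (0 < y)%N by apply: leq_trans yz.
  have mx : (0 < m <= x)%N by rewrite m0 (leq_trans _ zx).
  have -> : u m * (\sum_(1 <= n < y.+1) v n) - l1 / b * Y * (w m * nk 1 m) = u m * (\sum_(1 <= n < y.+1) v n - l1 * (Y * nk b m / b)).
   have nk1m : nk 1 m = nk s m * nk b m by rewrite nkD /s subrK.
   by rewrite /u nk1m; move: (\sum_(1 <= n < y.+1) v n) => S1; ring.
  rewrite normrM; apply: ler_pM => //.
   rewrite /u normrM (ger0_norm (nk_ge0 _ _)); apply: le_trans (ler_piMr (normr_ge0 _) (nk_le1 _ s0)) _.
   by apply: le_trans (conv_le m0 n2 n12) _; rewrite ler_nat.
  have A1 := R_zero b8 bs1 Q1 n1 hl1 hl0 y0; rewrite -/s in A1.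
  have /andP[B1 B2] := floor_pw bb mx; rewrite -/Y -/s -/y in B1 B2.
  have C1 : (nk (3/8) y : R) <= nk 5 z.
   apply: le_trans (nk_anti _ z15 yz) _ => //.
   by rewrite nkX//; apply: nk_anti_s; clear; lra.
  have C2 : nk s y <= nk 5 z.
   apply: le_trans (nk_anti s0 z15 yz) _; rewrite nkX//; apply: nk_anti_s; rewrite /s; clear - b0 b1; lra.
  have D1 : 16 * Q / b * nk (3/8) y <= 16 * Q / b * nk 5 z by rewrite ler_wpM2l.
  have E1 : `|l1 * (nk (- b) y / b - Y * nk b m / b)| <= Q / b * nk 5 z.
   rewrite normrM; apply: (@le_trans _ _ (Q * nk 5 z)); first by apply: ler_pM => //; rewrite ler_norml; apply/andP; split; clear - B1 B2 C2; lra.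
   by rewrite ler_wpM2r ?nk_ge0// ler_peMr.
  move: A1; move: (\sum_(1 <= n < y.+1) _) => S1 A1.
  have -> : S1 - l1 * (Y * nk b m / b) = (S1 - l1 * nk (- b) y / b) + l1 * (nk (- b) y / b - Y * nk b m / b) by ring.
  apply: le_trans (ler_normD _ _) _; apply: le_trans (lerD A1 E1) _; clear - D1; lra.
 rewrite sumr_const_nat subn1 /= -[_ *+ _]mulr_natr.
 have zE : z%:R = nk (-1) z :> R by rewrite /nk mulN1r opprK lnK// posrE ltr0n.
 have n3 : nk 3 z = nk (-1) z * nk (-1) z * nk 5 z :> R by rewrite !nkD (_ : -1 + -1 + 5 = 3)//; ring.
 by rewrite zE n3 le_eqVlt; apply/orP; left; apply/eqP; ring.
have P2 : `|\sum_(1 <= m < z.+1) w m * nk 1 m - L2 * L12| <= 20 * Q ^+ 2 * nk (1/4) z.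
 by apply: W_asym => //; apply/andP; split; clear; lra.
have P3 : `|\sum_(1 <= n < x.+1) v n * (\sum_(z.+1 <= m < (x %/ n).+1) u m)| <= (Q / b * Y + 16 * Q / b) * (40 * Q ^+ 2 * nk (1/4) z).
 have q2 : 0 <= 40 * Q ^+ 2 * nk (1/4) z by rewrite !mulr_ge0 ?sqr_ge0 ?nk_ge0.
 apply: le_trans (ler_norm_sum _ _ _) _.
 apply: (@le_trans _ _ (\sum_(1 <= n < x.+1) v n * (40 * Q ^+ 2 * nk (1/4) z))).
  rewrite big_nat_cond [leRHS]big_nat_cond; apply: ler_sum => n /andP[/andP[n0 nx] _].
  have v0 : 0 <= v n by rewrite mulr_ge0 ?r0.
  rewrite normrM (ger0_norm v0) ler_wpM2l//; set y := (x %/ n)%N.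
  have [zy|yz] := leqP z y; last by rewrite big_geq ?normr0// ltnW.
  have y0 : (0 < y)%N by apply: leq_trans zy.
  have A1 := W_asym s34 bs2 bs12 Q1 n2 n12 hLs hLs' y0.
  have A2 := W_asym s34 bs2 bs12 Q1 n2 n12 hLs hLs' z0.
  rewrite (big_cat_nat (n := z.+1)) /=// in A1.
  have A3 : 20 * Q ^+ 2 * nk (1/4) y <= 20 * Q ^+ 2 * nk (1/4) z.
   by rewrite ler_wpM2l//; apply: nk_anti.
  move: A1 A2 A3; rewrite -/(w _) -/u; set S1 := \sum_(1 <= i < z.+1) _; set S2 := \sum_(z.+1 <= i < _) _; move: (20 * _ * nk (1/4) y) => t1.
  rewrite (_ : 40 * _ * _ = 2 * (20 * Q ^+ 2 * nk (1/4) z)); last by ring.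
  move: (20 * _ * nk (1/4) z) => t2; rewrite !ler_norml => /andP[h1 h2] /andP[h3 h4] h5; apply/andP; split; clear - h1 h2 h3 h4 h5; lra.
 rewrite -mulr_suml ler_wpM2r//.
 have := R_zero b8 bs1 Q1 n1 hl1 hl0 x0; rewrite -/s -/Y ler_distl => /andP[_ h]; apply: le_trans h _; apply: lerD.
  have : l1 <= Q := le_trans (ler_norm _) lQ.
  by move=> h; rewrite mulrAC ler_wpM2r// ler_wpM2r// ltW.
 by rewrite ler_piMr// nk_le1.
(* The three errors are at most 17, 20 and 680 times [Q ^ 3 * e / b], in all 717 times, which is
   below 1/2. *)
have hz' : 1440 * Q ^+ 3 / b * e <= 1.
 apply: le_trans (ler_wpM2r (ltW e0) hz) _; rewrite /e nkD addNr /nk mul0r oppr0 expR0//.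
move: T1; rewrite Te -YE; move: P1 P2 P3; set A := \sum_(1 <= m < z.+1) u m * _; set B := \sum_(1 <= n < x.+1) _; set S := \sum_(1 <= m < z.+1) _ => P1 P2 P3 T1.
have q3 : 0 <= Q ^+ 3 / b by [].
have n3e : nk 3 z <= e by apply: nk_anti_s; clear; lra.
have QQ3 : Q / b <= Q ^+ 3 / b.
 by rewrite ler_wpM2r ?(ltW i0)// -[leLHS]expr1; apply: ler_weXn2l.
have t1 : 17 * Q / b * nk 3 z <= 17 * (Q ^+ 3 / b * e).
 have Qb : 0 <= Q / b by [].
 have h := ler_pM Qb (nk_ge0 3 z) QQ3 n3e; clear - h; lra.
have t2 : `|l1 / b * Y * (S - L2 * L12)| <= 20 * (Q ^+ 3 / b * e).
 rewrite !normrM (ger0_norm (ltW i0)) (ger0_norm Y0).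
 apply: (@le_trans _ _ (Q / b * Y * (20 * Q ^+ 2 * nk (1/4) z))).
  apply: ler_pM => //.
  by rewrite ler_wpM2r// ler_wpM2r// ltW.
 have -> : Q / b * Y * (20 * Q ^+ 2 * nk (1/4) z) = 20 * (Q ^+ 3 / b * (Y * nk (1/4) z)) by rewrite [Q ^+ 3]exprS; ring.
 by rewrite ler_pM2l// ler_wpM2l.
have t3 : (Q / b * Y + 16 * Q / b) * (40 * Q ^+ 2 * nk (1/4) z) <= 680 * (Q ^+ 3 / b * e).
 have h := ler_wpM2l q3 Yn14; have h' := ler_wpM2l q3 n14; clear - h h'; lra.
move: P1 P3 t2; rewrite mulrBr !ler_norml => /andP[_ P1] /andP[_ P3] /andP[_ t2].
clear - P1 P3 t1 t2 t3 hz' T1; lra.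
Qed.
(** The logarithmic derivative has the coefficients [Lam k * (1 + c1 k) * (1 + c2 k)], which are
    nonnegative. *)
Lemma conv4_ge0 R (c1 c2 : nat -> R) n : rcm c1 -> rcm c2 -> (forall n, -1 <= c1 n) -> (forall n, -1 <= c2 n) -> (0 < n)%N ->
 0 <= conv (conv c2 (fun k => c1 k * c2 k)) (conv c1 (fun=> 1)) n.
Proof.
move=> r1 r2 h1 h2 n0; pose c12 k := c1 k * c2 k.
have r12 : rcm c12.
 split; rewrite /c12; first by rewrite r1.1 r2.1 mulr1.
 by move=> k l k0 l0; rewrite r1.2// r2.2//; ring.
pose g k := Lam R k * ((1 + c1 k) * (1 + c2 k)).
apply: (@conv_nonneg R _ g) => //.
- by rewrite !conv_1 r1.1 r2.1 !mulr1.
- by move=> k; rewrite !mulr_ge0//; [have := h1 k|have := h2 k]; lra.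
- by rewrite /g Lam1 mul0r.
move=> k; rewrite conv_ln.
pose g1 k := c2 k * Lam R k + c12 k * Lam R k; pose g2 k := c1 k * Lam R k + 1 * Lam R k.
transitivity (conv (conv c2 c12) (conv (conv c1 (fun=> 1)) g1) k + conv (conv c2 c12) (conv (conv c1 (fun=> 1)) g2) k).
 congr (_ + _).
  rewrite (@conv_ext _ _ _ (conv (conv c2 c12) g1) (conv c1 (fun=> 1)))// => [|j _]; last exact: conv2_ln.
  by rewrite convA; apply: conv_ext => // j _; exact: conv_comm.
 by apply: conv_ext => // j _; rewrite conv2_ln//; exact: rcm1.
rewrite -!convA -convDr; apply: conv_ext => // j _; rewrite /g /g1 /g2 /c12; ring.
Qed.
Lemma bsum_le R (c : nat -> R) (Q Q' : R) : Q <= Q' -> bsum c Q -> bsum c Q'.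
Proof. by move=> h b m n; apply: le_trans (b m n) h. Qed.
Lemma isL_le R (c : nat -> R) (Q Q' s L : R) : Q <= Q' -> isL c Q s L -> isL c Q' s L.
Proof. by move=> h b N; apply: le_trans (b N) _; rewrite ler_wpM2r. Qed.
Lemma rc_mul R q1 q2 (x1 x2 : nat -> R) : realchar q1 x1 -> realchar q2 x2 -> realchar (q1 * q2) (fun n => x1 n * x2 n).
Proof.
move=> [q10 r1 p1 u1 z1] [q20 r2 p2 u2 z2]; split.
- by rewrite muln_gt0 q10.
- by split=> [|k l k0 l0]; rewrite ?r1.1 ?r2.1 ?mulr1// r1.2// r2.2//; ring.
- move=> n; rewrite -(per_mod (n + q1 * q2) p1) -(per_mod (n + q1 * q2) p2).
 by rewrite addnC modnMDl {1}mulnC modnMDl !per_mod.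
- by move=> n; rewrite coprimeMr => /andP[/u1 h1 /u2 h2]; rewrite exprMn h1 h2 mulr1.
- by move=> n; rewrite coprimeMr negb_and => /orP[/z1|/z2] ->; rewrite ?mul0r ?mulr0.
Qed.
Lemma L_le_log R (c : nat -> R) q (L : R) : (0 < q)%N -> (forall n, `|c n| <= 1) -> isL c q%:R 1 L -> L <= 2 + ln q%:R.
Proof.
move=> q0 c1 h; have := h q; rewrite ler_distlC => /andP[_ h1]; apply: le_trans h1 _.
have : q%:R * nk 1 q.+1 <= 1 :> R by rewrite nk1E// ler_pdivrMr// mul1r ler_nat.
have : Sx c 1 q <= 1 + ln q%:R.
 apply: le_trans (harmonic_le _ q0); rewrite /Sx big_nat_cond [leRHS]big_nat_cond; apply: ler_sum => n /andP[/andP[n0 _] _].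
 by rewrite nk1E// ler_piMl//; apply: le_trans (ler_norm _) (c1 n).
lra.
Qed.
Lemma rc_geN1 R q (x : nat -> R) n : realchar q x -> -1 <= x n.
Proof. by move=> rx; have := rc_norm n rx; rewrite ler_norml => /andP[]. Qed.

Lemma Lam_prime R p : prime p -> Lam R p = ln p%:R.
Proof.
move=> pp; have p0 := prime_gt0 pp; rewrite -(sum_Lam_dvd R p0) big_mkcond big_nat_recr//= dvdnn big1_seq ?add0r// => d /andP[_].
rewrite mem_index_iota => /andP[d0 dp]; case: ifP => // dv.
by case/primeP: pp => _ /(_ d dv) /orP[/eqP->|/eqP e]; [exact: Lam1|rewrite e ltnn in dp].
Qed.
Lemma Sx_approx R (x : nat -> R) (Q L e : R) : bsum x Q -> (forall n, `|x n| <= 1) -> isL x Q 1 L -> 0 < e ->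
 exists2 d : R, 0 < d & forall k, 0 < k <= d -> exists N0, forall N, (N0 <= N)%N -> `|Sx x (1 + k) N - L| <= e.
Proof.
move=> bs x1 hL e0; have [d d0 hd] := @L_cont R x Q 1 (e / 2) bs x1 ltac:(lra) ltac:(lra).
exists d => // k /andP[k0 kd]; have Q0 : 0 <= Q := le_trans (normr_ge0 _) (bs 0%N 0%N).
have [L' hL'] := @L_exists R x Q (1 + k) bs ltac:(lra).
have h1 : `|L - L'| <= e / 2.
 apply: (hd (1 + k)) => //; first lra.
 rewrite (_ : 1 - (1 + k) = - k); last ring.
 by rewrite normrN ger0_norm// ltW.
have [N hN] := @nk_small R (1 + k) (e / (2 * (Q + 1))) ltac:(lra) ltac:(by rewrite divr_gt0; lra).
exists N => n Nn; have := hN n.+1 (leqW Nn); rewrite ler_pdivlMr; last lra.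
move=> h2; have h3 := hL' n; have h4 := nk_gt0 (1 + k) n.+1.
have -> : Sx x (1 + k) n - L = (Sx x (1 + k) n - L') - (L - L') by ring.
by apply: le_trans (ler_normB _ _) _; lra.
Qed.
Lemma Lk_real R (x : nat -> R) (k : R) N : Lk (fun n => (x n)%:C) k N = (Sx x (1 + k) N)%:C.
Proof.
rewrite /Lk /Sx rmorph_sum big_nat_cond [RHS]big_nat_cond; apply: eq_bigr => n /andP[/andP[n0 _] _].
by rewrite -!RcM -nk1E// nkD addrC.
Qed.
(** Primes up to [P] contribute at most [P]; for the others [1 / p <= 1 / P] and [1 <= 2 * Lam p],
    and [Lam] sums to [ln q] over the divisors. [P] is free in order to make the coefficient of
    [ln q] small. *)
Lemma sum_prime_dvd R q N P : (0 < q)%N -> (0 < P)%N ->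
 \sum_(1 <= p < N.+1 | prime p && (p %| q)%N) (p%:R : R)^-1 <= P%:R + 2 * ln q%:R / P%:R.
Proof.
move=> q0 P0; rewrite (bigID (fun p => (p <= P)%N)); apply: lerD.
 apply: (@le_trans _ _ (\sum_(1 <= p < P.+1) 1)); last by rewrite sumr_const_nat subn1.
 rewrite big_mkcond; have [le|lt] := leqP N P.
  rewrite [leRHS](big_cat_nat (n := N.+1))//= -[leLHS]addr0; apply: lerD; last by [].
  apply: ler_sum_nat => p /andP[p0 _].
  by case: ifP => // _; rewrite invf_le1// ler1n.
 rewrite [leLHS](big_cat_nat (n := P.+1)) /=; [|by []|by apply: ltnW].
 rewrite [X in _ + X]big1_seq ?addr0; last first.
  move=> p /andP[_]; rewrite mem_index_iota => /andP[h _]; case: ifP => // /andP[_]; lia.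
 apply: ler_sum_nat => p /andP[p0 _].
 by case: ifP => // _; rewrite invf_le1// ler1n.
rewrite ler_pdivlMr// mulr_suml.
apply: (@le_trans _ _ (\sum_(1 <= p < N.+1 | prime p && (p %| q)%N) 2 * Lam R p)).
 rewrite big_mkcond [leRHS]big_mkcond; apply: ler_sum => p _.
 case: (boolP (prime p && (p %| q)%N)) => //= /andP[pp _]; case: ifP => [h|_]; last by [].
 rewrite -ltnNge in h; have p0 := prime_gt0 pp.
 apply: (@le_trans _ _ 1).
  by rewrite ler_pdivrMl// mulr1 ler_nat ltnW.
 have : ln 2 <= Lam R p.
  by rewrite Lam_prime// ler_ln ?posrE// ler_nat prime_gt1.
 have := @ln2_ge R; lra.
rewrite -mulr_sumr ler_pM2l// -(sum_Lam_dvd R q0) big_mkcond [leRHS]big_mkcond; have [le|lt] := leqP N q.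
 rewrite [leRHS](big_cat_nat (n := N.+1))//= -[leLHS]addr0; apply: lerD; last first.
  by apply: sumr_ge0 => d _; case: ifP => // _; exact: Lam_ge0.
 by apply: ler_sum => p _; case: (prime p); case: (_ %| _)%N => //=; exact: Lam_ge0.
rewrite [leLHS](big_cat_nat (n := q.+1)) /=; [|by []|by apply: ltnW].
rewrite [X in _ + X]big1_seq ?addr0; last first.
 move=> p /andP[_]; rewrite mem_index_iota => /andP[h _]; case: ifP => // /andP[_ /(dvdn_leq q0)]; lia.
by apply: ler_sum => p _; case: (prime p); case: (_ %| _)%N => //=; exact: Lam_ge0.
Qed.
Lemma rc_cmul R q (x : nat -> R) : realchar q x -> cmul (fun n => (x n)%:C).
Proof. by move=> [_ [r1 rM] _ _ _]; split=> [|m n m0 n0]; rewrite ?r1// rM// RcM. Qed.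
(** Two characters that agree away from [q1 * q2] have L-values that differ by Euler factors at the
    primes dividing it. The comparison is made on truncated sums at [1 + k] through [euler_bounds],
    and [Sx_approx] lets [k] go to 0. *)
Lemma compareL R q1 q2 (x1 x2 : nat -> R) (L1 L2 : R) P : realchar q1 x1 -> nonprinc x1 -> realchar q2 x2 -> nonprinc x2 ->
 (forall n, coprime n (q1 * q2) -> x1 n = x2 n) -> isL x1 q1%:R 1 L1 -> isL x2 q2%:R 1 L2 -> (0 < P)%N ->
 expR (- (8 + 2 * (P%:R + 2 * ln (q1 * q2)%:R / P%:R))) * L1 <= L2.
Proof.
move=> rx1 nx1 rx2 nx2 hx hL1 hL2 P0; have [q10 _ _ _ _] := rx1; have [q20 _ _ _ _] := rx2.
have L20 := L1_pos rx2 nx2 hL2.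
set B := P%:R + _; set K := expR _.
have K0 : 0 < K := expR_gt0 _.
have q0 : (0 < q1 * q2)%N by rewrite muln_gt0 q10.
have B0 : 0 <= B by rewrite addr_ge0// divr_ge0 mulr_ge0 ln_ge0n.
have K1 : K <= 1 by rewrite expR_le1; lra.
apply/ler_addgt0Pr => e e0.
have [d1 d10 h1] := @Sx_approx R x1 q1%:R L1 (e / 2) (rc_bsum rx1 nx1) (fun n => rc_norm n rx1) hL1 ltac:(lra).
have [d2 d20 h2] := @Sx_approx R x2 q2%:R L2 (e / 2) (rc_bsum rx2 nx2) (fun n => rc_norm n rx2) hL2 ltac:(lra).
pose k := Num.min (Num.min d1 d2) 1.
have k0 : 0 < k by rewrite !lt_min d10 d20 ltr01.
have kd1 : k <= d1 by rewrite !ge_min lexx.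
have kd2 : k <= d2 by rewrite !ge_min lexx orbT.
have k1 : k <= 1 by rewrite ge_min lexx orbT.
have [N1 hN1] := h1 k ltac:(by rewrite k0). have [N2 hN2] := h2 k ltac:(by rewrite k0).
have [N3 hN3] := trunc_ex k0.
pose N := (N1 + N2 + N3).+1.
have {}hN1 := hN1 N ltac:(by apply: leqW; rewrite -addnA leq_addr).
have {}hN2 := hN2 N ltac:(by apply: leqW; rewrite addnAC leq_addl).
have tr : trunc_ok k N by apply: hN3; apply: leqW; exact: leq_addl.
have kk : 0 < k <= 1 by rewrite k0.
have b1 n : cn ((fun n => (x1 n)%:C) n) <= 1 by rewrite cn_real (rc_norm n rx1).
have b2 n : cn ((fun n => (x2 n)%:C) n) <= 1 by rewrite cn_real (rc_norm n rx2).
have Np : (0 < N)%N by [].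
have /andP[_ E1] := euler_bounds (rc_cmul rx1) b1 kk Np tr.
have /andP[E2 _] := euler_bounds (rc_cmul rx2) b2 kk Np tr.
rewrite !Lk_real !cn_real in E1 E2; clear b1 b2.
have EE : Ek (fun n => (x1 n)%:C) k N - 2 * B <= Ek (fun n => (x2 n)%:C) k N.
 have := @sum_prime_dvd R (q1 * q2) N P q0 P0; rewrite -/B => hB.
 rewrite lerBlDr /Ek.
 apply: (@le_trans _ _ (\sum_(1 <= p < N.+1 | prime p) (complex.Re (x2 p)%:C * (nk k p / p%:R) + (if (p %| q1 * q2)%N then 2 * p%:R^-1 else 0)))).
  apply: ler_sum => p pp; case: ifPn => [pq|pq].
   have a0 : 0 <= nk k p / p%:R by [].
   have a1 : nk k p / p%:R <= p%:R^-1 by rewrite ler_piMl// nk_le1// ltW.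
   have := rc_norm p rx1; have := rc_norm p rx2; rewrite !ler_norml /= => /andP[? ?] /andP[? ?]; nra.
  by rewrite addr0 hx// prime_coprime.
 rewrite big_split lerD2l -big_mkcondr -mulr_sumr ler_pM2l//.
have KE : K * `|Sx x1 (1 + k) N| <= `|Sx x2 (1 + k) N|.
 apply: le_trans E2; apply: le_trans (ler_wpM2l (ltW K0) E1) _.
 by rewrite -expRD ler_expR; lra.
move: hN1 hN2; set S1 := Sx x1 _ _ in KE *; set S2 := Sx x2 _ _ in KE * => hN1 hN2.
have a1 : L1 <= `|S1| + e / 2 by have := ler_norm S1; move: hN1; rewrite ler_distl; lra.
have a2 : `|S2| <= L2 + e / 2.
 have -> : S2 = (S2 - L2) + L2 by ring.
 by apply: le_trans (ler_normD _ _) _; rewrite (ger0_norm (ltW L20)); lra.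
have := ler_wpM2l (ltW K0) a1; nra.
Qed.
Lemma ln_sqrp R (x : R) : 1 <= x -> exists z : nat, [/\ (0 < z)%N, x <= z%:R & ln z%:R <= 1 + ln x].
Proof.
move=> x1; have x0 : 0 < x by lra.
exists (Num.truncn x).+1; split=> //; first exact: ltW (truncnS_gt _).
have h : (Num.truncn x).+1%:R <= 2 * x.
 have : (Num.truncn x)%:R <= x by rewrite truncn_le ltW.
 by rewrite -natr1; lra.
apply: (@le_trans _ _ (ln (2 * x))); first by rewrite ler_ln ?posrE// mulr_gt0.
rewrite lnM ?posrE// lerD2r; have := @le_ln1Dx R 1 ltac:(lra); lra.
Qed.
(** As [z <= 0], a nonnegative [La] gives the term [z * La] the favourable sign. The coefficient 1
    at [n = 1] then yields [1/2 <= L1 * y ^ a / a] with [y] of order [(q / a) ^ 4], whence the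
    exponent [4 * a]. *)
Lemma caseB R (a : R) : 0 < a <= 1/4 -> exists2 c : R, 0 < c & forall q (x : nat -> R) (L1 La : R),
 realchar q x -> nonprinc x -> isL x q%:R 1 L1 -> isL x q%:R (1 - a) La -> 0 <= La -> c * nk (4 * a) q <= L1.
Proof.
move=> /andP[a0 a4]; have i0 : 0 < a^-1 by rewrite invr_gt0.
exists (a / 2 * expR (- (2 * a * (1 + 2 * ln (16 / a))))); first by [].
move=> q x L1 La rx nx hL1 hLa La0; have [q0 xr _ _ _] := rx.
have Q1 : 1 <= q%:R :> R by rewrite ler1n.
(* With [D] at least this square, the error [8 * q / a * D ^ (2 * a - 1)] is at most 1/2, as
   [2 * a <= 1/2]. *)
have t1 : 1 <= (16 * q%:R / a) ^+ 2.
 rewrite exprn_ege1// -mulrA mulrCA; have : 1 <= a^-1 by rewrite invf_ge1; lra.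
 nra.
have [D [D0 hD lD]] := ln_sqrp t1.
have Dy : (D * D <= D * D < D.+1 * D.+1)%N by (clear; nia).
have [z [zb hz]] := @zeta_asym R a ltac:(by apply/andP; split; lra).
have a2 : 0 < a <= 1/2 by rewrite a0; lra.
have := rsum_asym a2 zb hz (rc_bsum rx nx) Q1 (fun n => rc_norm n rx) hL1 hLa D0 Dy.
rewrite ler_distl => /andP[_ hS].
have T1 : 1 <= \sum_(1 <= n < (D * D).+1) conv x (fun=> 1) n * nk (1 - a) n.
 rewrite big_ltn; last by rewrite ltnS muln_gt0 D0.
 rewrite conv_1 xr.1 nk1n !mulr1 lerDl big_nat_cond; apply: sumr_ge0 => n /andP[/andP[n0 _] _].
 by rewrite mulr_ge0 ?nk_ge0// (rc_conv_ge0 rx)//; exact: leq_trans n0.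
have zL : z * La <= 0 by case/andP: zb => _ z0; rewrite mulr_le0_ge0.
have er : 8 * q%:R / a * nk (1 - 2 * a) D <= 1/2.
 have h : nk (1 - 2 * a) D <= nk (1/2) D by apply: nk_anti_s; lra.
 have h2 : nk (1/2) D <= a / (16 * q%:R).
  have e : nk (1/2) D ^+ 2 = D%:R^-1 :> R by rewrite expr2 nkD (_ : 1/2 + 1/2 = 1) ?nk1E//; field.
  rewrite -(@ler_pXn2r _ 2) ?nnegrE// e invf_ple ?posrE ?divr_gt0 ?mulr_gt0// -exprVn invf_div.
  exact: hD.
 have : 0 <= 8 * q%:R / a by [].
 move=> h0; apply: le_trans (ler_wpM2l h0 (le_trans h h2)) _.
 apply: eq_ler; field; by [].
have half : 1/2 <= L1 * nk (- a) (D * D) / a by lra.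
have e1 : nk (- a) (D * D) * nk a (D * D) = 1 by rewrite nkD addNr /nk mul0r oppr0 expR0.
have h3 : a / 2 * nk a (D * D) <= L1.
 move: half; rewrite ler_pdivlMr// => half.
 have := ler_wpM2r (nk_ge0 a (D * D)) half; rewrite -[X in _ <= X -> _]mulrA e1 mulr1; lra.
apply: le_trans h3; rewrite -mulrA ler_pM2l; last lra.
rewrite nkM// /nk -!expRD ler_expR.
have lq : ln ((16 * q%:R / a) ^+ 2) = 2 * (ln (16 / a) + ln q%:R).
 by rewrite lnXn// mulrAC lnM ?posrE// -[_ *+ 2]mulr_natl.
rewrite lq in lD; have := ler_wpM2l (ltW a0) lD; lra.
Qed.
Lemma siegel_alg R (c X Z L n A A' : R) : 0 < c -> 0 < X -> 0 < Z -> 0 < L -> 0 <= n ->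
 1/2 <= c * (X * A) * (L * (Z * A')) -> n * (A * A') <= 1 -> (2 * c * X * Z)^-1 * n <= L.
Proof.
move=> c0 X0 Z0 L0 n0 h1 h2; rewrite mulrC ler_pdivrMr//.
have := ler_wpM2r n0 h1.
have h3 : 0 <= c * X * Z * L by [].
have := ler_wpM2l h3 h2; rewrite mulr1; lra.
Qed.
(** Either no real character takes a negative value at [1 - a], and [caseB] applies to all of them;
    or one such character [x1] is fixed once for all, and [caseA] with its zero bounds every other
    one from below, except those that agree with [x1] away from [q1 * q2], left to [compareL]. The
    constant depends on [x1] and is ineffective. *)
Lemma siegel R (eta : R) : 0 < eta -> exists2 c : R, 0 < c & forall q (x : nat -> R) (L : R),
 realchar q x -> nonprinc x -> isL x q%:R 1 L -> c * nk eta q <= L.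
Proof.
(* In [caseA], [z] is about [(q1 * q2 / b) ^ 16], so [z ^ (16 * b)] costs [q2 ^ (256 * b)], at most
   [q2 ^ (eta / 4)] when [b < a]. *)
move=> eta0; pose a := Num.min eta 1 / 1024.
have m0 : 0 < Num.min eta 1 by rewrite lt_min eta0 ltr01.
have a0 : 0 < a by rewrite divr_gt0.
have aE : 1024 * a = Num.min eta 1 by rewrite /a; move: (Num.min eta 1) => m; field.
have ae : 1024 * a <= eta by rewrite aE ge_min lexx.
have a1 : 1024 * a <= 1 by rewrite aE ge_min lexx orbT.
have [[q1 [x1 [L1a [rx1 nx1 hL1a L1a0]]]]|noA] := pselect (exists q1 (x1 : nat -> R) L1a, [/\ realchar q1 x1, nonprinc x1, isL x1 q1%:R (1 - a) L1a & L1a < 0]); last first.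
 have [c c0 hc] := @caseB R a ltac:(by apply/andP; split; clear - a0 a1; lra).
 exists c => // q x L rx nx hL; have [La hLa] := @L_exists R x q%:R (1 - a) (rc_bsum rx nx) ltac:(clear - a0 a1; lra).
 apply: le_trans (hc q x L La rx nx hL hLa _).
  by rewrite ler_pM2l//; apply: nk_anti_s; clear - a0 ae; lra.
 by rewrite leNgt; apply/negP => h; apply: noA; exists q, x, La.
have [q10 r1 _ _ _] := rx1; have bs1 := rc_bsum rx1 nx1.
have [l1 hl1] := L_exists bs1 ler01.
have l10 := L1_pos rx1 nx1 hl1.
have a12 : 0 < a <= 1/2 by rewrite a0; clear - a1; lra.
have [b /andP[b0 ba] hb] := L_zero bs1 (fun n => rc_norm n rx1) a12 hl1 hL1a l10 L1a0.
have i0 : 0 < b^-1 by rewrite invr_gt0.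
have i1 : 1 <= b^-1 by rewrite invf_ge1//; clear - ba a1; lra.
have [P [P0 hP _]] := @ln_sqrp R (1 + 16 / eta) ltac:(by rewrite lerDl divr_ge0// ltW).
pose e := eta / 4; have e0 : 0 < e by rewrite /e.
pose Kc := expR (- (8 + 2 * (P%:R + 2 * ln q1%:R / P%:R))) * l1.
pose Kb := (2 * (l1 / b) * expR (16 * b * (1 + 16 * ln (1440 / b))) * expR (256 * b * ln q1%:R) * ((2 + e^-1) * expR (e * ln q1%:R)))^-1.
have Kc0 : 0 < Kc by rewrite /Kc.
have Kb0 : 0 < Kb by rewrite /Kb.
exists (Num.min Kc Kb); first by rewrite lt_min Kc0.
move=> q2 x2 L2 rx2 nx2 hL2; have [q20 r2 _ _ _] := rx2; have L20 := L1_pos rx2 nx2 hL2.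
have lnq : ln (q1 * q2)%:R = ln q1%:R + ln q2%:R :> R by rewrite ln_natM.
have l10' := @ln_ge0n R q1; have l20' := @ln_ge0n R q2.
have bs2 := rc_bsum rx2 nx2.
have [n12|p12] := pselect (nonprinc (fun n => x1 n * x2 n)); last first.
 have hx n : coprime n (q1 * q2) -> x1 n = x2 n.
  rewrite coprimeMr => /andP[c1 c2]; have [_ _ _ u1 _] := rx1; have [_ _ _ u2 _] := rx2.
  have := u1 n c1; have := u2 n c2.
  case: (rc_val n rx1) => h1; case: (rc_val n rx2) => h2; rewrite h1 h2//.
  - by move=> _ _; case: p12; exists n; rewrite h1 h2 mul1r.
  - by rewrite expr0n /= => /eqP; rewrite eq_sym oner_eq0.
  - by move=> _ _; case: p12; exists n; rewrite h1 h2 mulr1.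
  - by rewrite expr0n /= => /eqP; rewrite eq_sym oner_eq0.
  - by move=> _; rewrite expr0n /= => /eqP; rewrite eq_sym oner_eq0.
  - by move=> _; rewrite expr0n => /eqP; rewrite eq_sym oner_eq0.
 apply: le_trans (compareL rx1 nx1 rx2 nx2 hx hl1 hL2 P0).
 apply: (@le_trans _ _ (Kc * nk eta q2)); first by rewrite ler_wpM2r// ge_min lexx.
 rewrite /Kc mulrAC ler_pM2r// /nk -expRD ler_expR lnq.
 have Pp : 0 < P%:R :> R by rewrite ltr0n.
 have h4 : 4 * ln q2%:R / P%:R <= eta * ln q2%:R.
  rewrite mulrAC ler_wpM2r// ler_pdivrMr//.
  have : 16 / eta <= P%:R by clear - hP; lra.
  rewrite ler_pdivrMr// => h; clear - h; lra.
 clear - h4; lra.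
have rx12 := rc_mul rx1 rx2; have bs12 := rc_bsum rx12 n12.
pose Q : R := (q1 * q2)%:R; have Q1 : 1 <= Q by rewrite ler1n muln_gt0 q10.
have qQ1 : q1%:R <= Q by rewrite ler_nat leq_pmulr.
have qQ2 : q2%:R <= Q by rewrite ler_nat leq_pmull.
have [L12 hL12] := @L_exists R _ Q 1 bs12 ler01.
have t1 : 1 <= (1440 * Q / b) ^+ 16 by rewrite exprn_ege1// -mulrA mulrCA; clear - Q1 i1; nra.
have [z [z0 hz lz]] := ln_sqrp t1.
have Qp : 0 < Q by clear - Q1; lra.
have hz3 : 1440 * Q ^+ 3 / b <= nk (- (3/16)) z.
 apply: (@le_trans _ _ ((1440 * Q / b) ^+ 3)).
  have -> : 1440 * Q ^+ 3 / b = 1440 / b * Q ^+ 3 by ring.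
  have -> : (1440 * Q / b) ^+ 3 = (1440 / b) ^+ 3 * Q ^+ 3 by ring.
  rewrite ler_wpM2r// -[leLHS]expr1; apply: ler_weXn2l => //; clear - i1; lra.
 have : ln ((1440 * Q / b) ^+ 16) <= ln z%:R by rewrite ler_ln ?posrE ?ltr0n.
 rewrite lnXn// -[_ *+ 16]mulr_natl => h.
 rewrite -[leLHS]lnK ?posrE// lnXn// -[_ *+ 3]mulr_natl /nk ler_expR; clear - h; lra.
have f1 : conv (conv x2 (fun k => x1 k * x2 k)) (conv x1 (fun=> 1)) 1 = 1 by rewrite !conv_1 r1.1 r2.1 !mulr1.
have f0 n : (0 < n)%N -> 0 <= conv (conv x2 (fun k => x1 k * x2 k)) (conv x1 (fun=> 1)) n.
 by move=> n0; apply: conv4_ge0 => // k; [exact: rc_geN1 rx1|exact: rc_geN1 rx2].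
have bb : 0 < b <= 1/256 by rewrite b0; clear - ba a1; lra.
have := caseA bb Q1 (bsum_le qQ1 bs1) (bsum_le qQ2 bs2) bs12 (fun n => rc_norm n rx1) (fun n => rc_norm n rx2) (fun n => rc_norm n rx12) (isL_le qQ1 hl1) (isL_le qQ1 hb) (isL_le qQ2 hL2) hL12 (fun n n0 => rc_conv_ge0 rx1 n0) f0 f1 z0 hz3.
have L12l := L_le_log (_ : (0 < q1 * q2)%N) (fun n => rc_norm n rx12) hL12.
move: L12l; rewrite muln_gt0 q10 q20 => /(_ isT) L12l half.
have lnQ : ln Q = ln q1%:R + ln q2%:R by rewrite /Q lnq.
have zY : nk (- (16 * b)) z <= expR (16 * b * (1 + 16 * ln (1440 / b))) * expR (256 * b * ln q1%:R) * expR (256 * b * ln q2%:R).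
 rewrite /nk -!expRD ler_expR.
 have lq : ln ((1440 * Q / b) ^+ 16) = 16 * (ln (1440 / b) + (ln q1%:R + ln q2%:R)).
  by rewrite lnXn// mulrAC lnM ?posrE// -[_ *+ 16]mulr_natl lnQ.
 rewrite lq in lz; have h := ler_wpM2l (ltW b0) lz; clear - h; lra.
have L12u : L12 <= (2 + e^-1) * expR (e * ln q1%:R) * expR (e * ln q2%:R).
 apply: le_trans L12l _; rewrite lnq -mulrA -expRD -mulrDr; set l := ln _ + _; have l0 : 0 <= l by rewrite addr_ge0.
 have E1 := expR_ge1Dx (e * l); have el : 0 <= e * l by [].
 have ei : 0 < e^-1 by rewrite invr_gt0.
 have : e^-1 * (e * l) <= e^-1 * expR (e * l) by rewrite ler_pM2l//; clear - E1; lra.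
 rewrite mulKf// => h; clear - h E1 el; lra.
apply: (@le_trans _ _ (Kb * nk eta q2)); first by rewrite ler_wpM2r// ge_min lexx orbT.
have c0 : 0 < l1 / b by [].
have X0 : 0 < expR (16 * b * (1 + 16 * ln (1440 / b))) * expR (256 * b * ln q1%:R) by rewrite mulr_gt0.
have Z0 : 0 < (2 + e^-1) * expR (e * ln q1%:R) by rewrite mulr_gt0// addr_gt0 invr_gt0.
have KbE : Kb = (2 * (l1 / b) * (expR (16 * b * (1 + 16 * ln (1440 / b))) * expR (256 * b * ln q1%:R)) * ((2 + e^-1) * expR (e * ln q1%:R)))^-1 by rewrite /Kb !mulrA.
move: zY L12u X0 Z0 KbE; set X := _ * expR (256 * b * ln q1%:R); set Z := (2 + e^-1) * _; move: X Z => X Z zY L12u X0 Z0 KbE.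
have key : 1/2 <= (l1 / b) * (X * expR (256 * b * ln q2%:R)) * (L2 * (Z * expR (e * ln q2%:R))).
 apply: le_trans half _; apply: (@le_trans _ _ (l1 / b * nk (- (16 * b)) z * (L2 * (Z * expR (e * ln q2%:R))))).
  by rewrite ler_pM2l// ler_pM2l.
 apply: ler_wpM2r; last by rewrite ler_pM2l.
 by [].
have nE : nk eta q2 * (expR (256 * b * ln q2%:R) * expR (e * ln q2%:R)) <= 1.
 rewrite /nk -!expRD expR_le1; rewrite /e; clear - ba a0 ae l20'; nra.
rewrite KbE; exact: siegel_alg c0 X0 Z0 L20 (nk_ge0 _ _) key nE.
Qed.

(** * Complex characters: truncated L-sums near 1 *)

Definition cchar R (q : nat) (x : nat -> R[i]) :=
 [/\ (0 < q)%N, x 1%N = 1, forall m n, x (m * n)%N = x m * x n, forall n, x (n + q)%N = x n &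
   (forall n, coprime n q -> cn (x n) = 1) /\ (forall n, ~~ coprime n q -> x n = 0)].
Definition cnonpr R (q : nat) (x : nat -> R[i]) := exists2 n, coprime n q & x n != 1.
Definition xi R (x : nat -> R[i]) (t : R) (n : nat) : R[i] := x n * cis (- (t * ln n%:R)).

Lemma cc_norm R q (x : nat -> R[i]) n : cchar q x -> cn (x n) <= 1.
Proof. by move=> [_ _ _ _ [h1 h0]]; case: (boolP (coprime n q)) => [/h1 ->|/h0 ->]; rewrite ?cn0. Qed.
Lemma cc_bound R q (x : nat -> R[i]) : cchar q x -> cnonpr q x -> forall m n, cn (\sum_(m <= i < n) x i) <= q%:R.
Proof.
move=> cx [n0 c0 xn]; have [q0 x1 xM xp _] := cx; apply: per_cbound => //; last by move=> n; exact: cc_norm cx.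
exact: char_sum0 q0 xp xM c0 xn.
Qed.
Lemma xi_cmul R q (x : nat -> R[i]) t : cchar q x -> cmul (xi x t).
Proof.
move=> [_ x1 xM _ _]; split; first by rewrite /xi x1 ln1 mulr0 oppr0 cis0 mulr1.
by move=> m n m0 n0; rewrite /xi xM ln_natM// mulrDr opprD cisD; ring.
Qed.
Lemma xi_norm R q (x : nat -> R[i]) t n : cchar q x -> cn (xi x t n) <= 1.
Proof. by move=> cx; rewrite /xi cnM cn_cis mulr1 (cc_norm n cx). Qed.
Lemma xi_sq R (x : nat -> R[i]) t n : xi x t n ^+ 2 = xi (fun n => x n ^+ 2) (2 * t) n.
Proof. by rewrite /xi exprMn -cisMn -mulr_natl; congr (_ * cis _); ring. Qed.
Lemma cc_sq R q (x : nat -> R[i]) : cchar q x -> cchar q (fun n => x n ^+ 2).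
Proof.
move=> [q0 x1 xM xp [u z]]; split=> //; [by rewrite x1 expr1n|by move=> m n; rewrite xM exprMn|by move=> n; rewrite xp|].
by split=> n h; [rewrite cnX u// expr1n|rewrite z// expr0n].
Qed.
Lemma tame_nk R (k : R) : 0 <= k <= 1 -> tame (fun n => (nk k n)%:C) 1 0.
Proof. exact: tame_exp. Qed.
Lemma tame_1nk R (k : R) : 0 <= k -> tame (fun n => (1 - nk k n)%:C) k 1.
Proof. exact: tame_1mexp. Qed.
Lemma Lk_xi R (x : nat -> R[i]) t k N :
 Lk (xi x t) k N = \sum_(1 <= n < N.+1) x n * (cis (- (t * ln n%:R)) * (nk k n)%:C * (n%:R^-1)%:C).
Proof. by rewrite /Lk; apply: eq_bigr => n _; rewrite /xi; ring. Qed.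

(** The difference of the weights contains the factor [1 - n ^ (- (k0 - k))], whose [tame] constant
    is [k0 - k]. *)
Lemma Lk_diff R (eta : R) : 0 < eta -> exists2 C : R, 1 <= C & forall q (x : nat -> R[i]) (t k k0 : R) N,
 cchar q x -> cnonpr q x -> `|t| <= 1 -> 0 <= k <= k0 -> k0 <= 1 ->
 cn (Lk (xi x t) k N - Lk (xi x t) k0 N) <= C * q%:R `^ eta * k0.
Proof.
move=> e0; have [C [C0 hC]] := @L_bound R 1 eta e0.
exists (1 + 8 * C); first lra.
move=> q x t k k0 N cx nx t1 /andP[kp kk] k01; have [q0 _ _ _ _] := cx.
rewrite !Lk_xi -sumrB (eq_bigr (fun n => x n * (cis (- (t * ln n%:R)) * ((nk k n)%:C * (1 - nk (k0 - k) n)%:C) * (n%:R^-1)%:C))); last first.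
 move=> n _; have nkk : nk k0 n = nk k n * nk (k0 - k) n by rewrite nkD subrKC.
 by rewrite nkk RcB !RcM; ring.
have T1 : tame (fun n => (nk k n)%:C * (1 - nk (k0 - k) n)%:C) (2 * 1 * (k0 - k)) (0 + 1).
 by apply: tameM => //; [lra|apply: tame_nk; rewrite kp; lra|apply: tame_1nk; lra].
have T2 := tameM (_ : 0 <= 1 + `|t|) (_ : 0 <= 2 * 1 * (k0 - k)) (tame_cis t) T1.
have P0 : 0 <= 1 + `|t| by [].
have P1 : 0 <= 2 * 1 * (k0 - k) by lra.
have P2 : 0 <= 2 * (1 + `|t|) * (2 * 1 * (k0 - k)) by [].
apply: le_trans (hC q x _ _ N.+1 q0 P2 (fun n => cc_norm n cx) (cc_bound cx nx) (T2 P0 P1)) _.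
rewrite [leRHS]mulrAC ler_wpM2r//.
have : 2 * (1 + `|t|) * (2 * 1 * (k0 - k)) <= 8 * k0 by have := normr_ge0 t; nra. 
nra.
Qed.
Lemma Lk_upper R (eta : R) : 0 < eta -> exists2 C : R, 1 <= C & forall q (x : nat -> R[i]) (t k : R) N,
 cchar q x -> cnonpr q x -> `|t| <= 2 -> 0 <= k <= 1 -> cn (Lk (xi x t) k N) <= C * q%:R `^ eta.
Proof.
move=> e0; have [C [C0 hC]] := @L_bound R 0 eta e0.
exists (1 + 6 * C); first lra.
move=> q x t k N cx nx t1 kk; have [q0 _ _ _ _] := cx.
rewrite Lk_xi.
have P0 : 0 <= 1 + `|t| by [].
have T2 := tameM P0 ler01 (tame_cis t) (tame_nk kk).
have P2 : 0 <= 2 * (1 + `|t|) * 1 by [].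
apply: le_trans (hC q x _ _ N.+1 q0 P2 (fun n => cc_norm n cx) (cc_bound cx nx) T2) _.
rewrite ler_wpM2r ?powR_ge0//; nra.
Qed.
Lemma Lk_tdiff R (eta : R) : 0 < eta -> exists2 C : R, 1 <= C & forall q (x : nat -> R[i]) (t k : R) N,
 cchar q x -> cnonpr q x -> 0 <= k <= 1 -> cn (Lk (xi x t) k N - Lk x k N) <= C * q%:R `^ eta * `|t|.
Proof.
move=> e0; have [C [C0 hC]] := @L_bound R 1 eta e0.
exists (1 + 2 * C); first lra.
move=> q x t k N cx nx kk; have [q0 _ _ _ _] := cx.
rewrite Lk_xi /Lk -sumrB (eq_bigr (fun n => x n * ((cis (- (t * ln n%:R)) - 1) * (nk k n)%:C * (n%:R^-1)%:C))); last by move=> n _; ring.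
have T2 := tameM (normr_ge0 t) ler01 (tame_cisB t) (tame_nk kk).
have P2 : 0 <= 2 * `|t| * 1 by [].
apply: le_trans (hC q x _ _ N.+1 q0 P2 (fun n => cc_norm n cx) (cc_bound cx nx) T2) _.
rewrite [leRHS]mulrAC ler_wpM2r ?powR_ge0//; have := normr_ge0 t; nra.
Qed.
Lemma even_sum (A : zmodType) (z : nat -> A) N :
 \sum_(1 <= n < N.+1) (if odd n then 0 else z n) = \sum_(1 <= m < (N./2).+1) z (2 * m)%N.
Proof.
elim: N => [|N IH]; first by rewrite !big_geq.
rewrite big_nat_recr//= IH uphalf_half; case: (boolP (odd N)) => o.
 rewrite add1n [RHS]big_nat_recr//=; congr (_ + z _); have := odd_double_half N; rewrite o; lia.
by rewrite addr0 add0n.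
Qed.
Lemma half_le N : (N./2 <= N)%N /\ (N - N./2 <= N./2.+1)%N.
Proof. by have := odd_double_half N; case: (odd N); lia. Qed.
Lemma one_sub_ge R (r : R) (w : R[i]) : 0 <= r -> r <= 1 -> cn w = 1 -> cn (1 - w) / 2 <= cn (1 - r%:C * w).
Proof.
move=> r0 r1 w1.
have h1 : cn (1 - w) <= cn (1 - r%:C * w) + (1 - r).
 have -> : 1 - w = (1 - r%:C * w) + (r - 1)%:C * w by rewrite RcB; ring.
 apply: le_trans (cnD _ _) _; rewrite lerD2l cnM w1 mulr1 cn_real ler0_norm; lra.
have h2 : 1 - r <= cn (1 - r%:C * w).
 have := cnD (1 - r%:C * w) (r%:C * w); rewrite subrK cn1 cnM w1 mulr1 cn_real (ger0_norm r0); lra.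
lra.
Qed.
(** The partial sums of a principal character are unbounded, but as [q] is odd the twist by
    [(-1) ^ (n + 1)] has mean 0 over the period [2 * q]. Up to a bounded error the twist multiplies
    the sum by [1 - rho] with [rho = 2 ^ (- k - it)], and [|1 - rho| >= |t| / 8]. *)
Lemma Lk_princ R (eta : R) : 0 < eta -> exists2 C : R, 1 <= C & forall q (x : nat -> R[i]) (t k : R) N,
 odd q -> cchar q x -> (forall n, coprime n q -> x n = 1) -> 0 < `|t| <= 2 -> 0 <= k <= 1 ->
 cn (Lk (xi x t) k N) <= C * q%:R `^ eta / `|t|.
Proof.
move=> e0; have [C [C0 hC]] := @L_bound R 0 eta e0.
have p20 : 0 <= 2 `^ eta :> R by exact: powR_ge0.
exists (8 * (1 + 6 * C * 2 `^ eta)); first by have := mulr_ge0 (ltW C0) p20; lra.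
move=> q x t k N oq cx xpr /andP[t0 t2] kk; have [q0 x1 xM xp [xu xz]] := cx.
pose z n := x n * (cis (- (t * ln n%:R)) * (nk k n)%:C * (n%:R^-1)%:C).
pose b n := x n * (-1) ^+ n.+1.
have bq n : b (n + q)%N = - b n.
 by rewrite /b xp -addSn exprD -[(-1) ^+ q]signr_odd oq expr1 mulrN1 mulrN.
have b2q n : b (n + 2 * q)%N = b n by rewrite mul2n -addnn addnA !bq opprK.
have bs : \sum_(0 <= i < 2 * q) b i = 0.
 rewrite mul2n -addnn (big_cat_nat (n := q)) ?leq_addr//=.
 rewrite -{2}[q]add0n big_addn addnK -big_split /= big1// => i _; by rewrite bq subrr.
have b1 n : cn (b n) <= 1 by rewrite /b cnM cnX cnN cn1 expr1n mulr1 (cc_norm n cx).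
have q20 : (0 < 2 * q)%N by rewrite muln_gt0.
have bb := per_cbound q20 b2q bs b1.
have P0 : 0 <= 1 + `|t| by [].
have T2 := tameM P0 ler01 (@tame_cis R t) (tame_nk kk).
have P2 : 0 <= 2 * (1 + `|t|) * 1 by [].
have alt := hC (2 * q)%N b _ _ N.+1 q20 P2 b1 bb T2.
rewrite natrM powRM// in alt.
pose S M := \sum_(1 <= n < M.+1) z n.
have zM m : (0 < m)%N -> z (2 * m)%N = z 2 * z m.
 move=> m0; rewrite /z xM ln_natM// mulrDr opprD cisD nkM// natrM invfM !RcM; ring.
have altE : \sum_(1 <= n < N.+1) b n * (cis (- (t * ln n%:R)) * (nk k n)%:C * (n%:R^-1)%:C) = S N - 2 * z 2 * S (N./2).
 have -> : 2 * z 2 * S (N./2) = 2 * \sum_(1 <= n < N.+1) (if odd n then 0 else z n).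
  rewrite even_sum -mulrA; congr (_ * _); rewrite /S mulr_sumr big_nat_cond [RHS]big_nat_cond.
  by apply: eq_bigr => m /andP[/andP[m0 _] _]; rewrite zM.
 rewrite /S mulr_sumr -sumrB; apply: eq_bigr => n _; rewrite /b /z -signr_odd /=.
 by case: (odd n) => /=; rewrite ?expr0; ring.
rewrite altE in alt.
pose rho := (nk k 2)%:C * cis (- (t * ln 2)).
have x2 : x 2%N = 1 by apply: xpr; rewrite coprime_sym coprimen2.
have rhoE : 2 * z 2 = rho.
 have aux (w v u : R[i]) : u * 2 = 1 -> 2 * (w * v * u) = v * w.
  move=> e; have -> : 2 * (w * v * u) = v * w * (u * 2) by ring.
  by rewrite e mulr1.
 rewrite /z x2 /rho mul1r; apply: aux.
 by rewrite -(rmorph_nat (real_complex R) 2) -RcM mulVf.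
rewrite rhoE in alt.
have [k0 k1] := andP kk.
have r1 : nk k 2 <= 1 by apply: nk_le1.
have dS : cn (S N - S (N./2)) <= 1.
 have [NN NN2] := half_le N.
 rewrite /S (big_cat_nat (n := N./2.+1) (p := N.+1))//= addrAC subrr add0r.
 apply: le_trans (cn_sum _ _ _) _.
 apply: (@le_trans _ _ (\sum_(N./2.+1 <= n < N.+1) (N./2.+1%:R)^-1)).
  rewrite big_nat_cond [leRHS]big_nat_cond; apply: ler_sum => n /andP[/andP[n0 _] _].
  have np : (0 < n)%N by apply: leq_trans n0.
  rewrite /z !cnM cn_cis mul1r !cn_real (ger0_norm (nk_ge0 _ _)) ger0_norm//.
  apply: le_trans (ler_piMl _ (cc_norm n cx)) _; first by [].
  apply: le_trans (ler_piMl _ (nk_le1 n k0)) _; first by [].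
  by rewrite lef_pV2 ?posrE// ler_nat.
 rewrite sumr_const_nat -[_ *+ _]mulr_natl ler_pdivrMr ?ltr0n// mul1r ler_nat subSS; exact: NN2.
have l2 : ln 2 <= 1 :> R by have := @le_ln1Dx R 1 ltac:(lra); rewrite (_ : 1 + 1 = 2)//; ring.
have l2' := @ln2_ge R.
have rg : `|t| / 8 <= cn (1 - rho).
 apply: le_trans (one_sub_ge (nk_ge0 _ _) r1 (cn_cis _)).
 rewrite cnBC.
 have tl : `|- (t * ln 2)| = `|t| * ln 2 by rewrite normrN normrM (ger0_norm (_ : 0 <= ln 2))//; lra.
 have a0 := normr_ge0 t.
 have tl2 : `|t| * ln 2 <= 2 by clear - a0 t2 l2 l2'; nra.
 have tl3 : `|t| / 2 <= `|t| * ln 2 by clear - a0 l2'; nra.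
 have h := @cn_cis_sub1_ge R (- (t * ln 2)); rewrite tl in h; have {}h := h tl2.
 clear - h tl3; lra.
have key : cn (S N) * cn (1 - rho) <= C * (2 * (1 + `|t|) * 1) * (2 `^ eta * q%:R `^ eta) + 1.
 rewrite -cnM; have -> : S N * (1 - rho) = (S N - rho * S (N./2)) - rho * (S N - S (N./2)) by ring.
 apply: le_trans (cnB _ _) _; apply: lerD => //; rewrite !cnM cn_cis mulr1 cn_real (ger0_norm (nk_ge0 _ _)).
 by rewrite -[leRHS]mulr1; apply: ler_pM; rewrite ?cn_ge0.
rewrite Lk_xi -/(S N) ler_pdivlMr//.
have y1 : 1 <= q%:R `^ eta by rewrite powR_ge1 ?ler1n// ltW.
have h1 : cn (S N) * (`|t| / 8) <= C * 6 * (2 `^ eta * q%:R `^ eta) + 1.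
 apply: le_trans (ler_wpM2l (cn_ge0 _) rg) _; apply: le_trans key _; rewrite lerD2r ler_wpM2r ?powR_ge0//.
 by rewrite ler_pM2l//; lra.
lra.
Qed.
Lemma nk_powR R (eta : R) q : (0 < q)%N -> nk eta q = (q%:R `^ eta)^-1.
Proof. by move=> q0; rewrite /nk /powR pnatr_eq0 gtn_eqF// expRN. Qed.
(** If [x ^ 2] is not principal, or if [|t|] is at least [t0 / y ^ 2], the sum of the square is
    bounded and [L_lower] applies. Otherwise [x] is real and [t] tiny, and [siegel] at [t = 0] is
    moved to [t] by [Lk_tdiff]. The exponent 7 is 4 from [(D * y) ^ 4], 1 from the bound on the
    square and 2 from the threshold on [|t|]. *)
Lemma Llow R (eta : R) : 0 < eta -> exists2 c : R, 0 < c <= 1 & forall q (x : nat -> R[i]) (t : R) N (k : R),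
 odd q -> cchar q x -> cnonpr q x -> `|t| <= 1 -> (0 < N)%N -> trunc_ok (c / (q%:R `^ eta) ^+ 7) N ->
 q%:R * nk 1 N.+1 <= c / q%:R `^ eta -> 0 <= k <= c / (q%:R `^ eta) ^+ 7 ->
 c / (q%:R `^ eta) ^+ 7 <= cn (Lk (xi x t) k N).
Proof.
move=> e0; have [D D1 hD] := Lk_diff e0; have [X0 X01 hX0] := Lk_upper e0.
have [X1 X11 hX1] := Lk_princ e0; have [T T1 hT] := Lk_tdiff e0; have [cs' cs0' hs'] := siegel e0.
pose cs := Num.min cs' 1.
have cs0 : 0 < cs by rewrite lt_min cs0' ltr01.
have cs1 : cs <= 1 by rewrite ge_min lexx orbT.
have css : cs <= cs' by rewrite ge_min lexx.
pose t0 := cs / (4 * T); have t00 : 0 < t0 by rewrite divr_gt0//; lra.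
pose E : R := expR (-32); have E0 : 0 < E := expR_gt0 _.
pose c := Num.min (E / (128 * D ^+ 4 * X0)) (Num.min (E * t0 / (128 * D ^+ 4 * X1)) (cs / (8 * D))).
have D0 : 0 < D by lra.
have X00 : 0 < X0 by clear - X01; lra.
have X10 : 0 < X1 by clear - X11; lra.
have c0 : 0 < c by rewrite !lt_min !divr_gt0// mulr_gt0.
have c1 : c <= E / (128 * D ^+ 4 * X0) by rewrite ge_min lexx.
have c2 : c <= E * t0 / (128 * D ^+ 4 * X1) by rewrite !ge_min lexx orbT.
have c3 : c <= cs / (8 * D) by rewrite !ge_min lexx !orbT.
have c38 : 8 * D * c <= cs by move: c3; rewrite ler_pdivlMr mulrC.
have cle1 : c <= 1 by clear - c38 D1 cs1 c0; nra.
have c8 : c <= cs / 8 by clear - c38 D1 c0; nra.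
exists c; first by rewrite c0.
move=> q x t N k oq cx nx t1 N0 tr tl /andP[k0 kc]; have [q0 x1 xM xp [xu xz]] := cx.
set y := q%:R `^ eta in tr tl kc *.
have y1 : 1 <= y by rewrite powR_ge1 ?ler1n// ltW.
have y0 : 0 < y by clear - y1; lra.
have yk n : 1 <= y ^+ n by rewrite exprn_ege1.
have yk0 n : 0 < y ^+ n by [].
have y20 : 0 < y ^+ 2 := yk0 2%N.
set k7 := c / y ^+ 7 in tr kc *.
have k70 : 0 < k7 by rewrite divr_gt0.
have k71 : k7 <= 1 by rewrite ler_pdivrMr// mul1r; apply: le_trans cle1 (yk 7%N).
have kk7 : 0 < k7 <= 1 by rewrite k70.
have dif : cn (Lk (xi x t) k N - Lk (xi x t) k7 N) <= D * y * k7 by apply: hD => //; rewrite k0.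
have Dy1 : 1 <= D * y by rewrite mulr_ege1.
have fin X : 1 <= X -> cn (Lk (fun n => xi x t n ^+ 2) k7 N) <= X -> k7 <= E / (128 * (D * y) ^+ 4 * X) -> k7 <= cn (Lk (xi x t) k N).
 move=> X1' hX hk; apply: le_trans (L_lower (xi_cmul t cx) (fun n => xi_norm t n cx) kk7 N0 tr X1' Dy1 hX dif hk).
 by rewrite ler_peMl// ltW.
have LE k' : Lk (fun n => xi x t n ^+ 2) k' N = Lk (xi (fun n => x n ^+ 2) (2 * t)) k' N.
 by apply: eq_bigr => n _; rewrite xi_sq.
have k7k : 0 <= k7 <= 1 by rewrite ltW.
have [np|pr] := pselect (cnonpr q (fun n => x n ^+ 2)).
 apply: (fin (X0 * y)); first by rewrite mulr_ege1.
  rewrite LE; apply: hX0 => //; first exact: cc_sq.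
  by rewrite normrM ger0_norm; clear - t1; lra.
 have -> : 128 * (D * y) ^+ 4 * (X0 * y) = (128 * D ^+ 4 * X0) * y ^+ 5 by ring.
 rewrite invfM mulrA /k7; apply: ler_pM; rewrite//.
 by rewrite lef_pV2 ?posrE//; apply: ler_weXn2l.
have sq n : coprime n q -> x n ^+ 2 = 1.
 by move=> h; apply/eqP; apply: contraT => h2; case: pr; exists n.
have [tb|ts] := leP (t0 / y ^+ 2) `|t|.
 have tau0 : 0 < t0 / y ^+ 2 := divr_gt0 t00 y20.
 have tau1 : t0 / y ^+ 2 <= 1.
  rewrite (ler_pdivrMr _ _ y20) mul1r; apply: le_trans (yk 2%N).
  rewrite /t0 ler_pdivrMr; clear - cs1 T1; lra.
 have tp : 0 < `|t| := lt_le_trans tau0 tb.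
 apply: (fin (X1 * y / (t0 / y ^+ 2))).
 - apply: (@le_trans _ _ (X1 * y * 1)); first by rewrite mulr1 mulr_ege1.
  by rewrite (ler_pM2l (mulr_gt0 X10 y0)) (invf_ge1 tau0).
 - rewrite LE; apply: (le_trans (hX1 q (fun n => x n ^+ 2) (2 * t) k7 N oq (cc_sq cx) sq _ k7k)).
   by rewrite normrM ger0_norm//; apply/andP; split; clear - tp t1; lra.
  rewrite -/y ler_pM2l//.
  have e2t : `|2 * t| = 2 * `|t| by rewrite normrM ger0_norm.
  have p2 : 0 < 2 * `|t| by [].
  by rewrite e2t lef_pV2//; clear - tb tp; lra.
 rewrite /k7 ler_pdivrMr//; apply: le_trans c2 _.
 rewrite le_eqVlt; apply/orP; left; apply/eqP; field.
 by rewrite !lt0r_neq0.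
pose xr n := complex.Re (x n).
have xv n : x n = (xr n)%:C /\ (coprime n q -> xr n ^+ 2 = 1).
 rewrite /xr; case: (boolP (coprime n q)) => h; last by rewrite xz.
 have /eqP := sq n h; rewrite sqrf_eq1 => /orP[]/eqP ->; split=> //=.
 - by rewrite expr1n.
 - by rewrite rmorphN rmorph1.
 - by rewrite sqrrN expr1n.
have rx : realchar q xr.
 split=> //.
 - split; first by rewrite /xr x1.
  by move=> m n _ _; rewrite /xr xM (xv m).1 (xv n).1 -RcM.
 - by move=> n; rewrite /xr xp.
 - by move=> n; exact: (xv n).2.
 - by move=> n h; rewrite /xr xz.
have nr : nonprinc xr.
 have [n cn1' xn] := nx; exists n; have := (xv n).2 cn1'; move/eqP; rewrite sqrf_eq1 => /orP[]/eqP// e.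
 by move: xn; rewrite (xv n).1 e eqxx.
have bs := rc_bsum rx nr.
have [L hL] := L_exists bs ler01.
have Ls := hs' q xr L rx nr hL; rewrite nk_powR// -/y in Ls.
have {Ls}Ls : cs / y <= L by apply: le_trans Ls; rewrite ler_wpM2r// invr_ge0 ltW.
have hk1 : 0 <= k <= 1 by rewrite k0 (le_trans kc).
have E1 := hT q x t k N cx nx hk1; rewrite -/y in E1.
have E2 : cn (Lk x k N - Lk x 0 N) <= D * y * k7.
 have xi0 n : xi x 0 n = x n by rewrite /xi mul0r oppr0 cis0 mulr1.
 have LL k' : Lk x k' N = Lk (xi x 0) k' N by apply: eq_bigr => n _; rewrite xi0.
 rewrite !LL cnBC; apply: le_trans (hD q x 0 0 k N cx nx _ _ _) _; rewrite ?normr0 ?lexx//; first by case/andP: hk1.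
 by rewrite ler_wpM2l.
have E3 : Lk x 0 N = (Sx xr 1 N)%:C.
 by have := Lk_real xr 0 N; rewrite addr0 => <-; apply: eq_bigr => n _; rewrite (xv n).1.
have E4 := hL N.
have E5 : cn (Lk (xi x t) k N) >= L - q%:R * nk 1 N.+1 - D * y * k7 - T * y * `|t|.
 have G1 : L <= `|Sx xr 1 N| + q%:R * nk 1 N.+1.
  by have h := ler_norm (Sx xr 1 N); move: E4; rewrite ler_distl => /andP[h1 h2]; clear - h h1 h2; lra.
 have G2 : `|Sx xr 1 N| <= cn (Lk x k N) + D * y * k7.
  rewrite -cn_real -E3; have h := cnD (Lk x 0 N - Lk x k N) (Lk x k N); rewrite subrK cnBC in h; clear - h E2; lra.
 have h := cnD (Lk x k N - Lk (xi x t) k N) (Lk (xi x t) k N); rewrite subrK cnBC in h; clear - h G1 G2 E1; lra.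
apply: le_trans E5.
have F1 : T * y * `|t| <= cs / 4 / y.
 have T0 : 0 < T by clear - T1; lra.
 apply: (@le_trans _ _ (T * y * (t0 / y ^+ 2))); first by rewrite ler_wpM2l// ltW.
 apply: eq_ler; rewrite /t0; field.
 by [].
have yle n : y ^- n.+1 <= y^-1.
 by rewrite lef_pV2 ?posrE// -[leLHS]expr1; apply: ler_weXn2l.
have F2 : D * y * k7 <= cs / 8 / y.
 have -> : D * y * k7 = D * c * y ^- 6 by rewrite /k7; field; rewrite !lt0r_neq0.
 by apply: ler_pM => //; clear - c38; lra.
have F3 : q%:R * nk 1 N.+1 <= cs / 8 / y.
 by apply: le_trans tl _; rewrite ler_pM2r.
have F4 : k7 <= cs / 8 / y.
 by rewrite /k7; apply: ler_pM.
have cy : 0 <= cs / y by [].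
clear - cy Ls F1 F2 F3 F4; lra.
Qed.

(** * Finite differences of the logarithmic derivative *)

Lemma fdiff_weight R (a X : nat -> R[i]) N i j :
 iter i (@fdiff R) (fun j => \sum_(1 <= n < N) a n * X n ^+ j.+1) j = \sum_(1 <= n < N) a n * (X n ^+ j.+1 * (1 - X n) ^+ i).
Proof.
elim: i j => [|i IH] j /=; first by apply: eq_bigr => n _; rewrite mulr1.
by rewrite /fdiff !IH -sumrB; apply: eq_bigr => n _; rewrite !exprS; ring.
Qed.
Lemma nk_pow R (k : R) n m : nk (m%:R * k) n = nk k n ^+ m.
Proof. by rewrite -expRM_natl; congr expR; ring. Qed.
(** By [fdiff_weight] these are the differences of order [i] of the L-sum when [e = 0] and, up to
    sign, of its derivative when [e = 1]; each factor [1 - nk k n] gains one [k]. *)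
Lemma wbound R (eta : R) J : 0 < eta -> exists2 K : R, 1 <= K & forall i j e q (x : nat -> R[i]) (t k : R) N,
 (i <= J)%N -> (j <= J)%N -> (e <= 1)%N -> cchar q x -> cnonpr q x -> `|t| <= 1 -> 0 <= k -> J.+1%:R * k <= 1 ->
 cn (\sum_(1 <= n < N.+1) (xi x t n * (n%:R^-1)%:C * (ln n%:R : R)%:C ^+ e) * ((nk k n)%:C ^+ j.+1 * (1 - (nk k n)%:C) ^+ i)) <= K * q%:R `^ eta * k ^+ i.
Proof.
move=> e0; have /choice [C hC] := fun d => @L_bound R d eta e0.
pose S := \sum_(d < J.+2) C d.
have S0 : 0 <= S by apply: sumr_ge0 => d _; exact: ltW (hC d).1.
have CS (d : nat) : (d < J.+2)%N -> C d <= S.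
 move=> h; rewrite /S (bigD1 (Ordinal h))//= lerDl; apply: sumr_ge0 => d' _; exact: ltW (hC d').1.
exists (1 + S * (32 * 2 ^+ J)); first by rewrite lerDl mulr_ge0// mulr_ge0.
move=> i j e q x t k N iJ jJ e1 cx nx t1 k0 Jk; have [q0 _ _ _ _] := cx.
pose p n := cis (- (t * ln n%:R)) * ((ln n%:R : R)%:C ^+ e * ((nk (j.+1%:R * k) n)%:C * ((1 - nk k n)%:C) ^+ i)).
rewrite (eq_bigr (fun n => x n * (p n * (n%:R^-1)%:C))); last first.
 by move=> n _; rewrite /p /xi nk_pow RcX RcB; ring.
have jk : 0 <= j.+1%:R * k <= 1.
 by rewrite mulr_ge0//=; apply: le_trans Jk; rewrite ler_wpM2r// ler_nat.
have k2 : 0 <= 2 ^+ i * k ^+ i by [].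
have T1 := tameM ler01 k2 (tame_nk jk) (tameX i k0 (tame_1nk k0)).
have k3 : 0 <= 2 * 1 * (2 ^+ i * k ^+ i) by [].
have k4 : 0 <= 2 ^+ e * 1 ^+ e :> R by [].
have T2 := tameM k4 k3 (tameX e ler01 (@tame_ln R)) T1.
have k5 : 0 <= 2 * (2 ^+ e * 1 ^+ e) * (2 * 1 * (2 ^+ i * k ^+ i)) by [].
have k6 : 0 <= 1 + `|t| by [].
have T3 := tameM k6 k5 (tame_cis t) T2.
have oE : (0 + (e * 1 + (0 + i * 1)) = e + i)%N by rewrite !muln1.
rewrite oE in T3.
have k7 : 0 <= 2 * (1 + `|t|) * (2 * (2 ^+ e * 1 ^+ e) * (2 * 1 * (2 ^+ i * k ^+ i))) by [].
have [Ce hCe] := hC (e + i)%N.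
apply: le_trans (hCe q x p _ N.+1 q0 k7 (fun n => cc_norm n cx) (cc_bound cx nx) T3) _.
rewrite [leRHS]mulrAC ler_wpM2r//.
have ei : C (e + i)%N <= S by apply: CS; clear - iJ e1; lia.
have b2 : 2 ^+ e <= 2 :> R by case: e e1 {T2 T3 p k4 k5 k7 oE Ce hCe ei} => [|[|]]// _; lra.
have b3 : 2 ^+ i <= 2 ^+ J :> R by apply: ler_weXn2l => //; lra.
have -> : C (e + i)%N * (2 * (1 + `|t|) * (2 * (2 ^+ e * 1 ^+ e) * (2 * 1 * (2 ^+ i * k ^+ i)))) = C (e + i)%N * (8 * ((1 + `|t|) * 2 ^+ e * 2 ^+ i)) * k ^+ i.
 by rewrite expr1n; ring.
rewrite ler_wpM2r//; apply: (@le_trans _ _ (S * (32 * 2 ^+ J))); last by rewrite lerDr.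
apply: ler_pM => //.
have -> : 32 * 2 ^+ J = 8 * (2 * 2 * 2 ^+ J) :> R by ring.
rewrite ler_pM2l//; apply: ler_pM => //.
by apply: ler_pM => //; clear - t1; lra.
Qed.
Lemma fdiff_small R (u : nat -> R[i]) (e : R) i j : (forall l, cn (u l) <= e) -> cn (iter i (@fdiff R) u j) <= 2 ^+ i * e.
Proof.
move=> h; elim: i j => [|i IH] j; first by rewrite mul1r.
rewrite /fdiff; apply: le_trans (cnB _ _) _; rewrite exprS -mulrA; have h1 := IH j; have h2 := IH j.+1.
have -> : 2 * (2 ^+ i * e) = 2 ^+ i * e + 2 ^+ i * e by ring.
exact: lerD.
Qed.
Lemma conv_RC R (u v : nat -> R) n : conv (fun n => (u n)%:C) (fun n => (v n)%:C) n = (conv u v n)%:C.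
Proof.
rewrite rmorph_sum; apply: eq_bigr => a _; rewrite rmorph_sum/=; apply: eq_bigr => b _; by rewrite RcM.
Qed.
(** Truncated form of [(- L' / L) * L = - L']: the pairs with [a * b > N] are the only discrepancy,
    and each of them carries [nk k N]. *)
Lemma PL_M R (w : nat -> R[i]) (k : R) N : cmul w -> (0 < N)%N -> 0 <= k -> (forall n, (0 < n)%N -> cn (w n) <= nk k n / n%:R) ->
 cn ((\sum_(1 <= n < N.+1) (Lam R n)%:C * w n) * (\sum_(1 <= n < N.+1) w n) - \sum_(1 <= n < N.+1) (ln n%:R : R)%:C * w n)
  <= nk k N * ((ln N%:R + 6) * (1 + ln N%:R)).
Proof.
move=> [w1 wM] N0 k0 wb.
have -> : \sum_(1 <= n < N.+1) (ln n%:R : R)%:C * w n = \sum_(1 <= n < N.+1) conv (fun n => (Lam R n)%:C) (fun=> 1) n * w n.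
 apply: eq_bigr => n _; congr (_ * _); have := rcm_ln n (@rcm1 R); rewrite mul1r => ->.
 rewrite conv_comm -conv_RC; apply: conv_ext => // m _; by rewrite mul1r.
rewrite sum_conv mulr_suml -sumrB; apply: le_trans (cn_sum _ _ _) _.
apply: (@le_trans _ _ (\sum_(1 <= a < N.+1) \sum_(1 <= b < N.+1) nk k N * (Lam R a / a%:R * b%:R^-1))); last first.
 under eq_bigr do rewrite -mulr_sumr -mulr_sumr.
 rewrite -mulr_sumr ler_wpM2l// -mulr_suml; apply: ler_pM.
 - by [].
 - by [].
 - exact: mertens_le.
 - exact: harmonic_le.
apply: ler_sum_nat => a /andP[a0 aN].
rewrite mulr_sumr [X in _ - X]big_mkcond -sumrB; apply: le_trans (cn_sum _ _ _) _.
apply: ler_sum_nat => b /andP[b0 bN].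
case: ifPn => h.
 have -> : (Lam R a)%:C * w a * w b - (Lam R a)%:C * 1 * w (a * b)%N = 0 by rewrite wM//; ring.
 by rewrite cn0.
rewrite subr0 -mulrA cnM cn_real (ger0_norm (Lam_ge0 _ _)) -wM//.
have ab : (N <= a * b)%N by rewrite leqNgt; apply: contra h => /leqW.
apply: le_trans (ler_wpM2l (Lam_ge0 _ _) (wb _ _)) _; first by rewrite muln_gt0 a0.
have -> : nk k N * (Lam R a / a%:R * b%:R^-1) = Lam R a * (nk k N / (a * b)%:R) by lra.
rewrite ler_wpM2l// ler_wpM2r//; exact: nk_anti.
Qed.

(** The truncation is made at [ln N] about [V ^ 3], so that [N ^ (- 1 / V)] is about
    [expR (- V ^ 2)] and beats every power of [V]. The conclusions are the inequalities consumed by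
    [char_small]. *)
Lemma large_V R (A c : R) J : 0 < A -> 0 < c -> exists2 V0 : R, 2 <= V0 & forall V, V0 <= V ->
 [/\ expR (- V ^+ 2) * (2 + V ^+ 3) ^+ 2 * expR (1 + V) <= 1/2,
   expR ((A + 1) * V - V ^+ 3) <= c,
   (J.+1%:R / c) ^+ 2 <= V,
   expR (- V ^+ 2) * ((V ^+ 3 + 7) * (V ^+ 3 + 2)) * (2 * V) ^+ J <= 1 &
   20 <= V].
Proof.
move=> A0 c0; pose K : R := 24 * 2 ^+ J * (J + 6)`!%:R.
have K0 : 0 <= K by rewrite !mulr_ge0 ?exprn_ge0.
exists (20 + (A + 2) + c^-1 + (J.+1%:R / c) ^+ 2 + K).
 have := invr_gt0 c; rewrite c0 => ic; have := sqr_ge0 (J.+1%:R / c); clear - A0 ic K0; lra.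
move=> V hV; have ic : 0 < c^-1 by rewrite invr_gt0.
have sq := sqr_ge0 (J.+1%:R / c).
have V20 : 20 <= V by clear - hV A0 ic sq K0; lra.
have VA : A + 2 <= V by clear - hV A0 ic sq K0; lra.
have Vc : c^-1 <= V by clear - hV A0 ic sq K0; lra.
have VJ : (J.+1%:R / c) ^+ 2 <= V by clear - hV A0 ic sq K0; lra.
have VK : K <= V by clear - hV A0 ic sq K0; lra.
have V0 : 0 < V by lra.
have V1 : 1 <= V ^+ 3 by apply: exprn_ege1; clear - V20; lra.
split=> //.
- have h6 := @powR_expR R V 6 (ltW V0).
 have h : (2 + V ^+ 3) ^+ 2 <= 6480 * expR V.
  apply: (@le_trans _ _ (9 * V ^+ 6)).
   have -> : 9 * V ^+ 6 = (3 * V ^+ 3) ^+ 2 by ring.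
   by apply: lerXn2r; rewrite ?nnegrE; clear - V1; lra.
  have f6 : (6`!)%:R = 720 :> R by [].
  rewrite f6 in h6; clear - h6; lra.
 have x2 := @powR_expR R (V ^+ 2 - 2 * V - 1) 2 ltac:(clear - V20; nra).
 have x3 : 12960 <= expR (V ^+ 2 - 2 * V - 1).
  have hx : 359 <= V ^+ 2 - 2 * V - 1 by clear - V20; nra.
  have : 359 ^+ 2 <= (V ^+ 2 - 2 * V - 1) ^+ 2 by apply: lerXn2r; rewrite ?nnegrE; clear - hx; lra.
  rewrite (_ : 2`! = 2)%N// in x2; move: x2; move: (_ ^+ 2) (expR _) => u v; clear; lra.
 apply: (@le_trans _ _ (expR (- V ^+ 2) * (6480 * expR V) * expR (1 + V))).
  by rewrite ler_wpM2r// ler_wpM2l.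
 have -> : expR (- V ^+ 2) * (6480 * expR V) * expR (1 + V) = 6480 / expR (V ^+ 2 - 2 * V - 1).
  rewrite -expRN (_ : - (V ^+ 2 - 2 * V - 1) = - V ^+ 2 + V + (1 + V)); last by ring.
  by rewrite !expRD; ring.
 by rewrite ler_pdivrMr//; clear - x3; lra.
- have h : (A + 1) * V - V ^+ 3 <= - V.
  have : V * (A + 2) <= V * V ^+ 2 by rewrite ler_pM2l//; clear - VA V20; nra.
  clear; rewrite [V ^+ 3]exprS; lra.
 apply: (@le_trans _ _ (expR (- V))); first by rewrite ler_expR.
 rewrite expRN -[leRHS]invrK lef_pV2 ?posrE//.
 by apply: le_trans (expR_ge1Dx V); clear - Vc; lra.
- have hJ := @powR_expR R V (J + 6) (ltW V0).
 apply: (@le_trans _ _ (expR (- V ^+ 2) * (24 * V ^+ 6) * (2 * V) ^+ J)).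
  rewrite ler_wpM2r// ler_wpM2l//.
  have -> : 24 * V ^+ 6 = 8 * V ^+ 3 * (3 * V ^+ 3) by ring.
  by apply: ler_pM; clear - V1; lra.
 have -> : expR (- V ^+ 2) * (24 * V ^+ 6) * (2 * V) ^+ J = expR (- V ^+ 2) * (24 * 2 ^+ J * V ^+ (J + 6)).
  by rewrite exprMn exprD; ring.
 apply: (@le_trans _ _ (expR (- V ^+ 2) * (V * expR V))).
  rewrite ler_wpM2l ?expR_ge0//; apply: (@le_trans _ _ (24 * 2 ^+ J * ((J + 6)`!%:R * expR V))).
   by rewrite ler_wpM2l//.
  by rewrite mulrA ler_wpM2r.
 apply: (@le_trans _ _ (expR (- V ^+ 2) * (expR V * expR V))).
  rewrite ler_wpM2l// ler_wpM2r//; apply: le_trans (expR_ge1Dx V); clear; lra.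
 by rewrite -!expRD expR_le1; clear - V20; nra.
Qed.
(** The sums [Ps] over [Lam] are [(Ms + Es) / Ls], where [Es] is the truncation error. [wbound]
    makes [Ms] and [Ls] smooth, [Llow] bounds [Ls] from below, and [fsmoothV] and [fsmoothM] carry
    the smoothness to the quotient. The sum in the statement is the difference of order [J] at 0. *)
Lemma char_small R (A : R) J : 0 < A -> exists2 K : R, 0 < K & exists V0 : R, 20 <= V0 /\ forall V N q (x : nat -> R[i]) (t : R),
 V0 <= V -> (0 < N)%N -> V ^+ 3 <= ln N%:R <= 1 + V ^+ 3 -> odd q -> q%:R <= V `^ A -> cchar q x -> cnonpr q x -> `|t| <= 1 ->
 cn (\sum_(1 <= n < N.+1) xi x t n * ((Lam R n / n%:R * (nk V^-1 n * (1 - nk V^-1 n) ^+ J))%:C)) <= K * V / V ^+ J.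
Proof.
move=> A0; have [e [Kv [Kv0 hV]]] := fsmoothV R J.
(* [eta] is such that [y = q ^ eta] satisfies [y ^ m <= V] as soon as [q <= V ^ A]. The exponent [m]
   covers [y * (y ^ 7) ^ e], lost in the inversion, and [(y ^ 7) ^ 2], used for
   [J.+1 / V <= c / y ^ 7]. *)
pose m := (14 * e + 14)%N; pose eta := (A * m%:R)^-1.
have m0 : 0 < m%:R :> R by rewrite ltr0n /m addnC.
have e0 : 0 < eta by rewrite invr_gt0 mulr_gt0.
have [c /andP[c0 c1] hL] := Llow e0; have [K1 K11 hW] := wbound J e0.
pose K2 := K1 + c^-1; have ic : 0 < c^-1 by rewrite invr_gt0.
have K10 : 0 < K1 by clear - K11; lra.
have K20 : 0 < K2 by rewrite addr_gt0.
have [V0 V02 hV0] := large_V J A0 c0.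
exists (2 ^+ J * ((K1 + 1) * (Kv * K2 ^+ e))).
 by rewrite !mulr_gt0 ?exprn_gt0//.
exists V0; split; first by have [_ _ _ _] := hV0 V0 (lexx _).
move=> V N q x t VV N0 /andP[lN1 lN2] oq qV cx nx t1.
have [h1 h2 h3 h4 h5] := hV0 V VV.
have [q0 _ _ _ _] := cx.
have V0' : 0 < V by clear - h5; lra.
have V1 : 1 <= V by clear - h5; lra.
have iV : 0 < V^-1 by rewrite invr_gt0.
have y1 : 1 <= q%:R `^ eta :> R by rewrite powR_ge1 ?ler1n//.
have ym : (q%:R `^ eta) ^+ m <= V.
 rewrite -powR_mulrn ?powR_ge0// -powRrM (_ : eta * m%:R = A^-1); last first.
  by rewrite /eta invfM -mulrA mulVf ?lt0r_neq0// mulr1.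
 apply: (@le_trans _ _ ((V `^ A) `^ A^-1)).
  by apply: ge0_ler_powR => //; rewrite ?nnegrE ?powR_ge0// invr_ge0 ltW.
 by rewrite -powRrM mulfV ?lt0r_neq0// powRr1 ?(ltW V0').
move: y1 ym; set y := q%:R `^ eta; move=> y1 ym.
have y0 : 0 < y by clear - y1; lra.
have y70 : 0 < y ^+ 7 by rewrite exprn_gt0.
have y7sq : (y ^+ 7) ^+ 2 <= V.
 by apply: le_trans ym; rewrite -exprM; apply: ler_weXn2l => //; rewrite /m; clear; lia.
have kJ : J.+1%:R * V^-1 <= c / y ^+ 7.
 rewrite ler_pdivlMr// mulrAC ler_pdivrMr//.
 have : (J.+1%:R * y ^+ 7) ^+ 2 <= (c * V) ^+ 2.
  rewrite [(J.+1%:R * _) ^+ 2]exprMn [(c * V) ^+ 2]exprMn; move: h3; rewrite expr_div_n ler_pdivrMr ?exprn_gt0// => h3.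
  have s1 : 0 <= J.+1%:R ^+ 2 :> R by exact: sqr_ge0.
  have s2 : 0 <= (y ^+ 7) ^+ 2 by exact: sqr_ge0.
  apply: (@le_trans _ _ (V * c ^+ 2 * V)); first exact: ler_pM s1 s2 h3 y7sq.
  by rewrite le_eqVlt; apply/orP; left; apply/eqP; ring.
 have cV0 : 0 <= c * V by apply: mulr_ge0; apply: ltW.
 have Jy0 : 0 <= J.+1%:R * y ^+ 7 by apply: mulr_ge0 => //; apply: ltW.
 by rewrite ler_pXn2r.
have k71 : c / y ^+ 7 <= 1 by rewrite ler_pdivrMr// mul1r (le_trans c1)// exprn_ege1.
have kV : V^-1 <= c / y ^+ 7 by apply: le_trans kJ; rewrite ler_peMl ?(ltW iV)// ler1n.
have k70 : 0 < c / y ^+ 7 by rewrite divr_gt0.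
have nkN : nk V^-1 N <= expR (- V ^+ 2).
 rewrite /nk ler_expR lerN2 [V ^+ 2]expr2; rewrite ler_pdivlMl//; apply: le_trans lN1.
have l0 := @ln_ge0n R N.
have V30 : 0 <= V ^+ 3 by rewrite exprn_ge0// ltW.
have tr : trunc_ok (c / y ^+ 7) N.
 have lN0 : 0 <= 1 + ln N%:R :> R by clear - l0; lra.
 have p1 : 0 <= nk (c / y ^+ 7) N * (1 + ln N%:R) ^+ 2 by rewrite mulr_ge0 ?nk_ge0 ?exprn_ge0.
 rewrite /trunc_ok; apply: le_trans h1; apply: (ler_pM p1 (expR_ge0 _)).
  apply: (ler_pM (nk_ge0 _ _) (sqr_ge0 _)); first by apply: le_trans (nk_anti_s N kV) nkN.
  by apply: lerXn2r; rewrite ?nnegrE; clear - l0 lN2 V30; lra.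
 by rewrite ler_expR lerD2l -[leRHS]invrK lef_pV2 ?posrE// invr_gt0.
have yV : y <= V.
 by apply: le_trans ym; rewrite -[leLHS]expr1; apply: ler_weXn2l => //; rewrite /m; clear; lia.
have tl : q%:R * nk 1 N.+1 <= c / y.
 rewrite ler_pdivlMr//; apply: le_trans h2.
 have a1 : q%:R <= expR (A * V).
  apply: le_trans qV _; rewrite /powR gt_eqF// ler_expR ler_pM2l//.
  by apply: le_trans (_ : ln (1 + (V - 1)) <= _); [rewrite (addrC 1) subrK|apply: le_trans (le_ln1Dx _) _; clear - h5; lra].
 have a2 : y <= expR V by apply: le_trans yV _; apply: le_trans (expR_ge1Dx V); clear; lra.
 have a3 : nk 1 N.+1 <= expR (- V ^+ 3).
  apply: le_trans (nk_anti ler01 N0 (leqnSn N)) _; by rewrite /nk ler_expR lerN2 mul1r.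
 rewrite (_ : (A + 1) * V - V ^+ 3 = A * V + - V ^+ 3 + V); last by ring.
 rewrite !expRD; apply: ler_pM; rewrite ?mulr_ge0 ?nk_ge0 ?(ltW y0)//.
 by apply: ler_pM; rewrite ?nk_ge0.
pose X n : R[i] := (nk V^-1 n)%:C.
pose a n : R[i] := xi x t n * (n%:R^-1)%:C.
pose Ls j := \sum_(1 <= n < N.+1) a n * X n ^+ j.+1.
pose Ms j := \sum_(1 <= n < N.+1) (a n * (ln n%:R : R)%:C) * X n ^+ j.+1.
pose Ps j := \sum_(1 <= n < N.+1) (a n * (Lam R n)%:C) * X n ^+ j.+1.
have LsE j : Ls j = Lk (xi x t) (j.+1%:R * V^-1) N.
 by apply: eq_bigr => n _; rewrite /a /X nk_pow RcX; ring.
have Jk1 : J.+1%:R * V^-1 <= 1 by apply: le_trans kJ k71.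
have sL : fsmooth Ls V (K2 * y ^+ 7) J.
 move=> i j ij; rewrite fdiff_weight.
 have iJ : (i <= J)%N := leq_trans (leq_addr _ _) ij.
 have jJ : (j <= J)%N := leq_trans (leq_addl _ _) ij.
 have := hW i j 0%N q x t V^-1 N iJ jJ isT cx nx t1 (ltW iV) Jk1.
 rewrite exprVn => h; apply: le_trans (_ : K1 * y / V ^+ i <= _).
  by apply: le_trans h; rewrite le_eqVlt; apply/orP; left; apply/eqP; congr cn; apply: eq_bigr => n _; rewrite expr0 mulr1.
 rewrite ler_wpM2r ?invr_ge0//; apply: ler_pM; rewrite// ?lerDl ?(ltW ic)//.
 by rewrite -[leLHS]expr1; apply: ler_weXn2l.
have lL j : (j <= J)%N -> (K2 * y ^+ 7)^-1 <= cn (Ls j).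
 move=> jJ; rewrite LsE; apply: le_trans (hL q x t N _ oq cx nx t1 N0 tr tl _).
  rewrite -/y invfM ler_wpM2r// -[leRHS]invrK lef_pV2//.
  by rewrite /K2 lerDr ltW.
 rewrite mulr_ge0//=; apply: le_trans kJ; by rewrite ler_wpM2r ?(ltW iV)// ler_nat ltnS.
pose B := K2 * y ^+ 7.
have B1 : 1 <= B.
 rewrite /B mulr_ege1// ?exprn_ege1//; clear - K11 ic; rewrite /K2; lra.
have sV := hV Ls V B V0' B1 sL lL.
pose eps := nk V^-1 N * ((ln N%:R + 6) * (1 + ln N%:R)).
have epsb : 2 ^+ J * eps <= 1 / V ^+ J.
 rewrite ler_pdivlMr ?exprn_gt0//; apply: le_trans h4.
 rewrite mulrAC -exprMn mulrC ler_wpM2r ?exprn_ge0 ?mulr_ge0 ?(ltW V0')//.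
 apply: ler_pM; rewrite//; apply: ler_pM; clear - l0 lN2; lra.
have eps0 : 0 <= eps by rewrite !mulr_ge0.
pose Es j := Ps j * Ls j - Ms j.
have Eb j : cn (Es j) <= eps.
 pose w n := a n * X n ^+ j.+1.
 have wc : cmul w.
  have [xi1 xiM] := xi_cmul t cx; split.
   by rewrite /w /a /X nk1n invr1 !expr1n !mulr1.
  by move=> n1 n2 n10 n20; rewrite /w /a /X xiM// nkM// natrM invfM !RcM exprMn; ring.
 have wb n : (0 < n)%N -> cn (w n) <= nk V^-1 n / n%:R.
  move=> n0; have := xi_norm t n cx; rewrite /w /a; move: (xi x t n) => z z1.
  rewrite !cnM cnX !cn_real (ger0_norm (nk_ge0 _ _)) ger0_norm// mulrAC mulrC [leRHS]mulrC ler_wpM2l// -[leRHS]mul1r; apply: ler_pM; rewrite ?exprn_ge0 ?nk_ge0//.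
  by rewrite exprS ler_piMr// exprn_ile1 ?nk_le1.
 have := PL_M wc N0 (ltW iV) wb.
 rewrite (eq_bigr (fun n => a n * (Lam R n)%:C * X n ^+ j.+1)) => [|n _]; last by rewrite /w; ring.
 by rewrite [X in _ - X](eq_bigr (fun n => a n * (ln n%:R : R)%:C * X n ^+ j.+1)) => [|n _]; last by rewrite /w; ring.
have sM : fsmooth (fun j => Ms j + Es j) V ((K1 + 1) * y) J.
 move=> i j ij.
 have iJ : (i <= J)%N := leq_trans (leq_addr _ _) ij.
 have jJ : (j <= J)%N := leq_trans (leq_addl _ _) ij.
 rewrite iter_fdiffD; apply: le_trans (cnD _ _) _.
 have g1 : cn (iter i (@fdiff R) Ms j) <= K1 * y / V ^+ i.
  rewrite fdiff_weight; have := hW i j 1%N q x t V^-1 N iJ jJ isT cx nx t1 (ltW iV) Jk1.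
  rewrite exprVn => h; apply: le_trans h; apply: eq_ler; congr cn.
 have g2 : cn (iter i (@fdiff R) Es j) <= y / V ^+ i.
  apply: le_trans (fdiff_small i j Eb) _; apply: (@le_trans _ _ (1 / V ^+ J)).
   apply: le_trans epsb; rewrite ler_wpM2r//; apply: ler_weXn2l; [clear; lra|exact: iJ].
  apply: ler_pM; rewrite//.
  by rewrite lef_pV2 ?posrE ?exprn_gt0//; apply: ler_weXn2l.
 by apply: le_trans (lerD g1 g2) _; apply: eq_ler; ring.
have Y0 : 0 <= (K1 + 1) * y by [].
have Z0 : 0 <= Kv * B ^+ e by rewrite mulr_ge0// exprn_ge0; clear - B1; lra.
have sP := fsmoothM V0' Y0 Z0 sM sV.
have := sP J 0%N ltac:(by rewrite addn0).
rewrite (@iter_fdiff_ext _ _ Ps) => [|l /andP[_ lJ]]; last first.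
 rewrite addrC subrK mulfK//; apply/eqP => L0; rewrite addn0 in lJ; have := lL l lJ; rewrite L0 cn0 leNgt invr_gt0 mulr_gt0//.
rewrite fdiff_weight => h.
apply: le_trans (_ : cn _ <= _); last first.
 apply: (le_trans h); rewrite ler_wpM2r//.
 rewrite -[leRHS]mulrA ler_wpM2l//.
 have yy : y * (y ^+ 7) ^+ e <= V.
  rewrite -exprM -exprS; apply: le_trans ym; apply: ler_weXn2l => //; clear; lia.
 rewrite exprMn; have -> : (K1 + 1) * y * (Kv * (K2 ^+ e * (y ^+ 7) ^+ e)) = (K1 + 1) * (Kv * K2 ^+ e) * (y * (y ^+ 7) ^+ e) by ring.
 by rewrite ler_wpM2l//; lra.
apply: eq_ler; congr cn; apply: eq_bigr => n _.
by rewrite /a !RcM RcX RcB; ring.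
Qed.

(** * Localization by a trigonometric polynomial *)

Definition band R (f : R -> R[i]) (S F : R) := forall (a : nat -> R[i]) N (v e T0 : R),
 (forall t, `|t| <= T0 -> cn (\sum_(1 <= n < N) a n * cis (- (t * ln n%:R))) <= e) ->
 forall t, `|t| + F <= T0 -> cn (\sum_(1 <= n < N) (a n * f (ln n%:R - v)) * cis (- (t * ln n%:R))) <= S * e.
Lemma band_ext R (f g : R -> R[i]) S F : (forall y, f y = g y) -> band f S F -> band g S F.
Proof.
move=> fg h a N v e T0 ha t ht; have := h a N v e T0 ha t ht.
by rewrite (eq_bigr (fun n => a n * g (ln n%:R - v) * cis (- (t * ln n%:R)))) => [//|n _]; rewrite fg.
Qed.
(** [band f S F] records what is used of a trigonometric polynomial with frequencies at most [F] and
    coefficients of total modulus [S]: multiplying by [f (ln n - v)] moves [t] by at most [F] and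
    costs the factor [S]. For one exponential it is a mere translation of [t]. *)
Lemma band_cis R (tau : R) : band (fun y => cis (tau * y)) 1 `|tau|.
Proof.
move=> a N v e T0 ha t ht.
have -> : \sum_(1 <= n < N) a n * cis (tau * (ln n%:R - v)) * cis (- (t * ln n%:R)) = cis (- (tau * v)) * \sum_(1 <= n < N) a n * cis (- ((t - tau) * ln n%:R)).
 rewrite mulr_sumr; apply: eq_bigr => n _.
 rewrite (_ : - ((t - tau) * ln n%:R) = tau * ln n%:R + - (t * ln n%:R)); last by ring.
 by rewrite (_ : tau * (ln n%:R - v) = - (tau * v) + tau * ln n%:R); [rewrite !cisD; ring|ring].
rewrite cnM cn_cis mul1r mul1r; apply: ha; apply: le_trans (ler_normB _ _) _; exact: ht.
Qed.
Lemma bandM R (f g : R -> R[i]) S1 F1 S2 F2 : band f S1 F1 -> band g S2 F2 -> band (fun y => f y * g y) (S1 * S2) (F1 + F2).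
Proof.
move=> hf hg a N v e T0 ha t ht.
have h1 : forall t', `|t'| <= T0 - F2 -> cn (\sum_(1 <= n < N) (a n * g (ln n%:R - v)) * cis (- (t' * ln n%:R))) <= S2 * e.
 by move=> t' h; apply: (hg a N v e T0 ha); lra.
have := hf (fun n => a n * g (ln n%:R - v)) N v (S2 * e) (T0 - F2) h1 t ltac:(lra).
rewrite mulrA (eq_bigr (fun n => a n * (f (ln n%:R - v) * g (ln n%:R - v)) * cis (- (t * ln n%:R)))) => [//|n _]; ring.
Qed.
Lemma bandD R (f g : R -> R[i]) S1 F1 S2 F2 : band f S1 F1 -> band g S2 F2 -> band (fun y => f y + g y) (S1 + S2) (Num.max F1 F2).
Proof.
move=> hf hg a N v e T0 ha t ht.
have m1 : F1 <= Num.max F1 F2 by rewrite le_max lexx.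
have m2 : F2 <= Num.max F1 F2 by rewrite le_max lexx orbT.
have h1 := hf a N v e T0 ha t ltac:(lra); have h2 := hg a N v e T0 ha t ltac:(lra).
rewrite (eq_bigr (fun n => a n * f (ln n%:R - v) * cis (- (t * ln n%:R)) + a n * g (ln n%:R - v) * cis (- (t * ln n%:R)))) => [|n _]; last by ring.
by rewrite big_split mulrDl; apply: le_trans (cnD _ _) _; exact: lerD.
Qed.
Lemma bandZ R (f : R -> R[i]) S F c : band f S F -> band (fun y => c * f y) (cn c * S) F.
Proof.
move=> hf a N v e T0 ha t ht; have h := hf a N v e T0 ha t ht.
rewrite (eq_bigr (fun n => c * (a n * f (ln n%:R - v) * cis (- (t * ln n%:R))))) => [|n _]; last by ring.
by rewrite -mulr_sumr cnM -mulrA ler_wpM2l.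
Qed.
Lemma band_le R (f : R -> R[i]) S F F' : F <= F' -> band f S F -> band f S F'.
Proof. by move=> FF hf a N v e T0 ha t ht; apply: (hf a N v e T0 ha); lra. Qed.
Lemma band_sum R H (w F : R) : 0 <= F -> (forall h, (h < H)%N -> `|h%:R * w| <= F) -> band (fun y => \sum_(h < H) cis (h%:R * w * y)) H%:R F.
Proof.
move=> F0; elim: H => [|H IH] hF.
 move=> a N v e T0 ha t ht; rewrite mul0r big1 ?cn0// => n _; by rewrite big_ord0 mulr0 mul0r.
have h1 := IH (fun h hH => hF h (ltnW hH)).
apply: (@band_ext _ (fun y => \sum_(h < H) cis (h%:R * w * y) + cis (H%:R * w * y))); first by move=> y; rewrite big_ord_recr.
rewrite -natr1; apply: (@band_le _ _ _ (Num.max F F)); first by rewrite maxxx.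
apply: bandD => //; exact: (band_le (hF H (ltnSn H)) (@band_cis R (H%:R * w))).
Qed.
Definition dker R H (w y : R) : R[i] := \sum_(h < H) cis (h%:R * w * y).
Lemma dker_le R H (w y : R) : cn (dker H w y) <= H%:R.
Proof.
apply: le_trans (cn_sum _ _ _) _; rewrite (eq_bigr (fun=> 1)) => [|h _]; last by rewrite cn_cis.
by rewrite sumr_const card_ord.
Qed.
Lemma dker_ge R H (w y : R) : H%:R * `|w * y| <= 1 -> H%:R / 2 <= cn (dker H w y).
Proof.
move=> h; apply: le_trans (le_trans (ler_norm _) (Re_le_cn _)); rewrite Re_sum.
apply: (@le_trans _ _ (\sum_(i < H) (1/2))); first by rewrite sumr_const card_ord -[leRHS]mulr_natl div1r.
apply: ler_sum => i _; apply: cos_ge_half; rewrite -mulrA normrM (ger0_norm (ler0n _ _)); apply: le_trans h.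
by rewrite ler_wpM2r// ler_nat ltnW.
Qed.
Lemma dker_dec R H (w y : R) : 0 < `|w * y| <= 2 -> cn (dker H w y) <= 4 / `|w * y|.
Proof.
move=> /andP[p0 p2]; rewrite ler_pdivlMr//.
have e : dker H w y * (cis (w * y) - 1) = cis (w * y) ^+ H - 1.
 rewrite subrX1 mulrC; congr (_ * _); apply: eq_bigr => h _; by rewrite -cisMn -[w * y *+ h]mulr_natl mulrA.
have := congr1 cn e; rewrite cnM => e2.
have h1 : cn (cis (w * y) ^+ H - 1) <= 2.
 by apply: le_trans (cnB _ _) _; rewrite cnX cn_cis expr1n cn1; lra.
have h2 := cn_cis_sub1_ge p2.
have := ler_wpM2l (cn_ge0 (dker H w y)) h2; lra.
Qed.
Lemma cos_sub_ge R (a b : R) : 0 <= a <= b -> a + b <= 2 -> (b ^+ 2 - a ^+ 2) / 8 <= cos a - cos b.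
Proof.
move=> /andP[a0 ab] ab2.
have [u [v [ea eb]]] : exists u v : R, a = u - v /\ b = u + v by exists ((a + b) / 2), ((b - a) / 2); split; field.
have u0 : 0 <= u <= 1 by apply/andP; split; lra.
have v0 : 0 <= v <= 1 by apply/andP; split; lra.
have su := sin_ge_half u0; have sv := sin_ge_half v0.
rewrite ea eb [cos (u - v)]cosB cosD.
have -> : cos u * cos v + sin u * sin v - (cos u * cos v - sin u * sin v) = 2 * (sin u * sin v) by ring.
have -> : ((u + v) ^+ 2 - (u - v) ^+ 2) / 8 = 2 * (u / 2 * (v / 2)) by field.
rewrite ler_pM2l//; apply: ler_pM => //; lra.
Qed.
Lemma cos_sub1 R (x : R) : 1 - cos x <= x ^+ 2 / 2.
Proof.
have h := cn_cis_sub x 0; rewrite cis0 subr0 in h.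
have : cn (cis x - 1) ^+ 2 <= `|x| ^+ 2 by apply: lerXn2r; rewrite ?nnegrE.
rewrite cn_sqr/= real_normK ?num_real//.
have := cos2Dsin2 x; lra.
Qed.
(** The last factor changes sign at [|y| = T], so while [w * |y| <= 1] the function is positive only
    inside the window: a lower bound for a sum against it is carried by the window alone. The fourth
    power of the kernel makes the negative part decay like [y ^ (- 2)], which is summable against
    [Lam n / n]. *)
Definition psik R H (w T y : R) : R := cn (dker H w y) ^+ 4 * (cos (w * y) - cos (w * T)).
Lemma conj_dker R H (w y : R) : (cn (dker H w y) ^+ 2)%:C = dker H w y * dker H w (- y).
Proof.
have cj : dker H w (- y) = (dker H w y)^*%C.
 rewrite rmorph_sum; apply: eq_bigr => h _; rewrite /cis mulrN cosN sinN//.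
by rewrite cj cn_sqr; case: (dker H w y) => a b; apply/eqP; rewrite eq_complex/=; apply/andP; split; apply/eqP; ring.
Qed.
(** By [conj_dker] the fourth power is a product of four kernels with frequencies at most [H * w];
    the cosine adds one frequency [w]. *)
Lemma band_psik R H (w T : R) : 0 <= w -> band (fun y => (psik H w T y)%:C) (H%:R ^+ 4 * 2) (4 * (H%:R * w) + w).
Proof.
move=> w0; have F0 : 0 <= H%:R * w by [].
have b1 : band (fun y => dker H w y) H%:R (H%:R * w).
 by apply: band_sum => // h hH; rewrite ger0_norm// ler_wpM2r// ler_nat ltnW.
have b2 : band (fun y => dker H w (- y)) H%:R (H%:R * w).
 apply: (@band_ext _ (fun y => \sum_(h < H) cis (h%:R * (- w) * y))).
  by move=> y; apply: eq_bigr => h _; rewrite mulrN mulNr mulrN.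
 by apply: band_sum => // h hH; rewrite mulrN normrN ger0_norm// ler_wpM2r// ler_nat ltnW.
have b3 := bandM (bandM b1 b2) (bandM b1 b2).
have c1 : band (fun y => (cos (w * y) - cos (w * T))%:C) 2 w.
 have d1 := bandZ (2^-1) (bandD (@band_cis R w) (@band_cis R (- w))).
 have d2 : band (fun y => - (cos (w * T))%:C * cis (0 * y)) (cn (- (cos (w * T))%:C) * 1) `|0 : R|.
  exact: bandZ (@band_cis R 0).
 have d3 := bandD d1 d2.
 move=> a N v e T0 ha t ht.
 have := d3 a N v e T0 ha t; rewrite normr0 normrN maxxx (ger0_norm w0) (_ : Num.max w 0 = w); last by apply/max_idPl.
 move=> /(_ ht) h.
 rewrite (eq_bigr (fun n => a n * (2^-1 * (cis (w * (ln n%:R - v)) + cis (- w * (ln n%:R - v))) + - (cos (w * T))%:C * cis (0 * (ln n%:R - v))) * cis (- (t * ln n%:R)))); last first.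
  move=> n _; congr (_ * _ * _); rewrite mul0r cis0 mulr1 RcB; congr (_ - _).
  rewrite /cis mulNr cosN sinN; apply/eqP; rewrite -(inj_eq (mulfI (_ : 2 != 0 :> R[i])))// mulrA mulfV// mul1r.
  by rewrite mulr_natl; apply/eqP; apply/eqP; rewrite eq_complex/= addrN addr0 !eqxx.
 apply: (le_trans h); have e0 : 0 <= e.
  by apply: le_trans (cn_ge0 _) (ha t _); have := ht; lra.
 rewrite ler_wpM2r// cnV cnN cn_real.
 have two : (2 : R[i]) = 2%:C by rewrite (rmorph_nat (real_complex R) 2).
 have -> : cn (2 : R[i]) = 2 by rewrite two cn_real ger0_norm.
 rewrite//; have := cos_max (w * T); lra.
have b4 := bandM b3 c1.
apply: (@band_ext _ (fun y => dker H w y * dker H w (- y) * (dker H w y * dker H w (- y)) * (cos (w * y) - cos (w * T))%:C)).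
 by move=> y; rewrite -conj_dker -!RcM -!exprD.
have e1 (x : R) : x ^+ 4 * 2 = x * x * (x * x) * 2 by ring.
have e2 x : 4 * x + w = x + x + (x + x) + w by ring.
by rewrite e1 e2.
Qed.

(** * Von Mangoldt sums over short logarithmic windows *)

Lemma Lam_small R (P : pred nat) X Y : (0 < X)%N ->
 (forall p k, prime p -> (0 < k)%N -> (p ^ k <= X)%N -> P (p ^ k)%N -> (p <= Y)%N) ->
 \sum_(1 <= n < X.+1 | P n) Lam R n <= Y%:R * ln X%:R.
Proof.
move=> X0 hP.
have -> : \sum_(1 <= n < X.+1 | P n) Lam R n = \sum_(1 <= n < X.+1) Lam R n * (if P n then 1 else 0).
 by rewrite big_mkcond; apply: eq_bigr => n _; case: ifP; rewrite ?mulr1 ?mulr0.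
rewrite sum_Lam.
apply: (@le_trans _ _ (\sum_(1 <= p < X.+1 | prime p) (if (p <= Y)%N then ln X%:R else 0))).
 apply: ler_sum => p pp; case: ifPn => pY; last first.
  rewrite big_nat_cond big1// => k /andP[/andP[k0 _] kX]; case: ifP => [h|_]; last by lra.
  by case/negP: pY; apply: hP h => //.
 (* One prime contributes [ln p] for each of its powers up to [X], in total at most [ln X]. *)
 set K := trunc_log p X.
 have p1 := prime_gt1 pp.
 have pK : (p ^ K <= X)%N by rewrite trunc_logP.
 have KX : (K < X.+1)%N by rewrite ltnS; apply: leq_trans pK; apply: ltnW; exact: ltn_expl.
 apply: (@le_trans _ _ (\sum_(1 <= k < K.+1) ln p%:R)).
  rewrite [leRHS](big_nat_widen _ _ X.+1)// big_mkcond [leRHS]big_mkcond; apply: ler_sum => k _.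
  have -> : (p ^ k < X.+1)%N = (k < K.+1)%N.
   rewrite !ltnS; apply/idP/idP => h; first by rewrite trunc_log_max.
   by apply: leq_trans pK; rewrite leq_exp2l.
  case: ifP => // _; case: ifP => _; rewrite ?mulr1// mulr0 ln_ge0n//.
 rewrite sumr_const_nat subn1 -lnXn ?ltr0n ?(ltnW p1)// -natrX ler_ln ?posrE ?ltr0n ?expn_gt0 ?(ltnW p1)// ler_nat//.
rewrite big_mkcond; apply: (@le_trans _ _ (\sum_(1 <= p < X.+1) (if (p <= Y)%N then ln X%:R else 0))).
 by apply: ler_sum => p _; case: (prime p) => //; case: ifP.
rewrite -big_mkcond.
have -> : \sum_(1 <= p < X.+1 | (p <= Y)%N) ln X%:R = (\sum_(1 <= p < X.+1 | (p <= Y)%N) 1) * ln X%:R :> R.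
 by rewrite mulr_suml; rewrite mul1r.
rewrite ler_wpM2r//; have [le|lt] := leqP X Y.
 apply: (@le_trans _ _ (\sum_(1 <= p < X.+1) 1)); last by rewrite sumr_const_nat subn1 ler_nat.
 by rewrite big_mkcond; apply: ler_sum => p _; case: ifP.
rewrite (eq_bigl (fun p => (p < Y.+1)%N))// -(big_nat_widen _ _ _ xpredT) 1?ltnW//.
by rewrite sumr_const_nat subn1.
Qed.
Lemma expR1_le4 R : expR 1 <= 4 :> R.
Proof.
have h := expR_ge1Dx (- (1/2) : R).
have e : expR 1 * (expR (- (1/2)) * expR (- (1/2))) = 1 :> R.
 by rewrite -!expRD (_ : 1 + (- (1/2) + - (1/2)) = 0) ?expR0; field.
have h2 : 1/4 <= expR (- (1/2)) * expR (- (1/2)) :> R by nra.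
have := ler_wpM2l (expR_ge0 1) h2; lra.
Qed.
Lemma Lam_win R (u : R) N : \sum_(1 <= n < N | u <= ln n%:R <= u + 1) Lam R n / n%:R <= 24.
Proof.
have [u1|u1] := leP u (-1).
 rewrite big_nat_cond big1; first lra.
 move=> n /andP[/andP[n0 _] /andP[_ h]]; have := ln_ge0n R n => h0.
 have n1 : n = 1%N.
  apply/eqP; rewrite eqn_leq n0 andbT leqNgt; apply/negP => n2.
  have : ln (1 : R) < ln n%:R by rewrite ltr_ln ?posrE// ltr1n.
  by rewrite ln1; lra.
 by rewrite n1 Lam1 mul0r.
set X := Num.truncn (expR (u + 1)).
have e1 : 1 <= expR (u + 1) by rewrite -[leLHS]expR0 ler_expR; lra.
have eu := expR_gt0 u.
apply: (@le_trans _ _ (\sum_(1 <= n < N | u <= ln n%:R <= u + 1) Lam R n / expR u)).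
 rewrite big_nat_cond [leRHS]big_nat_cond; apply: ler_sum => n /andP[/andP[n0 _] /andP[h _]].
 by rewrite ler_wpM2l// lef_pV2 ?posrE// -[leRHS]lnK ?posrE// ler_expR.
rewrite -mulr_suml ler_pdivrMr//.
apply: (@le_trans _ _ (psi R X)).
 rewrite big_mkcond /psi.
 have st n : (X.+1 <= n)%N -> (if u <= ln n%:R <= u + 1 then Lam R n else 0) = 0.
  move=> Xn; case: ifP => // /andP[_ h]; suff : n%:R <= expR (u + 1).
   by rewrite -truncn_ge_nat//; lia.
  by rewrite -[leLHS]lnK ?posrE ?ltr0n ?ler_expR//; apply: leq_trans Xn.
 have [NX|XN] := leqP N X.+1.
  have [N1|N1] := leqP N 1; first by rewrite big_geq//.
  rewrite [leRHS](big_cat_nat (n := N)) ?(ltnW N1)//= -[leLHS]addr0; apply: lerD.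
   by apply: ler_sum => n _; case: ifP => // _.
  by [].
 rewrite (big_cat_nat (n := X.+1)) ?(ltnW XN)//= [X in _ + X]big1_seq ?addr0; last first.
  by move=> n /andP[_]; rewrite mem_index_iota => /andP[h _]; exact: st.
 by apply: ler_sum => n _; case: ifP => // _.
apply: le_trans (psi_le _ _) _.
have : X%:R <= expR (u + 1) by rewrite truncn_le.
rewrite expRD; have := @expR1_le4 R; nra.
Qed.
Lemma sum_inv_sq R T M : (0 < T)%N -> \sum_(T <= j < M) (j%:R ^+ 2 : R)^-1 <= 2 / T%:R.
Proof.
move=> T0; have [MT|TM] := leqP M T; first by rewrite big_geq//.
suff h k : \sum_(T <= j < T + k) (j%:R ^+ 2 : R)^-1 <= 2 / T%:R - 2 / (T + k)%:R.
 rewrite -(subnKC (ltnW TM)); apply: le_trans (h _) _; by rewrite gerBl.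
elim: k => [|k IH]; first by rewrite addn0 big_geq// subrr.
rewrite addnS big_nat_recr ?leq_addr//=; set m := (T + k)%N in IH *.
have m0 : (0 < m)%N by rewrite addn_gt0 T0.
have p0 : 0 < m%:R :> R by [].
have m1 : 1 <= m%:R :> R by rewrite ler1n.
suff h : (m%:R ^+ 2 : R)^-1 <= 2 / m%:R - 2 / m.+1%:R by apply: le_trans (lerD IH h) _; rewrite addrA subrK.
rewrite -[m.+1%:R]natr1; move: (m%:R) p0 m1 => x x0 x1.
have -> : 2 / x - 2 / (x + 1) = 2 / (x * (x + 1)) by field; lra.
rewrite -[leLHS]mul1r ler_pdivrMr ?exprn_gt0// mulrAC ler_pdivlMr ?mulr_gt0//; nra.
Qed.
(** Slicing by the integer part [j] of [|ln n - V|]: each slice is covered by two windows of length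
    1, of mass at most 24 each, and the sum of the [1 / j ^ 2] is at most [2 / T]. *)
Lemma Lam_tail R (V : R) T N : (0 < T)%N ->
 \sum_(1 <= n < N | T%:R <= `|ln n%:R - V|) Lam R n / n%:R / (ln n%:R - V) ^+ 2 <= 96 / T%:R.
Proof.
move=> T0.
have [M hM] : exists M, forall n, (n < N)%N -> `|ln n%:R - V| < M%:R.
 exists (Num.truncn (ln N%:R + `|V|)).+1 => n nN; apply: le_lt_trans (truncnS_gt _).
 apply: le_trans (ler_normB _ _) _; rewrite lerD2r ger0_norm//.
 case: n nN => [|n] nN; first by rewrite (ln0 (lexx 0)) ln_ge0n.
 by rewrite ler_ln ?posrE ?ltr0n ?ler_nat//; apply: leq_trans nN.
pose tr n := Num.truncn `|ln n%:R - V|.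
have trP n : (tr n)%:R <= `|ln n%:R - V| < (tr n).+1%:R by exact: truncn_itv.
apply: (@le_trans _ _ (\sum_(T <= j < M) \sum_(1 <= n < N | tr n == j) Lam R n / n%:R * (j%:R ^+ 2)^-1)).
 rewrite (exchange_big_dep xpredT)//= big_mkcond big_nat_cond [leRHS]big_nat_cond; apply: ler_sum => n /andP[/andP[n0 nN] _].
 have s0 : 0 <= \sum_(T <= j < M | tr n == j) Lam R n / n%:R * (j%:R ^+ 2)^-1.
  by [].
 case: ifPn => // h; have /andP[t1 t2] := trP n.
 have jT : (T <= tr n)%N by rewrite -ltnS -(ltr_nat R); apply: le_lt_trans h t2.
 have jM : (tr n < M)%N by rewrite -(ltr_nat R); apply: le_lt_trans t1 (hM n nN).
 rewrite (eq_bigl (fun j => j == tr n)) => [|j] => //.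
 rewrite big_nat1_eq jT jM ler_wpM2l//.
 have tp : 0 < (tr n)%:R :> R by rewrite ltr0n; apply: leq_trans jT.
 have sp : 0 < (ln n%:R - V) ^+ 2 by rewrite -real_normK ?num_real// exprn_gt0//; apply: lt_le_trans t1.
 by rewrite lef_pV2 ?posrE// -[leRHS]real_normK ?num_real//; apply: lerXn2r; rewrite ?nnegrE.
apply: (@le_trans _ _ (\sum_(T <= j < M) 48 * (j%:R ^+ 2)^-1)).
 apply: ler_sum => j _; rewrite -mulr_suml ler_wpM2r//.
 apply: (@le_trans _ _ (\sum_(1 <= n < N | V + j%:R <= ln n%:R <= V + j%:R + 1) Lam R n / n%:R + \sum_(1 <= n < N | V - j%:R - 1 <= ln n%:R <= V - j%:R - 1 + 1) Lam R n / n%:R)).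
  rewrite big_mkcond [X in _ <= X + _]big_mkcond [X in _ <= _ + X]big_mkcond -big_split; apply: ler_sum => n _.
  have i0 b : 0 <= (if b : bool then Lam R n / n%:R else 0) by case: b.
  case: ifPn => [/eqP e|_]; last exact: addr_ge0.
  have := trP n; rewrite e; have [h|h] := leP 0 (ln n%:R - V).
   rewrite (ger0_norm h) => /andP[a1 a2]; rewrite ifT; first by rewrite lerDl.
   by apply/andP; split; lra.
  rewrite (ltr0_norm h) => /andP[a1 a2]; rewrite [X in _ <= _ + X]ifT; first by rewrite lerDr.
  by apply/andP; split; lra.
 have := Lam_win (V + j%:R) N; have := Lam_win (V - j%:R - 1) N; lra.
rewrite -mulr_sumr; have := sum_inv_sq R M T0; lra.
Qed.
(** The ratio of the end points, [expR 8 >= 256], outweighs the gap between the constants 1/4 and 6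
    in the Chebyshev bounds. *)
Lemma Lam_mass R (V : R) N : 20 <= V -> expR (V + 4) <= N%:R ->
 1/8 <= \sum_(1 <= n < N.+1 | `|ln n%:R - V| <= 4) Lam R n / n%:R.
Proof.
move=> V20 hN; set X := Num.truncn (expR (V + 4)); set Y := Num.truncn (expR (V - 4)).
have p1 := expR_gt0 (V + 4); have p2 := expR_gt0 (V - 4).
have /andP[X1 X2] : X%:R <= expR (V + 4) < X.+1%:R by rewrite truncn_itv//.
have /andP[Y1 Y2] : Y%:R <= expR (V - 4) < Y.+1%:R by rewrite truncn_itv//.
have XN : (X <= N)%N by rewrite -(ler_nat R); apply: le_trans X1 hN.
have YX : (Y <= X)%N by apply: le_truncn; rewrite ler_expR; lra.
have e8 : 256 * expR (V - 4) <= expR (V + 4).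
 rewrite (_ : V + 4 = (V - 4) + 8); last by ring.
 rewrite [leRHS]expRD mulrC ler_pM2l//.
 have h8 : 2 <= expR 1 :> R by have := expR_ge1Dx (1 : R); lra.
 have -> : expR 8 = expR 1 ^+ 8 :> R by rewrite -expRM_natl mulr1.
 have -> : 256 = 2 ^+ 8 :> R by ring.
 by apply: lerXn2r; rewrite ?nnegrE//; lra.
have e1 : 24 <= expR (V + 4) by have := expR_ge1Dx (V + 4); lra.
apply: (@le_trans _ _ (\sum_(Y.+1 <= n < X.+1) Lam R n / expR (V + 4))).
 rewrite -mulr_suml ler_pdivlMr//.
 have -> : \sum_(Y.+1 <= n < X.+1) Lam R n = psi R X - psi R Y.
  by rewrite /psi (big_cat_nat (m := 1%N) (n := Y.+1) (p := X.+1))//= addrAC subrr add0r.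
 have := psi_le R Y; have := psi_ge R X; lra.
rewrite [leRHS]big_mkcond (big_cat_nat (n := Y.+1) (p := N.+1)) ?ltnS ?(leq_trans YX)//= [X in _ <= _ + X](big_cat_nat (n := X.+1))//=.
have nn n : 0 <= (if `|ln n%:R - V| <= 4 then Lam R n / n%:R else 0) by case: ifP => // _; rewrite divr_ge0.
rewrite -[leLHS]add0r; apply: lerD; first by [].
rewrite -[leLHS]addr0; apply: lerD => //.
apply: ler_sum_nat => n /andP[n1 n2].
have n0 : (0 < n)%N by apply: leq_trans n1.
have np : 0 < n%:R :> R by [].
have b1 : expR (V - 4) <= n%:R by apply: le_trans (ltW Y2) _; rewrite ler_nat.
have b2 : n%:R <= expR (V + 4) by apply: le_trans X1; rewrite ler_nat.
rewrite ifT; first by rewrite ler_wpM2l// lef_pV2.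
have c1 : V - 4 <= ln n%:R by rewrite -[leLHS]expRK ler_ln.
have c2 : ln n%:R <= V + 4 by rewrite -[leRHS]expRK ler_ln.
by rewrite ler_norml; apply/andP; split; lra.
Qed.

(** * Sign of the kernel, and the contribution of the principal character *)

Lemma cos_abs R (x : R) : cos `|x| = cos x.
Proof. by have [h|h] := leP 0 x; rewrite ?(ger0_norm h)// (ltr0_norm h) cosN. Qed.
Lemma psik_mid R H (w T y : R) : 0 <= w -> `|y| <= T -> w * (2 * T) <= 2 ->
 0 <= psik H w T y <= H%:R ^+ 4 * (w ^+ 2 * T ^+ 2 / 2).
Proof.
move=> w0 yT wT; have T0 : 0 <= T := le_trans (normr_ge0 _) yT.
have c : 0 <= cos (w * y) - cos (w * T).
 rewrite -[cos (w * y)]cos_abs normrM (ger0_norm w0).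
 have h1 : w * `|y| <= w * T by rewrite ler_wpM2l.
 apply: le_trans (cos_sub_ge (_ : 0 <= w * `|y| <= w * T) _); last 2 first.
 - by rewrite mulr_ge0.
 - lra.
 rewrite divr_ge0// subr_ge0; apply: lerXn2r; rewrite ?nnegrE//.
apply/andP; split; first by rewrite mulr_ge0.
apply: ler_pM; rewrite//.
 by apply: lerXn2r; rewrite ?nnegrE// dker_le.
have := cos_sub1 (w * T); have := cos_le1 (w * y); lra.
Qed.
Lemma psik_pos R H (w T y : R) : 0 <= w -> `|y| <= 4 -> 8 <= T -> H%:R * w <= 1/8 -> w * (2 * T) <= 2 ->
 H%:R ^+ 4 / 16 * (3 / 32 * (w ^+ 2 * T ^+ 2)) <= psik H w T y.
Proof.
move=> w0 y4 T8 Hw wT.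
have h2 : H%:R / 2 <= cn (dker H w y).
 apply: dker_ge; rewrite normrM (ger0_norm w0).
 have : H%:R * w * `|y| <= 1/8 * 4 by apply: ler_pM => //.
 lra.
apply: ler_pM => //.
 apply: le_trans (_ : (H%:R / 2) ^+ 4 <= _); last by apply: lerXn2r; rewrite ?nnegrE//.
 by apply: eq_ler; field.
rewrite -[cos (w * y)]cos_abs normrM (ger0_norm w0).
have h1 : w * `|y| <= w * T by rewrite ler_wpM2l//; lra.
apply: le_trans (cos_sub_ge (_ : 0 <= w * `|y| <= w * T) _); last 2 first.
- by rewrite mulr_ge0.
- lra.
have : `|y| ^+ 2 <= 16 by have := normr_ge0 y; rewrite expr2; nra.
have : 64 <= T ^+ 2 by rewrite expr2; nra.
move=> a b; have : 3/4 * T ^+ 2 <= T ^+ 2 - `|y| ^+ 2 by lra.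
move=> /(ler_wpM2l (exprn_ge0 2 w0)); lra.
Qed.
Lemma psik_neg R H (w T y : R) : 0 < w -> 0 < T -> T <= `|y| -> w * `|y| <= 1 -> 1/16 <= H%:R * w ->
 - (128 * 16 ^+ 4 * (w ^+ 2 * H%:R ^+ 4) / y ^+ 2) <= psik H w T y.
Proof.
move=> w0 T0 Ty wy Hw; have y0 : 0 < `|y| := lt_le_trans T0 Ty.
have y2 : 0 < y ^+ 2 by rewrite -real_normK ?num_real//.
have yn0 : y != 0 by rewrite -normr_gt0.
have nwy : `|w * y| = w * `|y| by rewrite normrM (ger0_norm (ltW w0)).
have d : cn (dker H w y) <= 4 / (w * `|y|).
 rewrite -nwy; apply: dker_dec; rewrite nwy mulr_gt0//=; lra.
have d4 : cn (dker H w y) ^+ 4 <= 256 / (w ^+ 4 * (y ^+ 2) ^+ 2).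
 apply: le_trans (_ : (4 / (w * `|y|)) ^+ 4 <= _).
  by apply: lerXn2r; rewrite ?nnegrE.
 rewrite -[y ^+ 2]real_normK ?num_real//; apply: eq_ler; field.
 by [].
have c1 : cos (w * T) - cos (w * y) <= w ^+ 2 * y ^+ 2 / 2.
 have := cos_sub1 (w * y); have := cos_le1 (w * T); lra.
have [c0|c0] := leP (cos (w * T)) (cos (w * y)).
 apply: (@le_trans _ _ 0); last by rewrite mulr_ge0// subr_ge0.
 by rewrite oppr_le0//.
rewrite /psik -[cos (w * y) - _]opprB mulrN lerN2.
apply: (@le_trans _ _ (256 / (w ^+ 4 * (y ^+ 2) ^+ 2) * (w ^+ 2 * y ^+ 2 / 2))).
 by apply: ler_pM => //; lra.
have -> : 256 / (w ^+ 4 * (y ^+ 2) ^+ 2) * (w ^+ 2 * y ^+ 2 / 2) = 128 * w^-1 ^+ 2 / y ^+ 2.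
 by field.
rewrite ler_pM2r//.
have iw : w^-1 <= 16 * H%:R.
 by rewrite -[leLHS]mul1r ler_pdivrMr//; lra.
have h4 : w^-1 ^+ 4 <= (16 * H%:R) ^+ 4 by apply: lerXn2r; rewrite ?nnegrE//.
have -> : 128 * w^-1 ^+ 2 = 128 * (w ^+ 2 * w^-1 ^+ 4) by field.
apply: (@le_trans _ _ (128 * (w ^+ 2 * (16 * H%:R) ^+ 4))).
 by rewrite ler_pM2l// ler_pM2l.
apply: eq_ler; ring.
Qed.
(** The weight produced by the difference of order [J] at [k = 1 / V]. Near [ln n = V] its two
    factors are of constant size, as [n ^ (- 1 / V)] is close to [1 / e]. *)
Definition om R (V : R) J n : R := Lam R n / n%:R * (nk V^-1 n * (1 - nk V^-1 n) ^+ J).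
Lemma om_bounds R (V : R) J n : 0 < V -> 0 <= om V J n <= Lam R n / n%:R.
Proof.
move=> V0; have iV : 0 <= V^-1 by [].
have k1 := nk_le1 n iV; have k0 := nk_ge0 V^-1 n.
have m0 : 0 <= 1 - nk V^-1 n by lra.
have m1 : (1 - nk V^-1 n) ^+ J <= 1 by apply: exprn_ile1 => //; lra.
rewrite /om; apply/andP; split => //.
by rewrite ler_piMr//; apply: mulr_ile1 => //.
Qed.
Lemma om_ge R (V : R) J n : 20 <= V -> `|ln n%:R - V| <= 4 -> expR (-2) * (1/4) ^+ J * (Lam R n / n%:R) <= om V J n.
Proof.
move=> V20; rewrite ler_norml => /andP[h1 h2]; have V0 : 0 < V by lra.
rewrite mulrC ler_wpM2l//.
have a1 : V^-1 * ln n%:R <= 2 by rewrite ler_pdivrMl; lra.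
have a2 : 4/5 <= V^-1 * ln n%:R by rewrite ler_pdivlMl; lra.
have k1 : expR (-2) <= nk V^-1 n by rewrite ler_expR lerN2.
have k2 : nk V^-1 n <= 3/4.
 apply: (@le_trans _ _ (expR (- (4/5)))); first by rewrite ler_expR lerN2.
 have e : expR (- (4/5)) * expR (4/5) = 1 :> R by rewrite -expRD addNr expR0.
 have := expR_ge1Dx (4/5 : R); have := expR_gt0 (- (4/5) : R); nra.
apply: ler_pM; rewrite//; try lra.
by apply: lerXn2r; rewrite ?nnegrE; lra.
Qed.
(** The mass within distance 4 of [V] enters with a factor of order [T ^ 2] by [psik_pos], while the
    negative tail is [O(1 / T)] by [psik_neg] and [Lam_tail]; so some fixed [T] works. The [n] not
    coprime to [q] are removed by [Lam_small]. *)
Lemma S0_lower R J : exists2 c1 : R, 0 < c1 & exists T : nat, (8 <= T)%N /\ forall (V : R) N q H (w : R),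
 20 + T%:R <= V -> (0 < q)%N -> q%:R * (V + 4) * expR (4 - V) <= 1/16 -> 0 < w -> w * (1 + V ^+ 3) = 1 -> 1/16 <= H%:R * w <= 1/8 ->
 (0 < N)%N -> V ^+ 3 <= ln N%:R <= 1 + V ^+ 3 ->
 c1 * (w ^+ 2 * H%:R ^+ 4) <= \sum_(1 <= n < N.+1 | coprime n q) om V J n * psik H w T%:R (ln n%:R - V).
Proof.
pose k : R := expR (-2) * (1/4) ^+ J; have k0 : 0 < k by rewrite mulr_gt0//; lra.
pose c0 : R := 3 / 512 / 16 * k; have c00 : 0 < c0 by rewrite mulr_gt0//; lra.
have [KB KBE] : exists KB : R, KB = 128 * 16 ^+ 4 by exists (128 * 16 ^+ 4).
have KB0 : 0 <= KB by rewrite KBE mulr_ge0// exprn_ge0.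
(* The tail is at most [96 * KB]; this [T] makes it at most half of [c0 * T ^ 2]. *)
pose T := (8 + Num.truncn (192 * KB / c0)).+1.
have T8 : (8 <= T)%N by [].
have Tr8 : 8 <= T%:R :> R by rewrite ler_nat.
have TC : 192 * KB <= c0 * T%:R.
 rewrite -ler_pdivrMl// mulrC; apply: le_trans (ltW (truncnS_gt _)) _; rewrite ler_nat ltnS; exact: leq_addl.
exists (c0 * T%:R ^+ 2 / 2); first by rewrite// mulr_gt0 exprn_gt0//; lra.
exists T; split=> // V N q H w VT q0 hq w0 wV /andP[Hw1 Hw2] N0 /andP[lN1 lN2].
clearbody T; have V20 : 20 <= V by clear - VT Tr8; lra.
have V0 : 0 < V by clear - V20; lra.
have V3 : 20 * V <= V ^+ 3 by rewrite exprS mulrC ler_pM2l//; clear - V20; nra.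
have wb (y : R) : `|y| <= 1 + V ^+ 3 -> w * `|y| <= 1 by move=> h; rewrite -wV ler_pM2l.
have wT : w * (2 * T%:R) <= 2.
 have := wb T%:R; rewrite ger0_norm// => /(_ _) h; suff : w * T%:R <= 1 by clear; lra.
 apply: h; clear - VT V3 V20; lra.
have yb n : (0 < n < N.+1)%N -> `|ln n%:R - V| <= 1 + V ^+ 3.
 move=> /andP[n0 nN]; have l0 := @ln_ge0n R n.
 have l1 : ln n%:R <= ln N%:R :> R by rewrite ler_ln ?posrE ?ltr0n// ler_nat.
 rewrite ler_norml; apply/andP; split; clear - l0 l1 lN2 V3 V20; lra.
set W := w ^+ 2 * H%:R ^+ 4; have W0 : 0 <= W by rewrite mulr_ge0 ?(ltW w0).
pose A n := if coprime n q && (`|ln n%:R - V| <= 4) then Lam R n / n%:R else 0.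
pose B n := if T%:R <= `|ln n%:R - V| then Lam R n / n%:R / (ln n%:R - V) ^+ 2 else 0.
have term n : (0 < n < N.+1)%N -> W * (k * (3 / 512) * T%:R ^+ 2 * A n - KB * B n) <= (if coprime n q then om V J n * psik H w T%:R (ln n%:R - V) else 0).
 move=> hn; have L0 : 0 <= Lam R n / n%:R by [].
 have /andP[o0 o1] := om_bounds J n V0; rewrite /A /B.
 have c8 : 0 <= W * (KB * (Lam R n / n%:R / (ln n%:R - V) ^+ 2)).
  by rewrite// mulr_ge0.
 have [nT|nT] := leP T%:R `|ln n%:R - V|.
  rewrite (_ : (`|ln n%:R - V| <= 4) = false) ?andbF; last by apply/negbTE; rewrite -ltNge; clear - nT Tr8; lra.
  rewrite mulr0 sub0r mulrN; case: ifP => _; last by rewrite oppr_le0.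
  have T0 : 0 < T%:R :> R by clear - Tr8; lra.
  have := psik_neg w0 T0 nT (wb _ (yb n hn)) Hw1; rewrite -/W -KBE => hn'.
  apply: le_trans (ler_wpM2l o0 hn'); rewrite mulrN lerN2.
  rewrite (_ : W * _ = Lam R n / n%:R * (KB * W / (ln n%:R - V) ^+ 2)); last by ring.
  by rewrite ler_wpM2r// divr_ge0.
 rewrite mulr0 subr0; case: ifPn => [/andP[-> h4]|_].
  have p := psik_pos (ltW w0) h4 Tr8 Hw2 wT.
  have om' := om_ge J V20 h4; rewrite -/k in om'.
  have a0 : 0 <= H%:R ^+ 4 / 16 :> R by [].
  have b0 : 0 <= 3 / 32 * (w ^+ 2 * T%:R ^+ 2) by apply: mulr_ge0; [clear; lra|rewrite mulr_ge0 ?sqr_ge0].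
  apply: le_trans (ler_pM (mulr_ge0 (ltW k0) L0) (mulr_ge0 a0 b0) om' p).
  by rewrite /W; apply: eq_ler; move: (Lam R n / n%:R) => L; field.
 rewrite !mulr0; case: ifP => // _.
 have /andP[p0 _] := psik_mid H (ltW w0) (ltW nT) wT.
 exact: mulr_ge0.
rewrite [leRHS]big_mkcond.
apply: (@le_trans _ _ (\sum_(1 <= n < N.+1) W * (k * (3 / 512) * T%:R ^+ 2 * A n - KB * B n))); last first.
 by apply: ler_sum_nat => n hn; exact: term.
rewrite -mulr_sumr sumrB -!mulr_sumr mulrC ler_wpM2l//.
have hB : \sum_(1 <= n < N.+1) B n <= 96 / T%:R.
 by rewrite /B -big_mkcond /=; apply: Lam_tail; apply: leq_trans T8.
have eN : expR (V + 4) <= N%:R.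
 rewrite -[leRHS]lnK ?posrE ?ltr0n// ler_expR; apply: le_trans lN1; clear - V3 V20; lra.
have hA : 1/16 <= \sum_(1 <= n < N.+1) A n.
 have m := Lam_mass V20 eN.
 pose Cn n := if ~~ coprime n q && (`|ln n%:R - V| <= 4) then Lam R n / n%:R else 0.
 have -> : \sum_(1 <= n < N.+1) A n = \sum_(1 <= n < N.+1 | `|ln n%:R - V| <= 4) Lam R n / n%:R - \sum_(1 <= n < N.+1) Cn n.
  rewrite [X in X - _]big_mkcond -sumrB; apply: eq_bigr => n _; rewrite /A /Cn.
  by case: (coprime n q); case: (_ <= 4); rewrite ?subr0 ?subrr.
 suff : \sum_(1 <= n < N.+1) Cn n <= 1/16 by clear - m; lra.
 apply: le_trans hq; set X := Num.truncn (expR (V + 4)).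
 have e1 : 1 <= expR (V + 4) by rewrite -[leLHS]expR0 ler_expR; clear - V20; lra.
 have X0 : (0 < X)%N by rewrite truncn_gt0.
 have XN : (X <= N)%N by rewrite -(ler_nat R); apply: le_trans eN; rewrite truncn_le//.
 have lX : ln X%:R <= V + 4.
  rewrite -[leRHS]expRK ler_ln ?posrE ?expR_gt0// truncn_le//.
 have hs := @Lam_small R (fun n => ~~ coprime n q) X q X0 _.
 have {}hs : \sum_(1 <= n < X.+1 | ~~ coprime n q) Lam R n <= q%:R * ln X%:R.
  apply: hs => p j pp j0 _; rewrite coprime_pexpl// prime_coprime// negbK; exact: dvdn_leq.
 rewrite (big_cat_nat (n := X.+1))//= [X in _ + X]big1_seq ?addr0; last first.
  move=> n /andP[_]; rewrite mem_index_iota => /andP[Xn _]; rewrite /Cn; case: ifP => // /andP[_].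
  rewrite ler_norml => /andP[_ h]; suff : n%:R <= expR (V + 4).
   by rewrite -truncn_ge_nat ?expR_ge0// leqNgt Xn.
  rewrite -[leLHS]lnK ?posrE ?ltr0n ?ler_expR; [clear - h; lra|exact: leq_trans Xn].
 apply: (@le_trans _ _ (\sum_(1 <= n < X.+1 | ~~ coprime n q) Lam R n * expR (4 - V))).
  rewrite [leRHS]big_mkcond big_nat_cond [leRHS]big_nat_cond; apply: ler_sum => n /andP[/andP[n0 _] _]; rewrite /Cn.
  case: (coprime n q) => //=; case: ifP => [|_] => //.
  rewrite ler_norml => /andP[h _]; rewrite ler_wpM2l ?Lam_ge0//.
  by rewrite -[4 - V]opprB expRN lef_pV2 ?posrE// -[leRHS]lnK ?posrE// ler_expR; clear - h; lra.
 rewrite -mulr_suml ler_wpM2r//; apply: le_trans hs _; by rewrite ler_wpM2l.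
have T0 : 0 < T%:R :> R by clear - Tr8; lra.
have iT : 96 / T%:R <= 96 :> R by rewrite ler_pdivrMr//; clear - Tr8; lra.
have kk : c0 * T%:R ^+ 2 <= k * (3 / 512) * T%:R ^+ 2 * \sum_(1 <= n < N.+1) A n.
 have -> : c0 * T%:R ^+ 2 = k * (3 / 512) * T%:R ^+ 2 * (1 / 16) by rewrite /c0; field.
 rewrite ler_wpM2l//.
have bb : KB * \sum_(1 <= n < N.+1) B n <= c0 * T%:R ^+ 2 / 2.
 apply: (@le_trans _ _ (KB * 96)); first by rewrite ler_wpM2l//; apply: le_trans hB iT.
 have : c0 * T%:R <= c0 * T%:R ^+ 2 by rewrite ler_pM2l// ler_peMr; clear - Tr8; lra.
 clear - TC; lra.
clear - kk bb; lra.
Qed.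

Lemma pow_exp_small R (n : nat) (a c : R) : 0 < a -> 0 < c ->
 exists2 V0 : R, 1 <= V0 & forall V, V0 <= V -> V ^+ n * expR (- (a * V)) <= c.
Proof.
move=> a0 c0; have ac : 0 < a ^+ n.+1 * c by [].
have K0 : 0 <= n.+1`!%:R / (a ^+ n.+1 * c) by [].
exists (1 + n.+1`!%:R / (a ^+ n.+1 * c)); first by lra.
move=> V hV; have V0 : 0 < V by lra.
have h := @powR_expR R (a * V) n.+1 (mulr_ge0 (ltW a0) (ltW V0)).
have f : n.+1`!%:R <= V * (a ^+ n.+1 * c) by rewrite -ler_pdivrMr//; lra.
have aV : 0 < a ^+ n.+1 * V by [].
rewrite expRN ler_pdivrMr// -(ler_pM2l aV) mulrAC -mulrA -exprSr -exprMn.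
apply: (le_trans h); apply: (@le_trans _ _ (V * (a ^+ n.+1 * c) * expR (a * V))).
 by rewrite ler_wpM2r.
by lra.
Qed.

(** * Primes in residue classes *)

Definition zunit (q n : nat) : {unit 'Z_q} := insubd (1%g : {unit 'Z_q}) (n%:R : 'Z_q).
Lemma val_zunit q n : (1 < q)%N -> coprime n q -> val (zunit q n) = n%:R.
Proof.
move=> q1 c; have u : (n%:R : 'Z_q) \is a GRing.unit by rewrite unitZpE// coprime_sym.
exact: (insubdK _ u).
Qed.
Lemma zunitM q m n : (1 < q)%N -> coprime m q -> coprime n q -> zunit q (m * n) = (zunit q m * zunit q n)%g.
Proof.
move=> q1 cm cn; apply: val_inj; rewrite FinRing.val_unitM !val_zunit ?natrM//.
by rewrite coprimeMl cm.
Qed.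
Lemma zunit_eq q m n : (1 < q)%N -> coprime m q -> coprime n q -> (zunit q m == zunit q n) = (m == n %[mod q]).
Proof.
move=> q1 cm cn; apply/eqP/eqP => [h|h].
 by rewrite -!(val_Zp_nat q1) -!val_zunit// h.
by apply: val_inj; rewrite !val_zunit//; apply: val_inj; rewrite/= !val_Zp_nat.
Qed.
Lemma zunit_surj q (g : {unit 'Z_q}) : (1 < q)%N -> exists2 n, coprime n q & zunit q n = g.
Proof.
move=> q1; have e : ((val g : 'Z_q) : nat)%:R = val g :> 'Z_q by rewrite natr_Zp.
have c : coprime (val g : 'Z_q) q.
 by rewrite coprime_sym -unitZpE// e; case: g {e}.
by exists (val g : 'Z_q); rewrite//; apply: val_inj; rewrite val_zunit.
Qed.

(** [zunit] sends residues that are not units to the default value 1, so the value 0 at these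
    residues has to be imposed here. *)
Definition xchi R q (k : {ffun {unit 'Z_q} -> 'Z_#|{: {unit 'Z_q}}|}) n : R[i] := if coprime n q then chi R k (zunit q n) else 0.
Lemma xchi_cchar R q k : (1 < q)%N -> k \in Dual {unit 'Z_q} -> cchar q (@xchi R q k).
Proof.
move=> q1 kD; rewrite /xchi; split.
- exact: ltnW.
- rewrite coprime1n (_ : zunit q 1 = 1%g) ?chi1//; apply: val_inj; rewrite val_zunit ?coprime1n//.
- move=> m n; rewrite coprimeMl; case: (boolP (coprime m q)) => cm; rewrite ?mul0r//=.
 by case: (boolP (coprime n q)) => cn; rewrite ?mulr0// zunitM// chiM.
- move=> n; have e : coprime (n + q) q = coprime n q by rewrite -coprime_modl modnDr coprime_modl.
 rewrite e; case: ifP => // c; congr chi; apply: val_inj.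
 by rewrite !val_zunit ?e// natrD pchar_Zp// addr0.
- by split=> n => [->|/negbTE ->]; rewrite ?cn_chi.
Qed.
Lemma xchi_nonpr R q k : (1 < q)%N -> k != 0 -> cnonpr q (@xchi R q k).
Proof.
move=> q1 k0; have [g hg] : exists g, k g != 0.
 apply: contrapT => H; case/negP: k0; apply/eqP/ffunP => g; rewrite ffunE; apply/eqP.
 by apply: contrapT => /negP h; apply: H; exists g.
have [n c ng] := zunit_surj g q1; exists n => //.
by rewrite /xchi c ng chi_eq1.
Qed.
(** Orthogonality: the principal character gives the sum over the [n] coprime to [q], and the
    others, fewer than [totient q], are bounded by [B] each. *)
Lemma char_extract R q u N (w : nat -> R) (B : R) : (1 < q)%N -> coprime u q -> 0 <= B ->
 (forall x, cchar q x -> cnonpr q x -> cn (\sum_(1 <= n < N) x n * (w n)%:C) <= B) ->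
 \sum_(1 <= n < N | coprime n q) w n - (totient q)%:R * B <= (totient q)%:R * \sum_(1 <= n < N | n == u %[mod q]) w n.
Proof.
move=> q1 cu B0 hB; pose D := Dual {unit 'Z_q}.
have ab : abelian [set: {unit 'Z_q}] := units_Zp_abelian q.
have cG : #|{: {unit 'Z_q}}| = totient q by rewrite -cardsT; exact: card_units_Zp (ltnW q1).
pose P (k : {ffun {unit 'Z_q} -> 'Z_#|{: {unit 'Z_q}}|}) : R[i] := \sum_(1 <= n < N) xchi R k n * (w n)%:C.
have E1 : \sum_(k in D) P k * (chi R k (zunit q u))^-1 = ((totient q)%:R * \sum_(1 <= n < N | n == u %[mod q]) w n)%:C.
 rewrite (eq_bigr (fun k => \sum_(1 <= n < N) xchi R k n * (w n)%:C * (chi R k (zunit q u))^-1)); last by move=> k _; rewrite mulr_suml.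
 rewrite exchange_big mulr_sumr big_mkcond [in RHS]big_mkcond (rmorph_sum (real_complex R)) /=.
 apply: eq_bigr => n _; case: (boolP (coprime n q)) => cn.
  rewrite (eq_bigr (fun k => (w n)%:C * (chi R k (zunit q n) * (chi R k (zunit q u))^-1))); last first.
   by move=> k _; rewrite /xchi cn; ring.
  rewrite -mulr_sumr chi_orth// cG zunit_eq//; case: (n == u %[mod q]); last by rewrite muln0 mulr0.
  by rewrite muln1 RcM (rmorph_nat (real_complex R)) mulrC.
 rewrite big1 => [|k _]; last by rewrite /xchi (negbTE cn) !mul0r.
 case: ifP => // /eqP nu; case/negP: cn; by rewrite -coprime_modl nu coprime_modl.
have P0 : P 0 = (\sum_(1 <= n < N | coprime n q) w n)%:C.
 rewrite [in RHS]big_mkcond (rmorph_sum (real_complex R)); apply: eq_bigr => n _; rewrite /xchi.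
 case: ifP => _; last by rewrite mul0r.
 by have /eqP -> : chi R (0 : {ffun {unit 'Z_q} -> 'Z_#|{: {unit 'Z_q}}|}) (zunit q n) == 1; [rewrite chi_eq1 ffunE|rewrite mul1r].
have c0 : chi R (0 : {ffun {unit 'Z_q} -> 'Z_#|{: {unit 'Z_q}}|}) (zunit q u) = 1 by apply/eqP; rewrite chi_eq1 ffunE.
move: E1; rewrite (bigD1 (0 : {ffun {unit 'Z_q} -> 'Z_#|{: {unit 'Z_q}}|})) ?Dual0//= c0 invr1 mulr1 P0 => E1.
have hS : cn (\sum_(k in D | k != 0) P k * (chi R k (zunit q u))^-1) <= (totient q)%:R * B.
 apply: le_trans (cn_sum _ _ _) _.
 apply: (@le_trans _ _ (\sum_(k in D | k != 0) B)).
  apply: ler_sum => k /andP[kD k0]; rewrite cnM cnV cn_chi invr1 mulr1.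
  by apply: hB; [exact: xchi_cchar|exact: xchi_nonpr].
 apply: (@le_trans _ _ (\sum_(k in D) B)).
  by rewrite [leRHS](bigID (fun k => k != 0))/= lerDl.
 by rewrite sumr_const (card_Dual R ab) cG mulr_natl.
have := hS; have -> : \sum_(k in D | k != 0) P k / chi R k (zunit q u) =
  ((totient q)%:R * \sum_(1 <= n < N | n == u %[mod q]) w n - \sum_(1 <= n < N | coprime n q) w n)%:C.
 by rewrite RcB -E1 [X in X - _]addrC addrK.
rewrite cn_real ler_norml => /andP[h _]; clear - h; lra.
Qed.

Lemma psik_le0 R H (w T y : R) : 0 <= w -> 0 <= T <= `|y| -> w * `|y| <= 1 -> psik H w T y <= 0.
Proof.
move=> w0 /andP[T0 Ty] wy; rewrite /psik -[cos (w * y)]cos_abs normrM (ger0_norm w0).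
have h1 : w * T <= w * `|y| by rewrite ler_wpM2l.
have h0 : 0 <= w * T by [].
have := @cos_sub_ge R (w * T) (w * `|y|); rewrite h0 h1 => /(_ isT) h.
have {}h : 0 <= cos (w * T) - cos (w * `|y|).
 apply: le_trans (h _); last by lra.
 by rewrite divr_ge0// subr_ge0 lerXn2r//; apply: le_trans h1.
rewrite mulr_ge0_le0// subr_le0 -subr_ge0//.
Qed.

(** [char_small] bounds the twisted sums for [|t| <= 1], [band_psik] introduces the kernel, and
    [char_extract] isolates the class of [u]. Outside the window [psik] is nonpositive there, so the
    terms of the window must account for the whole lower bound. *)
Lemma T1_sum R (A : R) : 0 < A -> exists2 c : R, 0 < c & exists T : nat, exists V0 : R, 20 + T%:R <= V0 /\ forall V q u,
 V0 <= V -> odd q -> (1 < q)%N -> q%:R <= V `^ A -> coprime u q ->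
 c / (totient q)%:R <= \sum_(1 <= n < (Num.truncn (expR (V + T%:R))).+1 | (n == u %[mod q]) && (V - T%:R <= ln n%:R)) Lam R n / n%:R.
Proof.
(* Up to the common factor [H ^ 4], the error is [q * V / V ^ J] and the main term [w ^ 2], of order
   [V ^ (- 6)]. With [q <= V ^ (tA + 1)], this [J] leaves a factor [V] to spare. *)
move=> A0; pose tA := Num.truncn A; pose J := (tA + 9)%N.
have [K K0 [Va [Va20 hC]]] := @char_small R A J A0.
have [c1 c10 [T [T8 hS]]] := @S0_lower R J.
have e4 : 0 < (32 * expR 4)^-1 :> R by rewrite invr_gt0 mulr_gt0 ?expR_gt0.
have [Vb Vb1 hb] := pow_exp_small (tA + 2) (ltr01 : 0 < 1 :> R) e4.
have Tr8 : 8 <= T%:R :> R by rewrite ler_nat.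
have T0 : 0 < T%:R :> R by clear - Tr8; lra.
exists (c1 / T%:R ^+ 2); first by rewrite divr_gt0 ?exprn_gt0.
have K1 : 0 < 16 * K / c1 by rewrite divr_gt0// mulr_gt0.
exists T, (20 + T%:R + Va + Vb + 16 * K / c1); split; first by clear - Va20 Vb1 K1; lra.
move=> V q u VV oq q1 qV cu.
have V20 : 20 + T%:R <= V by clear - VV Va20 Vb1 K1; lra.
have VVa : Va <= V by clear - VV T0 Vb1 K1; lra.
have VVb : Vb <= V by clear - VV T0 Va20 K1; lra.
have VK : 16 * K <= c1 * V.
 by rewrite [c1 * V]mulrC -ler_pdivrMr//; clear - VV T0 Va20 Vb1; lra.
have V0 : 0 < V by clear - V20 T0; lra.
have V1 : 1 <= V by clear - V20 T0; lra.
have qp : q%:R <= V ^+ tA.+1.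
 apply: (le_trans qV); rewrite -powR_mulrn ?(ltW V0)//; apply: ler_powR => //; exact: ltW (truncnS_gt _).
have q0 : (0 < q)%N := ltnW q1.
have hq : q%:R * (V + 4) * expR (4 - V) <= 1/16.
 have h := hb V VVb; rewrite mul1r in h.
 have s1 : q%:R * (V + 4) <= V ^+ tA.+1 * (2 * V) by apply: ler_pM => //; clear - V20 T0; lra.
 have := ler_wpM2r (expR_ge0 (4 - V)) s1.
 have -> : V ^+ tA.+1 * (2 * V) * expR (4 - V) = 2 * expR 4 * (V ^+ (tA + 2) * expR (- V)).
  by rewrite expRD addn2 [V ^+ tA.+2]exprS; ring.
 have e40 : 0 <= 2 * expR 4 :> R by rewrite mulr_ge0 ?expR_ge0.
 have := ler_wpM2l e40 h.
 have -> : 2 * expR 4 * (32 * expR 4)^-1 = 1 / 16 :> R by field; rewrite gt_eqF ?expR_gt0.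
 by move=> a b; apply: le_trans b a.
have V3 : 8000 <= V ^+ 3.
 have -> : 8000 = 20 ^+ 3 :> R by ring.
 by apply: lerXn2r; rewrite ?nnegrE//; clear - V20 T0; lra.
have V30 : 0 < 1 + V ^+ 3 by clear - V3; lra.
(* As [ln N <= 1 + V ^ 3], this keeps [w * |ln n - V| <= 1] for all [n <= N], the range where the
   sign of [psik] is known. The choice of [H] below makes [H * w] at most 1/8, so the frequencies
   stay below 1. *)
pose w := (1 + V ^+ 3)^-1; have w0 : 0 < w by rewrite invr_gt0.
have wV : w * (1 + V ^+ 3) = 1 by rewrite mulVf ?gt_eqF.
pose H := Num.truncn ((1 + V ^+ 3) / 8).
have H1 : H%:R <= (1 + V ^+ 3) / 8 by rewrite truncn_le divr_ge0// ltW.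
have H2 : (1 + V ^+ 3) / 8 < H%:R + 1 by rewrite natr1; exact: truncnS_gt.
have Hw1 : 1/16 <= H%:R * w by rewrite ler_pdivlMr//; clear - H2 V3; lra.
have Hw2 : H%:R * w <= 1/8 by rewrite ler_pdivrMr//; clear - H1; lra.
have ws : w <= 1/8 by rewrite /w -[leLHS]mul1r ler_pdivrMr//; clear - V3; lra.
clearbody H; have H0 : (0 < H)%N by rewrite -(ltr0n R); clear - H2 V3; lra.
have [N [N0 N1 N2]] := @ln_sqrp R (expR (V ^+ 3)) ltac:(rewrite -[leLHS]expR0 ler_expR; clear - V3; lra).
rewrite expRK in N2.
have N3 : V ^+ 3 <= ln N%:R by rewrite -[leLHS]expRK ler_ln ?posrE ?expR_gt0 ?ltr0n.
have lN : V ^+ 3 <= ln N%:R <= 1 + V ^+ 3 by rewrite N3.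
pose ps n := psik H w T%:R (ln n%:R - V).
have hS0 := hS V N q H w V20 q0 hq w0 wV ltac:(by rewrite Hw1) N0 lN.
pose eps := K * V / V ^+ J.
have hX (x : nat -> R[i]) : cchar q x -> cnonpr q x -> cn (\sum_(1 <= n < N.+1) x n * (om V J n * ps n)%:C) <= H%:R ^+ 4 * 2 * eps.
 move=> cx nx; have := @band_psik R H w T%:R (ltW w0) (fun n => x n * (om V J n)%:C) N.+1 V eps 1.
 move=> /(_ _ 0) hh; have {}hh := hh _ _.
 apply: le_trans (hh _ _); rewrite ?normr0 ?add0r.
 - rewrite le_eqVlt; apply/orP; left; apply/eqP; congr cn; apply: eq_bigr => n _.
  by rewrite mul0r oppr0 cis0 mulr1 RcM mulrA.
 - move=> t t1; have := hC V N q x t VVa N0 lN oq qV cx nx t1; apply: le_trans.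
  rewrite le_eqVlt; apply/orP; left; apply/eqP; congr cn; apply: eq_bigr => n _; rewrite /xi /om; ring.
 - clear - Hw2 ws; lra.
have eps0 : 0 <= eps by rewrite divr_ge0 ?mulr_ge0 ?exprn_ge0 ?(ltW K0) ?(ltW V0).
have HH0 : 0 <= H%:R ^+ 4 * 2 * eps by rewrite mulr_ge0// mulr_ge0 ?exprn_ge0.
have ex := char_extract q1 cu HH0 hX.
have tq0 : 0 < (totient q)%:R :> R by rewrite ltr0n totient_gt0.
have tq : (totient q)%:R <= q%:R :> R.
 by rewrite ler_nat -[leqRHS]card_ord totient_count_coprime -sum1_card big_mkord; apply: leq_sum => i _; case: coprime.
have W0 : 0 < w ^+ 2 * H%:R ^+ 4 by rewrite mulr_gt0 ?exprn_gt0 ?ltr0n.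
have small : (totient q)%:R * (H%:R ^+ 4 * 2 * eps) <= c1 * (w ^+ 2 * H%:R ^+ 4) / 2.
 have w2 : (4 * V ^+ 6)^-1 <= w ^+ 2.
  rewrite /w exprVn lef_pV2 ?posrE ?exprn_gt0 ?mulr_gt0 ?exprn_gt0//.
  have -> : 4 * V ^+ 6 = (2 * V ^+ 3) ^+ 2 by ring.
  have h1 : 1 <= V ^+ 3 by apply: le_trans V3; rewrite ler1n.
  by apply: lerXn2r; rewrite ?nnegrE; clear - h1; lra.
 have s1 : (totient q)%:R * eps <= c1 / 4 * (4 * V ^+ 6)^-1.
  apply: (@le_trans _ _ (V ^+ tA.+1 * eps)); first by rewrite ler_wpM2r//; apply: le_trans qp.
  have Vn : V != 0 by rewrite gt_eqF.
  have -> : V ^+ tA.+1 * eps = K / V ^+ 7.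
   by rewrite /eps /J (_ : tA + 9 = tA.+1 + 8)%N ?exprD; [field; rewrite Vn expf_neq0|rewrite addnS addSn].
  have -> : c1 / 4 * (4 * V ^+ 6)^-1 = c1 * V / 16 / V ^+ 7 by field.
  by rewrite ler_wpM2r ?invr_ge0 ?exprn_ge0 ?(ltW V0)//; clear - VK; lra.
 have s2 : c1 / 4 * (4 * V ^+ 6)^-1 <= c1 / 4 * w ^+ 2 by rewrite ler_pM2l// divr_gt0.
 have h4 : 0 <= H%:R ^+ 4 * 2 :> R by rewrite mulr_ge0 ?exprn_ge0.
 have := ler_wpM2l h4 (le_trans s1 s2); move: (H%:R ^+ 4 : R) => h; clear; move=> hh.
 have -> : (totient q)%:R * (h * 2 * eps) = h * 2 * ((totient q)%:R * eps) by ring.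
 by apply: (le_trans hh); rewrite le_eqVlt; apply/orP; left; apply/eqP; field.
set Sg := \sum_(1 <= n < _ | _ && _) _.
have up : \sum_(1 <= n < N.+1 | n == u %[mod q]) om V J n * ps n <= H%:R ^+ 4 * (w ^+ 2 * T%:R ^+ 2 / 2) * Sg.
 set Bp := H%:R ^+ 4 * _.
 have Bp0 : 0 <= Bp by rewrite mulr_ge0 ?exprn_ge0// divr_ge0// mulr_ge0 ?exprn_ge0// ltW.
 apply: (@le_trans _ _ (\sum_(1 <= n < N.+1 | (n == u %[mod q]) && (`|ln n%:R - V| <= T%:R)) Bp * (Lam R n / n%:R))).
  rewrite big_mkcond [leRHS]big_mkcond; apply: ler_sum_nat => n /andP[n0 nN].
  case: (n == u %[mod q]) => //=; have /andP[o0 o1] := om_bounds J n V0.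
  have [yT|yT] := leP `|ln n%:R - V| T%:R.
   have wT : w * (2 * T%:R) <= 2.
    suff : w * T%:R <= 1 by clear; lra.
    apply: (@le_trans _ _ (w * (1 + V ^+ 3))); last by rewrite wV.
    rewrite ler_pM2l//; have : V <= V ^+ 3 by rewrite -[leLHS]expr1; apply: ler_weXn2l.
    clear - V20; lra.
   have /andP[p0 p1] := psik_mid H (ltW w0) yT wT.
   by rewrite mulrC; apply: ler_pM.
  rewrite mulr_ge0_le0//; apply: psik_le0 (ltW w0) _ _; first by rewrite (ltW T0) ltW.
  apply: (@le_trans _ _ (w * (1 + V ^+ 3))); last by rewrite wV.
  rewrite ler_pM2l// ler_norml.
  have l0 := @ln_ge0n R n; have l1 : ln n%:R <= ln N%:R :> R by rewrite ler_ln ?posrE ?ltr0n// ler_nat.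
  have : V <= V ^+ 3 by rewrite -[leLHS]expr1; apply: ler_weXn2l.
  by move=> h; apply/andP; split; clear - l0 l1 N2 h V1; lra.
 rewrite -mulr_sumr ler_wpM2l// /Sg; set X := Num.truncn _.
 have XN : (X <= N)%N.
  rewrite -(ler_nat R); apply: (@le_trans _ _ (expR (V + T%:R))); first by rewrite truncn_le expR_ge0.
  rewrite -[leRHS]lnK ?posrE ?ltr0n// ler_expR; apply: le_trans N3.
  have : V * 20 <= V ^+ 3 by rewrite exprS ler_pM2l//; clear - V20 T0; nra.
  clear - V20 T0; lra.
 rewrite (big_cat_nat (n := X.+1))//= [X in _ + X]big1_seq ?addr0; last first.
  move=> n /andP[/andP[_ h]]; rewrite mem_index_iota => /andP[Xn _]; exfalso.
  move: h; rewrite ler_norml => /andP[_ h]; suff : n%:R <= expR (V + T%:R).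
   by rewrite -truncn_ge_nat ?expR_ge0// -/X leqNgt Xn.
  by rewrite -[leLHS]lnK ?posrE ?ltr0n ?ler_expR; [clear - h; lra|exact: leq_trans Xn].
 rewrite big_mkcond [leRHS]big_mkcond; apply: ler_sum => n _.
 case: (n == u %[mod q]) => //=; case: ifP => [|_]; last by case: ifP => // _; rewrite divr_ge0 ?Lam_ge0.
 by rewrite ler_norml => /andP[h _]; case: ifP => // /negP[]; clear - h; lra.
have fin : c1 * (w ^+ 2 * H%:R ^+ 4) / 2 <= (totient q)%:R * (H%:R ^+ 4 * (w ^+ 2 * T%:R ^+ 2 / 2) * Sg).
 have := ler_wpM2l (ltW tq0) up; move: ex hS0 small; rewrite /ps.
 move: (\sum_(1 <= n < N.+1 | coprime n q) _) (\sum_(1 <= n < N.+1 | n == u %[mod q]) _) => a b.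
 move: (_ * (_ * 2 * eps)) (_ * (_ * Sg)) (c1 * _) (_ * b) => x y z t; clear; lra.
have W21 : 0 < w ^+ 2 * H%:R ^+ 4 / 2 by clear - W0; lra.
have W20 : 0 < (totient q)%:R * (w ^+ 2 * H%:R ^+ 4 / 2) * T%:R ^+ 2 by rewrite (mulr_gt0 (mulr_gt0 tq0 W21))// exprn_gt0.
rewrite -(ler_pM2l W20); move: fin; move: (H%:R ^+ 4 : R) (w ^+ 2) ((totient q)%:R : R) tq0 T0 => h ww t t0 T0'.
move: (T%:R : R) T0' => T1 T1p fin.
have -> : t * (ww * h / 2) * T1 ^+ 2 * (c1 / T1 ^+ 2 / t) = c1 * (ww * h) / 2 by field; rewrite !gt_eqF.
by apply: (le_trans fin); rewrite le_eqVlt; apply/orP; left; apply/eqP; field.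
Qed.

(** Proper prime powers are removed by [Lam_small] with [Y] the square root of the end of the
    window; each remaining term is at most [2 * V * expR (T - V)], which turns the weighted sum into
    a count. *)
Lemma T1 R (A : R) : 0 < A -> exists2 c : R, 0 < c & exists T : nat, exists V0 : R, 20 + T%:R <= V0 /\ forall V q u,
 V0 <= V -> odd q -> (1 < q)%N -> q%:R <= V `^ A -> coprime u q ->
 c * expR V / (V * (totient q)%:R) <= (count (fun p => [&& prime p, p == u %[mod q] & V - T%:R <= ln p%:R]) (index_iota 1 (Num.truncn (expR (V + T%:R))).+1))%:R.
Proof.
move=> A0; have [c c0 [T [V0 [V0T h]]]] := T1_sum A0; pose tA := Num.truncn A.
have e4 : 0 < c / (4 * expR (3/2 * T%:R)) by [].
have [Vb Vb1 hb] := pow_exp_small (tA + 2) (ltac:(lra) : 0 < 1/2) e4.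
exists (c * expR (- T%:R) / 4) => //.
exists T, (V0 + Vb); split; first by clear - V0T Vb1; lra.
move=> V q u VV oq q1 qV cu.
have VV0 : V0 <= V by clear - VV Vb1; lra.
have T0 : 0 <= T%:R :> R by [].
have VVb : Vb <= V by clear - VV V0T T0; lra.
have V20 : 20 + T%:R <= V by clear - VV0 V0T; lra.
have Vp : 0 < V by clear - V20 T0; lra.
have hs := h V q u VV0 oq q1 qV cu; set X := Num.truncn _ in hs *.
have eX : 1 <= expR (V + T%:R) by rewrite -[leLHS]expR0 ler_expR; clear - Vp T0; lra.
have X0 : (0 < X)%N by rewrite truncn_gt0.
have Xe : X%:R <= expR (V + T%:R) by rewrite truncn_le expR_ge0.
have lX : ln X%:R <= V + T%:R by rewrite -[leRHS]expRK ler_ln ?posrE ?expR_gt0 ?ltr0n.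
have tq0 : 0 < (totient q)%:R :> R by rewrite ltr0n totient_gt0 ltnW.
have tq : (totient q)%:R <= q%:R :> R.
 by rewrite ler_nat -[leqRHS]card_ord totient_count_coprime -sum1_card big_mkord; apply: leq_sum => i _; case: coprime.
pose np n := ~~ prime n && (V - T%:R <= ln n%:R).
have t1 n : (0 < n)%N -> V - T%:R <= ln n%:R -> n%:R^-1 <= expR (T%:R - V) :> R.
 move=> n0 hn; rewrite -[T%:R - V]opprB expRN lef_pV2 ?posrE ?expR_gt0//.
 by rewrite -[leRHS]lnK ?posrE// ler_expR.
have nps : \sum_(1 <= n < X.+1 | np n) Lam R n / n%:R <= c / (2 * (totient q)%:R).
 apply: (@le_trans _ _ (\sum_(1 <= n < X.+1 | np n) Lam R n * expR (T%:R - V))).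
  rewrite big_mkcond [leRHS]big_mkcond; apply: ler_sum_nat => n /andP[n0 _].
  rewrite /np; case: ifP => // /andP[_ hn]; by rewrite ler_wpM2l// t1.
 rewrite -mulr_suml; set Y := Num.truncn (expR ((V + T%:R) / 2)).
 have hY : \sum_(1 <= n < X.+1 | np n) Lam R n <= Y%:R * ln X%:R.
  apply: Lam_small => // p k pp k0 pX /andP[npr _].
  have k2 : (1 < k)%N by case: k k0 pX npr => [|[|k]] //; rewrite pp.
  rewrite truncn_ge_nat// -(@ler_pXn2r _ 2) ?nnegrE//.
  have -> : expR ((V + T%:R) / 2) ^+ 2 = expR (V + T%:R) by rewrite -expRM_natl; congr expR; field.
  apply: le_trans Xe; rewrite -natrX ler_nat; apply: leq_trans pX; by rewrite leq_pexp2l// prime_gt0.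
 have hY2 : Y%:R * ln X%:R <= expR ((V + T%:R) / 2) * (2 * V).
  apply: ler_pM => //; [by rewrite truncn_le|clear - lX V20; lra].
 have := ler_wpM2r (expR_ge0 (T%:R - V)) (le_trans hY hY2); move=> g; apply: (le_trans g).
 rewrite ler_pdivlMr; last by [].
 have -> : expR ((V + T%:R) / 2) * (2 * V) * expR (T%:R - V) = 2 * expR (3/2 * T%:R) * (V * expR (- (1/2 * V))).
  rewrite (_ : 2 * expR (3 / 2 * T%:R) * (V * expR (- (1 / 2 * V))) = 2 * V * (expR (3 / 2 * T%:R) * expR (- (1 / 2 * V)))); last by ring.
  rewrite mulrAC -expRD mulrC -expRD (_ : (V + T%:R) / 2 + (T%:R - V) = 3/2 * T%:R + - (1/2 * V)) //.
  by field.
 have qp : q%:R <= V ^+ tA.+1.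
  apply: (le_trans qV); rewrite -powR_mulrn//; apply: ler_powR; [clear - V20 T0; lra|exact: ltW (truncnS_gt _)].
 have hh := hb V VVb.
 have h2 : V * expR (- (1/2 * V)) * (totient q)%:R <= c / (4 * expR (3/2 * T%:R)).
  apply: le_trans hh; rewrite addn2 mulrAC ler_wpM2r// ler_pM2l//.
  exact: le_trans tq qp.
 rewrite ler_pdivlMr// in h2; move: h2.
 move: (expR (3/2 * _)) (expR _) => a b; clear; move=> z; apply: le_trans z; apply: eq_ler; ring.
pose gp p := [&& prime p, p == u %[mod q] & V - T%:R <= ln p%:R].
have main : c / (2 * (totient q)%:R) <= \sum_(1 <= n < X.+1 | gp n) Lam R n / n%:R.
 have : c / (totient q)%:R <= \sum_(1 <= n < X.+1 | gp n) Lam R n / n%:R + \sum_(1 <= n < X.+1 | np n) Lam R n / n%:R.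
  apply: (le_trans hs); rewrite big_mkcond [X in _ <= X + _]big_mkcond [X in _ <= _ + X]big_mkcond -big_split /=.
  apply: ler_sum => n _; rewrite /gp /np; have L0 : 0 <= Lam R n / n%:R by [].
  by case: (prime n); case: (n == u %[mod q]); case: (_ <= ln _); rewrite ?addr0 ?add0r.
 have -> : c / (totient q)%:R = c / (2 * (totient q)%:R) + c / (2 * (totient q)%:R) by field.
 move: nps; clear; lra.
have up : \sum_(1 <= n < X.+1 | gp n) Lam R n / n%:R <= (2 * V * expR (T%:R - V)) * (count gp (index_iota 1 X.+1))%:R.
 apply: (@le_trans _ _ (\sum_(1 <= n < X.+1 | gp n) 2 * V * expR (T%:R - V))); last first.
  by rewrite big_const_seq iter_addr_0 mulr_natr.
 rewrite big_mkcond [leRHS]big_mkcond; apply: ler_sum_nat => n /andP[n0 nX]; case: ifP => // /and3P[pn _ hn].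
 rewrite Lam_prime//; apply: ler_pM; rewrite//; last exact: t1.
 have : ln n%:R <= ln X%:R :> R by rewrite ler_ln ?posrE// ler_nat.
 clear - lX V20; lra.
have := le_trans main up; move: (count _ _) => cc z.
have -> : c * expR (- T%:R) / 4 * expR V / (V * (totient q)%:R) = c / (2 * (totient q)%:R) * (2 * V * expR (T%:R - V))^-1.
 rewrite expRD !expRN; have := expR_gt0 V; have := expR_gt0 (T%:R : R).
 move: (expR V) (expR T%:R) => a b b0 a0; field.
 by [].
by rewrite ler_pdivrMr// [leRHS]mulrC.
Qed.

(** * Stepanov's method *)

Lemma lin_dep (F : fieldType) (I J : finType) (A : I -> J -> F) : (#|J| < #|I|)%N ->
 exists c : I -> F, (exists i, c i != 0) /\ forall j, \sum_i c i * A i j = 0.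
Proof.
move=> JI; pose Mx : 'M[F]_(#|I|, #|J|) := \matrix_(i, j) A (enum_val i) (enum_val j).
have nf : ~~ row_free Mx by rewrite neq_ltn (leq_ltn_trans (rank_leq_col _)).
have k0 : kermx Mx != 0 by rewrite kermx_eq0.
pose v := nz_row (kermx Mx); have v0 : v != 0 by rewrite nz_row_eq0.
have vM : v *m Mx = 0 by apply/sub_kermxP; exact: nz_row_sub.
exists (fun i => v 0 (enum_rank i)); split.
 have /rV0Pn [j hj] := v0; by exists (enum_val j); rewrite enum_valK.
move=> j; have /matrixP/(_ 0 (enum_rank j)) := vM; rewrite !mxE => h; apply: etrans h.
rewrite [RHS](reindex (@enum_rank I)); last exact: onW_bij (@enum_rank_bij I).
by apply: eq_bigr => i _; rewrite mxE !enum_rankK.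
Qed.

(** Tuples are plain lists, so that the zeros can be counted one coordinate at a time. *)
Fixpoint tups (T : Type) (S : seq T) (t : nat) : seq (seq T) :=
 if t is t'.+1 then [seq x :: xs | x <- S, xs <- tups S t'] else [:: [::]].
Lemma size_tups (T : Type) (S : seq T) t : size (tups S t) = (size S ^ t)%N.
Proof. by elim: t => // t IH; rewrite size_allpairs IH expnS. Qed.
Lemma count_sum (T : Type) (P : pred T) s : count P s = (\sum_(x <- s) P x)%N.
Proof. by rewrite -sum1_count big_mkcond; apply: eq_bigr => x _; case: (P x). Qed.
Lemma count_tupsS (T : Type) (S : seq T) t (P : pred (seq T)) :
 count P (tups S t.+1) = (\sum_(xs <- tups S t) count (fun x => P (x :: xs)) S)%N.
Proof.
rewrite count_sum big_allpairs_dep exchange_big; apply: eq_bigr => xs _; by rewrite count_sum.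
Qed.
Definition tphi E (I : finType) (g : I -> {poly E}) (r : I -> E) (xs : seq E) : E :=
 \sum_a r a * \prod_(x <- xs) (g a).[x].

(** With all coordinates but one frozen, the form is a polynomial [Y] in the remaining one. Either
    [Y] is nonzero and has at most [D] roots, or dividing it by the smallest power of [G i] and
    evaluating at the root [th i] keeps only the exponents with [a i] minimal: a relation [r'] of
    the same kind with one free index less. *)
Lemma zero_count E (M N D : nat) (G : 'I_M -> {poly E}) (th : 'I_M -> E) (S : seq E) :
 (forall i, (G i).[th i] = 0) -> (forall i i', i' != i -> (G i').[th i] != 0) -> (forall i, G i != 0) ->
 uniq S -> (forall a : {ffun 'I_M -> 'I_N}, (size (\prod_i G i ^+ a i)%R <= D.+1)%N) ->
 forall (js : seq 'I_M) (r : {ffun 'I_M -> 'I_N} -> E), (exists a, r a != 0) ->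
 (forall a a', r a != 0 -> r a' != 0 -> forall i, i \notin js -> a i = a' i) ->
 (count (fun xs => tphi (fun a : {ffun 'I_M -> 'I_N} => (\prod_i G i ^+ a i)%R) r xs == 0%R) (tups S (size js)) * size S
  <= size js * D * size S ^ size js)%N.
Proof.
move=> thr thn G0 uS hD; set g := fun a : {ffun 'I_M -> 'I_N} => _.
elim=> [|i js IH] r [a0 ra0] hr.
 rewrite/= /tphi (bigD1 a0)//= big_nil mulr1 big1 ?addr0 ?(negbTE ra0)// => a aa0.
 rewrite big_nil mulr1; apply/eqP; apply: contraNT aa0 => ra; apply/eqP/ffunP => i; exact: hr.
pose am := [arg min_(a < a0 | r a != 0) (a i : nat)].
have [ram minm] : r am != 0 /\ forall a, r a != 0 -> (am i <= a i)%N.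
 by rewrite /am; case: arg_minnP.
pose r' a := if (r a != 0) && (a i == am i) then r a * \prod_(i' | i' != i) (G i').[th i] ^+ a i' else 0.
have c0 (a : {ffun 'I_M -> 'I_N}) : \prod_(i' | i' != i) (G i').[th i] ^+ a i' != 0.
 by apply/prodf_neq0 => i' hi; rewrite expf_neq0// thn.
have r'am : r' am != 0 by rewrite /r' ram eqxx mulf_neq0.
have hr' a a' : r' a != 0 -> r' a' != 0 -> forall j, j \notin js -> a j = a' j.
 rewrite /r'; case: ifP => [/andP[ra /eqP ai]|]; last by rewrite eqxx.
 case: ifP => [/andP[ra' /eqP ai'] _ _ j js'|]; last by rewrite eqxx.
 have [->|ji] := eqVneq j i; first by rewrite ai'.
 by apply: hr => //; rewrite negb_or ji.
have {IH} := IH r' (ex_intro _ am r'am) hr'.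
set t := size js; set n := size S; rewrite (_ : size (i :: js) = t.+1)// count_tupsS.
set cnt' := count _ _ => IH.
have bound xs : (count (fun x => tphi g r (x :: xs) == 0%R) S <= D + n * (tphi g r' xs == 0%R))%N.
 pose Y := \sum_a (r a * \prod_(x <- xs) (g a).[x]) *: g a.
 have eY x : tphi g r (x :: xs) = Y.[x].
  rewrite horner_sum; apply: eq_bigr => a _; rewrite hornerZ big_cons; ring.
 rewrite (eq_count (a2 := root Y)); last by move=> x; rewrite eY.
 have [Y0|Y0] := eqVneq Y 0; last first.
  apply: leq_trans (leq_addr _ _); rewrite -size_filter -ltnS.
  apply: leq_trans (max_poly_roots Y0 _ _) _; first exact: filter_all.
   exact: filter_uniq.
  apply: leq_trans (size_sum _ _ _) _; apply/bigmax_leqP => a _.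
  by apply: leq_trans (size_scale_leq _ _) _; exact: hD.
 suff -> : tphi g r' xs == 0 by rewrite muln1 (leq_trans (count_size _ _))// leq_addl.
 pose Y1 := \sum_a (r a * \prod_(x <- xs) (g a).[x]) *: (G i ^+ (a i - am i) * \prod_(i' | i' != i) G i' ^+ a i').
 have e1 : Y = G i ^+ am i * Y1.
  rewrite mulr_sumr; apply: eq_bigr => a _; have [->|ra] := eqVneq (r a) 0.
   by rewrite mul0r !scale0r mulr0.
  rewrite -scalerAr mulrA -exprD subnKC ?minm//; congr (_ *: _).
  by rewrite /g (bigD1 i).
 have {}e1 : Y1 = 0.
  by move/eqP: e1; rewrite Y0 eq_sym mulf_eq0 expf_eq0 (negbTE (G0 i)) andbF => /eqP.
 have := congr1 (horner^~ (th i)) e1; rewrite horner0 horner_sum => e2.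
 apply/eqP; rewrite -[RHS]e2; apply: eq_bigr => a _.
 rewrite hornerZ hornerM horner_exp thr horner_prod.
 have -> : \prod_(i' | i' != i) (G i' ^+ a i').[th i] = \prod_(i' | i' != i) (G i').[th i] ^+ a i'.
  by apply: eq_bigr => i' _; rewrite horner_exp.
 rewrite /r'; have [->|ra] := eqVneq (r a) 0; first by rewrite !mul0r.
 rewrite/=; have [ai|ai] := eqVneq (a i) (am i); first by rewrite ai subnn; ring.
 by rewrite expr0n subn_eq0 leqNgt ltn_neqAle minm// eq_sym ai !mul0r mulr0.
apply: (@leq_trans ((\sum_(xs <- tups S t) (D + n * (tphi g r' xs == 0%R))) * n)%N).
 by rewrite leq_mul2r leq_sum ?orbT.
rewrite big_split big_const_seq count_predT iter_addn addn0 size_tups -big_distrr /= -count_sum -/n -/cnt' expnS; nia.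
Qed.

(** While [m] stays within the characteristic, the factorials that relate ordinary derivatives to
    divided ones are invertible. *)
Lemma deriv_root_dvd (F : fieldType) (q : {poly F}) (u : F) m :
 (forall n, (n < m)%N -> q^`(n).[u] = 0) -> (forall n, (0 < n < m)%N -> n%:R != 0 :> F) -> ('X - u%:P) ^+ m %| q.
Proof.
move=> h hc.
have f0 n : (n < m)%N -> (n`!)%:R != 0 :> F.
 elim: n => [|n IH] nm; first by rewrite oner_eq0.
 by rewrite natrM mulf_neq0 ?(IH (ltnW nm))//; exact: hc.
have h' n : (n < m)%N -> q^`N(n).[u] = 0.
 move=> nm; have := h n nm; rewrite nderivn_def hornerMn -mulr_natr => /eqP.
 by rewrite mulf_eq0 (negbTE (f0 n nm)) orbF => /eqP.
have -> : q = \sum_(i < size q) (q^`N(i).[u])%:P * ('X - u%:P) ^+ i.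
 have := @nderiv_taylor _ (map_poly polyC q) u%:P ('X - u%:P) (mulrC _ _).
 rewrite addrC subrK size_map_polyC => e; rewrite -[LHS]comp_polyXr /comp_poly e.
 by apply: eq_bigr => i _; rewrite nderivn_map horner_map.
elim/big_ind: _ => [|p1 p2 d1 d2|i _]; rewrite ?dvdp_add//.
case: (ltnP i m) => im; first by rewrite h' ?mul0r.
by rewrite dvdp_mull// dvdp_exp2l.
Qed.
Lemma prod_XsubC_dvd (F : fieldType) (q : {poly F}) (s : seq F) m : uniq s ->
 (forall u, u \in s -> ('X - u%:P) ^+ m %| q) -> \prod_(u <- s) ('X - u%:P) ^+ m %| q.
Proof.
elim: s => [|u s IH]; first by rewrite big_nil dvd1p.
move=> /andP[us uq] h; rewrite big_cons Gauss_dvdp ?h ?mem_head ?IH//=.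
 by move=> v vs; apply: h; rewrite inE vs orbT.
elim: s us {IH uq h} => [|v s IH]; first by rewrite big_nil coprimep1.
rewrite negb_or => /andP[uv us]; rewrite big_cons coprimepMr IH//.
by rewrite coprimep_expl ?coprimep_expr ?coprimep_XsubC ?root_XsubC// eq_sym.
Qed.
Lemma size_mulS (F : fieldType) (a b : {poly F}) x y : (size a <= x.+1)%N -> (size b <= y)%N ->
 (size (a * b)%R <= x + y)%N.
Proof. by move=> h1 h2; apply: leq_trans (size_polyMleq _ _) _; lia. Qed.
Lemma mupX (F : fieldType) (x : F) (q : {poly F}) d : q != 0 -> mup x (q ^+ d) = (d * mup x q)%N.
Proof.
move=> q0; elim: d => [|d IH]; first by rewrite mupNroot ?root1.
by rewrite exprS mupM ?expf_neq0// IH.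
Qed.

(* the n-th derivative of g^k * Q is g^(k-n) * (stepQ g k n Q) *)
Fixpoint stepQ (F : fieldType) (g : {poly F}) (k n : nat) (Q : {poly F}) : {poly F} :=
 if n is n'.+1 then (k - n')%:R *: (g^`() * stepQ g k n' Q) + g * (stepQ g k n' Q)^`() else Q.
Lemma stepQ_linear (F : fieldType) (g : {poly F}) k n (I : finType) (c : I -> F) (Q : I -> {poly F}) :
 stepQ g k n (\sum_i c i *: Q i) = \sum_i c i *: stepQ g k n (Q i).
Proof.
elim: n => [//|n IH] /=; rewrite IH linear_sum !mulr_sumr scaler_sumr -big_split; apply: eq_bigr => i _.
by rewrite linearZ -!scalerAr scalerDr !scalerA mulrC.
Qed.
Lemma size_stepQ (F : fieldType) (g : {poly F}) k n (Q : {poly F}) A D : (size g <= D)%N -> (size Q <= A)%N ->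
 (size (stepQ g k n Q) <= A + n * D)%N.
Proof.
move=> gD QA; elim: n => [|n IH]; first by rewrite addn0.
have m2 (a b : {poly F}) x y : (size a <= x -> size b <= y -> size (a * b)%R <= x + y)%N.
 by move=> h1 h2; apply: leq_trans (size_polyMleq _ _) _; lia.
have ds (p : {poly F}) : (size (p^`())%R <= size p)%N by apply: leq_trans (size_poly _ _) (leq_pred _).
apply: leq_trans (size_polyD _ _) _; rewrite geq_max; apply/andP; split.
 apply: leq_trans (size_scale_leq _ _) _.
 rewrite addnCA; apply: m2 => //; exact: leq_trans (ds _) _.
rewrite addnCA; apply: m2 => //; exact: leq_trans (ds _) _.
Qed.
Lemma derivn_stepQ (F : fieldType) (g : {poly F}) k n (Q Y : {poly F}) : Y^`() = 0 -> (n <= k)%N ->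
 (g ^+ k * Q * Y)^`(n) = g ^+ (k - n) * stepQ g k n Q * Y.
Proof.
move=> Y0; elim: n => [|n IH] nk; first by rewrite subn0.
rewrite derivnS IH; last exact: ltnW.
rewrite !derivM Y0 mulr0 addr0 deriv_exp/=; have -> : (k - n = (k - n.+1).+1)%N by lia.
rewrite exprS -mul_polyC; congr (_ * _); ring.
Qed.
Lemma derivn_mulY (F : fieldType) n (P Y : {poly F}) : Y^`() = 0 -> (P * Y)^`(n) = P^`(n) * Y.
Proof. by move=> Y0; elim: n => [//|n IH]; rewrite !derivnS IH derivM Y0 mulr0 addr0. Qed.

(* base-p digits: coefficients of size <= p are recovered from T(X^p) *)
Lemma digits_inj (F : fieldType) (p : nat) (T : {poly {poly F}}) : (0 < p)%N ->
 (forall i, (size (T`_i)%R <= p)%N) -> T.['X^p] = 0 -> T = 0.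
Proof.
move=> p0; elim/poly_ind: T => [//|T c IH] hs.
rewrite hornerMXaddC => e.
have hc : (size c <= p)%N by have := hs 0%N; rewrite coefD coefMX coefC add0r.
have cz : c = 0.
 apply/polyP => i; rewrite coef0; case: (ltnP i p) => ip; last by rewrite nth_default// (leq_trans hc).
 by have := congr1 (fun q : {poly F} => q`_i) e; rewrite coefD coefMXn ip add0r coef0.
rewrite cz addr0 in e hs *.
have Tz : T.['X^p] = 0 by move/eqP: e; rewrite mulf_eq0 expf_eq0 polyX_eq0 andbF orbF => /eqP.
rewrite (IH _ Tz) ?mul0r ?addr0// => i; have := hs i.+1; by rewrite addr0 coefMX.
Qed.

Lemma innerM (F : fieldType) (A B : {poly {poly F}}) a b : (forall i, (size (A`_i)%R <= a.+1)%N) ->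
 (forall i, (size (B`_i)%R <= b.+1)%N) -> forall i, (size ((A * B)`_i)%R <= (a + b).+1)%N.
Proof.
move=> hA hB i; rewrite coefM; apply: leq_trans (size_sum _ _ _) _; apply/bigmax_leqP => j _.
apply: leq_trans (size_polyMleq _ _) _; have := hA j; have := hB (i - j)%N; lia.
Qed.
Lemma innerX (F : fieldType) (A : {poly {poly F}}) a d : (forall i, (size (A`_i)%R <= a.+1)%N) ->
 forall i, (size ((A ^+ d)`_i)%R <= (d * a).+1)%N.
Proof.
move=> hA; elim: d => [|d IH] i; last by rewrite exprS; exact: innerM.
by rewrite coef1; case: eqP => _; rewrite ?size_poly1 ?size_poly0.
Qed.
Lemma Frobenius_Fp (p : nat) (g : {poly 'F_p}) : prime p -> g ^+ p = g \Po 'X^p.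
Proof.
move=> pp; have cp : p \in [pchar {poly 'F_p}] by rewrite pchar_poly pchar_Fp.
rewrite -(pFrobenius_autE cp) -{1}[g]coefK poly_def rmorph_sum/= comp_polyE; apply: eq_bigr => i _.
rewrite pFrobenius_autE exprZn -exprM mulnC exprM; congr (_ *: _).
by have := expf_card (g`_i); rewrite card_Fp.
Qed.

Lemma coef_sumXn (R : nzRingType) (J : nat) (a : 'I_J -> R) (j : 'I_J) : (\sum_(i < J) a i *: 'X^i)`_j = a j.
Proof.
rewrite coef_sum (bigD1 j)//= coefZ coefXn eqxx mulr1 big1 ?addr0// => i ij.
by rewrite coefZ coefXn eq_sym (_ : (_ == _ :> nat) = false) ?mulr0//; apply/negbTE.
Qed.
Lemma coef_sumXn_big (R : nzRingType) (J : nat) (a : 'I_J -> R) (j : nat) :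
 (\sum_(i < J) a i *: 'X^i)`_j = if insub j is Some i then a i else 0.
Proof.
case: insubP => [i _ <-|]; first exact: coef_sumXn.
rewrite -leqNgt => Jj; rewrite coef_sum big1// => i _; rewrite coefZ coefXn (_ : (j == i) = false) ?mulr0//.
by apply/negbTE; rewrite neq_ltn (leq_trans (ltn_ord i)) ?orbT.
Qed.
Lemma size_sumXn (R : nzRingType) (J : nat) (a : 'I_J -> R) : (size (\sum_(i < J) a i *: 'X^i)%R <= J)%N.
Proof.
apply: leq_trans (size_sum _ _ _) _; apply/bigmax_leqP => i _.
by apply: leq_trans (size_scale_leq _ _) _; rewrite size_polyXn.
Qed.
(** The auxiliary polynomial [Phi], the sum over [j] of [(Pj j + g ^ k * Qj j) * X ^ (p * j)], has
    [2 * J * A] coefficients. On [Z] one has [g ^ k = z] and [u ^ p = u], so vanishing to order [m]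
    is implied by [m * (A + J + m * D)] linear conditions, fewer than the unknowns; the degree of
    [Phi] then bounds [m * #|Z|]. That [Phi] is not 0 rests on the multiplicity of [g] at [th] being
    no multiple of [d]. *)
Lemma stepanov (p : nat) E (iota : {rmorphism 'F_p -> E}) (g : {poly 'F_p}) (d A J m D : nat)
  (z : 'F_p) (Z : {set 'F_p}) (th : E) :
 prime p -> (1 < d)%N -> (d %| p.-1)%N -> (size g <= D)%N -> g != 0 ->
 ~~ (d %| mup th (map_poly iota g))%N ->
 (forall u, u \in Z -> g.[u] != 0 /\ g.[u] ^+ (p.-1 %/ d) = z) ->
 (0 < A)%N -> (m <= p.-1 %/ d)%N -> (d * A + D <= p)%N -> (J + D < p)%N ->
 (m * (A + J + m * D) < 2 * (J * A))%N -> (m * #|Z| <= p * (J + D))%N.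
Proof.
move=> pp d1 dp gD g0 dmu hZ A0 mk dAD JDp mlt; set k := (p.-1 %/ d)%N in hZ mk.
have p1 := prime_gt1 pp.
have kd : (k * d = p.-1)%N by rewrite divnK.
have D0 : (0 < D)%N by apply: leq_trans gD; rewrite size_poly_gt0.
(* At a point of [Z], [g ^ n] times the derivative of order [n] of [Phi] is the value of a
   combination of [CP] and [CQ]. These have low degree because [X ^ (p * j)] and [g ^ k] are
   replaced by [X ^ j] and [z]. *)
pose CP (j : 'I_J) (i : 'I_A) n : {poly 'F_p} := g ^+ n * ('X^i)^`(n) * 'X^j.
pose CQ (j : 'I_J) (i : 'I_A) n : {poly 'F_p} := (z *: stepQ g k n 'X^i) * 'X^j.
have sXi (i : 'I_A) : (size ('X^i : {poly 'F_p})%R <= A)%N by rewrite size_polyXn.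
have sdn n (q : {poly 'F_p}) : (size (q^`(n))%R <= size q)%N.
 elim: n => [//|n IH]; rewrite derivnS; apply: leq_trans IH; exact: leq_trans (size_poly _ _) (leq_pred _).
have sQ j i n : (n <= m)%N -> (size (CQ j i n) <= A + J + m * D)%N.
 move=> nm; have nD : (n * D <= m * D)%N by rewrite leq_mul2r nm orbT.
 have h := leq_trans (size_scale_leq z _) (size_stepQ k n gD (sXi i)).
 rewrite /CQ mulrC; apply: leq_trans (size_mulS (x := j) _ h) _; first by rewrite size_polyXn.
 by rewrite addnC addnAC leq_add// leq_add// ltnW.
have sP j i n : (n <= m)%N -> (size (CP j i n) <= A + J + m * D)%N.
 move=> nm; have nD : (n * D <= m * D)%N by rewrite leq_mul2r nm orbT.
 have h1 : (size (g ^+ n)%R <= (n * D).+1)%N.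
  by apply: leq_trans (size_poly_exp_leq _ _) _; rewrite ltnS mulnC leq_mul2l (leq_trans (leq_pred _) gD) orbT.
 have h2 := leq_trans (sdn n _) (sXi i).
 rewrite /CP mulrC; apply: leq_trans (size_mulS (x := j) _ (size_mulS h1 h2)) _; first by rewrite size_polyXn.
 by rewrite addnC [(_ + A)%N]addnC addnAC leq_add// leq_add// ltnW.
pose I := ('I_J * 'I_A + 'I_J * 'I_A)%type; pose Jx := ('I_m * 'I_(A + J + m * D))%type.
pose Bs (x : I) (n : nat) : {poly 'F_p} := match x with inl y => CP y.1 y.2 n | inr y => CQ y.1 y.2 n end.
have [c [[x0 cx0] hc]] : exists c : I -> 'F_p, (exists x, c x != 0) /\ forall y : Jx, \sum_x c x * (Bs x y.1)`_y.2 = 0.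
 by apply: lin_dep; rewrite card_sum !card_prod !card_ord; lia.
pose cP j i := c (inl (j, i)); pose cQ j i := c (inr (j, i)).
have hC n : (n < m)%N -> \sum_(j < J) \sum_(i < A) (cP j i *: CP j i n + cQ j i *: CQ j i n) = 0.
 move=> nm; transitivity (\sum_x c x *: Bs x n).
  rewrite big_sumType /= pair_bigA big_split /=; congr (_ + _); by apply: eq_bigr => -[j i] _.
 apply/polyP => i; rewrite coef0; case: (ltnP i (A + J + m * D)) => hi.
  have := hc (Ordinal nm, Ordinal hi); rewrite /= => h; rewrite coef_sum -[RHS]h; apply: eq_bigr => x _; by rewrite coefZ.
 rewrite nth_default//; apply: leq_trans hi; apply: leq_trans (size_sum _ _ _) _; apply/bigmax_leqP => x _.
 apply: leq_trans (size_scale_leq _ _) _; case: x => y; [apply: sP|apply: sQ]; exact: ltnW.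
pose Pj j := \sum_(i < A) cP j i *: 'X^i; pose Qj j := \sum_(i < A) cQ j i *: 'X^i.
pose Phi := \sum_(j < J) (Pj j * 'X^(p * j) + g ^+ k * Qj j * 'X^(p * j)).
have dX j : ('X^(p * j) : {poly 'F_p})^`() = 0.
 rewrite derivXn mulrnA; have cp : p \in [pchar {poly 'F_p}] by rewrite pchar_poly pchar_Fp.
 by rewrite (mulrn_pchar cp) mul0rn.
have up (u : 'F_p) : u ^+ p = u by have := expf_card u; rewrite card_Fp.
have root_n u n : u \in Z -> (n < m)%N -> Phi^`(n).[u] = 0.
 move=> uZ nm; have [gu gk] := hZ u uZ.
 have gn0 : g.[u] ^+ n != 0 by rewrite expf_neq0.
 apply: (mulfI gn0); rewrite mulr0 -[RHS](horner0 u) -(hC n nm) horner_sum.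
 have -> : Phi^`(n) = \sum_(j < J) ((Pj j)^`(n) * 'X^(p * j) + g ^+ (k - n) * stepQ g k n (Qj j) * 'X^(p * j)).
  rewrite /Phi linear_sum; apply: eq_bigr => j _; rewrite linearD /= derivn_mulY//.
  by rewrite derivn_stepQ//; lia.
 rewrite horner_sum mulr_sumr; apply: eq_bigr => j _.
 rewrite hornerD !hornerM !hornerXn exprM up horner_exp horner_sum (eq_bigr (fun i : 'I_A => cP j i * (g.[u] ^+ n * ('X^i)^`(n).[u] * u ^+ j) + cQ j i * (z * (stepQ g k n 'X^i).[u] * u ^+ j))); last first.
  by move=> i _; rewrite /CP /CQ hornerD !hornerZ !hornerM !hornerZ horner_exp hornerXn.
 rewrite big_split /= mulrDr; congr (_ + _).
  rewrite /Pj linear_sum horner_sum mulr_suml mulr_sumr; apply: eq_bigr => i _.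
  by rewrite linearZ /= hornerZ; ring.
 rewrite /Qj stepQ_linear horner_sum !mulrA -exprD subnKC; last by lia.
 rewrite gk mulr_sumr mulr_suml; apply: eq_bigr => i _.
 by rewrite hornerZ; ring.
have dvd : \prod_(u <- enum Z) ('X - u%:P) ^+ m %| Phi.
 apply: prod_XsubC_dvd; first exact: enum_uniq.
 move=> u; rewrite mem_enum => uZ; apply: deriv_root_dvd => [n|n /andP[n0 nm]]; first exact: root_n.
 rewrite -(dvdn_pcharf (pchar_Fp pp)); apply/negP => /(dvdn_leq n0).
 have := leq_div p.-1 d; rewrite -/k; lia.
have Phi0 : Phi != 0.
 (* If [Phi = 0], a power [d] and a factor [g] give [g * PP ^ d = g ^ p * (- QQ) ^ d] at [X ^ p].
    Since [g ^ p] is [g] at [X ^ p] and the inner degrees are below [p], this lifts by [digits_inj]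
    to an identity in two variables. Specializing the second one at a point of ['F_p] and comparing
    multiplicities at [th] modulo [d] is contradictory. *)
 apply/eqP => PhiE.
 pose PP : {poly {poly 'F_p}} := \sum_(j < J) Pj j *: 'X^j; pose QQ : {poly {poly 'F_p}} := \sum_(j < J) Qj j *: 'X^j.
 have PPe : PP.['X^p] = \sum_(j < J) Pj j * 'X^(p * j).
  by rewrite horner_sum; apply: eq_bigr => j _; rewrite hornerZ hornerXn -exprM.
 have QQe : QQ.['X^p] = \sum_(j < J) Qj j * 'X^(p * j).
  by rewrite horner_sum; apply: eq_bigr => j _; rewrite hornerZ hornerXn -exprM.
 have e1 : PP.['X^p] = g ^+ k * - QQ.['X^p].
  apply/eqP; rewrite mulrN -addr_eq0 PPe QQe mulr_sumr -big_split; apply/eqP; rewrite -[RHS]PhiE.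
  by apply: eq_bigr => j _; rewrite mulrA.
 pose gY := map_poly polyC g.
 have gYe : gY.['X^p] = g ^+ p by exact: esym (Frobenius_Fp g pp).
 pose T := g%:P * PP ^+ d - gY * (- QQ) ^+ d.
 have sPj j : (size (Pj j) <= A)%N by apply: size_sumXn.
 have sQj j : (size (Qj j) <= A)%N by apply: size_sumXn.
 have iP i : (size (PP`_i)%R <= A.-1.+1)%N.
  rewrite prednK// coef_sumXn_big; case: insubP => [j _ _|_]; [exact: sPj|by rewrite size_poly0].
 have iQ i : (size ((- QQ)`_i)%R <= A.-1.+1)%N.
  rewrite prednK// coefN size_polyN coef_sumXn_big; case: insubP => [j _ _|_]; [exact: sQj|by rewrite size_poly0].
 have ig i : (size (g%:P`_i)%R <= D.-1.+1)%N.
  by rewrite prednK// coefC; case: eqP => _; rewrite ?size_poly0.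
 have igY i : (size (gY`_i)%R <= 1)%N by rewrite coef_map size_polyC leq_b1.
 have T0 : T = 0.
  apply: (@digits_inj _ p) => [|i|]; first exact: prime_gt0.
   have dA : (d * A.-1 = d * A - d)%N by rewrite -subn1 mulnBr muln1.
   rewrite coefB; apply: leq_trans (size_polyD _ _) _; rewrite geq_max size_polyN; apply/andP; split.
    by apply: leq_trans (innerM ig (innerX d iP) i) _; rewrite dA; lia.
   by apply: leq_trans (innerM igY (innerX d iQ) i) _; rewrite dA; lia.
  by rewrite /T hornerD hornerN !hornerM !horner_exp hornerC hornerN gYe e1 exprMn -exprM kd mulrA -exprS prednK ?prime_gt0// subrr.
 have {T0} /eqP TE : T = 0 by []; rewrite subr_eq0 in TE; move/eqP: TE => TE.
 have QQ0 : QQ != 0.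
  apply/eqP => Q0; have d0 : (0 < d)%N by apply: ltnW.
  move: TE; rewrite Q0 oppr0 expr0n (gtn_eqF d0) mulr0 => /eqP; rewrite mulf_eq0 polyC_eq0 (negbTE g0) expf_eq0 d0 /= => /eqP P0.
  case/negP: cx0; case: x0 => -[j i]; apply/eqP.
   have := congr1 (fun q : {poly {poly 'F_p}} => q`_j`_i) P0; by rewrite coef_sumXn coef_sumXn !coef0.
  have := congr1 (fun q : {poly {poly 'F_p}} => q`_j`_i) Q0; by rewrite coef_sumXn coef_sumXn !coef0.
 have gY0 : gY != 0 by rewrite map_polyC_eq0.
 have [y0 hy0] : exists y0 : 'F_p, (QQ * gY).[y0%:P] != 0.
  apply: contrapT => H.
  have : (size [seq y%:P | y <- enum 'F_p] < size (QQ * gY)%R)%N.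
   apply: max_poly_roots; first by rewrite mulf_neq0.
    apply/allP => _ /mapP[y _ ->]; apply/eqP; apply: contrapT => h; apply: H; exists y; exact/eqP.
   by rewrite map_inj_uniq ?enum_uniq//; exact: polyC_inj.
  rewrite size_map -cardT card_Fp// => /leq_trans/(_ (size_polyMleq _ _)).
  have h1 := size_sumXn Qj; rewrite -/QQ in h1; have h2 : (size gY <= D)%N by rewrite size_map_polyC.
  have := leq_add h1 h2; move: (size QQ + size gY)%N => N; lia.
 move: hy0; rewrite hornerM mulf_eq0 negb_or => /andP[Qy gy].
 have gyE : gY.[y0%:P] = (g.[y0])%:P by rewrite /gY horner_map.
 have := congr1 (fun q : {poly {poly 'F_p}} => q.[y0%:P]) TE; rewrite !hornerM hornerC !horner_exp hornerN gyE.
 set P1 := PP.[_]; set Q1 := - _ => PQ.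
 have Q10 : Q1 != 0 by rewrite oppr_eq0.
 have gy0 : g.[y0] != 0 by rewrite -polyC_eq0 -gyE.
 have P10 : P1 != 0.
  apply: contraNneq Q10 => P0; move/eqP: PQ; rewrite P0 expr0n (gtn_eqF (ltnW d1)) mulr0 eq_sym mulf_eq0 polyC_eq0 (negbTE gy0) /=.
  by rewrite expf_eq0 => /andP[].
 have mp (q : {poly 'F_p}) : q != 0 -> map_poly iota q != 0 by rewrite map_poly_eq0.
 have := congr1 (fun q => mup th (map_poly iota q)) PQ; rewrite /= !rmorphM /= !rmorphXn map_polyC /=.
 rewrite !mupM ?expf_neq0 ?mp ?fmorph_eq0// !mupX ?mp// => e.
 case/negP: dmu; rewrite -(dvdn_addl _ (dvdn_mulr (mup th (map_poly iota P1)) (dvdnn d))) e.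
 rewrite (mupNroot (q := (iota g.[y0])%:P)); last by rewrite rootC fmorph_eq0.
 by rewrite add0n dvdn_mulr.
have k2 : (2 * k <= p)%N.
 have : (k * 2 <= k * d)%N by rewrite leq_mul2l d1 orbT.
 by move: kd; move: (k * d)%N => N; lia.
have A2 : (2 * A <= p)%N.
 have : (A * 2 <= A * d)%N by rewrite leq_mul2l d1 orbT.
 by lia.
have sPhi : (size Phi <= p * (J + D))%N.
 apply: leq_trans (size_sum _ _ _) _; apply/bigmax_leqP => j _; rewrite -mulrDl.
 apply: leq_trans (size_polyMleq _ _) _; rewrite size_polyXn addnS.
 have h0 : (size (g ^+ k)%R <= (k * D).+1)%N.
  by apply: leq_trans (size_poly_exp_leq _ _) _; rewrite ltnS mulnC leq_mul2l (leq_trans (leq_pred _) gD) orbT.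
 have h1 := size_mulS h0 (size_sumXn (cQ j)); rewrite -/(Qj j) in h1.
 have h2 : (size (Pj j + g ^+ k * Qj j)%R <= k * D + A)%N.
  apply: leq_trans (size_polyD _ _) _; rewrite geq_max h1 andbT.
  by apply: leq_trans (size_sumXn _) _; exact: leq_addl.
 apply: leq_trans (leq_add h2 (leqnn _)) _.
 have q1 : (p * j.+1 <= p * J)%N by rewrite leq_mul2l ltn_ord orbT.
 have q2 : (2 * (k * D) <= p * D)%N by rewrite mulnA leq_mul2r k2 orbT.
 have q3 : (p <= p * D)%N by rewrite leq_pmulr.
 move: q1 q2 q3; rewrite mulnS mulnDr; move: (p * j)%N (p * J)%N (k * D)%N (p * D)%N => *; lia.
have := dvdp_leq Phi0 dvd; rewrite size_prod_seq => [|u _]; last by rewrite expf_neq0 ?polyXsubC_eq0.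
rewrite (eq_bigr (fun=> m.+1)) => [|u _]; last by rewrite size_exp_XsubC.
rewrite big_const_seq count_predT iter_addn addn0 -cardE mulSn; move: sPhi.
by move: (m * #|Z|)%N (p * (J + D))%N (size Phi) => u1 u2 u3; lia.
Qed.

(** * Fibres of the product map *)

Definition gpoly (F : fieldType) M N (G : 'I_M -> {poly F}) (a : {ffun 'I_M -> 'I_N}) : {poly F} := \prod_i G i ^+ a i.
Lemma size_gpoly (F : fieldType) M N D (G : 'I_M -> {poly F}) (a : {ffun 'I_M -> 'I_N}) :
 (\sum_i (size (G i)).-1 <= D)%N -> (size (gpoly G a) <= (N * D).+1)%N.
Proof.
move=> hD.
have : (size (\prod_i G i ^+ a i)%R <= (\sum_i (size (G i)).-1 * N).+1)%N.
 elim/big_rec2: _ => [|i n q _ h]; first by rewrite size_poly1.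
 apply: leq_trans (size_polyMleq _ _) _; have h1 := size_poly_exp_leq (G i) (a i).
 have : ((size (G i)).-1 * a i <= (size (G i)).-1 * N)%N by rewrite leq_mul2l ltnW ?orbT.
 move: (size (G i ^+ a i)) (size q) h h1 => s1 s2; lia.
rewrite -big_distrl/= mulnC => h; apply: leq_trans h _; by rewrite ltnS leq_mul2l hD orbT.
Qed.
Lemma gpoly_eval (F : fieldType) M N (G : 'I_M -> {poly F}) (a : {ffun 'I_M -> 'I_N}) x :
 (gpoly G a).[x] = \prod_i (G i).[x] ^+ a i.
Proof. by rewrite horner_prod; apply: eq_bigr => i _; rewrite horner_exp. Qed.

(** Dimension count: there are [N * N ^ M] coefficients and [(N * D.+1) ^ M] monomials in the [x j],
    fewer because [D.+1 ^ M < N]. *)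
Lemma alg_dependence (F : finFieldType) M N D (G : 'I_M -> {poly F}) (k : 'I_M) :
 (\sum_i (size (G i)).-1 <= D)%N -> (D.+1 ^ M < N)%N ->
 exists c : 'I_N -> {ffun 'I_M -> 'I_N} -> F, (exists e a, c e a != 0) /\
 forall x : {ffun 'I_M -> F}, \sum_e \sum_a c e a * (x k ^+ e * \prod_j (gpoly G a).[x j]) = 0.
Proof.
move=> hD hN; pose B := (N * D.+1)%N.
pose h (e : 'I_N) (a : {ffun 'I_M -> 'I_N}) (j : 'I_M) : {poly F} := 'X^(if j == k then e : nat else 0%N) * gpoly G a.
have sh e a j : (size (h e a j) <= B)%N.
 apply: leq_trans (size_polyMleq _ _) _; rewrite size_polyXn.
 have := size_gpoly a hD; have : ((if j == k then e : nat else 0) < N)%N.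
  by case: ifP => // _; apply: leq_ltn_trans (ltn_ord e).
 move: (size (gpoly G a)) (if _ then _ else _) => s1 s2; lia.
have [c [[[e0 a0] ca] hc]] : exists c : 'I_N * {ffun 'I_M -> 'I_N} -> F, (exists i, c i != 0) /\
  forall n : {ffun 'I_M -> 'I_B}, \sum_i c i * (\prod_j (h i.1 i.2 j)`_(n j)) = 0.
 apply: lin_dep; rewrite card_prod !card_ffun !card_ord expnMn mulnC ltn_pmul2r ?expn_gt0//.
 by rewrite (leq_ltn_trans (leq0n _) hN).
exists (fun e a => c (e, a)); split; first by exists e0, a0.
move=> x; rewrite pair_bigA.
transitivity (\sum_(n : {ffun 'I_M -> 'I_B}) (\sum_i c i * (\prod_j (h i.1 i.2 j)`_(n j))) * \prod_j x j ^+ n j); last first.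
 by rewrite big1// => n _; rewrite hc mul0r.
rewrite (eq_bigr (fun n : {ffun 'I_M -> 'I_B} => \sum_i c i * (\prod_j ((h i.1 i.2 j)`_(n j) * x j ^+ n j)))); last first.
 by move=> n _; rewrite mulr_suml; apply: eq_bigr => i _; rewrite -mulrA big_split.
rewrite exchange_big; apply: eq_bigr => -[e a] _; rewrite -mulr_sumr; congr (_ * _).
rewrite -(bigA_distr_bigA (fun j (n : 'I_B) => (h e a j)`_n * x j ^+ n)).
rewrite [RHS](eq_bigr (fun j => (h e a j).[x j])) => [|j _]; last by rewrite (horner_coef_wide _ (sh e a j)).
rewrite [RHS](eq_bigr (fun j => x j ^+ (if j == k then e : nat else 0) * (gpoly G a).[x j])); last first.
 by move=> j _; rewrite hornerM hornerXn.
rewrite [RHS]big_split; congr (_ * _); rewrite [RHS](bigD1 k)//= eqxx big1 ?mulr1// => j /negbTE ->; by [].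
Qed.

Lemma mem_tups (T : eqType) (S : seq T) t (xs : seq T) : size xs = t -> {subset xs <= S} -> xs \in tups S t.
Proof.
elim: xs t => [|x xs IH] [|t] //= [st] h; apply/allpairsP; exists (x, xs) => /=; split=> //.
 by apply: h; rewrite mem_head.
by apply: IH => // y ys; apply: h; rewrite inE ys orbT.
Qed.
(** The product over [j] of [(gpoly G a).[x j]] depends only on the image of [x]. So
    [alg_dependence] makes each coordinate a root of a polynomial [Rk k] of size at most [N]
    attached to the fibre, which is nonzero where one chosen coefficient does not vanish;
    [zero_count] bounds the exceptions. *)
Lemma fiber_bound (F : finFieldType) E (iota : {rmorphism F -> E}) M N D (G : 'I_M -> {poly F}) (th : 'I_M -> E) :
 (\sum_i (size (G i)).-1 <= D)%N -> (D.+1 ^ M < N)%N -> (forall i, G i != 0) ->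
 (forall i, (map_poly iota (G i)).[th i] = 0) -> (forall i i', i' != i -> (map_poly iota (G i')).[th i] != 0) ->
 exists Xb : {set {ffun 'I_M -> F}}, (#|Xb| * #|F| <= M * (M * (N * D) * #|F| ^ M))%N /\
 forall x : {ffun 'I_M -> F}, x \notin Xb ->
  (#|[set x' : {ffun 'I_M -> F} | [forall i, (\prod_j (G i).[x' j])%R == (\prod_j (G i).[x j])%R]]| <= N ^ M)%N.
Proof.
move=> hD hN G0 thr thn.
have /choice [c hc] := fun k => alg_dependence k hD hN.
have /choice [e0 he0] : forall k, exists e, exists a, c k e a != 0.
 by move=> k; have [[e [a h]] _] := hc k; exists e, a.
pose r k (a : {ffun 'I_M -> 'I_N}) : F := c k (e0 k) a.
pose fv (x : {ffun 'I_M -> F}) (a : {ffun 'I_M -> 'I_N}) : F := \prod_j (gpoly G a).[x j].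
pose Zk k := [set x : {ffun 'I_M -> F} | \sum_a r k a * fv x a == 0].
exists (\bigcup_k Zk k); split.
 have Zb k : (#|Zk k| * #|F| <= M * (N * D) * #|F| ^ M)%N.
  pose S := [seq iota x | x <- enum F].
  have uS : uniq S by rewrite map_inj_uniq ?enum_uniq//; exact: fmorph_inj.
  have sS : size S = #|F| by rewrite size_map -cardT.
  pose G' i := map_poly iota (G i).
  have hs (a : {ffun 'I_M -> 'I_N}) : (size (\prod_i G' i ^+ a i)%R <= (N * D).+1)%N.
   apply: (@size_gpoly _ _ _ D G'); rewrite (eq_bigr (fun i => (size (G i)).-1))// => i _.
   by rewrite size_map_poly.
  have G'0 i : G' i != 0 by rewrite map_poly_eq0.
  have h1 : exists a, iota (r k a) != 0 by have [a ha] := he0 k; exists a; rewrite fmorph_eq0.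
  have h2 (a a' : {ffun 'I_M -> 'I_N}) : iota (r k a) != 0 -> iota (r k a') != 0 -> forall i, i \notin enum 'I_M -> a i = a' i.
   by move=> _ _ i; rewrite mem_enum.
  have zc := zero_count thr thn G'0 uS hs h1 h2; rewrite size_enum_ord sS in zc; apply: leq_trans zc.
  rewrite leq_mul2r; apply/orP; right; rewrite -size_filter.
  pose toS (x : {ffun 'I_M -> F}) := [seq iota (x j) | j <- enum 'I_M].
  have injS : injective toS.
   move=> x y /eq_in_map h; apply/ffunP => j; apply: (fmorph_inj iota); apply: h; exact: mem_enum.
  rewrite cardE -(size_map toS); apply: uniq_leq_size; first by rewrite map_inj_uniq ?enum_uniq.
  move=> xs /mapP[x]; rewrite mem_enum inE => /eqP hx ->; rewrite mem_filter; apply/andP; split.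
   apply/eqP; transitivity (iota (\sum_a r k a * fv x a)); last by rewrite hx rmorph0.
   rewrite rmorph_sum; apply: eq_bigr => a _.
   rewrite rmorphM big_map rmorph_prod big_enum; congr (_ * _); apply: eq_bigr => j _.
   by rewrite -horner_map rmorph_prod; congr _.[_]; apply: eq_bigr => i _; rewrite rmorphXn.
  apply: mem_tups; first by rewrite size_map size_enum_ord.
  by move=> _ /mapP[j _ ->]; apply: map_f; rewrite mem_enum.
 apply: (@leq_trans ((\sum_k #|Zk k|) * #|F|)).
  rewrite leq_mul2r; apply/orP; right; elim/big_rec2: _ => [|k n X _ h]; first by rewrite cards0.
  by apply: leq_trans (leq_card_setU _ _) _; rewrite leq_add2l.
 rewrite big_distrl; apply: (@leq_trans (\sum_(k < M) M * (N * D) * #|F| ^ M)%N); first by apply: leq_sum => k _.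
 by rewrite sum_nat_const card_ord.
move=> x hx.
have fvE (y : {ffun 'I_M -> F}) a : fv y a = \prod_i (\prod_j (G i).[y j]) ^+ a i.
 rewrite /fv (eq_bigr (fun j => \prod_i (G i).[y j] ^+ a i)) => [|j _]; last exact: gpoly_eval.
 by rewrite exchange_big; apply: eq_bigr => i _; rewrite prodrXl.
pose Rk k : {poly F} := \poly_(e < N) (if insub e is Some e' then \sum_a c k e' a * fv x a else 0).
have RkN k : Rk k != 0.
 apply/eqP => R0; case/negP: hx; apply/bigcupP; exists k => //; rewrite inE.
 have := congr1 (fun q : {poly F} => q`_(e0 k)) R0; rewrite coef_poly ltn_ord coef0 valK => ->//.
pose Rts k := [set y : F | root (Rk k) y].
have cR k : (#|Rts k| <= N)%N.
 rewrite cardE; apply: leq_trans (_ : (size (Rk k)).-1 <= _)%N; last by rewrite (leq_trans (leq_pred _))// size_poly.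
 rewrite -ltnS prednK ?size_poly_gt0//; apply: max_poly_roots => //; last exact: enum_uniq.
 by apply/allP => y; rewrite mem_enum inE.
apply: (@leq_trans #|family (fun k => mem (Rts k))|); last first.
 rewrite card_family foldrE big_image -[X in (_ <= _ ^ X)%N](card_ord M) -prod_nat_const.
 by apply: leq_prod => k _; exact: cR.
apply: subset_leq_card; apply/fintype.subsetP => x'; rewrite inE => /forallP hx'; apply/familyP => k.
rewrite inE /root horner_poly; apply/eqP.
have [_ /(_ x') h] := hc k; rewrite -[RHS]h; apply: eq_bigr => e _; rewrite valK mulr_suml; apply: eq_bigr => a _.
have -> : fv x a = fv x' a by rewrite !fvE; apply: eq_bigr => i _; rewrite (eqP (hx' i)).
by rewrite /fv; ring.
Qed.

(** * Exponential sums over discrete logarithms *)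

Definition ez R h (t : 'Z_h) : R[i] := zeta R (Zp_trunc h).+2 ^+ t.
Lemma ezD R h (s t : 'Z_h) : ez R (s + t) = ez R s * ez R t.
Proof. rewrite -exprD; exact: expr_mod (zetaX R (ltn0Sn _)). Qed.
Lemma cn_ez R h (t : 'Z_h) : cn (ez R t) = 1.
Proof. by rewrite cnX cn_cis expr1n. Qed.
Lemma ez_neq0 R h (t : 'Z_h) : ez R t != 0.
Proof. by apply/eqP => e; have := cn_ez R t; rewrite e cn0 => /eqP; rewrite eq_sym oner_eq0. Qed.
Lemma ezN R h (t : 'Z_h) : ez R (- t) = (ez R t)^-1.
Proof. by apply: (mulIf (ez_neq0 R t)); rewrite -ezD addNr mulVf ?ez_neq0. Qed.
Lemma ez_sum R h (I : finType) (P : pred I) (f : I -> 'Z_h) : ez R (\sum_(i | P i) f i) = \prod_(i | P i) ez R (f i).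
Proof. by elim/big_rec2: _ => [|i x y _ <-]; rewrite ?ezD. Qed.
Lemma ezMn R h (t : 'Z_h) j : ez R (t *+ j) = ez R t ^+ j.
Proof. by elim: j => [|j IH]; rewrite// mulrS ezD IH exprS. Qed.
Lemma ez_eq1 R h (t : 'Z_h) : (ez R t == 1) = (t == 0).
Proof.
apply/idP/idP => [/eqP e|/eqP ->] => //.
apply: contraT => t0; have ht : (0 < t < (Zp_trunc h).+2)%N by rewrite ltn_ord andbT lt0n.
by have := zeta_neq1 R ht; rewrite -/(ez R t) e eqxx.
Qed.
Lemma ez_orth1 R h (t : 'Z_h) : \sum_(c : 'Z_h) ez R (c * t) = (if t == 0 then (Zp_trunc h).+2 else 0%N)%:R.
Proof.
case: ifPn => [/eqP ->|t0].
 by rewrite (eq_bigr (fun=> 1)) => [|c _]; rewrite ?mulr0// sumr_const card_ord.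
set S := \sum_c _; have : ez R t * S = S.
 rewrite mulr_sumr [RHS](reindex_inj (addrI 1)); apply: eq_bigr => c _.
 by rewrite mulrDl mul1r ezD.
move/eqP; rewrite -subr_eq0 -{2}[S]mul1r -mulrBl mulf_eq0 subr_eq0 ez_eq1 (negbTE t0) => /eqP ->.
by [].
Qed.
Definition dotz h M (c L : {ffun 'I_M -> 'Z_h}) : 'Z_h := \sum_j c j * L j.
Lemma dotzBr h M (c L L' : {ffun 'I_M -> 'Z_h}) : dotz c (L - L') = dotz c L - dotz c L'.
Proof. by rewrite -sumrB; apply: eq_bigr => j _; rewrite !ffunE mulrBr. Qed.
Lemma dotzMnl h M (c L : {ffun 'I_M -> 'Z_h}) j : dotz (c *+ j) L = dotz c L *+ j.
Proof. by rewrite -sumrMnl; apply: eq_bigr => i _; rewrite ffunMnE mulrnAl. Qed.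
Lemma ez_orth R h M (L : {ffun 'I_M -> 'Z_h}) :
 \sum_(c : {ffun 'I_M -> 'Z_h}) ez R (dotz c L) = (if L == 0 then ((Zp_trunc h).+2 ^ M)%N else 0%N)%:R.
Proof.
rewrite (eq_bigr (fun c : {ffun 'I_M -> 'Z_h} => \prod_j ez R (c j * L j))) => [|c _]; last by rewrite ez_sum.
rewrite -(bigA_distr_bigA (fun j (x : 'Z_h) => ez R (x * L j))).
case: ifPn => [/eqP ->|L0].
 rewrite (eq_bigr (fun=> ((Zp_trunc h).+2)%:R)) => [|j _]; last by rewrite ez_orth1 ffunE.
 by rewrite prodr_const card_ord natrX.
have [j hj] : exists j, L j != 0.
 apply: contrapT => H; case/negP: L0; apply/eqP/ffunP => j; rewrite ffunE; apply/eqP.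
 by apply: contrapT => /negP h1; apply: H; exists j.
by rewrite (bigD1 j)//= ez_orth1 (negbTE hj) mul0r.
Qed.
(** When [L x] lists the discrete logarithms of the [(G i).[x]], this is the sum over [S] of a
    product of [M] multiplicative characters of the [G i], with exponents [c]. *)
Definition esum R h M (I : finType) (S : {set I}) (L : I -> {ffun 'I_M -> 'Z_h}) c : R[i] := \sum_(x in S) ez R (dotz c (L x)).
Lemma esum0 R h M (I : finType) (S : {set I}) (L : I -> {ffun 'I_M -> 'Z_h}) : esum R S L 0 = #|S|%:R.
Proof.
rewrite /esum (eq_bigr (fun=> 1)) => [|x _]; first by rewrite sumr_const.
by rewrite /dotz big1// => j _; rewrite ffunE mul0r.
Qed.
Lemma esum_le R h M (I : finType) (S : {set I}) (L : I -> {ffun 'I_M -> 'Z_h}) c : cn (esum R S L c) <= #|S|%:R.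
Proof.
apply: le_trans (cn_sum _ _ _) _; rewrite (eq_bigr (fun=> 1)) => [|x _]; last by rewrite cn_ez.
by rewrite sumr_const.
Qed.
Lemma esum_count R h M (I : finType) (S : {set I}) (L : I -> {ffun 'I_M -> 'Z_h}) b :
 \sum_c esum R S L c * ez R (- dotz c b) = ((Zp_trunc h).+2 ^ M * #|[set x in S | L x == b]|)%N%:R.
Proof.
rewrite (eq_bigr (fun c => \sum_(x in S) ez R (dotz c (L x - b)))) => [|c _]; last first.
 by rewrite mulr_suml; apply: eq_bigr => x _; rewrite dotzBr ezD.
rewrite exchange_big (eq_bigr (fun x => (if L x == b then (Zp_trunc h).+2 ^ M else 0)%N%:R)) => [|x _]; last first.
 by rewrite ez_orth subr_eq0.
rewrite -natr_sum -big_mkcondr sum_nat_const mulnC; congr (_ * _)%N%:R.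
by apply: eq_card => x; rewrite !inE.
Qed.
Lemma mul_conjc R (z : R[i]) : z * z^*%C = (cn z ^+ 2)%:C.
Proof.
by rewrite cn_sqr; case: z => a b; apply/eqP; rewrite eq_complex/=; apply/andP; split; apply/eqP; ring.
Qed.
Lemma esum_conj R h M (I : finType) (S : {set I}) (L : I -> {ffun 'I_M -> 'Z_h}) c :
 (cn (esum R S L c) ^+ 2)%:C = esum R S L c * \sum_(x in S) ez R (- dotz c (L x)).
Proof.
have cj (z : R[i]) : cn z = 1 -> z^-1 = z^*%C.
 move=> z1; have z0 : z != 0 by apply/eqP => z0; rewrite z0 cn0 in z1; move/eqP: z1; rewrite eq_sym oner_eq0.
 by apply: (mulfI z0); rewrite mulfV// mul_conjc z1 expr1n.
rewrite (eq_bigr (fun x => (ez R (dotz c (L x)))^*%C)) => [|x _]; last by rewrite ezN cj ?cn_ez.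
by rewrite -(rmorph_sum (@conjc R)) mul_conjc.
Qed.
Lemma esum_parseval R h M (I : finType) (S : {set I}) (L : I -> {ffun 'I_M -> 'Z_h}) :
 \sum_c cn (esum R S L c) ^+ 2 = ((Zp_trunc h).+2 ^ M * \sum_(x in S) #|[set y in S | L y == L x]|)%N%:R.
Proof.
apply: (can_inj (fun x : R => erefl (complex.Re x%:C))).
rewrite (rmorph_sum (real_complex R))/= (eq_bigr (fun c => \sum_(x in S) esum R S L c * ez R (- dotz c (L x)))) => [|c _]; last by rewrite esum_conj mulr_sumr.
rewrite exchange_big (eq_bigr (fun x => ((Zp_trunc h).+2 ^ M * #|[set y in S | L y == L x]|)%N%:R)) => [|x _]; last first.
 by rewrite esum_count.
by rewrite -natr_sum (rmorph_nat (real_complex R)) big_distrr.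
Qed.
(** On the unit circle [1 - Re (z ^ j) <= j ^ 2 * (1 - Re z)], which follows from
    [|1 - z ^ j| <= j * |1 - z|]. The factor [u] rotates the sum at [c] onto the real axis. *)
Lemma esum_pow R h M (I : finType) (S : {set I}) (L : I -> {ffun 'I_M -> 'Z_h}) c j (d : R) :
 (1 - d) * #|S|%:R <= cn (esum R S L c) -> (1 - j%:R ^+ 2 * d) * #|S|%:R <= cn (esum R S L (c *+ j)).
Proof.
set n := #|S|%:R => hc.
have [u u1 uE] : exists2 u : R[i], cn u = 1 & u * esum R S L c = (cn (esum R S L c))%:C.
 have [/eqP z0|z0] := boolP (cn (esum R S L c) == 0).
  by exists 1; rewrite ?cn1// (cn_eq0 z0) cn0 mulr0.
 have e0 : esum R S L c != 0 by apply: contraNneq z0 => ->; rewrite cn0.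
 exists ((cn (esum R S L c))%:C / esum R S L c); last by rewrite divfK.
 by rewrite cnM cnV cn_real ger0_norm// mulfV.
pose z x := u * ez R (dotz c (L x)).
have z1 x : cn (z x) = 1 by rewrite cnM cn_ez mulr1.
have hz : \sum_(x in S) (1 - complex.Re (z x)) <= d * n.
 have -> : \sum_(x in S) (1 - complex.Re (z x)) = n - cn (esum R S L c).
  rewrite sumrB sumr_const; congr (_ - _).
  by rewrite -(raddf_sum (@complex.Re R)) -mulr_sumr uE.
 clear - hc; lra.
have zj x : 1 - complex.Re (z x ^+ j) <= j%:R ^+ 2 * (1 - complex.Re (z x)).
 have sq (y : R[i]) : cn y = 1 -> cn (1 - y) ^+ 2 = 2 * (1 - complex.Re y).
  by move=> y1; have := cn_sqr y; rewrite y1 cn_sqr; case: y {y1} => a b /=; clear; lra.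
 have y1 : cn (z x ^+ j) = 1 by rewrite cnX z1 expr1n.
 have b1 : cn (1 - z x ^+ j) <= j%:R * cn (1 - z x).
  elim: (j) => [|i IH]; first by rewrite subrr cn0.
  have -> : 1 - z x ^+ i.+1 = (1 - z x) + z x * (1 - z x ^+ i) by rewrite exprS; ring.
  apply: le_trans (cnD _ _) _; rewrite cnM z1 mul1r -natr1 mulrDl mul1r addrC lerD2r//.
 have : cn (1 - z x ^+ j) ^+ 2 <= (j%:R * cn (1 - z x)) ^+ 2.
  by apply: lerXn2r; rewrite ?nnegrE.
 rewrite [(j%:R * _) ^+ 2]exprMn (sq _ y1) (sq _ (z1 x)); clear; lra.
have e : u ^+ j * esum R S L (c *+ j) = \sum_(x in S) z x ^+ j.
 by rewrite mulr_sumr; apply: eq_bigr => x _; rewrite dotzMnl ezMn exprMn.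
have -> : cn (esum R S L (c *+ j)) = cn (\sum_(x in S) z x ^+ j) by rewrite -e cnM cnX u1 expr1n mul1r.
apply: (@le_trans _ _ (complex.Re (\sum_(x in S) z x ^+ j))); last first.
 have := cn_sqr (\sum_(x in S) z x ^+ j); move: (\sum_(x in S) _) => y hy.
 have := cn_ge0 y; have : complex.Re y ^+ 2 <= cn y ^+ 2 by rewrite hy lerDl.
 clear; move=> a b; nra.
rewrite (raddf_sum (@complex.Re R)).
have : \sum_(x in S) (1 - complex.Re (z x ^+ j)) <= j%:R ^+ 2 * \sum_(x in S) (1 - complex.Re (z x)).
 by rewrite mulr_sumr; apply: ler_sum => x _.
rewrite sumrB sumr_const => h1.
have := ler_wpM2l (sqr_ge0 j%:R) hz; move: h1; clear; lra.
Qed.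
Lemma dlog (p : nat) : prime p -> (2 < p)%N -> exists (g : 'F_p) (ind : 'F_p -> 'Z_(p.-1)),
 [/\ forall i j : nat, (g ^+ i == g ^+ j) = (i == j %[mod p.-1]),
   forall y, y != 0 -> g ^+ ind y = y, g != 0 &
   forall y z, y != 0 -> z != 0 -> ind (y * z) = ind y + ind z].
Proof.
move=> pp p2; have cF : #|'F_p| = p := card_Fp pp.
have /cyclicP [x xE] := field_unit_group_cyclic [set: {unit 'F_p}]%G.
have ox : #[x]%g = p.-1 by rewrite /order -xE card_finField_unit cF.
have p1 : (1 < p.-1)%N by rewrite -subn1 ltn_subRL.
have vX i : val (x ^+ i)%g = (val x : 'F_p) ^+ i by rewrite FinRing.val_unitX.
have gi i j : ((val x : 'F_p) ^+ i == val x ^+ j) = (i == j %[mod p.-1]).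
 by rewrite -!vX (inj_eq val_inj) eq_expg_mod_order ox.
have g0 : (val x : 'F_p) != 0 by rewrite -unitfE; case: x {xE ox vX gi}.
have ex (y : 'F_p) : y != 0 -> exists i : 'Z_(p.-1), (val x : 'F_p) ^+ i == y.
 rewrite -unitfE => uy; have : FinRing.Unit uy \in <[x]>%g by rewrite -xE inE.
 case/cycleP => i hi; exists (i%:R); rewrite val_Zp_nat//.
 have -> : y = val (x ^+ i)%g by rewrite -hi.
 by rewrite vX gi modn_mod.
pose ind (y : 'F_p) : 'Z_(p.-1) := odflt 0 [pick i : 'Z_(p.-1) | (val x : 'F_p) ^+ i == y].
have indE y : y != 0 -> (val x : 'F_p) ^+ ind y = y.
 by move=> /ex [i hi]; rewrite /ind; case: pickP => [k /eqP //|/(_ i)]; rewrite hi.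
exists (val x), ind; split=> // y z y0 z0; apply: val_inj.
have : (val x : 'F_p) ^+ ind (y * z) == val x ^+ (ind y + ind z) by rewrite exprD !indE// mulf_neq0.
rewrite gi => /eqP e /=.
have -> : ((ind y + ind z) %% (Zp_trunc p.-1).+2 = (ind y + ind z) %% p.-1)%N by congr (_ %% _)%N; exact: Zp_cast.
by rewrite -e modn_small// -[X in (_ < X)%N](Zp_cast p1).
Qed.

Lemma dotz_sumr h M (I : finType) (P : pred I) (c : {ffun 'I_M -> 'Z_h}) (L : I -> {ffun 'I_M -> 'Z_h}) :
 dotz c (\sum_(i | P i) L i) = \sum_(i | P i) dotz c (L i).
Proof.
rewrite exchange_big; apply: eq_bigr => j _; rewrite sum_ffunE mulr_sumr; by [].
Qed.
Lemma esum_exp R h M (I : finType) (S : {set I}) (L : I -> {ffun 'I_M -> 'Z_h}) s c :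
 esum R S L c ^+ s = esum R [set x : {ffun 'I_s -> I} | x \in ffun_on (mem S)]%SET (fun x => \sum_j L (x j)) c.
Proof.
rewrite -[X in _ ^+ X]card_ord -prodr_const (bigA_distr_big (mem S) (fun _ x => ez R (dotz c (L x)))).
apply: eq_big => [x|x _]; first by rewrite finset.in_set.
by rewrite dotz_sumr ez_sum.
Qed.
Lemma ind_prod (p h : nat) (ind : 'F_p -> 'Z_h) (I : finType) (u : I -> 'F_p) :
 (forall y z, y != 0 -> z != 0 -> ind (y * z) = ind y + ind z) -> (forall i, u i != 0) ->
 ind (\prod_i u i) = \sum_i ind (u i).
Proof.
move=> hm u0; have i1 : ind 1 = 0.
 by apply: (addrI (ind 1)); rewrite -hm// mulr1 addr0.
have [//] : ind (\prod_i u i) = \sum_i ind (u i) /\ \prod_i u i != 0.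
elim/big_rec2: _ => [|i x y _ [<- y0]] => //.
by rewrite hm// mulf_neq0.
Qed.

(** The power [M] of the sum is an exponential sum over [M]-tuples. [f] is this sum without the
    exceptional tuples of [fiber_bound], so Parseval and the bound on the fibres control its second
    moment. *)
Lemma esum_good R (p : nat) E (iota : {rmorphism 'F_p -> E}) M N D (G : 'I_M -> {poly 'F_p}) (th : 'I_M -> E)
  (S : {set 'F_p}) (g : 'F_p) (ind : 'F_p -> 'Z_(p.-1)) : prime p -> (2 < p)%N ->
 (\sum_i (size (G i)).-1 <= D)%N -> (D.+1 ^ M < N)%N -> (forall i, G i != 0) ->
 (forall i, (map_poly iota (G i)).[th i] = 0) -> (forall i i', i' != i -> (map_poly iota (G i')).[th i] != 0) ->
 (forall x, x \in S -> forall i, (G i).[x] != 0) -> (forall y, y != 0 -> g ^+ ind y = y) ->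
 (forall y z, y != 0 -> z != 0 -> ind (y * z) = ind y + ind z) ->
 exists (f : {ffun 'I_M -> 'Z_(p.-1)} -> R[i]) (Xb : nat),
 [/\ (Xb * p <= M * (M * (N * D) * p ^ M))%N,
   forall c, cn (f c - esum R S (fun x => [ffun i => ind (G i).[x]]) c ^+ M) <= Xb%:R,
   forall c, cn (f c) <= #|S|%:R ^+ M &
   \sum_c cn (f c) ^+ 2 <= (p.-1 ^ M * (#|S| ^ M * N ^ M))%N%:R].
Proof.
move=> pp p2 hD hN G0 r1 r2 hS hg hm.
have p1 : (1 < p.-1)%N by rewrite -subn1 ltn_subRL.
have [Xb [hX1 hX2]] := fiber_bound hD hN G0 r1 r2.
rewrite (card_Fp pp) in hX1.
pose L x : {ffun 'I_M -> 'Z_(p.-1)} := [ffun i => ind (G i).[x]].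
pose LL (x : {ffun 'I_M -> 'F_p}) := \sum_j L (x j).
pose SM := [set x : {ffun 'I_M -> 'F_p} | x \in ffun_on (mem S)]%SET.
have cS : (#|(SM :\: Xb)%SET| <= #|S| ^ M)%N.
 apply: leq_trans (subset_leq_card (subsetDl _ _)) _.
 by rewrite cardsE card_ffun_on card_ord.
exists (esum R (SM :\: Xb)%SET LL), #|Xb|; split=> //.
 move=> c; rewrite esum_exp cnBC /esum (big_setID Xb) addrK.
 have := esum_le R (SM :&: Xb)%SET LL c; rewrite /esum => h; apply: (le_trans h).
 by rewrite ler_nat subset_leq_card// subsetIr.
 by move=> c; apply: le_trans (esum_le _ _ _ _) _; rewrite -natrX ler_nat.
have zc : ((Zp_trunc p.-1).+2 ^ M = p.-1 ^ M)%N by congr (_ ^ M)%N; exact: Zp_cast.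
rewrite esum_parseval ler_nat zc leq_mul2l; apply/orP; right.
apply: (@leq_trans (\sum_(x in (SM :\: Xb)%SET) N ^ M)); last by rewrite sum_nat_const leq_mul2r cS orbT.
apply: leq_sum => x; rewrite finset.in_setD finset.in_set => /andP[xb xS].
apply: leq_trans (hX2 x xb); apply: subset_leq_card; apply/fintype.subsetP => y; rewrite !finset.in_set => /andP[/andP[_ yS] /eqP e].
have nz (z : {ffun 'I_M -> 'F_p}) i : z \in ffun_on (mem S) -> forall j, (G i).[z j] != 0.
 by move=> /ffun_onP h j; apply: hS.
apply/forallP => i; have h : ind (\prod_j (G i).[y j]) = ind (\prod_j (G i).[x j]).
 rewrite !ind_prod//; [|exact: nz|exact: nz].
 have := congr1 (fun f : {ffun 'I_M -> 'Z_(p.-1)} => f i) e; rewrite !sum_ffunE.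
 by move=> h; transitivity (\sum_j L (y j) i); [apply: eq_bigr => j _; rewrite ffunE|rewrite h; apply: eq_bigr => j _; rewrite ffunE].
by rewrite -[X in X == _]hg ?h ?hg//; apply/prodf_neq0 => j _; exact: nz.
Qed.
Lemma bern (R : realFieldType) (x : R) M : 0 <= x <= 1 -> 1 - M%:R * x <= (1 - x) ^+ M.
Proof.
move=> /andP[x0 x1]; elim: M => [|M IH]; first by lra.
have h : 0 <= 1 - x by lra.
rewrite exprS; apply: le_trans (ler_wpM2l h IH); rewrite -natr1.
have : 0 <= M%:R * x ^+ 2 by [].
move: (M%:R) => m; lra.
Qed.
(** Averaging over the multiples of [c] detects the equality of two values of [dotz c]. The squares
    average at least 361/400 of the maximum, and as this exceeds 9/10, some value is taken on nine
    tenths of [S]. *)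
Lemma order_mass R h M (I : finType) (S : {set I}) (L : I -> {ffun 'I_M -> 'Z_h}) c d : (0 < d)%N -> c *+ d = 0 ->
 (0 < #|S|)%N -> (forall j, (j < d)%N -> 19 / 20 * #|S|%:R <= cn (esum R S L (c *+ j))) ->
 exists x0, (9 * #|S| <= 10 * #|[set x in S | dotz c (L x) == dotz c (L x0)]|)%N.
Proof.
move=> d0 cd S0 hj; pose Z x := #|[set y in S | dotz c (L y) == dotz c (L x)]|.
have E : \sum_(j < d) cn (esum R S L (c *+ j)) ^+ 2 = (d * \sum_(x in S) Z x)%N%:R.
 apply: (can_inj (fun x : R => erefl (complex.Re x%:C))).
 rewrite (rmorph_sum (real_complex R))/= (eq_bigr (fun j : 'I_d => \sum_(x in S) \sum_(y in S) ez R (dotz c (L y - L x)) ^+ j)) => [|j _]; last first.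
  rewrite esum_conj mulr_sumr; apply: eq_bigr => x _; rewrite mulr_suml; apply: eq_bigr => y _.
  by rewrite -ezD -ezMn -dotzMnl dotzBr.
 rewrite exchange_big (rmorph_nat (real_complex R)) big_distrr natr_sum; apply: eq_bigr => x _.
 rewrite exchange_big (eq_bigr (fun y => (if dotz c (L y) == dotz c (L x) then d else 0%N)%:R)) => [|y _]; last first.
  case: ifPn => [/eqP e|ne].
   by rewrite (eq_bigr (fun=> 1)) => [|j _]; rewrite ?sumr_const ?card_ord// dotzBr e subrr expr1n.
  have z1 : ez R (dotz c (L y - L x)) != 1 by rewrite ez_eq1 dotzBr subr_eq0.
  apply/eqP; have := subrX1 (ez R (dotz c (L y - L x))) d.
  rewrite -ezMn -dotzMnl cd (_ : dotz 0 _ = 0) ?subrr; last by rewrite /dotz big1// => i _; rewrite ffunE mul0r.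
  by move/esym/eqP; rewrite mulf_eq0 subr_eq0 (negbTE z1).
 rewrite -natr_sum -big_mkcondr sum_nat_const mulnC; congr (_ * _)%N%:R.
 by apply: eq_card => y; rewrite !inE.
apply: contrapT => H.
have H' x : (10 * Z x < 9 * #|S|)%N by rewrite ltnNge; apply/negP => h1; apply: H; exists x.
have : (\sum_(x in S) 10 * Z x < \sum_(x in S) 9 * #|S|)%N.
 have [x0 x0S] : exists x, x \in S by apply/set0Pn; rewrite -card_gt0.
 rewrite (bigD1 x0)//= [X in (_ < X)%N](bigD1 x0)//= -addSn leq_add//; apply: leq_sum => x _; exact: ltnW.
rewrite -big_distrr sum_nat_const => hlt.
have : (361 / 400 * #|S|%:R ^+ 2) *+ d <= \sum_(j < d) cn (esum R S L (c *+ j)) ^+ 2.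
 rewrite -[X in _ *+ X]card_ord -sumr_const; apply: ler_sum => j _.
 have -> : 361 / 400 * #|S|%:R ^+ 2 = (19 / 20 * #|S|%:R) ^+ 2 :> R by field.
 by apply: lerXn2r; rewrite ?nnegrE ?hj//; lra.
rewrite E natrM -mulr_natl ler_pM2l//.
move: hlt; rewrite -(ltr_nat R) !natrM => a b.
have : 0 < #|S|%:R ^+ 2 :> R by [].
move: a b; clear; lra.
Qed.
Lemma mup_prod (F : fieldType) (I : finType) (f : I -> {poly F}) x : (forall i, f i != 0) -> mup x (\prod_i f i) = (\sum_i mup x (f i))%N.
Proof.
move=> f0; suff [] : mup x (\prod_i f i) = (\sum_i mup x (f i))%N /\ \prod_i f i != 0 by [].
elim/big_rec2: _ => [|i m y _ [<- y0]].
 by split; [rewrite mupNroot ?root1|exact: oner_neq0].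
by rewrite mupM ?mulf_neq0.
Qed.
(** Since [d] kills [c], the exponents are [c j = a j * (p.-1 %/ d)] with [a j < d], and the
    character becomes the power [p.-1 %/ d] of [gpoly G a], whose multiplicity at [th j0] is [a j0],
    strictly between 0 and [d]. [J = 10 * D'] and [m = 15 * D'] in [stepanov] give the ratio
    11/15. *)
Lemma stepanov_const (p : nat) E (iota : {rmorphism 'F_p -> E}) M D (G : 'I_M -> {poly 'F_p}) (th : 'I_M -> E)
  (S : {set 'F_p}) (g : 'F_p) (ind : 'F_p -> 'Z_(p.-1)) (c : {ffun 'I_M -> 'Z_(p.-1)}) d D' x0 : prime p -> (2 < p)%N ->
 (\sum_i (size (G i)).-1 <= D)%N -> (forall i, G i != 0) ->
 (forall i, mup (th i) (map_poly iota (G i)) = 1%N) -> (forall i i', i' != i -> (map_poly iota (G i')).[th i] != 0) ->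
 (forall x, x \in S -> forall i, (G i).[x] != 0) -> (forall y, y != 0 -> g ^+ ind y = y) ->
 (forall i j, (g ^+ i == g ^+ j) = (i == j %[mod p.-1])) ->
 c != 0 -> (1 < d)%N -> (d %| p.-1)%N -> c *+ d = 0 -> ((d * D).+1 <= D')%N -> (D' + d * (30 * D' + 45 * D' ^ 2).+1 < p)%N ->
 (15 * #|[set x in S | dotz c [ffun i => ind (G i).[x]] == dotz c [ffun i => ind (G i).[x0]]]| <= 11 * p)%N.
Proof.
move=> pp p2 hD G0 r1 r2 hS hg hgm c0 d1 dp cd dD hp.
pose L x := [ffun i => ind (G i).[x]] : {ffun 'I_M -> 'Z_(p.-1)}.
have p1 : (1 < p.-1)%N by rewrite -subn1 ltn_subRL.
have zc := Zp_cast p1.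
have d0 : (0 < d)%N by apply: ltnW.
have hd0 : (0 < p.-1 %/ d)%N by rewrite divn_gt0 dvdn_leq// ltnW.
have cdj j : (p.-1 %/ d %| c j)%N.
 have e : c j *+ d = 0 by have := congr1 (fun f : {ffun 'I_M -> 'Z_(p.-1)} => f j) cd; rewrite ffunMnE ffunE.
 have : (p.-1 %| c j * d)%N.
  have : ((c j * d)%N%:R : 'Z_(p.-1)) = 0 by rewrite natrM natr_Zp mulr_natr.
  by move/(congr1 val); rewrite/= (val_Zp_nat p1) => /eqP.
 by rewrite -{1}(divnK dp) dvdn_pmul2r.
have cl j : (c j < p.-1)%N by rewrite -[X in (_ < X)%N]zc.
have al j : (c j %/ (p.-1 %/ d) < d)%N by rewrite ltn_divLR// mulnC divnK.
pose a : {ffun 'I_M -> 'I_d} := [ffun j => Ordinal (al j)].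
have aE j : (a j * (p.-1 %/ d))%N = c j by rewrite ffunE divnK.
pose gg := gpoly G a.
have [j0 hj0] : exists j, c j != 0.
 apply: contrapT => H; case/negP: c0; apply/eqP/ffunP => j; rewrite ffunE; apply/eqP.
 by apply: contrapT => /negP h1; apply: H; exists j.
have aj0 : (0 < a j0 < d)%N.
 rewrite ltn_ord andbT lt0n; apply/eqP => e; case/negP: hj0; apply/eqP; apply: val_inj; rewrite/= -aE e mul0n//.
have Gm0 i : map_poly iota (G i) != 0 by rewrite map_poly_eq0.
have mg : mup (th j0) (map_poly iota gg) = a j0.
 have mX i : map_poly iota (G i ^+ a i) = map_poly iota (G i) ^+ a i by rewrite rmorphXn.
 rewrite rmorph_prod mup_prod => [|i]; last by rewrite map_poly_eq0 expf_neq0.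
 rewrite (bigD1 j0)//= big1 ?addn0 => [|i ij]; first by rewrite mX mupX// r1 muln1.
 by rewrite mX mupX// mupNroot ?muln0// r2.
set Z := [set x in S | _]; pose z := g ^+ dotz c (L x0).
have hZ u : u \in Z -> gg.[u] != 0 /\ gg.[u] ^+ (p.-1 %/ d) = z.
 rewrite inE => /andP[uS /eqP uE]; have Gu := hS u uS; split.
  by rewrite gpoly_eval; apply/prodf_neq0 => i _; rewrite expf_neq0.
 rewrite gpoly_eval -prodrXl /z -uE.
 have -> : \prod_i (G i).[u] ^+ a i ^+ (p.-1 %/ d) = g ^+ (\sum_i c i * L u i)%N.
  rewrite expr_sum; apply: eq_bigr => i _; rewrite -exprM aE ffunE mulnC exprM hg//.
 apply/eqP; rewrite hgm.
 have -> : (dotz c (L u) : nat) = ((\sum_i c i * L u i)%N %% p.-1)%N.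
  rewrite -(val_Zp_nat p1) natr_sum; congr (nat_of_ord _); apply: eq_bigr => i _.
  by rewrite natrM !natr_Zp.
 by rewrite modn_mod.
have sg : (size gg <= D')%N by apply: leq_trans dD; apply: size_gpoly.
have gg0 : gg != 0 by apply/prodf_neq0 => i _; rewrite expf_neq0.
pose A := ((p - D') %/ d)%N.
have hA : (30 * D' + 45 * D' ^ 2 < A)%N by rewrite leq_divRL// mulnC leq_subRL; [exact: ltnW|apply: leq_trans (ltnW hp); exact: leq_addr].
have D'0 : (0 < D')%N by apply: leq_trans dD.
have := @stepanov p E iota gg d A (10 * D') (15 * D') D' z Z (th j0) pp d1 dp sg gg0.
rewrite mg gtnNdvd; [|by case/andP: aj0|by case/andP: aj0].
move=> /(_ isT hZ) h.
have h1 : (0 < A)%N by apply: leq_trans hA.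
have h3 : (d * A + D' <= p)%N.
 clear - hp; lia.
have h2 : (15 * D' <= p.-1 %/ d)%N.
 rewrite leq_divRL//; clear - hp d0 D'0; nia.
have h4 : (10 * D' + D' < p)%N by clear - hp d0; nia.
have h5 : (15 * D' * (A + 10 * D' + 15 * D' * D') < 2 * (10 * D' * A))%N.
 rewrite (_ : 15 * D' * (A + 10 * D' + 15 * D' * D') = D' * (15 * (A + 10 * D' + 15 * (D' * D'))))%N; last by clear; nia.
 rewrite (_ : 2 * (10 * D' * A) = D' * (20 * A))%N; last by clear; nia.
 rewrite ltn_pmul2l//; rewrite -mulnn in hA; move: (D' * D')%N A hA {h h1 h3} => DD A; clear; lia.
have {h} := h h1 h2 h3 h4 h5.
rewrite (_ : 10 * D' + D' = 11 * D')%N; last by clear; lia.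
rewrite mulnAC mulnA [(p * 11)%N]mulnC leq_pmul2r//.
Qed.

(** Each such [c] contributes at least [n ^ (2 * M) / 4] to the second moment of [f]: the threshold
    remains above 19/20 after the power [M], and [Xb] takes away at most 1/20. *)
Lemma esum_large R (p : nat) M N b n Xb (S : {set 'F_p}) (L : 'F_p -> {ffun 'I_M -> 'Z_(p.-1)})
  (f : {ffun 'I_M -> 'Z_(p.-1)} -> R[i]) : n = #|S| -> (0 < n)%N -> (0 < p)%N ->
 (p ^ M)%N%:R <= 2 * n%:R ^+ M :> R -> (40 * b.+1 <= p)%N ->
 (Xb * p <= b * p ^ M)%N ->
 (forall c, cn (f c - esum R S L c ^+ M) <= Xb%:R) ->
 \sum_c cn (f c) ^+ 2 <= (p.-1 ^ M * (n ^ M * N ^ M))%N%:R ->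
 (#|[set c | ((1 - (20 * M.+1%:R)^-1) * n%:R <= cn (esum R S L c) :> R)%R]%SET| <= 8 * N ^ M)%N.
Proof.
move=> nE n0 p0 pM pb hX hf hs; set A := finset _.
have nM : 0 < n%:R ^+ M :> R by [].
have M1 : 1 <= M.+1%:R :> R by rewrite ler1n.
have Xs : Xb%:R <= n%:R ^+ M / 20 :> R.
 have h1 : Xb%:R * p%:R <= b%:R * (p ^ M)%N%:R :> R by rewrite -!natrM ler_nat.
 have h2 : b%:R * (p ^ M)%N%:R <= b.+1%:R * (2 * n%:R ^+ M) :> R by apply: ler_pM => //; rewrite ler_nat.
 have h3 : Xb%:R * (40 * b.+1%:R) <= Xb%:R * p%:R :> R by rewrite ler_wpM2l// -natrM ler_nat.
 have b0 : 0 < b.+1%:R :> R by [].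
 rewrite -(ler_pM2l b0); move: (le_trans h3 (le_trans h1 h2)).
 move: b.+1%:R Xb%:R (n%:R ^+ M) => u v w; clear; lra.
have big c : c \in A -> n%:R ^+ M / 2 <= cn (f c).
 rewrite finset.in_set => hc.
 have x0 : 0 <= ((20 * M.+1%:R)^-1 : R) <= 1.
  by rewrite invr_ge0//= invf_le1; clear - M1; lra.
 have h1 : 19 / 20 <= (1 - (20 * M.+1%:R)^-1) ^+ M :> R.
  apply: le_trans (bern M x0); rewrite invfM mulrCA.
  have : M%:R / M.+1%:R <= 1 :> R by rewrite ler_pdivrMr// mul1r ler_nat.
  move: (M%:R / M.+1%:R) => z; clear; lra.
 have h2 : ((1 - (20 * M.+1%:R)^-1) * n%:R) ^+ M <= cn (esum R S L c) ^+ M.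
  by apply: lerXn2r; rewrite ?nnegrE// mulr_ge0// subr_ge0; case/andP: x0.
 rewrite exprMn in h2.
 have h3 : 19 / 20 * n%:R ^+ M <= cn (esum R S L c) ^+ M.
  by apply: le_trans h2; rewrite ler_pM2r.
 have h4 : cn (esum R S L c) ^+ M <= cn (f c) + Xb%:R.
  rewrite -cnX (_ : esum R S L c ^+ M = f c - (f c - esum R S L c ^+ M)); last by ring.
  by apply: le_trans (cnB _ _) _; rewrite lerD2l.
 move: h3 h4 Xs nM; clear; lra.
have h1 : (n%:R ^+ M / 2) ^+ 2 *+ #|A| <= \sum_c cn (f c) ^+ 2.
 rewrite -sumr_const [leRHS](bigID (mem A)) -[leLHS]addr0; apply: lerD => //.
 apply: ler_sum => c cA; apply: lerXn2r; rewrite ?nnegrE ?big//.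
have h2 : (p.-1 ^ M * (n ^ M * N ^ M))%N%:R <= 2 * n%:R ^+ M * (n%:R ^+ M * (N ^ M)%N%:R) :> R.
 rewrite !natrM; apply: ler_pM; rewrite//; last by rewrite natrX.
 by apply: le_trans pM; rewrite !natrX lerXn2r ?nnegrE// ler_nat leq_pred.
rewrite -(ler_nat R) natrM.
have := le_trans h1 (le_trans hs h2); rewrite -mulr_natr.
have nn : 0 < (n%:R ^+ M) ^+ 2 :> R by [].
rewrite -(ler_pM2l nn).
move: #|A|%:R (n%:R ^+ M) ((N ^ M)%N%:R : R) => a u v; clear; lra.
Qed.
Lemma powD2 (R : realFieldType) (y e : R) k : 0 <= y -> 0 <= e -> (y + e) ^+ k <= 2 ^+ k * (y ^+ k + e ^+ k).
Proof.
move=> y0 e0; have h (u v : R) : 0 <= u -> 0 <= v -> u <= v -> (u + v) ^+ k <= 2 ^+ k * (u ^+ k + v ^+ k).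
 move=> u0 v0 uv; apply: (@le_trans _ _ ((2 * v) ^+ k)).
  by apply: lerXn2r; rewrite ?nnegrE; lra.
 by rewrite exprMn ler_wpM2l// lerDr.
by have [ye|ey] := leP y e; [exact: h|rewrite addrC [y ^+ k + _]addrC; apply: h => //; exact: ltW].
Qed.
(** If the sum at [c] were nearly maximal, so would be those at the multiples [c *+ j] for
    [j < B + 2] by [esum_pow], more than [esum_large] lets be distinct. So [c] has bounded order,
    and [order_mass] contradicts [stepanov_const]. The second claim combines the gap with a bound
    for the moment of order [2 * M * M.+1]. *)
Lemma char_gap R M D : exists2 del : R, 0 < del <= 1 & exists P0 : nat, forall (p : nat) E (iota : {rmorphism 'F_p -> E})
  (G : 'I_M -> {poly 'F_p}) (th : 'I_M -> E) (S : {set 'F_p}) (g : 'F_p) (ind : 'F_p -> 'Z_(p.-1)), prime p -> (P0 < p)%N ->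
 (\sum_i (size (G i)).-1 <= D)%N -> (forall i, G i != 0) ->
 (forall i, mup (th i) (map_poly iota (G i)) = 1%N) -> (forall i i', i' != i -> (map_poly iota (G i')).[th i] != 0) ->
 (forall x, x \in S -> forall i, (G i).[x] != 0) -> (forall y, y != 0 -> g ^+ ind y = y) ->
 (forall i j, (g ^+ i == g ^+ j) = (i == j %[mod p.-1])) ->
 (forall y z, y != 0 -> z != 0 -> ind (y * z) = ind y + ind z) -> (p <= #|S| + D.+1)%N ->
 (forall c, c != 0 -> cn (esum R S (fun x => [ffun i => ind (G i).[x]]) c) <= (1 - del) * #|S|%:R) /\
 forall s, (2 * M * M.+1 <= s)%N ->
  \sum_(c : {ffun 'I_M -> 'Z_(p.-1)} | c != 0) cn (esum R S (fun x => [ffun i => ind (G i).[x]]) c) ^+ s <= del^-1 * (1 - del) ^+ (s - 2 * M * M.+1) * #|S|%:R ^+ s.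
Proof.
pose N := (D.+1 ^ M).+1; pose B := (8 * N ^ M)%N; pose b := (M * (M * (N * D)))%N.
pose T := M.+1; pose BB : R := 2 ^+ (2 * T) * (2 * (N ^ M)%N%:R + (4 * b.+1%:R) ^+ (2 * T)).
have BB0 : 0 <= BB by rewrite// ?mulr_ge0.
pose D0 : R := 20 * M.+1%:R * (B + 2)%:R ^+ 2 + BB.
have D01 : 20 * M.+1%:R * (B + 2)%:R ^+ 2 <= D0 by rewrite lerDl.
have D02 : BB <= D0 by rewrite lerDr.
have M1 : 1 <= M.+1%:R :> R by rewrite ler1n.
have B2 : 1 <= (B + 2)%:R :> R by rewrite ler1n addn2.
have D00 : 20 <= D0.
 apply: le_trans D01; rewrite -mulrA ler_peMr// mulr_ege1// expr_ge1//.
have D0p : 0 < D0 by lra.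
exists (D0^-1).
 by rewrite invr_gt0 invf_le1; clear - D00; lra.
pose D' := ((B + 2) * D).+1.
pose P0 := (40 * b.+1 + 20 * M.+1 * D.+1 + 3 + (D' + (B + 2) * (30 * D' + 45 * D' ^ 2).+1))%N.
exists P0 => p E iota G th S g ind pp hp hD G0 r1 r2 hS hg hgm hm pS.
set L := fun x => _; set n := #|S| in pS *.
have p2 : (2 < p)%N by move: hp; clear; lia.
have p1 : (1 < p.-1)%N by rewrite -subn1 ltn_subRL.
have p40 : (40 * b.+1 <= p)%N by move: hp; rewrite /P0; clear; lia.
have pD : (20 * (M.+1 * D.+1) < p)%N by move: hp; rewrite /P0; clear; lia.
have pD' : (D' + (B + 2) * (30 * D' + 45 * D' ^ 2).+1 < p)%N by move: hp; rewrite /P0; clear; lia.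
have n19 : (19 * p <= 20 * n)%N by move: pD pS; clear; nia.
have n0 : (0 < n)%N by move: n19 p2; clear; lia.
have nr : 0 < n%:R by [].
have pr : 0 < p%:R :> R by rewrite ltr0n prime_gt0.
have pM : (p ^ M)%N%:R <= 2 * n%:R ^+ M :> R.
 have x1 : 0 <= (D.+1%:R / p%:R : R) <= 1.
  rewrite divr_ge0//= ler_pdivrMr// mul1r ler_nat; move: pD; clear; nia.
 have h := bern M x1.
 have h2 : 1/2 <= 1 - M%:R * (D.+1%:R / p%:R) :> R.
  have : M%:R * (D.+1%:R / p%:R) <= 1/2 :> R.
   rewrite mulrA ler_pdivrMr//.
   have : (2 * (M * D.+1))%N%:R <= p%:R :> R by rewrite ler_nat; move: pD; clear; nia.
   rewrite natrM; clear; lra.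
  clear; lra.
 have h3 : (1 - D.+1%:R / p%:R) * p%:R <= n%:R :> R.
  rewrite mulrBl mul1r divfK ?gt_eqF// lerBlDr -natrD ler_nat//.
 have h4 : ((1 - D.+1%:R / p%:R) * p%:R) ^+ M <= n%:R ^+ M :> R.
  by apply: lerXn2r; rewrite ?nnegrE// mulr_ge0// subr_ge0; case/andP: x1.
 rewrite exprMn in h4; rewrite natrX.
 have : 1/2 * p%:R ^+ M <= n%:R ^+ M :> R.
  apply: le_trans h4; rewrite ler_wpM2r//; exact: le_trans h2 h.
 clear; lra.
have r1' i : (map_poly iota (G i)).[th i] = 0.
 by apply/eqP; rewrite -[_ == 0]/(root _ _) -dvdp_XsubCl XsubC_dvd ?map_poly_eq0// r1.
have [f [Xb [hX hf hfn hs]]] := esum_good R pp p2 hD (ltnSn _) G0 r1' r2 hS hg hm.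
have large : (#|[set c | ((1 - (20 * M.+1%:R)^-1) * n%:R <= cn (esum R S L c) :> R)%R]%SET| <= B)%N.
 apply: (@esum_large R p M N b n Xb S L f) => //; first exact: prime_gt0.
 by apply: leq_trans hX _; rewrite /b !mulnA.
have gap c : c != 0 -> cn (esum R S L c) <= (1 - D0^-1) * n%:R.
 move=> c0; rewrite leNgt; apply/negP => /ltW hc.
 have js j : (j < B + 2)%N -> (1 - (20 * M.+1%:R)^-1) * n%:R <= cn (esum R S L (c *+ j)).
  move=> jB; apply: le_trans (esum_pow j hc); rewrite ler_pM2r// lerD2l lerN2 ler_pdivrMr//.
  rewrite ler_pdivlMl//; apply: le_trans D01; rewrite ler_wpM2l ?mulr_ge0//.
  by apply: lerXn2r; rewrite ?nnegrE// ler_nat ltnW.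
 have [i [j [ij e]]] : exists i j : nat, (i < j < B + 2)%N /\ c *+ i = c *+ j.
  pose F (j : 'I_(B + 2)) := c *+ j.
  have /injectivePn [i [j ij e]] : ~~ injectiveb F.
   apply/negP => /injectiveP iF; have := card_imset predT iF; rewrite card_ord.
   have : (#|[set F j | j in predT]%SET| <= B)%N.
    apply: leq_trans large; apply: subset_leq_card; apply/fintype.subsetP => x /finset.imsetP [j _ ->].
    by rewrite finset.in_set; apply: js.
   by move=> h1 h2; move: h1; rewrite h2 addn2 ltnNge leqnSn.
  have [lt|gt|eq] := ltngtP i j; [exists i, j|exists j, i|]; rewrite ?lt ?gt ?ltn_ord//.
  by case/negP: ij; apply/eqP/val_inj.
 have ex : exists d, (0 < d)%N && (c *+ d == 0).
  exists (j - i)%N; case/andP: ij => ij _; rewrite subn_gt0 ij mulrnBr ?(ltnW ij)// e subrr eqxx//.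
 case: (ex_minnP ex) => d /andP[d0 /eqP cd] dmin.
 have dB : (d < B + 2)%N.
  case/andP: ij => ij jB; apply: leq_ltn_trans jB; apply: leq_trans (leq_subr i j); apply: dmin.
  by rewrite subn_gt0 ij mulrnBr ?(ltnW ij)// e subrr eqxx.
 have d1 : (1 < d)%N.
  rewrite ltn_neqAle d0 andbT; apply/eqP => d1; case/negP: c0; by rewrite -[c]mulr1n d1 cd.
 have ch : c *+ p.-1 = 0.
  by apply/ffunP => k; rewrite ffunMnE ffunE -mulr_natr pchar_Zp// mulr0.
 have dp : (d %| p.-1)%N.
  rewrite /dvdn; apply/eqP; apply: contrapT => /eqP; rewrite -lt0n => r0.
  have := dmin (p.-1 %% d)%N; rewrite r0 => h.
  have : (d <= p.-1 %% d)%N.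
   apply: h; apply/eqP; apply: (addrI (c *+ (p.-1 %/ d * d))).
   by rewrite -mulrnDr -divn_eq mulnC mulrnA cd mul0rn addr0.
  by rewrite leqNgt ltn_pmod.
 have S0 : (0 < #|S|)%N by [].
 have js2 j' : (j' < d)%N -> 19 / 20 * n%:R <= cn (esum R S L (c *+ j')).
  move=> jd; apply: le_trans (js j' (ltn_trans jd dB)); rewrite ler_pM2r//.
  have : M.+1%:R^-1 <= 1 :> R by rewrite invf_le1.
  rewrite invfM; move: (M.+1%:R^-1) => z; clear; lra.
 have [x0 hx0] := order_mass d0 cd S0 js2.
 have hst := @stepanov_const p E iota M D G th S g ind c d D' x0 pp p2 hD G0 r1 r2 hS hg hgm c0 d1 dp cd.
 have {hst} : (15 * #|[set x in S | dotz c (L x) == dotz c (L x0)]| <= 11 * p)%N.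
  apply: hst; first by rewrite ltnS leq_mul2r ltnW// orbT.
  apply: leq_ltn_trans pD'; rewrite leq_add2l leq_mul2r (ltnW dB) orbT//.
 move: hx0; rewrite -/n; move: #|_| n19 n0 => z; clear; lia.
split=> // s hs2.
have mom : \sum_c cn (esum R S L c) ^+ (2 * M * T) <= D0 * n%:R ^+ (2 * M * T).
 apply: (@le_trans _ _ (BB * n%:R ^+ (2 * M * T))); last by rewrite ler_wpM2r// exprn_ge0.
 (* The exceptional tuples save a factor [p] over all tuples; raised to the power [2 * T] with
    [T = M.+1], this saving pays for summing over the [p.-1 ^ M] characters. *)
 have X4 : Xb%:R <= 4 * b.+1%:R * n%:R ^+ M / p%:R :> R.
  rewrite ler_pdivlMr//; apply: (@le_trans _ _ (b%:R * (p ^ M)%N%:R)).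
   by rewrite -!natrM ler_nat; apply: leq_trans hX _; rewrite /b !mulnA.
  have := ler_wpM2l (ler0n R b) pM; move=> h; apply: (le_trans h).
  rewrite mulrA ler_wpM2r//; have : b%:R <= b.+1%:R :> R by rewrite ler_nat.
  have : 0 <= b.+1%:R :> R by []. clear; lra.
 have pt c : cn (esum R S L c) ^+ (2 * M * T) <= 2 ^+ (2 * T) * ((n%:R ^+ M) ^+ (2 * M) * cn (f c) ^+ 2 + Xb%:R ^+ (2 * T)).
  have a0 := cn_ge0 (f c).
  have h4 : cn (esum R S L c) ^+ M <= cn (f c) + Xb%:R.
   rewrite -cnX (_ : esum R S L c ^+ M = f c - (f c - esum R S L c ^+ M)); last by ring.
   by apply: le_trans (cnB _ _) _; rewrite lerD2l.
  rewrite (_ : 2 * M * T = M * (2 * T))%N; last by rewrite [(2 * M)%N]mulnC mulnA.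
  rewrite exprM; apply: (@le_trans _ _ ((cn (f c) + Xb%:R) ^+ (2 * T))).
   by apply: lerXn2r; rewrite ?nnegrE// addr_ge0.
  apply: le_trans (powD2 (2 * T) a0 (ler0n R Xb)) _; rewrite ler_pM2l// lerD2r.
  rewrite (_ : 2 * T = 2 * M + 2)%N; last by rewrite mulnS addnC.
  rewrite exprD ler_wpM2r//.
  by apply: lerXn2r; rewrite ?nnegrE//.
 apply: le_trans (ler_sum _ (fun c _ => pt c)) _.
 rewrite -mulr_sumr big_split -mulr_sumr sumr_const -mulrA ler_pM2l// mulrDl.
 have nT : n%:R ^+ (2 * M * T) = (n%:R ^+ M) ^+ (2 * M) * (n%:R ^+ M) ^+ 2 :> R.
  by rewrite -exprD -exprM; congr (_ ^+ _); rewrite /T; clear; nia.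
 apply: lerD.
  apply: (@le_trans _ _ ((n%:R ^+ M) ^+ (2 * M) * (2 * n%:R ^+ M * (n%:R ^+ M * (N ^ M)%N%:R)))).
   rewrite ler_wpM2l//; apply: (le_trans hs).
   rewrite !natrM; apply: ler_pM; rewrite//; last by rewrite natrX.
   by apply: le_trans pM; rewrite !natrX lerXn2r ?nnegrE// ler_nat leq_pred.
  by rewrite nT; apply: eq_ler; ring.
 have zc : #|{ffun 'I_M -> 'Z_(p.-1)}| = (p.-1 ^ M)%N.
  by rewrite card_ffun !card_ord; congr (_ ^ M)%N; exact: Zp_cast.
 rewrite zc -[leLHS]mulr_natl; apply: (@le_trans _ _ (p%:R ^+ (2 * T) * Xb%:R ^+ (2 * T))).
  rewrite ler_wpM2r// natrX; apply: (@le_trans _ _ (p%:R ^+ M)).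
   by apply: lerXn2r; rewrite ?nnegrE// ler_nat leq_pred.
  by apply: ler_weXn2l; [rewrite ler1n prime_gt0|rewrite /T; clear; lia].
 rewrite -exprMn (_ : 2 * M * T = M * (2 * T))%N; last by rewrite [(2 * M)%N]mulnC mulnA.
 have -> : n%:R ^+ (M * (2 * T)) = (n%:R ^+ M) ^+ (2 * T) :> R by rewrite exprM.
 rewrite -exprMn; apply: lerXn2r; rewrite ?nnegrE//.
 by move: X4; rewrite ler_pdivlMr// mulrC.
have x0 : 0 <= 1 - D0^-1 by rewrite subr_ge0 invf_le1; clear - D00; lra.
apply: (@le_trans _ _ (\sum_(c : {ffun 'I_M -> 'Z_(p.-1)} | c != 0) ((1 - D0^-1) * n%:R) ^+ (s - 2 * M * M.+1) * cn (esum R S L c) ^+ (2 * M * T))).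
 apply: ler_sum => c c0; rewrite -{1}(subnK hs2) exprD ler_wpM2r//.
 by apply: lerXn2r; rewrite ?nnegrE ?gap//.
rewrite -mulr_sumr exprMn invrK.
have : \sum_(c : {ffun 'I_M -> 'Z_(p.-1)} | c != 0) cn (esum R S L c) ^+ (2 * M * T) <= D0 * n%:R ^+ (2 * M * T).
 apply: le_trans mom; rewrite [leRHS](bigID (fun c => c != 0)) lerDl// => c _.
move=> h; have k0 : 0 <= (1 - D0^-1) ^+ (s - 2 * M * M.+1) * n%:R ^+ (s - 2 * M * M.+1) by [].
apply: le_trans (ler_wpM2l k0 h) _; apply: eq_ler.
have -> : n%:R ^+ s = n%:R ^+ (s - 2 * M * M.+1) * n%:R ^+ (2 * M * T) :> R by rewrite -exprD subnK.
move: ((1 - D0^-1) ^+ (s - 2 * M * M.+1)) (n%:R ^+ (s - 2 * M * M.+1)) (n%:R ^+ (2 * M * T)) => u v w; ring.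
Qed.

(** * Reduction modulo a prime l *)

Lemma intFp_eq0 l (z : int) : prime l -> ((z%:~R : 'F_l) == 0) = (l %| `|z|)%N.
Proof.
move=> pl; have h n : ((n%:R : 'F_l) == 0) = (l %| n)%N by rewrite (dvdn_pcharf (pchar_Fp pl)).
by case: z => n; rewrite ?oppr_eq0 h.
Qed.
Definition red l (p : {poly int}) : {poly 'F_l} := map_poly (intr : int -> 'F_l) p.
Lemma red_size l p : prime l -> p != 0 -> (`|lead_coef p| < l)%N -> size (red l p) = size p /\ red l p != 0.
Proof.
move=> pl p0 lp; have h : ((lead_coef p)%:~R : 'F_l) != 0.
 by rewrite intFp_eq0// gtnNdvd// absz_gt0 lead_coef_eq0.
have e : size (red l p) = size p by apply: size_map_poly_id0.
by split=> //; rewrite -size_poly_gt0 e size_poly_gt0.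
Qed.
(** A Bezout relation over the integers has a nonzero constant on its right-hand side, and this
    constant stays invertible modulo every larger prime. *)
Lemma coprimep_red p q : coprimep p q -> exists N : nat, forall l, prime l -> (N < l)%N -> coprimep (red l p) (red l q).
Proof.
move=> /Pdiv.Idomain.Bezout_coprimepP [[u v] /eqpP [[c1 c2] /andP[c10 c20] e]].
exists `|c2|%N => l pl Nl; apply/Bezout_eq1_coprimepP.
have c2l : (c2%:~R : 'F_l) != 0 by rewrite intFp_eq0// gtnNdvd// absz_gt0.
have := congr1 (red l) e; rewrite /red !linearZ_LR rmorphD !rmorphM/= rmorph1 => e2.
exists ((c2%:~R)^-1 *: (c1%:~R *: red l u), (c2%:~R)^-1 *: (c1%:~R *: red l v)) => /=.
rewrite -!scalerAl -!scalerDr e2 scalerA mulVf// scale1r//.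
Qed.
Lemma irr_size (G : {poly int}) : primitive G -> irreducible_elt G -> (1 < size G)%N.
Proof.
move=> pG [G0 uG _]; rewrite ltn_neqAle size_poly_gt0 G0 andbT; apply/negP => /eqP s1.
case/negP: uG; rewrite poly_int_unitE -s1.
by apply/unitrPr; exists (zcontents G); rewrite -expr2 -real_normK ?num_real// pG.
Qed.
(** The primitive part of the gcd with the derivative divides [G] over the integers. By
    irreducibility it is constant or of full degree, and the derivative has smaller degree. *)
Lemma irr_sep (G : {poly int}) : primitive G -> irreducible_elt G -> coprimep G G^`().
Proof.
move=> pG iG; have s1 := irr_size pG iG; case: iG => G0 _ iG.
have d0 : gcdp G G^`() != 0 by rewrite gcdp_eq0 negb_and G0.
have G'0 : G^`() != 0.
 apply/eqP => e; have := congr1 (fun p : {poly int} => p`_(size G).-2) e.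
 rewrite coef_deriv coef0 => /eqP; rewrite mulrn_eq0/= (_ : (size G).-2.+1 = (size G).-1); last by case: (size G) s1 => [|[]].
 by rewrite lead_coef_eq0 (negbTE G0).
have /dvdpP_int [t Gt] : gcdp G G^`() %| G by rewrite dvdp_gcdl.
case: (iG _ _ Gt).
 by rewrite poly_int_unitE size_zprimitive => /andP[h _].
rewrite poly_int_unitE => /andP[/eqP t1 _].
have t0 : t != 0 by rewrite -size_poly_gt0 t1.
have sG : size G = size (gcdp G G^`()).
 rewrite {1}Gt size_mul ?zprimitive_eq0// t1 addn1 size_zprimitive//.
have := dvdp_leq G'0 (dvdp_gcdr G G^`()); rewrite -sG => h.
by have := lt_size_deriv G0; rewrite ltnNge h.
Qed.
Lemma map_deriv (A B : comNzRingType) (f : {rmorphism A -> B}) (p : {poly A}) : map_poly f p^`() = (map_poly f p)^`().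
Proof. by apply/polyP => i; rewrite coef_deriv !coef_map/= coef_deriv rmorphMn. Qed.
Lemma red_deriv l (p : {poly int}) : red l p^`() = (red l p)^`().
Proof. by apply/polyP => i; rewrite coef_deriv !coef_map/= coef_deriv rmorphMn. Qed.
Lemma simple_mup (F : fieldType) (p : {poly F}) x : p != 0 -> root p x -> p^`().[x] != 0 -> mup x p = 1%N.
Proof.
move=> p0 rx d; apply/eqP; rewrite eqn_leq -XsubC_dvd// dvdp_XsubCl rx andbT leqNgt mup_geq//.
apply/negP => /dvdpP [r e]; case/negP: d; by rewrite e derivM deriv_exp !hornerE subrr/= !(mulr0, mul0r, addr0, add0r).
Qed.
Lemma common_bound (I : finType) (P : I -> nat -> Prop) : (forall i, exists N, forall l, prime l -> (N < l)%N -> P i l) ->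
 exists N, forall l, prime l -> (N < l)%N -> forall i, P i l.
Proof.
move=> /choice [f hf]; exists (\max_i f i)%N => l pl hl i; apply: hf => //.
by apply: leq_ltn_trans hl; apply: leq_bigmax.
Qed.
Lemma coprimep_nroot (F : fieldType) (p q : {poly F}) x : coprimep p q -> root p x -> q.[x] != 0.
Proof.
move=> c rp; have := coprimep_root c; move=> /(_ x rp); by [].
Qed.
(** Finitely many coprimality relations survive modulo every large [l]. The roots [th j] in an
    algebraic closure serve as test points: [th j] is a simple root of [G j] and no root of the
    others. *)
Lemma local_data M (G : 'I_M -> {poly int}) : (forall j, primitive (G j) /\ irreducible_elt (G j)) ->
 (forall j j', j != j' -> coprimep (G j) (G j')) ->
 exists N, forall l, prime l -> (N < l)%N -> (forall j, size (red l (G j)) = size (G j) /\ red l (G j) != 0) /\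
  exists E (iota : {rmorphism 'F_l -> E}) (th : 'I_M -> E),
  [/\ forall i, mup (th i) (map_poly iota (red l (G i))) = 1%N,
    forall i i', i' != i -> (map_poly iota (red l (G i'))).[th i] != 0 &
    forall i, root (map_poly iota (red l (G i))) (th i) /\ (map_poly iota (red l (G i))^`()).[th i] != 0].
Proof.
move=> hG hc.
have [N1 h1] : exists N, forall l, prime l -> (N < l)%N -> forall j, size (red l (G j)) = size (G j) /\ red l (G j) != 0.
 apply: common_bound => j; exists `|lead_coef (G j)|%N => l pl hl; apply: red_size => //.
 by case: (hG j) => _ [].
have [N2 h2] : exists N, forall l, prime l -> (N < l)%N -> forall j, coprimep (red l (G j)) (red l (G j)^`()).
 by apply: common_bound => j; apply: coprimep_red; apply: irr_sep; case: (hG j).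
have [N3 h3] : exists N, forall l, prime l -> (N < l)%N -> forall jj : 'I_M * 'I_M, jj.1 != jj.2 -> coprimep (red l (G jj.1)) (red l (G jj.2)).
 apply: common_bound => -[j j']; have [->|ne] := eqVneq j j'; first by exists 0%N.
 have [N hN] := coprimep_red (hc _ _ ne); exists N => l pl hl _; exact: hN.
exists (N1 + N2 + N3)%N => l pl hl.
have l1 : (N1 < l)%N by apply: leq_ltn_trans hl; rewrite -addnA leq_addr.
have l2 : (N2 < l)%N by apply: leq_ltn_trans hl; rewrite addnAC leq_addl.
have l3 : (N3 < l)%N by apply: leq_ltn_trans hl; rewrite leq_addl.
split; first exact: h1.
have [E [iota _]] := countable_algebraic_closure 'F_l.
have /choice [th hth] : forall i, exists t : E, root (map_poly iota (red l (G i))) t.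
 move=> i; apply/closed_rootP; rewrite size_map_poly (h1 l pl l1 i).1.
 by have := irr_size (hG i).1 (hG i).2; rewrite ltn_neqAle eq_sym => /andP[].
have hd i : (map_poly iota (red l (G i))^`()).[th i] != 0.
 have := h2 l pl l2 i; rewrite -(coprimep_map iota) => c; have := coprimep_nroot c (hth i).
 by rewrite red_deriv.
exists E, iota, th; split.
- move=> i; apply: simple_mup; [by rewrite map_poly_eq0 (h1 l pl l1 i).2|exact: hth|].
 by rewrite -map_deriv.
- move=> i i' ii'; have := h3 l pl l3 (i, i'); rewrite eq_sym => /(_ ii'); rewrite -(coprimep_map iota) => c.
 exact: coprimep_nroot c (hth i).
- by [].
Qed.
(** The system is diagonalized by the Smith form. It serves over ['Z_(l.-1)], where coprimality of
    [l - 1] with the last invariant factor makes the [d i] invertible, so that nontrivial characters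
    of the [F i] stay nontrivial on the [G j]; and over ['F_l], for linear relations between
    logarithmic derivatives. *)
Lemma smith_inj (A : comNzRingType) m M (mu : 'I_m -> 'I_M -> nat) (d : nat -> nat) (P : 'M[int]_M) (Q : 'M[int]_m) (c : 'I_m -> A) : (m <= M)%N ->
 Q \in unitmx -> P *m (\matrix_(j, i) (mu i j)%:Z) *m Q = \matrix_(i, j) ((d i)%:Z *+ (i == j :> nat)) ->
 (forall i (x : A), (i < m)%N -> (d i)%:R * x = 0 -> x = 0) ->
 (forall j, \sum_i c i *+ mu i j = 0) -> forall i, c i = 0.
Proof.
move=> mM uQ e hd hc.
pose cv : 'cV[A]_m := \col_i c i; pose rm (n p : nat) (X : 'M[int]_(n, p)) : 'M[A]_(n, p) := map_mx (intr : int -> A) X.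
have rM n p r (X : 'M[int]_(n, p)) (Y : 'M[int]_(p, r)) : rm _ _ (X *m Y) = rm _ _ X *m rm _ _ Y by rewrite /rm map_mxM.
pose w := rm _ _ (invmx Q) *m cv.
have cw : cv = rm _ _ Q *m w.
 by rewrite mulmxA -rM mulmxV// /rm map_mx1 mul1mx.
have A0 : rm _ _ (\matrix_(j, i) (mu i j)%:Z) *m cv = 0.
 apply/matrixP => j k; rewrite !mxE -[RHS](hc j); apply: eq_bigr => i _.
 by rewrite !mxE mulr_natl.
have Dw : rm _ _ (\matrix_(i < M, j < m) ((d i)%:Z *+ (i == j :> nat))) *m w = 0.
 by rewrite -e !rM -!mulmxA -cw A0 mulmx0.
have w0 : w = 0.
 apply/matrixP => i k; rewrite [RHS]mxE; apply: (hd i) => //.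
 have := congr1 (fun X : 'cV[A]_M => X (widen_ord mM i) k) Dw; rewrite !mxE (bigD1 i)//= big1 ?addr0 => [|j ji].
  by rewrite !mxE eqxx.
 have ne : (nat_of_ord i == nat_of_ord j) = false by rewrite val_eqE eq_sym (negbTE ji).
 by rewrite !mxE ne mul0r.
move=> i; have := congr1 (fun X : 'cV[A]_m => X i 0) cw; by rewrite w0 mulmx0 !mxE.
Qed.

(** * Logarithmic derivatives and local counts *)

Lemma logder_prod (F : fieldType) (I : finType) (f : I -> {poly F}) x : (forall i, (f i).[x] != 0) ->
 (\prod_i f i)^`().[x] / (\prod_i f i).[x] = \sum_i (f i)^`().[x] / (f i).[x].
Proof.
move=> h; suff [//] : (\prod_i f i)^`().[x] / (\prod_i f i).[x] = \sum_i (f i)^`().[x] / (f i).[x] /\ (\prod_i f i).[x] != 0.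
elim/big_rec2: _ => [|i s p _ [<- p0]]; first by rewrite derivC horner0 hornerC mul0r oner_neq0.
split; last by rewrite hornerM mulf_neq0.
by rewrite derivM !hornerE; field.
Qed.
Lemma logder_exp (F : fieldType) (p : {poly F}) x n : p.[x] != 0 -> (p ^+ n)^`().[x] / (p ^+ n).[x] = n%:R * (p^`().[x] / p.[x]).
Proof.
move=> p0; elim: n => [|n IH]; first by rewrite derivC horner0 !mul0r.
have pn : (p ^+ n).[x] != 0 by rewrite horner_exp expf_neq0.
have -> : n.+1%:R * (p^`().[x] / p.[x]) = n%:R * (p^`().[x] / p.[x]) + p^`().[x] / p.[x] by rewrite -[n.+1%:R]natr1 mulrDl mul1r.
rewrite -IH exprS derivM hornerD !hornerM.
by field.
Qed.
Lemma card_roots (F : finFieldType) (p : {poly F}) n : p != 0 -> (size p <= n.+1)%N -> (#|[set x | root p x]%SET| <= n)%N.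
Proof.
move=> p0 sp; rewrite cardE -ltnS; apply: leq_trans sp; apply: max_poly_roots => //; last exact: enum_uniq.
by apply/allP => x; rewrite mem_enum finset.in_set.
Qed.
(** The point 0 is excluded too, because the residues must be units modulo the powers of [l]. *)
Definition gset l M (G : 'I_M -> {poly int}) : {set 'F_l} := [set x | (x != 0) && [forall j, (red l (G j)).[x] != 0]]%SET.
Lemma gsetP l M (G : 'I_M -> {poly int}) x : x \in gset l G -> x != 0 /\ forall j, (red l (G j)).[x] != 0.
Proof. by rewrite finset.in_set => /andP[x0 /forallP]. Qed.
Lemma size_prod_le (F : idomainType) (I : finType) (f : I -> {poly F}) : (size (\prod_i f i)%R <= (\sum_i (size (f i)).-1).+1)%N.
Proof.
elim/big_rec2: _ => [|i n p _ IH]; first by rewrite size_poly1.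
apply: leq_trans (size_polyMleq _ _) _; case: (size (f i)) => [|a]; lia.
Qed.
Lemma card_gset l M D (G : 'I_M -> {poly int}) : prime l -> (forall j, size (red l (G j)) = size (G j) /\ red l (G j) != 0) ->
 (\sum_j (size (G j)).-1 <= D)%N -> (l <= #|gset l G| + D.+1)%N.
Proof.
move=> pl hG hD; pose P := 'X * \prod_j red l (G j).
have P0 : P != 0 by rewrite mulf_neq0 ?polyX_eq0//; apply/prodf_neq0 => j _; case: (hG j).
have sP : (size P <= D.+2)%N.
 rewrite /P mulrC size_mulX; last by apply/prodf_neq0 => j _; case: (hG j).
 rewrite ltnS; apply: leq_trans (size_prod_le _) _; apply: leq_trans hD.
 by apply: leq_sum => j _; rewrite (hG j).1.
have := card_roots P0 sP; set Z := [set x | _]%SET => hZ.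
have : (#|(gset l G :|: Z)%SET| <= #|gset l G| + #|Z|)%N by rewrite cardsU leq_subr.
have -> : (gset l G :|: Z)%SET = [set: 'F_l]%SET.
 apply/setP => x; rewrite !finset.in_set rootM rootX.
 have [//|x0] := eqVneq x 0; case: (boolP [forall j, _]) => //= /forallPn [j]; rewrite negbK => /eqP h.
 by rewrite /root horner_prod (bigD1 j)//= h.
rewrite cardsT (card_Fp pl) => h; apply: leq_trans h _; by rewrite leq_add2l.
Qed.
(* Linear relations between logarithmic derivatives are detected at the roots of the G j. *)
Lemma logder_indep l M D (G : 'I_M -> {poly int}) E (iota : {rmorphism 'F_l -> E}) (th : 'I_M -> E) (k : 'I_M -> 'F_l) j0 : prime l ->
 (forall j, size (red l (G j)) = size (G j) /\ red l (G j) != 0) -> (\sum_j (size (G j)).-1 <= D)%N ->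
 (forall i i', i' != i -> (map_poly iota (red l (G i'))).[th i] != 0) ->
 (forall i, root (map_poly iota (red l (G i))) (th i) /\ (map_poly iota (red l (G i))^`()).[th i] != 0) -> k j0 != 0 ->
 (#|[set x in gset l G | (\sum_j k j * ((red l (G j))^`().[x] / (red l (G j)).[x]) == 0)%R]%SET| <= D)%N.
Proof.
move=> pl hG hD nr rr k0.
pose P := \sum_j k j *: ((red l (G j))^`() * \prod_(i | i != j) red l (G i)).
have P0 : P != 0.
 apply/eqP => e; have := congr1 (fun p => (map_poly iota p).[th j0]) e.
 rewrite rmorph0 horner0 rmorph_sum horner_sum (bigD1 j0)//= [X in _ + X]big1 ?addr0 => [|j jj]; last first.
  rewrite map_polyZ rmorphM hornerZ hornerM rmorph_prod horner_prod (bigD1 j0) 1?eq_sym//=.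
  by case: (rr j0) => /eqP -> _; rewrite mul0r !mulr0.
 rewrite map_polyZ rmorphM /= hornerZ hornerM rmorph_prod horner_prod => /eqP; apply/negP.
 rewrite !mulf_neq0 ?fmorph_eq0//; first by case: (rr j0).
 by apply/prodf_neq0 => i ij; apply: nr.
have sP : (size P <= D.+1)%N.
 apply: leq_trans (size_sum _ _ _) _; apply/bigmax_leqP => j _.
 apply: leq_trans (size_scale_leq _ _) _; apply: leq_trans (size_polyMleq _ _) _.
 have h1 : (size (red l (G j))^`() <= (size (G j)).-1)%N by rewrite -(hG j).1; exact: size_poly.
 have h2 : (size (\prod_(i | i != j) red l (G i))%R <= (\sum_(i | i != j) (size (G i)).-1).+1)%N.
  rewrite (eq_bigr (fun i => (size (red l (G i))).-1)) => [|i _]; last by rewrite (hG i).1.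
  elim/big_rec2: _ => [|i n p _ IH]; first by rewrite size_poly1.
  apply: leq_trans (size_polyMleq _ _) _; move: IH; case: (size (red l (G i))) => [|a]; move: (size p) => b; clear; lia.
 move: hD; rewrite (bigD1 j)//=; move: h1 h2.
 set a := size ((red l (G j))^`()); set b := size (\prod_(i | i != j) red l (G i))%R; set s := (\sum_(i | i != j) (size (G i)).-1)%N.
 clearbody a b s; move: (size (G j)).-1 => g; clear; lia.
apply: leq_trans (card_roots P0 sP); apply: subset_leq_card; apply/fintype.subsetP => x.
rewrite !finset.in_set => /andP[/andP[x0 /forallP hx] /eqP e]; rewrite /root horner_sum.
have := congr1 (fun z => z * \prod_j (red l (G j)).[x]) e; rewrite mul0r mulr_suml => e2; apply/eqP; rewrite -[RHS]e2.
apply: eq_bigr => j _; rewrite hornerZ hornerM horner_prod [in RHS](bigD1 j)//=; field; exact: hx.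
Qed.
(** The rows are chosen one by one: [f x] is a nonzero column annihilated by the rows already there,
    and any point of [S] off its at most [D] zeros gives a new independent row. *)
Lemma nonsing_count (F : finFieldType) m n D (S : {set F}) (v : F -> 'rV[F]_m) : #|S| = n ->
 (forall lam : 'cV[F]_m, lam != 0 -> (#|[set x in S | (v x *m lam == 0)%R]%SET| <= D)%N) ->
 forall r, (r <= m)%N -> ((n - D) ^ r <= #|[set x : {ffun 'I_r -> F} | (x \in ffun_on (mem S)) && row_free (\matrix_(a < r) v (x a))]%SET|)%N.
Proof.
move=> cS hv; elim=> [|r IH] rm.
 rewrite card_gt0; apply/set0Pn; exists [ffun a : 'I_0 => 0]; rewrite finset.in_set; apply/andP; split.
  by apply/ffun_onP => -[].
 by apply: inj_row_free => w _; apply/rowP => -[].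
set A := [set x | _]%SET; set A' := [set x | _]%SET in IH.
have [f hf] : {f : {ffun 'I_r -> F} -> 'cV[F]_m | forall x, x \in A' -> f x != 0 /\ (\matrix_(a < r) v (x a)) *m f x = 0}.
 apply/cid; suff /choice [f hf] : forall x : {ffun 'I_r -> F}, exists lam : 'cV[F]_m, x \in A' -> lam != 0 /\ (\matrix_(a < r) v (x a)) *m lam = 0 by exists f.
 move=> x; set V := \matrix_(a < r) v (x a).
 have : cokermx V != 0.
  rewrite -mxrank_eq0 mxrank_coker -lt0n subn_gt0; exact: leq_ltn_trans (rank_leq_row V) rm.
 move=> c0; have [j hj] : exists j, col j (cokermx V) != 0.
  apply: contrapT => H; case/negP: c0; apply/eqP/matrixP => i j.
  have /eqP/colP/(_ i) : col j (cokermx V) == 0 by apply: contrapT => /negP h; apply: H; exists j.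
  by rewrite !mxE.
 by exists (col j (cokermx V)) => _; split=> //; rewrite colE mulmxA mulmx_coker mul0mx.
pose ext (x : {ffun 'I_r -> F}) y : {ffun 'I_r.+1 -> F} := [ffun a => if unlift ord_max a is Some b then x b else y].
have extm x y : ext x y ord_max = y by rewrite ffunE unlift_none.
have extl x y b : ext x y (lift ord_max b) = x b by rewrite ffunE liftK.
pose good x := [set y in S | v y *m f x != 0]%SET.
have cg x : x \in A' -> (n - D <= #|good x|)%N.
 move=> xA; have := hv _ (hf x xA).1; rewrite leq_subLR -cS; set B := [set y in S | _]%SET => hB.
 apply: leq_trans (leq_add hB (leqnn _)); rewrite -cardsUI; apply: leq_trans (leq_addr _ _); apply: subset_leq_card.
 by apply/fintype.subsetP => y yS; rewrite !finset.in_set yS; case: (_ == 0).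
pose P := [set xy : {ffun 'I_r -> F} * F | (xy.1 \in A') && (xy.2 \in good xy.1)]%SET.
have cP : ((n - D) ^ r.+1 <= #|P|)%N.
 have -> : #|P| = (\sum_(x in A') #|good x|)%N.
  rewrite -sum1_card (eq_bigl (fun xy : {ffun 'I_r -> F} * F => (xy.1 \in A') && (xy.2 \in good xy.1))); last by move=> xy; rewrite finset.in_set.
  rewrite -(pair_big_dep (mem A') (fun x y => y \in good x) (fun _ _ => 1%N)); apply: eq_bigr => x _; by rewrite sum1_card.
 apply: (@leq_trans (\sum_(x in A') (n - D))); last by apply: leq_sum => x; exact: cg.
 by rewrite sum_nat_const expnSr leq_mul2r (IH (ltnW rm)) orbT.
apply: (leq_trans cP).
have inj : {in P &, injective (fun xy => ext xy.1 xy.2)}.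
 move=> [x y] [x' y'] _ _ e; congr pair; last by rewrite -(extm x y) e.
 by apply/ffunP => b; rewrite -(extl x y) e.
rewrite -(card_in_imset inj); apply: subset_leq_card; apply/fintype.subsetP => z /finset.imsetP [[x y]].
rewrite finset.in_set => /andP[xA]; rewrite finset.in_set => /andP[yS hy] ->.
have [f0 fV] := hf x xA; move: xA; rewrite finset.in_set => /andP[xS rf].
rewrite finset.in_set; apply/andP; split.
 apply/ffun_onP => a; case: (unliftP ord_max a) => [b|] ->; rewrite ?extl ?extm//.
 by move/ffun_onP: xS.
apply: inj_row_free => w hw.
have sumE : \sum_(b < r) w 0 (lift ord_max b) *: v (x b) + w 0 ord_max *: v y = 0.
 rewrite -[RHS]hw mulmx_sum_row big_ord_recr; congr (_ + _).
  by apply: eq_bigr => b _; rewrite rowK -(extl x y b); congr (w 0 _ *: v (ext x y _)); apply: val_inj; rewrite/= /bump leqNgt ltn_ord.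
 by rewrite rowK extm.
have wm : w 0 ord_max = 0.
 have := congr1 (fun u => u *m f x) sumE; rewrite mul0mx mulmxDl mulmx_suml big1 ?add0r => [|b _]; last first.
  rewrite -scalemxAl; have := congr1 (fun X => row b X) fV; by rewrite row_mul rowK row0 => ->; rewrite scaler0.
 by rewrite -scalemxAl => /eqP; rewrite scaler_eq0 (negbTE hy) orbF => /eqP.
move: sumE; rewrite wm scale0r addr0 => sE.
have w0 : (\row_b w 0 (lift ord_max b) : 'rV_r) = 0.
 apply: (row_free_inj rf); rewrite mul0mx mulmx_sum_row -[RHS]sE; apply: eq_bigr => b _; by rewrite mxE rowK.
apply/rowP => a; rewrite [RHS]mxE; case: (unliftP ord_max a) => [b|] -> //.
by have /rowP/(_ b) := w0; rewrite !mxE.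
Qed.

Lemma red_horner l (p : {poly int}) (z : int) : (red l p).[z%:~R] = (p.[z])%:~R.
Proof. by rewrite horner_map. Qed.
Lemma ind_pow (p h : nat) (ind : 'F_p -> 'Z_h) (y : 'F_p) k :
 (forall y z, y != 0 -> z != 0 -> ind (y * z) = ind y + ind z) -> y != 0 -> ind (y ^+ k) = ind y *+ k.
Proof.
move=> hm y0; elim: k => [|k IH]; last by rewrite exprS hm ?expf_neq0// IH mulrS.
by rewrite mulr0n; apply: (addrI (ind 1)); rewrite -hm// mulr1 addr0.
Qed.
(** Discrete logarithms turn the number of solutions into a Fourier sum over [c]. The term [c = 0]
    is the expected count; the others are sums of [char_gap] at [kap c], the exponents on the [G j]
    induced by the exponents [c] on the [F i]. The condition on [beta] enters as injectivity of
    [kap]. The last item supplies the tuples from which Hensel lifting starts. *)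
Lemma local_count R m M (F : 'I_m -> {poly int}) r (G : 'I_M -> {poly int}) mu (d : nat -> nat) (P : 'M[int]_M) (Q : 'M[int]_m) bt :
 factorization F r G mu -> (m <= M)%N -> (forall i, r i != 0) ->
 Q \in unitmx -> P *m (\matrix_(j, i) (mu i j)%:Z) *m Q = \matrix_(i, j) ((d i)%:Z *+ (i == j :> nat)) ->
 (forall i, (i < m)%N -> (d i %| bt)%N) ->
 exists2 del : R, 0 < del <= 1 & exists D N0 s0 : nat, forall l, prime l -> (N0 < l)%N -> gcdn (l - 1) bt = 1%N ->
 [/\ (l <= #|gset l G| + D.+1)%N,
   forall x i, x \in gset l G -> (red l (F i)).[x] != 0,
   forall b : 'I_m -> 'F_l, (forall i, b i != 0) -> forall s, (s0 <= s)%N ->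
    #|gset l G|%:R ^+ s * (1 - del^-1 * (1 - del) ^+ (s - s0)) <=
    (l.-1 ^ m * #|[set x : {ffun 'I_s -> 'F_l} | (x \in ffun_on (mem (gset l G))) && [forall i, (\prod_j (red l (F i)).[x j] == b i)%R]]%SET|)%N%:R :> R &
   ((#|gset l G| - D) ^ m <= #|[set x : {ffun 'I_m -> 'F_l} | (x \in ffun_on (mem (gset l G))) &&
     row_free (\matrix_(a < m) \row_i ((red l (F i))^`().[x a] / (red l (F i)).[x a])%R)]%SET|)%N].
Proof.
move=> [FE hG cG muG] mM r0 uQ sm hbt; pose D := (\sum_j (size (G j)).-1)%N.
have [del del0 [P0 gap]] := char_gap R M D; have [N1 hN1] := local_data hG cG.
exists del => //; exists D, (P0 + N1 + bt + 3 + \sum_i `|r i|)%N, (2 * M * M.+1)%N => l pl hl gl.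
have lP : (P0 < l)%N by move: hl; clear; lia.
have lN : (N1 < l)%N by move: hl; clear; lia.
have lb : (bt < l)%N by move: hl; clear; lia.
have l2 : (2 < l)%N by move: hl; clear; lia.
have lr i : (`|r i| < l)%N.
 have : (`|r i| <= \sum_i `|r i|)%N by rewrite (bigD1 i)//= leq_addr.
 move: hl; clear; lia.
have h1 : (1 < l.-1)%N by rewrite -subn1 ltn_subRL.
have bt0 : (0 < bt)%N by move: gl; case: (bt) => // ; rewrite gcdn0; move: l2; clear; lia.
have [sG [E [iota [th [t1 t2 t3]]]]] := hN1 l pl lN.
have sD : (\sum_i (size (red l (G i))).-1 <= D)%N by apply: leq_sum => i _; rewrite (sG i).1.
have pS : (l <= #|gset l G| + D.+1)%N := card_gset pl sG (leqnn _).
have rb0 i : ((r i)%:~R : 'F_l) != 0 by rewrite intFp_eq0// gtnNdvd// absz_gt0.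
have FR i : red l (F i) = (r i)%:~R *: \prod_j red l (G j) ^+ mu i j.
 by rewrite /red FE linearZ_LR/= rmorph_prod; congr (_ *: _); apply: eq_bigr => j _; rewrite rmorphXn.
have Gx x j : x \in gset l G -> (red l (G j)).[x] != 0 by move=> /gsetP[].
have FRx i x : (red l (F i)).[x] = (r i)%:~R * \prod_j (red l (G j)).[x] ^+ mu i j.
 by rewrite FR hornerZ horner_prod; congr (_ * _); apply: eq_bigr => j _; rewrite horner_exp.
have Fx x i : x \in gset l G -> (red l (F i)).[x] != 0.
 by move=> xS; rewrite FRx mulf_neq0//; apply/prodf_neq0 => j _; rewrite expf_neq0// Gx.
have [g [ind [gm gi g0 im]]] := dlog pl l2.
have [gapc mom] := gap l E iota (fun j => red l (G j)) th (gset l G) g ind pl lP sD (fun j => (sG j).2) t1 t2 (fun x xS j => Gx x j xS) gi gm im pS.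
split=> //.
- move=> b b0 s ss0.
 pose L x : {ffun 'I_M -> 'Z_(l.-1)} := [ffun j => ind (red l (G j)).[x]].
 pose L' x : {ffun 'I_m -> 'Z_(l.-1)} := [ffun i => ind (red l (F i)).[x]].
 pose kap (c : {ffun 'I_m -> 'Z_(l.-1)}) : {ffun 'I_M -> 'Z_(l.-1)} := [ffun j => \sum_i c i *+ mu i j].
 have L'E x i : x \in gset l G -> L' x i = ind ((r i)%:~R) + \sum_j L x j *+ mu i j.
  move=> xS; rewrite ffunE FRx im//; last by apply/prodf_neq0 => j _; rewrite expf_neq0// Gx.
  rewrite ind_prod// => [|j]; last by rewrite expf_neq0// Gx.
  by congr (_ + _); apply: eq_bigr => j _; rewrite ind_pow ?Gx// ffunE.
 have dE c x : x \in gset l G -> dotz c (L' x) = (\sum_i c i * ind ((r i)%:~R)) + dotz (kap c) (L x).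
  move=> xS; rewrite /dotz (eq_bigr (fun i => c i * ind ((r i)%:~R) + \sum_j (c i *+ mu i j) * L x j)) => [|i _]; last first.
   by rewrite L'E// mulrDr; congr (_ + _); rewrite mulr_sumr; apply: eq_bigr => j _; rewrite mulrnAr mulrnAl.
  rewrite big_split; congr (_ + _); rewrite exchange_big; apply: eq_bigr => j _.
  by rewrite -mulr_suml; congr (_ * _); rewrite ffunE.
 have cE c : cn (esum R (gset l G) L' c) = cn (esum R (gset l G) L (kap c)).
  have -> : esum R (gset l G) L' c = ez R (\sum_i c i * ind ((r i)%:~R)) * esum R (gset l G) L (kap c).
   by rewrite /esum mulr_sumr; apply: eq_bigr => x xS; rewrite dE// ezD.
  by rewrite cnM cn_ez mul1r.
 have kap0 c : kap c = 0 -> c = 0.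
  move=> e; apply/ffunP => i; rewrite [RHS]ffunE.
  apply: (smith_inj mM uQ sm (c := fun i => c i)) => [k x km|j]; last first.
   by have := congr1 (fun f : {ffun 'I_M -> 'Z_(l.-1)} => f j) e; rewrite !ffunE.
  have u : ((d k)%:R : 'Z_(l.-1)) \is a GRing.unit.
   rewrite unitZpE//; apply/eqP; apply/eqP; rewrite -dvdn1 -gl subn1 dvdn_gcd dvdn_gcdl.
   by apply: dvdn_trans (hbt k km); exact: dvdn_gcdr.
  by move=> h; apply: (mulrI u); rewrite mulr0.
 have kapB c c' : kap (c - c') = kap c - kap c'.
  by apply/ffunP => j; rewrite !ffunE -sumrB; apply: eq_bigr => i _; rewrite !ffunE mulrnBl.
 have kinj : injective kap.
  by move=> c c' e; apply/eqP; rewrite -subr_eq0; apply/eqP/kap0; rewrite kapB e subrr.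
 pose b' : {ffun 'I_m -> 'Z_(l.-1)} := [ffun i => ind (b i)].
 set SM := [set x : {ffun 'I_s -> 'F_l} | x \in ffun_on (mem (gset l G))]%SET.
 have ec := esum_count R SM (fun x : {ffun 'I_s -> 'F_l} => \sum_j L' (x j)) b'.
 set W := [set x in SM | _]%SET in ec.
 have zc : ((Zp_trunc l.-1).+2 ^ m = l.-1 ^ m)%N by congr (_ ^ m)%N; exact: Zp_cast.
 rewrite zc in ec.
 have WW : (#|W| <= #|[set x : {ffun 'I_s -> 'F_l} | (x \in ffun_on (mem (gset l G))) && [forall i, (\prod_j (red l (F i)).[x j] == b i)%R]]%SET|)%N.
  apply: subset_leq_card; apply/fintype.subsetP => x; rewrite !finset.in_set => /andP[xS /eqP e]; rewrite xS; apply/forallP => i.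
  have nz j : (red l (F i)).[x j] != 0 by apply: Fx; move/ffun_onP: xS.
  have h : ind (\prod_j (red l (F i)).[x j]) = ind (b i).
   rewrite ind_prod//; have := congr1 (fun f : {ffun 'I_m -> 'Z_(l.-1)} => f i) e; rewrite sum_ffunE ffunE => <-.
   by apply: eq_bigr => j _; rewrite ffunE.
  by rewrite -[X in X == _]gi ?h ?gi//; apply/prodf_neq0 => j _.
 have e1 : \sum_c esum R (gset l G) L' c ^+ s * ez R (- dotz c b') = (l.-1 ^ m * #|W|)%N%:R.
  by rewrite -ec; apply: eq_bigr => c _; rewrite esum_exp.
 have d0 (z : 'Z_(l.-1)) : dotz (0 : {ffun 'I_m -> 'Z_(l.-1)}) b' = 0 by rewrite /dotz big1// => i _; rewrite ffunE mul0r.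
 move: e1; rewrite (bigD1 (0 : {ffun 'I_m -> 'Z_(l.-1)}))//= esum0 (d0 0) oppr0 mulr1 => e1.
 have up : cn (\sum_(c : {ffun 'I_m -> 'Z_(l.-1)} | c != 0) esum R (gset l G) L' c ^+ s * ez R (- dotz c b')) <= #|gset l G|%:R ^+ s * (del^-1 * (1 - del) ^+ (s - 2 * M * M.+1)).
  rewrite mulrC; apply: le_trans (mom s ss0); apply: le_trans (cn_sum _ _ _) _.
  rewrite (eq_bigr (fun c => cn (esum R (gset l G) L (kap c)) ^+ s)) => [|c _]; last by rewrite cnM cn_ez mulr1 cnX cE.
  rewrite (eq_bigl (fun c => c \in [set c : {ffun 'I_m -> 'Z_(l.-1)} | c != 0]%SET)) => [|c]; last by rewrite finset.in_set.
  (* [kap] being injective, the sum over [c != 0] is a part of the sum over all nonzero exponents on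
     the [G j]. *)
  rewrite -(big_imset (fun c => cn (esum R (gset l G) L c) ^+ s) (in2W kinj)).
  rewrite [leRHS](bigID (fun c => c \in (kap @: [set c : {ffun 'I_m -> 'Z_(l.-1)} | c != 0])%SET)).
  rewrite -[leLHS]addr0; apply: lerD => //.
  apply: eq_ler; apply: eq_bigl => c; case: (boolP (c \in (kap @: [set c : {ffun 'I_m -> 'Z_(l.-1)} | c != 0])%SET)) => [/finset.imsetP [a]|_]; last by rewrite andbF.
   rewrite finset.in_set => a0 ->; rewrite andbT; apply/esym; apply: contraNneq a0 => /kap0 ->; by [].
 have : cn (((l.-1 ^ m * #|W|)%N%:R - #|gset l G|%:R ^+ s : R)%:C) <= #|gset l G|%:R ^+ s * (del^-1 * (1 - del) ^+ (s - 2 * M * M.+1)).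
  apply: le_trans up; rewrite RcB RcX !(rmorph_nat (real_complex R)) -e1 [X in cn (X - _)]addrC addrK//.
 rewrite cn_real ler_norml => /andP[h _]; apply: (@le_trans _ _ (l.-1 ^ m * #|W|)%N%:R).
  rewrite mulrBr; move: h; clear; lra.
 by rewrite ler_nat leq_mul2l WW orbT.
- apply: (@nonsing_count _ m #|gset l G| D (gset l G) (fun x => \row_i ((red l (F i))^`().[x] / (red l (F i)).[x])) erefl) => // lam lam0.
 pose k j := \sum_i lam i 0 *+ mu i j.
 have [j0 kj0] : exists j, k j != 0.
  apply: contrapT => H; case/negP: lam0; apply/eqP/colP => i; rewrite [RHS]mxE.
  apply: (smith_inj mM uQ sm (c := fun i => lam i 0)) => [a x am|j]; last first.
   by apply/eqP; apply: contrapT => /negP h; apply: H; exists j.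
  have da : ((d a)%:R : 'F_l) != 0.
   rewrite (pmulrn 1) intFp_eq0// gtnNdvd//; first by rewrite (dvdn_gt0 bt0)// hbt.
   by apply: leq_ltn_trans lb; apply: dvdn_leq => //; exact: hbt.
  by move/eqP; rewrite mulf_eq0 (negbTE da) => /eqP.
 apply: leq_trans (logder_indep pl sG (leqnn _) t2 t3 kj0); apply: subset_leq_card; apply/fintype.subsetP => x.
 rewrite !finset.in_set => /andP[xS /eqP e]; rewrite xS.
 have xS' : x \in gset l G by rewrite finset.in_set.
 have := congr1 (fun X : 'M['F_l]_1 => X 0 0) e; rewrite !mxE => e2; apply/eqP; rewrite -[RHS]e2.
 rewrite (eq_bigr (fun j => \sum_i (lam i 0 *+ mu i j) * ((red l (G j))^`().[x] / (red l (G j)).[x]))) => [|j _]; last by rewrite mulr_suml.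
 rewrite exchange_big; apply: eq_bigr => i _; rewrite mxE.
 have Gn j : (red l (G j) ^+ mu i j).[x] != 0 by rewrite horner_exp expf_neq0// Gx.
 have := @logder_prod _ _ (fun j => red l (G j) ^+ mu i j) x Gn => h.
 rewrite FR derivZ !hornerZ -mulf_div mulfV// mul1r h mulr_suml; apply: eq_bigr => j _.
 by rewrite logder_exp ?Gx//; ring.
Qed.

(** * Hensel lifting and the Chinese remainder theorem *)

Lemma taylor1 (p : {poly int}) (x h : int) : exists c, p.[x + h] = p.[x] + p^`().[x] * h + c * h ^+ 2.
Proof.
elim/poly_ind: p => [|p a [c IH]]; first by exists 0; rewrite deriv0 !horner0 !mul0r.
exists (c * (x + h) + p^`().[x]); rewrite !hornerMXaddC IH derivMXaddC hornerD hornerMX; ring.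
Qed.
Lemma dvdz_intr l (z : int) : prime l -> (l %| z)%Z = ((z%:~R : 'F_l) == 0).
Proof. by move=> pl; rewrite intFp_eq0//. Qed.
(** Each equation is a product over the variables [x a], so a small change of the [x a] multiplies
    it by 1 plus a sum of logarithmic derivatives: one matrix governs all the equations. *)
Definition ldm l m (F : 'I_m -> {poly int}) (x : 'I_m -> 'F_l) : 'M['F_l]_m := \matrix_(a < m) \row_i ((red l (F i))^`().[x a] / (red l (F i)).[x a]).
(** Moving [x a] to [x a + l ^ e * t a] multiplies the products by 1 plus [l ^ e] times the row
    [t *m V], modulo [l ^ e.+1], so [t] is found by inverting [V]. [Y] stands for the product over
    the other variables, held fixed in this step. *)
Lemma hensel_step l e m (F : 'I_m -> {poly int}) (x : 'I_m -> nat) (Y b : 'I_m -> int) : prime l -> (0 < e)%N ->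
 (forall i a, (red l (F i)).[(x a)%:R] != 0) -> (forall i, ((Y i)%:~R : 'F_l) != 0) -> row_free (ldm F (fun a => (x a)%:R : 'F_l)) ->
 (forall i, ((l ^ e)%N %| \prod_a (F i).[(x a)%:Z] * Y i - b i)%Z) ->
 exists t : {ffun 'I_m -> 'I_l}, forall i, ((l ^ e.+1)%N %| \prod_a (F i).[(x a + l ^ e * t a)%N%:Z] * Y i - b i)%Z.
Proof.
move=> pl e0 Fx Y0 rf hb; set V := ldm _ _ in rf; have uV : V \in unitmx by rewrite -row_free_unit.
have /choice [k hk] : forall i, exists k : int, \prod_a (F i).[(x a)%:Z] * Y i - b i = k * (l ^ e)%N%:Z by move=> i; apply/dvdzP.
pose Pb i : 'F_l := (\prod_a (F i).[(x a)%:Z] * Y i)%:~R.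
have PbE i : Pb i = \prod_a (red l (F i)).[(x a)%:R] * (Y i)%:~R.
 by rewrite /Pb rmorphM rmorph_prod/=; congr (_ * _); apply: eq_bigr => a _; rewrite -red_horner.
have Pb0 i : Pb i != 0 by rewrite PbE mulf_neq0//; apply/prodf_neq0 => a _.
pose w : 'rV['F_l]_m := \row_i (- (k i)%:~R / Pb i).
pose tb := w *m invmx V.
have tV : tb *m V = w by rewrite mulmxKV.
have tl a : (tb 0%R a < l)%N by rewrite -[X in (_ < X)%N](Fp_cast pl).
exists [ffun a => Ordinal (tl a)] => i.
pose t a : nat := tb 0 a; have tE a : (t a)%:R = tb 0 a by rewrite natr_Zp.
pose lin a : {poly int} := (x a)%:Z%:P + (t a)%:Z *: 'X.
pose Q := \prod_a (F i \Po lin a).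
have linE a (h : int) : (lin a).[h] = (x a)%:Z + (t a)%:Z * h by rewrite !hornerE.
have QE (h : int) : Q.[h] = \prod_a (F i).[(x a)%:Z + (t a)%:Z * h].
 by rewrite horner_prod; apply: eq_bigr => a _; rewrite horner_comp linE.
have [c hc] := taylor1 Q 0 (l ^ e)%N%:Z.
have -> : \prod_a (F i).[(x a + l ^ e * ([ffun a0 => Ordinal (tl a0)] a : 'I_l))%N%:Z] = Q.[(l ^ e)%N].
 by rewrite QE; apply: eq_bigr => a _; rewrite ffunE PoszD PoszM [(l ^ e)%N%:Z * _]mulrC.
rewrite add0r in hc; rewrite hc.
have Q0 : Q.[0] = \prod_a (F i).[(x a)%:Z] by rewrite QE; apply: eq_bigr => a _; rewrite mulr0 addr0.
have -> : (Q.[0] + Q^`().[0] * (l ^ e)%N + c * (l ^ e)%N%:Z ^+ 2) * Y i - b i = (k i + Q^`().[0] * Y i) * (l ^ e)%N + c * Y i * (l ^ e)%N%:Z ^+ 2.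
 have := hk i; rewrite -Q0 => h; transitivity ((Q.[0] * Y i - b i) + Q^`().[0] * (l ^ e)%N * Y i + c * (l ^ e)%N%:Z ^+ 2 * Y i); first by ring.
 by rewrite h; ring.
apply: rpredD; last first.
 apply: dvdz_mull; rewrite -[_ ^+ 2]/(((l ^ e)%N%:Z) * (l ^ e)%N%:Z) -PoszM -expnD; apply: dvdn_exp2l.
 by rewrite addnn -addnn -addn1 leq_add2l.
rewrite expnS PoszM; apply: dvdz_mul => //.
rewrite dvdz_intr//; rewrite rmorphD rmorphM /=.
have dQ : (Q^`().[0])%:~R = (\prod_a (red l (F i)).[(x a)%:R]) * w 0 i :> 'F_l.
 rewrite -(red_horner l) red_deriv.
 have rQ : red l Q = \prod_a (red l (F i) \Po red l (lin a)).
  by rewrite /red rmorph_prod/=; apply: eq_bigr => a _; rewrite map_comp_poly.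
 have rl a : (red l (lin a)).[0] = (x a)%:R by rewrite -[0]/((0 : int)%:~R) red_horner linE mulr0 addr0.
 have nz a : (red l (F i) \Po red l (lin a)).[0] != 0 by rewrite horner_comp rl.
 have := logder_prod nz; rewrite -rQ => h.
 have rQ0 : (red l Q).[0] = \prod_a (red l (F i)).[(x a)%:R].
  by rewrite rQ horner_prod; apply: eq_bigr => a _; rewrite horner_comp rl.
 have q0 : (red l Q).[0] != 0 by rewrite rQ0; apply/prodf_neq0.
 rewrite -rQ0 -[LHS](mulfVK q0) h mulrC; congr (_ * _).
 rewrite -tV mxE; apply: eq_bigr => a _; rewrite -tE !mxE deriv_comp hornerM !horner_comp rl.
 have -> : (red l (lin a))^`().[0] = (t a)%:R.
  rewrite -red_deriv derivD derivC add0r derivZ derivX -[0]/((0 : int)%:~R) red_horner hornerZ hornerC mulr1 -pmulrn//.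
 by ring.
rewrite dQ mxE mulrAC -PbE mulrCA mulfV// mulr1 addrN//.
Qed.

Lemma horner_congr (d : nat) (p : {poly int}) (x y : int) : (d %| x - y)%Z -> (d %| p.[x] - p.[y])%Z.
Proof.
move=> h; elim/poly_ind: p => [|p c IH]; first by rewrite !horner0.
rewrite !hornerMXaddC (_ : _ - _ = (p.[x] - p.[y]) * x + p.[y] * (x - y)); last by ring.
by apply: rpredD; [apply: dvdz_mulr|apply: dvdz_mull].
Qed.
Lemma prod_congr (d : nat) (I : finType) (f g : I -> int) : (forall i, (d %| f i - g i)%Z) -> (d %| \prod_i f i - \prod_i g i)%Z.
Proof.
move=> h; elim/big_rec2: _ => [|i x y _ IH] => //.
rewrite (_ : _ - _ = (f i - g i) * y + g i * (y - x)); last by ring.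
by apply: rpredD; [apply: dvdz_mulr|apply: dvdz_mull].
Qed.
(** The first [m] coordinates carry the invertible matrix and absorb the congruences; the other [s]
    can be lifted freely, which gives the factor [l ^ s] in [NSol_step]. *)
Definition NSol l m s (F : 'I_m -> {poly int}) (S : {set 'F_l}) (b : 'I_m -> int) e : {set {ffun 'I_m -> 'I_(l ^ e)} * {ffun 'I_s -> 'I_(l ^ e)}} :=
 [set xy : {ffun 'I_m -> 'I_(l ^ e)} * {ffun 'I_s -> 'I_(l ^ e)} | [&& [forall a, ((xy.1 a : nat)%:R : 'F_l) \in S], row_free (ldm F (fun a => ((xy.1 a : nat)%:R : 'F_l))),
   [forall c, ((xy.2 c : nat)%:R : 'F_l) \in S] &
   [forall i, ((l ^ e)%N %| \prod_a (F i).[(xy.1 a : nat)%:Z] * \prod_c (F i).[(xy.2 c : nat)%:Z] - b i)%Z]]]%SET.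
Lemma lft_proof l e (u : 'I_(l ^ e)) (t : 'I_l) : (u + l ^ e * t < l ^ e.+1)%N.
Proof.
apply: (@leq_trans (l ^ e * t.+1)); first by rewrite mulnS ltn_add2r.
by rewrite expnSr leq_mul2l ltn_ord orbT.
Qed.
Definition lft l e (u : 'I_(l ^ e)) (t : 'I_l) : 'I_(l ^ e.+1) := Ordinal (lft_proof u t).
Lemma lft_inj l e (u u' : 'I_(l ^ e)) (t t' : 'I_l) : (0 < l)%N -> lft u t = lft u' t' -> u = u' /\ t = t'.
Proof.
move=> l0 /(congr1 val) /= h; have le0 : (0 < l ^ e)%N by rewrite expn_gt0 l0.
have uu : u = u' :> nat by have := congr1 (fun z => (z %% l ^ e)%N) h; rewrite ![(_ + l ^ e * _)%N]addnC ![(l ^ e * _)%N]mulnC !modnMDl !modn_small.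
split; apply: val_inj => //=; move/eqP: h; rewrite uu eqn_add2l eqn_mul2l => /orP[/eqP h|/eqP //].
by rewrite h in le0.
Qed.
Lemma natr_lft l e (u t : nat) : prime l -> (0 < e)%N -> ((u + l ^ e * t)%N%:R : 'F_l) = u%:R.
Proof.
move=> pl e0; rewrite natrD natrM natrX (_ : (l%:R : 'F_l) = 0) ?expr0n; last by have /andP[_ /eqP] := pchar_Fp pl.
by rewrite (gtn_eqF e0) mul0r addr0.
Qed.
Lemma NSol_step l m s (F : 'I_m -> {poly int}) (S : {set 'F_l}) b e : prime l -> (0 < e)%N ->
 (forall x i, x \in S -> (red l (F i)).[x] != 0) -> (#|NSol s F S b e| * l ^ s <= #|NSol s F S b e.+1|)%N.
Proof.
move=> pl e0 hS; have l0 := prime_gt0 pl.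
pose y' (w : ({ffun 'I_m -> 'I_(l ^ e)} * {ffun 'I_s -> 'I_(l ^ e)}) * {ffun 'I_s -> 'I_l}) : {ffun 'I_s -> 'I_(l ^ e.+1)} := [ffun c => lft (w.1.2 c) (w.2 c)].
pose x' (w : ({ffun 'I_m -> 'I_(l ^ e)} * {ffun 'I_s -> 'I_(l ^ e)}) * {ffun 'I_s -> 'I_l}) (t : {ffun 'I_m -> 'I_l}) : {ffun 'I_m -> 'I_(l ^ e.+1)} := [ffun a => lft (w.1.1 a) (t a)].
have /choice [f hf] : forall w, exists t : {ffun 'I_m -> 'I_l}, w.1 \in NSol s F S b e -> (x' w t, y' w) \in NSol s F S b e.+1.
 move=> [[x y] z]; case: (boolP ((x, y) \in NSol s F S b e)) => [|_]; last by exists [ffun=> Ordinal l0].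
 rewrite finset.in_set => /and4P[/forallP xS rf /forallP yS /forallP hb].
 have yE c : ((y' (x, y, z) c : nat)%:R : 'F_l) = (y c : nat)%:R by rewrite ffunE natr_lft.
 have [t ht] := @hensel_step l e m F (fun a => x a : nat) (fun i => \prod_c (F i).[(y' (x, y, z) c : nat)%:Z]) b pl e0
  (fun i a => hS _ i (xS a)) (fun i => ltac:(rewrite rmorph_prod/=; apply/prodf_neq0 => c _; rewrite -red_horner -pmulrn yE; apply: hS; exact: yS)) rf
  (fun i => ltac:(have h := hb i; rewrite (_ : _ - _ = (\prod_a (F i).[(x a : nat)%:Z] * \prod_c (F i).[(y c : nat)%:Z] - b i) + \prod_a (F i).[(x a : nat)%:Z] * (\prod_c (F i).[(y' (x, y, z) c : nat)%:Z] - \prod_c (F i).[(y c : nat)%:Z])); [|ring];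
   apply: rpredD => //; apply: dvdz_mull; apply: prod_congr => c; apply: horner_congr; rewrite ffunE PoszD addrAC subrr add0r PoszM; exact: dvdz_mulr (dvdzz _))).
 exists t => _; rewrite finset.in_set; apply/and4P; split.
 - by apply/forallP => a; rewrite ffunE natr_lft.
 - rewrite (_ : ldm _ _ = ldm F (fun a => ((x a : nat)%:R : 'F_l))) //.
  by apply/matrixP => a i; rewrite !mxE ffunE natr_lft.
 - by apply/forallP => c; rewrite yE.
 - apply/forallP => i; have := ht i; congr (_ %| _ * _ - _)%Z; apply: eq_bigr => a _; by rewrite ffunE.
pose Phi w := (x' w (f w), y' w).
pose Dm := finset.setX (NSol s F S b e) [set: {ffun 'I_s -> 'I_l}]%SET.
have cD : #|Dm| = (#|NSol s F S b e| * l ^ s)%N by rewrite cardsX cardsT card_ffun !card_ord.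
have inj : injective Phi.
 move=> [[x y] z] [[x2 y2] z2] [] ex ey.
 have hx a : x a = x2 a by have := congr1 (fun g : {ffun _} => g a) ex; rewrite !ffunE => /(lft_inj l0)[].
 have hy c : y c = y2 c /\ z c = z2 c by have := congr1 (fun g : {ffun _} => g c) ey; rewrite !ffunE => /(lft_inj l0)[].
 congr (_, _, _); apply/ffunP => c //; by case: (hy c).
rewrite -cD -(card_imset _ inj); apply: subset_leq_card; apply/fintype.subsetP => u /finset.imsetP [[xy z]].
rewrite finset.in_setX => /andP[hw _] ->; exact: (hf (xy, z)).
Qed.
Lemma NSol_iter l m s (F : 'I_m -> {poly int}) (S : {set 'F_l}) b e : prime l ->
 (forall x i, x \in S -> (red l (F i)).[x] != 0) -> (#|NSol s F S b 1| * l ^ (s * e) <= #|NSol s F S b e.+1|)%N.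
Proof.
move=> pl hS; elim: e => [|e IH]; first by rewrite muln0 muln1.
rewrite mulnS expnD mulnCA mulnC; apply: leq_trans (NSol_step s b pl (ltn0Sn e) hS); by rewrite leq_mul2r IH orbT.
Qed.
(** The bound [X] holds for every right-hand side, hence also after division of [b] by the product
    over the first [m] coordinates. *)
Lemma NSol_base R l m s (F : 'I_m -> {poly int}) (S : {set 'F_l}) b (X : R) H : prime l ->
 (forall x i, x \in S -> (red l (F i)).[x] != 0) -> (forall i, ((b i)%:~R : 'F_l) != 0) ->
 (forall b' : 'I_m -> 'F_l, (forall i, b' i != 0) ->
  X <= (H * #|[set x : {ffun 'I_s -> 'F_l} | (x \in ffun_on (mem S)) && [forall i, (\prod_j (red l (F i)).[x j] == b' i)%R]]%SET|)%N%:R) ->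
 #|[set x : {ffun 'I_m -> 'F_l} | (x \in ffun_on (mem S)) && row_free (ldm F x)]%SET|%:R * X <= (H * #|NSol s F S b 1|)%N%:R.
Proof.
move=> pl hS b0 hX; set NS := [set x | _]%SET.
pose Pr (x : {ffun 'I_m -> 'F_l}) i := \prod_a (red l (F i)).[x a].
pose V (x : {ffun 'I_m -> 'F_l}) := [set y : {ffun 'I_s -> 'F_l} | (y \in ffun_on (mem S)) && [forall i, (\prod_j (red l (F i)).[y j] == (b i)%:~R / Pr x i)%R]]%SET.
have Pr0 x i : x \in NS -> Pr x i != 0.
 rewrite finset.in_set => /andP[/ffun_onP xS _]; apply/prodf_neq0 => a _; apply: hS; exact: xS.
pose P := [set xy : {ffun 'I_m -> 'F_l} * {ffun 'I_s -> 'F_l} | (xy.1 \in NS) && (xy.2 \in V xy.1)]%SET.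
have cP : #|P| = (\sum_(x in NS) #|V x|)%N.
 rewrite -sum1_card (eq_bigl (fun xy : {ffun 'I_m -> 'F_l} * {ffun 'I_s -> 'F_l} => (xy.1 \in NS) && (xy.2 \in V xy.1))); last by move=> xy; rewrite finset.in_set.
 rewrite -(pair_big_dep (mem NS) (fun x y => y \in V x) (fun _ _ => 1%N)); apply: eq_bigr => x _; by rewrite sum1_card.
apply: (@le_trans _ _ (H * #|P|)%N%:R).
 rewrite cP big_distrr natr_sum mulr_natl -sumr_const; apply: ler_sum => x xN.
 by apply: hX => i; rewrite mulf_neq0// invr_neq0// Pr0.
rewrite ler_nat leq_mul2l; apply/orP; right.
have vl (z : 'F_l) : (z < l ^ 1)%N by rewrite -[X in (_ < X)%N](Fp_cast pl).
pose to (z : 'F_l) : 'I_(l ^ 1) := Ordinal (vl z).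
have toR (z : 'F_l) : (to z : nat)%:R = z by rewrite natr_Zp.
have toinj : injective to by move=> z z' /(congr1 val) h; apply: val_inj.
pose Phi (xy : {ffun 'I_m -> 'F_l} * {ffun 'I_s -> 'F_l}) : {ffun 'I_m -> 'I_(l ^ 1)} * {ffun 'I_s -> 'I_(l ^ 1)} := ([ffun a => to (xy.1 a)], [ffun c => to (xy.2 c)]).
have inj : injective Phi.
 move=> [x y] [x2 y2] [] ex ey; congr (_, _); apply/ffunP => a.
  by apply: toinj; have := congr1 (fun g : {ffun _} => g a) ex; rewrite !ffunE.
 by apply: toinj; have := congr1 (fun g : {ffun _} => g a) ey; rewrite !ffunE.
rewrite -(card_imset _ inj); apply: subset_leq_card; apply/fintype.subsetP => u /finset.imsetP [[x y]].
rewrite finset.in_set => /andP[xN yV] ->; have Px := Pr0 x.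
move: (xN); rewrite finset.in_set => /andP[/ffun_onP xS rf]; move: yV; rewrite finset.in_set => /andP[/ffun_onP yS /forallP hy].
rewrite finset.in_set; apply/and4P; split.
- by apply/forallP => a; rewrite ffunE toR.
- rewrite (_ : ldm _ _ = ldm F x)//; by apply/matrixP => a i; rewrite !mxE ffunE toR.
- by apply/forallP => c; rewrite ffunE toR.
- apply/forallP => i; rewrite dvdz_intr// rmorphB rmorphM !rmorph_prod/= subr_eq0.
 rewrite (eq_bigr (fun a => (red l (F i)).[x a])) => [|a _]; last by rewrite -red_horner -pmulrn ffunE toR.
 rewrite [X in _ * X](eq_bigr (fun c => (red l (F i)).[y c])) => [|c _]; last by rewrite -red_horner -pmulrn ffunE toR.
 by move/eqP: (hy i) => ->; rewrite mulrC divfK// Pr0.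
Qed.
Definition Sol q t m (F : 'I_m -> {poly int}) (b : 'I_m -> int) : {set {ffun 'I_t -> 'I_q}} :=
 [set u : {ffun 'I_t -> 'I_q} | [forall j, coprime (u j) q] && [forall i, (q %| \prod_j (F i).[(u j : nat)%:Z] - b i)%Z]]%SET.
Lemma NSol_Sol l m s (F : 'I_m -> {poly int}) (S : {set 'F_l}) b e : prime l -> (0 < e)%N -> 0 \notin S ->
 (#|NSol s F S b e| <= #|Sol (l ^ e) (m + s) F b|)%N.
Proof.
move=> pl e0 S0.
pose Phi (xy : {ffun 'I_m -> 'I_(l ^ e)} * {ffun 'I_s -> 'I_(l ^ e)}) : {ffun 'I_(m + s) -> 'I_(l ^ e)} := [ffun j => match split j with inl a => xy.1 a | inr c => xy.2 c end].
have P1 xy a : Phi xy (lshift s a) = xy.1 a by rewrite ffunE (unsplitK (inl a)).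
have P2 xy c : Phi xy (rshift m c) = xy.2 c by rewrite ffunE (unsplitK (inr c)).
have inj : injective Phi.
 by move=> [x y] [x2 y2] h; congr (_, _); apply/ffunP => a; [rewrite -(P1 (x, y)) h|rewrite -(P2 (x, y)) h].
have cop (u : nat) : (u%:R : 'F_l) \in S -> coprime u (l ^ e).
 move=> uS; rewrite coprime_sym coprime_pexpl// prime_coprime//; apply: contra S0.
 by rewrite (dvdn_pcharf (pchar_Fp pl)) => /eqP <-.
rewrite -(card_imset _ inj); apply: subset_leq_card; apply/fintype.subsetP => u /finset.imsetP [[x y]].
rewrite finset.in_set => /and4P[/forallP xS _ /forallP yS /forallP hb] ->; rewrite finset.in_set; apply/andP; split.
 by apply/forallP => j; case: (split_ordP j) => a ->; rewrite ?P1 ?P2; apply: cop.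
apply/forallP => i; rewrite big_split_ord; have := hb i; congr (_ %| _ * _ - _)%Z; apply: eq_bigr => a _; by rewrite ?P1 ?P2.
Qed.
Lemma Sol_mul q1 q2 t m (F : 'I_m -> {poly int}) b : coprime q1 q2 -> (0 < q1)%N -> (0 < q2)%N ->
 (#|Sol q1 t F b| * #|Sol q2 t F b| <= #|Sol (q1 * q2) t F b|)%N.
Proof.
move=> co q10 q20; have q0 : (0 < q1 * q2)%N by rewrite muln_gt0 q10.
have lt (u : 'I_q1) (v : 'I_q2) : (chinese q1 q2 u v %% (q1 * q2) < q1 * q2)%N by rewrite ltn_pmod.
pose cr u v : 'I_(q1 * q2) := Ordinal (lt u v).
have cr1 u v : cr u v = u %[mod q1] by rewrite modn_dvdm ?dvdn_mulr// chinese_modl.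
have cr2 u v : cr u v = v %[mod q2] by rewrite modn_dvdm ?dvdn_mull// chinese_modr.
pose Phi (w : {ffun 'I_t -> 'I_q1} * {ffun 'I_t -> 'I_q2}) : {ffun 'I_t -> 'I_(q1 * q2)} := [ffun j => cr (w.1 j) (w.2 j)].
have inj : injective Phi.
 move=> [u v] [u2 v2] h; have h2 j : cr (u j) (v j) = cr (u2 j) (v2 j) by have := congr1 (fun g : {ffun _} => g j) h; rewrite !ffunE.
 congr (_, _); apply/ffunP => j; apply: val_inj => /=.
  by have := cr1 (u j) (v j); rewrite h2 cr1 !modn_small.
 by have := cr2 (u j) (v j); rewrite h2 cr2 !modn_small.
rewrite -cardsX -(card_imset _ inj); apply: subset_leq_card; apply/fintype.subsetP => z /finset.imsetP [[u v]].
rewrite !finset.in_set => /andP[/andP[/forallP cu /forallP hu] /andP[/forallP cv /forallP hv]] ->.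
apply/andP; split.
 apply/forallP => j; rewrite ffunE coprimeMr -coprime_modl cr1 coprime_modl cu.
 by rewrite -coprime_modl cr2 coprime_modl cv.
have key q (w : 'I_t -> nat) i : (forall j, (Phi (u, v) j : nat) = w j %[mod q]) -> (q %| \prod_j (F i).[(w j)%:Z] - b i)%Z -> (q %| \prod_j (F i).[(Phi (u, v) j : nat)%:Z] - b i)%Z.
 move=> hw h; rewrite (_ : _ - _ = (\prod_j (F i).[(Phi (u, v) j : nat)%:Z] - \prod_j (F i).[(w j)%:Z]) + (\prod_j (F i).[(w j)%:Z] - b i)); last by ring.
 apply: rpredD => //; apply: prod_congr => j; apply: horner_congr.
 by rewrite -eqz_mod_dvd; rewrite !modz_nat hw.
apply/forallP => i; rewrite PoszM Gauss_dvdz//; apply/andP; split.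
 by apply: key (hu i) => j; rewrite ffunE.
by apply: key (hv i) => j; rewrite ffunE.
Qed.

(** Stated in powers of the totient, the bound can be multiplied over the primes. The [4 * D] pays,
    relative to [l - 1], for the points missing in [gset] and for the [D] points lost in
    [nonsing_count]. *)
Lemma Sol_ppow R l m M s e D (F : 'I_m -> {poly int}) (G : 'I_M -> {poly int}) b (E : R) : prime l -> (4 * D < l)%N -> (l <= #|gset l G| + D.+1)%N ->
 (forall x i, x \in gset l G -> (red l (F i)).[x] != 0) ->
 (forall b' : 'I_m -> 'F_l, (forall i, b' i != 0) -> #|gset l G|%:R ^+ s * (1 - E) <=
  (l.-1 ^ m * #|[set x : {ffun 'I_s -> 'F_l} | (x \in ffun_on (mem (gset l G))) && [forall i, (\prod_j (red l (F i)).[x j] == b' i)%R]]%SET|)%N%:R) ->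
 ((#|gset l G| - D) ^ m <= #|[set x : {ffun 'I_m -> 'F_l} | (x \in ffun_on (mem (gset l G))) && row_free (ldm F x)]%SET|)%N ->
 0 <= 1 - E -> (forall i, ((b i)%:~R : 'F_l) != 0) ->
 (totient (l ^ e.+1))%:R ^+ (m + s) * ((1 - (4 * D)%N%:R / l%:R) ^+ (m + s) * (1 - E)) <=
 (totient (l ^ e.+1))%:R ^+ m * #|Sol (l ^ e.+1) (m + s) F b|%:R :> R.
Proof.
move=> pl lD lS hF hV hN E0 b0; set n := #|gset l G| in lS hV hN *.
have S0 : 0 \notin gset l G by rewrite finset.in_set.
have l0 : 0 < l%:R :> R by rewrite ltr0n prime_gt0.
have l2 := prime_gt1 pl.
have h1 : #|Sol (l ^ e.+1) (m + s) F b|%:R >= (#|NSol s F (gset l G) b 1| * l ^ (s * e))%N%:R :> R.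
 by rewrite ler_nat; apply: leq_trans (NSol_iter s b e pl hF) (NSol_Sol s F b pl (ltn0Sn e) S0).
have h2 := NSol_base pl hF b0 hV.
rewrite totient_pfactor//= natrM; set H : R := l.-1%:R; set q : R := (l ^ e)%N%:R.
have q0 : 0 <= q by []. have H0 : 0 <= H by [].
have a1 : 0 <= 1 - (4 * D)%N%:R / l%:R :> R by rewrite subr_ge0 ler_pdivrMr// mul1r ler_nat ltnW.
have Hn : H * (1 - (4 * D)%N%:R / l%:R) <= (n - D)%N%:R.
 have : (l - (2 * D).+1 <= n - D)%N by move: lS; clear; lia.
 rewrite -(ler_nat R); apply: le_trans; rewrite /H -subn1 !natrB ?(ltnW l2)//; last by move: lD l2; clear; lia.
 rewrite !natrM.
 have x0 : 4 * D%:R / l%:R <= 2 * D%:R :> R.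
  rewrite ler_pdivrMr//; have : 2 <= l%:R :> R by rewrite ler_nat.
  have : 0 <= D%:R :> R by []. move: (D%:R : R) (l%:R : R) => u v; clear; nra.
 have -> : (l%:R - 1) * (1 - 4 * D%:R / l%:R) = l%:R - 1 - 4 * D%:R + 4 * D%:R / l%:R :> R by field.
 move: x0; clear; lra.
have nD : (n - D)%N%:R <= n%:R :> R by rewrite ler_nat leq_subr.
have Hg : 0 <= H * (1 - (4 * D)%N%:R / l%:R) by [].
have k1 : (H * (1 - (4 * D)%N%:R / l%:R)) ^+ m <= #|[set x : {ffun 'I_m -> 'F_l} | (x \in ffun_on (mem (gset l G))) && row_free (ldm F x)]%SET|%:R.
 apply: (@le_trans _ _ ((n - D)%N%:R ^+ m)); first by apply: lerXn2r; rewrite ?nnegrE.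
 by rewrite -natrX ler_nat.
have k2 : (H * (1 - (4 * D)%N%:R / l%:R)) ^+ s <= n%:R ^+ s.
 by apply: lerXn2r; rewrite ?nnegrE//; apply: le_trans Hn nD.
set a := 1 - (4 * D)%N%:R / l%:R in a1 Hn Hg k1 k2 *.
have k3 : (H * a) ^+ m * ((H * a) ^+ s * (1 - E)) <= (l.-1 ^ m * #|NSol s F (gset l G) b 1|)%N%:R.
 apply: le_trans h2; apply: ler_pM; rewrite//.
 by rewrite ler_wpM2r.
apply: (@le_trans _ _ (q ^+ (m + s) * ((H * a) ^+ m * ((H * a) ^+ s * (1 - E))))).
 by rewrite !exprMn !exprD; apply: eq_ler; ring.
apply: (@le_trans _ _ (q ^+ (m + s) * (l.-1 ^ m * #|NSol s F (gset l G) b 1|)%N%:R)).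
 by rewrite ler_wpM2l//.
have Hq : 0 <= (H * q) ^+ m by [].
apply: le_trans (ler_wpM2l Hq h1); rewrite !natrM !natrX.
have -> : l%:R ^+ (s * e) = q ^+ s by rewrite /q natrX -exprM mulnC.
by rewrite exprD exprMn; apply: eq_ler; ring.
Qed.
(** Strong induction on [q], splitting off the full power of its smallest prime. The factor [g l]
    depends on the prime only, so the product runs over [primes q]. *)
Lemma Sol_lower R t m (F : 'I_m -> {poly int}) b (g : nat -> R) (P : nat -> Prop) : (forall l, 0 <= g l) ->
 (forall l e, prime l -> P l -> (totient (l ^ e.+1))%:R ^+ t * g l <= (totient (l ^ e.+1))%:R ^+ m * #|Sol (l ^ e.+1) t F b|%:R) ->
 forall q, (0 < q)%N -> (forall l, prime l -> (l %| q)%N -> P l) ->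
 (totient q)%:R ^+ t * \prod_(l <- primes q) g l <= (totient q)%:R ^+ m * #|Sol q t F b|%:R.
Proof.
move=> g0 hP q; have [n] := ubnP q; elim: n q => // n IH q qn q0 hq.
have [q1|q1] := leqP q 1.
 have -> : q = 1%N by apply/eqP; rewrite eqn_leq q1.
 rewrite// big_nil (_ : totient 1 = 1%N)// !expr1n !mul1r ler1n card_gt0; apply/set0Pn.
 by exists [ffun=> ord0]; rewrite finset.in_set; apply/andP; split; apply/forallP => j; rewrite ?coprimen1//.
have pl := pdiv_prime q1; set l := pdiv q in pl; have lq : (l %| q)%N := pdiv_dvd q.
clearbody l.
case: (pfactor_coprime pl q0) => q' co qE; set e := logn l q in qE.
have e0 : (0 < e)%N by rewrite logn_gt0 mem_primes pl q0.
clearbody e; have q'0 : (0 < q')%N by move: q0; rewrite qE muln_gt0 => /andP[].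
have le1 : (1 < l ^ e)%N by rewrite -(exp1n e) ltn_exp2r// prime_gt1.
have q'q : (q' < q)%N by rewrite qE -{1}[q']muln1 ltn_pmul2l.
have coe : coprime (l ^ e) q' by rewrite coprime_pexpl.
have dq : (q' %| q)%N by rewrite [X in (_ %| X)%N]qE dvdn_mulr.
have IHq := IH q' (leq_trans q'q qn) q'0 (fun l' pl' h => hq l' pl' (dvdn_trans h dq)).
have hl := hP l e.-1 pl (hq l pl lq); rewrite prednK// in hl.
have pe : \prod_(l <- primes q) g l = g l * \prod_(l <- primes q') g l.
 have -> : g l * \prod_(l <- primes q') g l = \prod_(x <- l :: primes q') g x by rewrite big_cons.
 apply: perm_big; apply: uniq_perm.
 - exact: primes_uniq.
 - rewrite/= primes_uniq andbT mem_primes q'0 pl; by rewrite -prime_coprime.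
 - move=> p; rewrite in_cons !mem_primes q0 q'0 [in LHS]qE; case pp: (prime p) => /=; last first.
   by apply/esym; rewrite orbF; apply/negbTE; apply: contraFneq pp => ->.
  rewrite Euclid_dvdM// Euclid_dvdX// e0 andbT [(p %| l)%N]dvdn_prime2//.
  exact: orbC.
rewrite pe qE mulnC totient_coprime// natrM.
have := Sol_mul t F b coe (ltnW le1) q'0; rewrite -(ler_nat R) natrM => hm.
set a := (totient (l ^ e))%:R in hl *; set c := (totient q')%:R in IHq *.
apply: (@le_trans _ _ ((a ^+ m * #|Sol (l ^ e) t F b|%:R) * (c ^+ m * #|Sol q' t F b|%:R))).
 rewrite exprMn mulrACA; apply: ler_pM; rewrite ?mulr_ge0 ?exprn_ge0//.
 by rewrite prodr_ge0.
rewrite mulrACA -exprMn ler_wpM2l ?exprn_ge0 ?mulr_ge0//.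
Qed.

(** * Multiplicative independence *)

Lemma exprz_prod (F : fieldType) (I : finType) (x : I -> F) (c : int) : (\prod_i x i) ^ c = \prod_i x i ^ c.
Proof. by apply: (big_morph (fun y => y ^ c)) => [y z|]; [exact: expfzMl|exact: exp1rz]. Qed.
Lemma prod_exprz (F : fieldType) (I : finType) (x : F) (c : I -> int) : x != 0 -> \prod_i x ^ c i = x ^ (\sum_i c i).
Proof. by move=> x0; apply/esym; apply: (big_morph (fun y => x ^ y)) => [y z|]; [exact: expfzDr|exact: expr0z]. Qed.
Lemma int_kernel m M (mu : 'I_m -> 'I_M -> nat) : (M < m)%N -> exists c : 'I_m -> int, (exists i, c i != 0) /\ forall j, \sum_i c i * (mu i j)%:Z = 0.
Proof.
move=> Mm; pose A : 'M[rat]_(m, M) := \matrix_(i, j) (mu i j)%:R.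
have : kermx A != 0.
 rewrite -mxrank_eq0 mxrank_ker -lt0n subn_gt0; exact: leq_ltn_trans (rank_leq_col A) Mm.
move=> /rowV0Pn [v /sub_kermxP vA v0].
pose N := \prod_i denq (v 0 i); have N0 : N != 0 by apply/prodf_neq0 => i _.
pose c i := numq (v 0 i) * \prod_(k | k != i) denq (v 0 k).
have cE i : (c i)%:~R = N%:~R * v 0 i :> rat.
 have NE : N = denq (v 0 i) * \prod_(k | k != i) denq (v 0 k) by rewrite /N (bigD1 i).
 rewrite NE !rmorphM/= numqE; ring.
exists c; split.
 have [i hi] : exists i, v 0 i != 0.
  apply: contrapT => H; case/negP: v0; apply/eqP/rowP => i; rewrite mxE; apply/eqP.
  by apply: contrapT => /negP h; apply: H; exists i.
 by exists i; rewrite -(@intr_eq0 rat) cE mulf_neq0// intr_eq0.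
move=> j; apply/eqP; rewrite -(@intr_eq0 rat) rmorph_sum/=; apply/eqP.
have := congr1 (fun X : 'rV[rat]_M => X 0 j) vA; rewrite !mxE => h.
transitivity (N%:~R * \sum_i v 0 i * A i j); last by rewrite h mulr0.
by rewrite mulr_sumr; apply: eq_bigr => i _; rewrite intrM cE !mxE mulrA.
Qed.
Lemma indep_neq0 m (F : 'I_m -> {poly int}) : mult_independent F -> forall i, F i != 0.
Proof.
move=> hF i; apply/eqP => Fi; apply: (hF (fun j => (j == i)%:Z)); first by exists i; rewrite eqxx.
exists 0; rewrite (bigD1 i)//= eqxx Fi !rmorph0 mul0r//.
Qed.
(** With fewer irreducible factors than polynomials, an integer relation between the exponents would
    make a product of powers of the [F i] constant. Hence [minn M m] is [m] and [beta] is the last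
    of [m] invariant factors. *)
Lemma indep_leq m M (F : 'I_m -> {poly int}) r (G : 'I_M -> {poly int}) mu : mult_independent F -> factorization F r G mu -> (m <= M)%N.
Proof.
move=> hF fa; have F0 := indep_neq0 hF; case: fa => FE hG _ _; rewrite leqNgt; apply/negP => Mm.
have [c [c0 hc]] := int_kernel mu Mm; apply: (hF c c0).
pose tf (p : {poly int}) : {fraction {poly rat}} := tofrac (map_poly intr p).
have G0 j : tf (G j) != 0.
 have g0 : G j != 0 by case: (hG j) => _ [].
 by rewrite tofrac_eq0 map_poly_eq0_id0 ?intr_eq0 ?lead_coef_eq0.
have tfE i : tf (F i) = tofrac ((r i)%:~R)%:P * \prod_j tf (G j) ^+ mu i j.
 rewrite /tf FE -mul_polyC !rmorphM/= map_polyC !rmorph_prod; congr (_ * _).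
 by apply: eq_bigr => j _; rewrite !rmorphXn.
exists (\prod_i ((r i)%:~R : rat) ^ c i).
transitivity (\prod_i ((tofrac ((r i)%:~R)%:P : {fraction {poly rat}}) ^ c i * \prod_j tf (G j) ^ (c i * (mu i j)%:Z))).
 apply: eq_bigr => i _; rewrite -/(tf (F i)) tfE expfzMl exprz_prod; congr (_ * _); apply: eq_bigr => j _.
 by rewrite exprnP exprz_exp mulrC.
rewrite big_split exchange_big/= [X in _ * X]big1 ?mulr1 => [|j _]; last first.
 by rewrite prod_exprz// hc.
have /(_ _ (fun i => (r i)%:~R) c) -> // : forall (I : finType) (x : I -> rat) (c : I -> int), \prod_i (tofrac (x i)%:P : {fraction {poly rat}}) ^ c i = tofrac (\prod_i x i ^ c i)%:P.
move=> I x cc; rewrite !rmorph_prod; apply: eq_bigr => i _.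
by rewrite -(fmorphXz (@tofrac _ \o polyC)).
Qed.

(** * Sums of 1/p over windows *)

Lemma T1q R (A : R) : 0 < A -> exists2 c : R, 0 < c & exists T : nat, exists V0 : R, 20 + T%:R <= V0 /\ forall V q u,
 V0 <= V -> odd q -> q%:R <= V `^ A -> coprime u q ->
 c * expR V / (V * (totient q)%:R) <= (count (fun p => [&& prime p, p == u %[mod q] & V - T%:R <= ln p%:R]) (index_iota 1 (Num.truncn (expR (V + T%:R))).+1))%:R.
Proof.
move=> A0; have [c c0 [T [V0 [V0T h]]]] := T1 A0.
exists (c / 2); first by [].
have p3 : 0 <= 3 `^ A^-1 by [].
exists T, (V0 + 3 `^ A^-1); split; first by lra.
have T0 : 0 <= T%:R :> R by [].
move=> V q u VV oq qV cu; have VV0 : V0 <= V by clear - VV p3; lra.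
have Vp : 0 < V by clear - VV0 V0T T0; lra.
have [q1|q1] := ltnP 1 q.
 apply: le_trans (h V q u VV0 oq q1 qV cu); rewrite ler_pM2r; last by rewrite invr_gt0 mulr_gt0// ltr0n totient_gt0 ltnW.
 by rewrite ler_pM2r//; clear - c0; lra.
have -> : q = 1%N by case: q oq q1 {qV cu} => [|[]].
have V3 : 3 <= V `^ A.
 apply: (@le_trans _ _ ((3 `^ A^-1) `^ A)); first by rewrite -powRrM mulVf// powRr1.
 by apply: ge0_ler_powR; rewrite ?nnegrE//; clear - VV V0T T0; lra.
have := h V 3%N 1%N VV0 isT isT V3 isT.
rewrite (_ : totient 3 = 2%N)// (_ : totient 1 = 1%N)//= => hh.
apply: (@le_trans _ _ (c * expR V / (V * 2))).
 by apply: eq_ler; field; rewrite gt_eqF.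
apply: le_trans hh _; rewrite ler_nat; apply: sub_count => p /and3P[pp _ hp].
by rewrite pp hp !modn1 eqxx.
Qed.
Definition psum R q u B (a b : R) : R := \sum_(1 <= p < B | [&& prime p, p == u %[mod q] & a <= ln p%:R < b]) p%:R^-1.
Lemma psum_cat R q u B (a b c : R) : a <= b -> b <= c -> psum q u B a b + psum q u B b c <= psum q u B a c.
Proof.
move=> ab bc; rewrite /psum big_mkcond [X in _ + X]big_mkcond [leRHS]big_mkcond -big_split; apply: ler_sum => p _.
case: (prime p); case: (p == u %[mod q]) => //=; rewrite ?addr0//.
have [h1|h1] := leP a (ln p%:R); have [h2|h2] := ltP (ln p%:R) b; have [h3|h3] := leP b (ln p%:R); have [h4|h4] := ltP (ln p%:R) c => //=;
 rewrite ?addr0 ?add0r//; exfalso; lra.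
Qed.
Lemma psum_ge0 R q u B (a b : R) : 0 <= psum q u B a b.
Proof. by apply: sumr_ge0 => p _; rewrite invr_ge0. Qed.
(** About [a / (2 * S)] consecutive windows of length [S] fit into the interval, each worth at least
    a constant over [a * totient q]. The length [2 * T + 1], rather than [2 * T], makes half-open
    windows contain the closed ones of [T1q]. *)
Lemma psum_dyadic R (A : R) : 0 < A -> exists2 c : R, 0 < c & exists a0 : R, 1 <= a0 /\ forall a q u B,
 a0 <= a -> odd q -> q%:R <= a `^ A -> coprime u q -> expR (2 * a) <= B%:R -> c / (totient q)%:R <= psum q u B a (2 * a).
Proof.
move=> A0; have [c c0 [T [V0 [V0T h]]]] := T1q A0; have T0 : 0 <= T%:R :> R by [].
pose S : R := 2 * T%:R + 1; have S0 : 0 < S by rewrite /S; clear - T0; lra.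
exists (c * expR (- T%:R) / (8 * S)); first by rewrite divr_gt0 ?mulr_gt0 ?expR_gt0.
exists (V0 + 4 * S); split; first by rewrite /S; lra.
move=> a q u B ha oq qa cu hB.
have a0 : 0 < a by rewrite /S in ha; clear - ha V0T T0; lra.
have aV : V0 <= a by rewrite /S in ha; lra.
have aS : 4 * S <= a by clear - ha V0T T0; lra.
have q0 : (0 < q)%N by case: (q) oq.
have tq : 0 < (totient q)%:R :> R by rewrite ltr0n totient_gt0.
have win V : a <= V -> V + T%:R < 2 * a -> c * expR (- T%:R) / (2 * a * (totient q)%:R) <= psum q u B (V - T%:R) (V - T%:R + S).
 move=> Va V2; have Vp : 0 < V := lt_le_trans a0 Va.
 have qV : q%:R <= V `^ A by apply: (le_trans qa); apply: ge0_ler_powR; rewrite ?nnegrE.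
 have := h V q u (le_trans aV Va) oq qV cu; set X := Num.truncn _; set gp := fun p => _ => hc.
 have XB : (X.+1 <= B)%N.
  rewrite -(ltr_nat R); apply: le_lt_trans (_ : expR (V + T%:R) < _); first by rewrite truncn_le expR_ge0.
  by apply: lt_le_trans hB; rewrite ltr_expR.
 have t1 p : (0 < p <= X)%N -> ln p%:R <= V + T%:R /\ expR (- (V + T%:R)) <= p%:R^-1.
  move=> /andP[p0 pX]; have hp : p%:R <= expR (V + T%:R) by rewrite -truncn_ge_nat.
  split; first by rewrite -[leRHS]expRK ler_ln ?posrE ?ltr0n.
  by rewrite expRN lef_pV2 ?posrE ?expR_gt0 ?ltr0n.
 have s1 : expR (- (V + T%:R)) * (count gp (index_iota 1 X.+1))%:R <= psum q u B (V - T%:R) (V - T%:R + S).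
  apply: (@le_trans _ _ (\sum_(1 <= p < X.+1 | gp p) p%:R^-1)).
   apply: (@le_trans _ _ (\sum_(1 <= p < X.+1 | gp p) expR (- (V + T%:R)))); first by rewrite big_const_seq iter_addr_0 mulr_natr.
   rewrite big_mkcond [leRHS]big_mkcond; apply: ler_sum_nat => p /andP[p0 pX]; case: ifP => // _.
   by apply: (t1 p _).2; rewrite p0.
  rewrite /psum [leRHS](big_cat_nat (n := X.+1))//= -[leLHS]addr0; apply: lerD; last by [].
  rewrite big_mkcond [leRHS]big_mkcond; apply: ler_sum_nat => p /andP[p0 pX]; rewrite /gp; case: ifP => [/and3P[-> -> ->]|_]; last by case: ifP => // _; rewrite invr_ge0.
  have [h1 _] := t1 p ltac:(by rewrite p0); case: ifP => // /negP[]; rewrite /S; clear - h1; lra.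
 apply: le_trans s1; apply: le_trans (ler_wpM2l (expR_ge0 _) hc).
 have -> : expR (- (V + T%:R)) * (c * expR V / (V * (totient q)%:R)) = c * expR (- T%:R) / (V * (totient q)%:R).
  rewrite opprD expRD expRN; have := expR_gt0 V; move: (expR V) (expR (- T%:R)) => x y x0; field.
  by rewrite !gt_eqF.
 rewrite ler_pM2l// lef_pV2 ?posrE// ler_pM2r//; clear - V2 T0; lra.
pose J := Num.truncn (a / (2 * S)).
have J1 : J%:R <= a / (2 * S) by rewrite truncn_le divr_ge0.
have J2 : a / (2 * S) < J%:R + 1 by rewrite natr1; exact: truncnS_gt.
rewrite ler_pdivlMr// in J1; rewrite ltr_pdivrMr// in J2.
have ind j : (j <= J)%N -> j%:R * (c * expR (- T%:R) / (2 * a * (totient q)%:R)) <= psum q u B a (a + j%:R * S).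
 elim: j => [|j IH] jJ; first by rewrite mul0r psum_ge0.
 have jS : (j.+1)%:R * (2 * S) <= a by apply: le_trans J1; rewrite ler_pM2r// ler_nat.
 have jS2 : 0 <= j%:R * S by [].
 rewrite -[j.+1%:R]natr1 in jS *.
 have := win (a + j%:R * S + T%:R) ltac:(clear - jS2 T0; lra) ltac:(rewrite /S in jS aS *; clear - jS aS a0 T0; nra).
 rewrite addrK => w; have -> : a + (j%:R + 1) * S = a + j%:R * S + S by ring.
 apply: le_trans (psum_cat _ _ _ (_ : a <= a + j%:R * S) _); [|clear - jS2; lra|by rewrite lerDl ltW].
 rewrite mulrDl mul1r; apply: lerD; [exact: IH (ltnW jJ)|exact: w].
have JS : J%:R * S <= a by clear - J1 a0; lra.
apply: (@le_trans _ _ (psum q u B a (a + J%:R * S))); last first.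
 apply: le_trans (psum_cat q u B (b := a + J%:R * S) _ _); rewrite ?lerDl ?psum_ge0//.
 clear - JS; lra.
apply: le_trans (ind J (leqnn J)).
have J4 : a <= J%:R * (4 * S) by clear - J2 aS; lra.
set C := c * expR (- T%:R); have C0 : 0 <= C by rewrite mulr_ge0.
have -> : C / (8 * S) / (totient q)%:R = a * (C / (8 * S * a * (totient q)%:R)) by field; rewrite !gt_eqF.
have -> : J%:R * (C / (2 * a * (totient q)%:R)) = J%:R * (4 * S) * (C / (8 * S * a * (totient q)%:R)) by field; rewrite !gt_eqF.
by rewrite ler_wpM2r// divr_ge0 !mulr_ge0.
Qed.
(** The bound of [psum_dyadic] does not depend on [a], so [h] successive doublings add up. *)
Lemma psum_window R (A : R) : 0 < A -> exists2 c : R, 0 < c & exists a0 : R, 1 <= a0 /\ forall a q u B h,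
 a0 <= a -> odd q -> q%:R <= a `^ A -> coprime u q -> expR (2 ^+ h * a) <= B%:R -> c * h%:R / (totient q)%:R <= psum q u B a (2 ^+ h * a).
Proof.
move=> A0; have [c c0 [a0 [a01 hd]]] := psum_dyadic A0; exists c => //; exists a0; split=> // a q u B h ha oq qa cu.
have ap : 0 < a by lra.
elim: h => [|h IH] hB; first by rewrite mulr0 mul0r psum_ge0.
have p2 : 1 <= 2 ^+ h :> R by apply: exprn_ege1; clear; lra.
have ph : a <= 2 ^+ h * a by rewrite ler_peMl// ltW.
have ph2 : 2 ^+ h * a <= 2 ^+ h.+1 * a by rewrite ler_pM2r// exprS; clear - p2; lra.
apply: le_trans (psum_cat q u B ph ph2); rewrite -[h.+1%:R]natr1 mulrDr mulr1 mulrDl; apply: lerD.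
 by apply: IH; apply: le_trans hB; rewrite ler_expR.
rewrite exprS -mulrA; apply: hd => //; first exact: le_trans ha ph.
 by apply: (le_trans qa); apply: ge0_ler_powR; rewrite ?nnegrE// (le_trans (ltW ap)).
by rewrite mulrA -exprS.
Qed.

(** * Integers built from increasing lists of primes *)

Lemma uniq_flatten_key (S T K : eqType) (s : seq S) (t : S -> seq T) (g : T -> K) (h : S -> K) : uniq s -> {in s &, injective h} ->
 (forall x, x \in s -> uniq (t x)) -> (forall x y, x \in s -> y \in t x -> g y = h x) -> uniq (flatten [seq t x | x <- s]).
Proof.
elim: s => //= x s IH /andP[xs us] ih ht hg; rewrite cat_uniq ht ?mem_head//=.
rewrite IH// ?andbT => [|a b as_ bs e|a as_|a b as_]; last 3 first.
- by apply: ih; rewrite // inE ?as_ ?bs orbT.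
- by apply: ht; rewrite inE as_ orbT.
- by apply: hg; rewrite inE as_ orbT.
apply/hasPn => y /flattenP [l /mapP [z zs ->] yz]; apply/negP => yx; case/negP: xs.
have -> // : x = z; apply: ih; rewrite ?mem_head ?inE ?zs ?orbT//.
by rewrite -(hg x y) ?mem_head// (hg z y)// inE zs orbT.
Qed.
Definition pwin R q B (lo : nat -> R) i u : seq nat := [seq p <- index_iota 1 B | [&& prime p, p == u %[mod q] & lo i <= ln p%:R < lo i.+1]].
Definition plast R q (X hi : R) u (P : nat) : seq nat := [seq p <- index_iota 1 (Num.truncn (X / P%:R)).+1 | [&& prime p, p == u %[mod q] & hi <= ln p%:R]].
(* Increasing lists of primes with prescribed residues: the i-th prime lies in the i-th window, the last one completes the product up to X. *)
Fixpoint plist R q B (lo : nat -> R) (X hi : R) i u (us : seq nat) (P : nat) : seq (seq nat) :=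
 match us with
 | [::] => [seq [:: p] | p <- plast q X hi u P]
 | u' :: us' => flatten [seq [seq p :: ps | ps <- plist q B lo X hi i.+1 u' us' (P * p)] | p <- pwin q B lo i u]
 end.
Lemma plist_uniq R q B (lo : nat -> R) (X hi : R) i u us P : uniq (plist q B lo X hi i u us P).
Proof.
elim: us i u P => [|u' us IH] i u P; first by rewrite map_inj_uniq ?filter_uniq ?iota_uniq// => x y [].
apply: (@uniq_flatten_key _ _ _ _ _ (ohead (T := nat)) Some) => [||p _|p y _ /mapP [z _ ->]] //.
- by rewrite filter_uniq ?iota_uniq.
- by move=> x y _ _ [].
- by rewrite map_inj_uniq// => x y [].
Qed.
(** The number of choices for the last prime is at least [z / P]. Prepending a prime [p] replaces
    [P] by [P * p], so summing over a window multiplies by its sum of [1 / p], at least [w]. *)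
Lemma plist_size R q B (lo : nat -> R) (X hi w z top : R) n : 0 <= w -> 0 <= z ->
 (forall i u, (i < n)%N -> coprime u q -> w <= \sum_(p <- pwin q B lo i u) p%:R^-1) ->
 (forall i p u, (i < n)%N -> p \in pwin q B lo i u -> ln p%:R <= top) ->
 (forall u P, (0 < P)%N -> ln P%:R <= n%:R * top -> coprime u q -> z / P%:R <= (size (plast q X hi u P))%:R) ->
 forall us i u P, (i + size us = n)%N -> all (fun v => coprime v q) (u :: us) -> (0 < P)%N -> ln P%:R <= i%:R * top ->
 z / P%:R * w ^+ size us <= (size (plist q B lo X hi i u us P))%:R.
Proof.
move=> w0 z0 hw htop hz; elim=> [|u' us IH] i u P iN /andP[cu cus] P0 lP.
 by rewrite expr0 mulr1 size_map; apply: hz => //; rewrite -iN addn0.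
have lt : (i < n)%N by rewrite -iN addnS ltnS leq_addr.
rewrite size_flatten /shape -map_comp sumnE big_map natr_sum.
apply: (@le_trans _ _ (\sum_(p <- pwin q B lo i u) z / P%:R * w ^+ size us * p%:R^-1)).
 by rewrite -mulr_sumr exprSr mulrA ler_wpM2l ?hw// mulr_ge0 divr_ge0.
rewrite big_seq [leRHS]big_seq; apply: ler_sum => p pw /=; rewrite size_map.
have p0 : (0 < p)%N by move: pw; rewrite mem_filter => /andP[/andP[/prime_gt0]].
have iN' : (i.+1 + size us = n)%N by rewrite addSn -addnS.
have Pp : (0 < P * p)%N by rewrite muln_gt0 P0.
have lPp : ln (P * p)%N%:R <= i.+1%:R * top.
 rewrite natrM lnM ?posrE// -[i.+1%:R]natr1 mulrDl mul1r lerD//; exact: htop pw.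
apply: le_trans (IH i.+1 u' (P * p)%N iN' cus Pp lPp).
by lra.
Qed.
Lemma plistP R q B (lo : nat -> R) (X hi : R) n : 0 <= X -> (forall i, lo i <= lo i.+1) -> lo n <= hi ->
 forall us i u P ps, (i + size us = n)%N -> (0 < P)%N -> ps \in plist q B lo X hi i u us P ->
 [/\ all prime ps, [seq (p %% q)%N | p <- ps] = [seq (v %% q)%N | v <- u :: us],
   (P * \prod_(p <- ps) p)%N%:R <= X, all (fun p => lo i <= ln p%:R) ps & sorted ltn ps].
Proof.
move=> X0 hlo hn; elim=> [|u' us IH] i u P ps iN P0.
 move=> /mapP [p]; rewrite mem_filter mem_index_iota => /andP[/and3P[pp /eqP pu hp] /andP[p0 pX]] ->; split=> //=.
 - by rewrite pp.
 - by rewrite pu.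
 - rewrite big_seq1 natrM mulrC -ler_pdivlMr//; move: pX; rewrite ltnS -(ler_nat R) => h; apply: (le_trans h).
  by rewrite truncn_le divr_ge0.
 - by rewrite andbT; apply: le_trans hp; rewrite -(addn0 i) iN.
move=> /flattenP [l /mapP [p pw ->] /mapP [ps' hps ->]].
move: pw; rewrite mem_filter => /andP[/and3P[pp /eqP pu /andP[h1 h2]] _]; have p0 := prime_gt0 pp.
have iN' : (i.+1 + size us = n)%N by rewrite addSn -addnS.
have Pp : (0 < P * p)%N by rewrite muln_gt0 P0.
have [a1 a2 a3 a4 a5] := IH i.+1 u' (P * p)%N ps' iN' Pp hps; split.
- by rewrite /= pp.
- by rewrite /= pu a2.
- by rewrite big_cons mulnA.
- by rewrite /= h1; apply: sub_all a4 => x; apply: le_trans.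
- rewrite /= path_sortedE; last exact: ltn_trans.
 rewrite a5 andbT; apply/allP => x xp; have lx := allP a4 x xp; have x0 := prime_gt0 (allP a1 x xp).
 change (p < x)%N; by rewrite -(ltr_nat R) -ltr_ln ?posrE//; apply: lt_le_trans h2 lx.
Qed.
Lemma primes_prodX ps k : (0 < k)%N -> all prime ps -> sorted ltn ps -> primes ((\prod_(p <- ps) p) ^ k) = ps.
Proof.
move=> k0 pp so; have p0 : (0 < \prod_(p <- ps) p)%N.
 by rewrite big_seq prodn_cond_gt0// => p /(allP pp)/prime_gt0.
rewrite primesX//; apply: (irr_sorted_eq ltn_trans ltnn (sorted_primes _) so) => x.
rewrite mem_primes p0; apply/andP/idP => [[px]|xs].
 rewrite big_seq; elim/big_rec: _ => [|p y pps IH]; first by rewrite dvdn1 => /eqP x1; rewrite x1 in px.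
 by rewrite Euclid_dvdM// => /orP[|//]; rewrite dvdn_prime2// ?(allP pp)// => /eqP ->.
by split; [exact: (allP pp)|rewrite (big_rem x)//= dvdn_mulr].
Qed.
(** Each prime of [ps] occurs at least [k] times among the prime factors, so there are at least
    [r * k] of them, all above [q]. *)
Lemma largest_prime_gt q r k ps : (0 < r)%N -> (0 < k)%N -> all prime ps -> sorted ltn ps -> all (ltn q) ps -> (r <= size ps)%N ->
 (q < largest_prime (r * k) ((\prod_(p <- ps) p) ^ k))%N.
Proof.
move=> r0 k0 pp so hq rs; set n := (_ ^ k)%N; have pn : primes n = ps := primes_prodX k0 pp so.
have n0 : (0 < n)%N by rewrite expn_gt0 big_seq prodn_cond_gt0// => p /(allP pp)/prime_gt0.
rewrite /largest_prime; set L := flatten _.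
have Lq x : x \in L -> (q < x)%N.
 move=> /flattenP [l /mapP [[p e] pe ->]]; rewrite mem_nseq => /andP[_ /eqP ->].
 by move: pe; rewrite prime_decompE pn => /mapP [p' pps [-> _]]; exact: (allP hq).
have sL : (r * k <= size L)%N.
 rewrite /L prime_decompE pn size_flatten /shape -!map_comp sumnE big_map.
 apply: leq_trans (_ : size ps * k <= _)%N; first by rewrite leq_mul2r rs orbT.
 rewrite -sum1_size big_distrl big_seq [leqRHS]big_seq; apply: leq_sum => p pps /=.
 rewrite mul1n size_nseq -pfactor_dvdn ?(allP pp)//; apply: dvdn_exp2r; by rewrite (big_rem p)//= dvdn_mulr.
apply: Lq; rewrite -(mem_sort geq); apply: mem_nth; rewrite size_sort; apply: leq_trans sL.
by rewrite prednK// muln_gt0 r0.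
Qed.
Lemma arith_prodX (f : nat -> int) k (W : {poly int}) ps : arith_multiplicative f -> (forall p, prime p -> f (p ^ k)%N = W.[p%:Z]) ->
 all prime ps -> uniq ps -> f ((\prod_(p <- ps) p) ^ k)%N = \prod_(p <- ps) W.[p%:Z].
Proof.
move=> [f1 fM] fW; elim: ps => [|p ps IH]; first by rewrite !big_nil exp1n.
move=> /andP[pp pps] /andP[pn un]; have p0 : (0 < \prod_(p <- ps) p)%N.
 by rewrite big_seq prodn_cond_gt0// => x /(allP pps)/prime_gt0.
have co : coprime (p ^ k) ((\prod_(p <- ps) p) ^ k).
 apply: coprimeXl; apply: coprimeXr; rewrite prime_coprime//; apply: contra pn.
 rewrite big_seq; elim/big_rec: _ => [|x y xps H]; first by rewrite dvdn1 => /eqP x1; rewrite x1 in pp.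
 by rewrite Euclid_dvdM// => /orP[|//]; rewrite dvdn_prime2// ?(allP pps)// => /eqP ->.
transitivity (f (p ^ k)%N * f ((\prod_(p <- ps) p) ^ k)%N); last by rewrite (fW p pp) IH// big_cons.
by rewrite big_cons expnMn; apply: fM => //; [rewrite expn_gt0 prime_gt0|rewrite expn_gt0 p0].
Qed.
Lemma seq_congr q (F : {poly int}) (s t : seq nat) : [seq (p %% q)%N | p <- s] = [seq (p %% q)%N | p <- t] ->
 (q %| \prod_(p <- s) F.[p%:Z] - \prod_(p <- t) F.[p%:Z])%Z.
Proof.
elim: s t => [|x s IH] [|y t] //=; first by rewrite subrr dvdz0.
move=> [xy /IH h]; rewrite !big_cons (_ : _ - _ = (F.[x%:Z] - F.[y%:Z]) * \prod_(p <- s) F.[p%:Z] + F.[y%:Z] * (\prod_(p <- s) F.[p%:Z] - \prod_(p <- t) F.[p%:Z])); last by ring.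
apply: rpredD; [apply: dvdz_mulr; apply: horner_congr; rewrite -eqz_mod_dvd; apply/eqP; by rewrite !modz_nat xy|exact: dvdz_mull].
Qed.
Lemma count_ge R K r k q (f : 'I_K -> nat -> int) (a : 'I_K -> 'I_q) (x : R) (s : seq nat) : uniq s -> 0 <= x ->
 (forall n, n \in s -> [/\ (0 < n)%N, n%:R <= x, (q < largest_prime (r * k) n)%N & forall i, (q %| f i n - (a i)%:Z)%Z]) ->
 (size s <= count_solutions r k f a x)%N.
Proof.
move=> us x0 hs; rewrite /count_solutions cardE.
have lt n : n \in s -> (n < (Num.truncn x).+1)%N by move=> /hs[_ h _ _]; rewrite ltnS truncn_ge_nat.
rewrite -(size_map (@inord (Num.truncn x))); apply: uniq_leq_size.
 rewrite map_inj_in_uniq// => m n ms ns /(congr1 val) /=; by rewrite !inordK ?lt.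
move=> z /mapP [n ns ->]; rewrite mem_enum finset.in_set inordK ?lt//; have [-> _ -> h] := hs n ns.
by apply/forallP => i; rewrite eqz_mod_dvd.
Qed.

(** * Loss at the primes dividing q, and choice of the parameters *)

Lemma sum_sub_le R (T : eqType) (s t : seq T) (g : T -> R) : uniq s -> uniq t -> {subset s <= t} -> (forall x, 0 <= g x) ->
 \sum_(x <- s) g x <= \sum_(x <- t) g x.
Proof.
move=> us ut st g0; have -> : \sum_(x <- s) g x = \sum_(x <- t | x \in s) g x.
 rewrite -[RHS]big_filter; apply: perm_big; apply: uniq_perm => //; first exact: filter_uniq.
 by move=> x; rewrite mem_filter; case: (boolP (x \in s)) => //= /st ->.
by rewrite big_mkcond; apply: ler_sum => x _; case: ifP.
Qed.
Lemma one_sub_exp R (t : R) : 0 <= t <= 1/2 -> expR (- (2 * t)) <= 1 - t.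
Proof.
move=> /andP[t0 t1]; have := expR_ge1Dx (2 * t); have e : expR (- (2 * t)) * expR (2 * t) = 1 by rewrite -expRD addNr expR0.
have := expR_gt0 (- (2 * t)); move: e; move: (expR _) (expR _) => x y xy x0 y1.
have h : 1 <= (1 - t) * x.
 apply: (@le_trans _ _ ((1 - t) * (1 + 2 * t))); first by clear - t0 t1; nra.
 by rewrite ler_wpM2l; lra.
have xp : 0 < x by lra.
by rewrite -(ler_pM2r xp) xy.
Qed.
(** The primes above [Y] number at most [Y], so they add at most 1 to the sum of [1 / l]. For the
    others [ln l >= 8 * a + 1], true beyond [N1], divides Mertens' bound by that amount; the
    exponent 1/4 is [2 * a / (8 * a)]. *)
Lemma prod_lower R (a : R) : 0 <= a -> exists2 c : R, 0 < c & exists N1 : nat, forall q Y, (0 < Y)%N -> (size (primes q) <= Y)%N ->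
 (forall l, l \in primes q -> (N1 < l)%N) -> c * expR (- (1/4 * ln Y%:R)) <= \prod_(l <- primes q) (1 - a / l%:R).
Proof.
move=> a0; exists (expR (- (2 * a + 2))); first exact: expR_gt0.
exists (Num.truncn (expR (8 * a + 1) + 2 * a)).+1 => q Y Y0 sY hl.
have big l : l \in primes q -> [/\ (0 < l)%N, prime l, 8 * a + 1 <= ln l%:R & a / l%:R <= 1/2].
 move=> lq; have pl : prime l by move: lq; rewrite mem_primes => /andP[].
 have l0 := prime_gt0 pl; have lr : 0 < l%:R :> R by [].
 have h : expR (8 * a + 1) + 2 * a <= l%:R.
  by apply: le_trans (ltW (truncnS_gt _)) _; rewrite ler_nat; apply: ltnW; apply: hl.
 have := expR_gt0 (8 * a + 1) => e0; split=> //.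
  by rewrite -[leLHS]expRK ler_ln//; clear - h a0; lra.
 by rewrite ler_pdivrMr//; clear - h e0; lra.
pose S : R := \sum_(l <- primes q) l%:R^-1.
have Sb : S <= 1 + (ln Y%:R + 6) / (8 * a + 1).
 have a8 : 0 < 8 * a + 1 by lra.
 rewrite /S (bigID (fun l => l <= Y)%N) /= addrC; apply: lerD.
  apply: (@le_trans _ _ (\sum_(l <- primes q) Y%:R^-1)).
   rewrite big_seq_cond [leRHS]big_seq big_mkcond [leRHS]big_mkcond; apply: ler_sum => l _.
   case: (boolP (l \in primes q)) => //= lq; have [l0 _ _ _] := big l lq.
   case: leqP => [_|Yl]; rewrite /=//.
   by rewrite lef_pV2 ?posrE// ler_nat ltnW.
  rewrite big_const_seq count_predT iter_addr_0 -[leLHS]mulr_natl ler_pdivrMr// mul1r ler_nat//.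
 rewrite ler_pdivlMr//; apply: le_trans (mertens_le R Y0).
 rewrite mulr_suml; apply: (@le_trans _ _ (\sum_(l <- [seq l <- primes q | (l <= Y)%N]) Lam R l / l%:R)).
  rewrite big_filter big_seq_cond [leRHS]big_seq_cond; apply: ler_sum => l /andP[lq _]; have [l0 pl h _] := big l lq.
  by rewrite Lam_prime// mulrC ler_wpM2r// invr_ge0.
 apply: sum_sub_le.
 - by rewrite filter_uniq// primes_uniq.
 - exact: iota_uniq.
 - move=> l; rewrite mem_filter mem_index_iota => /andP[lY lq]; have [l0 _ _ _] := big l lq; by rewrite l0 ltnS.
 - by [].
apply: (@le_trans _ _ (expR (- (2 * a * S)))).
 rewrite -expRD ler_expR.
 have lY := ln_ge0n R Y.
 have : 2 * a * S <= 2 * a + (1/4 * ln Y%:R + 3/2).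
  have h1 : 2 * a * S <= 2 * a * (1 + (ln Y%:R + 6) / (8 * a + 1)) by rewrite ler_wpM2l// mulr_ge0.
  apply: (le_trans h1); rewrite mulrDr mulr1 lerD2l mulrA ler_pdivrMr//; move: (ln Y%:R) lY => y lY; clear - a0 lY; nra.
 clear; lra.
have -> : expR (- (2 * a * S)) = \prod_(l <- primes q) expR (- (2 * (a / l%:R))).
 rewrite /S mulr_sumr -sumrN; elim: (primes q) => [|l s IH]; rewrite ?big_nil ?expR0// !big_cons expRD IH; congr (expR _ * _).
 by lra.
rewrite big_seq [leRHS]big_seq; apply: ler_prod => l lq; rewrite expR_ge0.
have [l0 _ _ h] := big l lq; apply: one_sub_exp; by rewrite h divr_ge0.
Qed.
Lemma size_primes_le R q : (0 < q)%N -> (size (primes q))%:R <= 2 * ln q%:R :> R.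
Proof.
move=> q0; have h : (2 ^ size (primes q) <= q)%N.
 rewrite [leqRHS](prod_prime_decomp q0) prime_decompE big_map -[X in (2 ^ X)%N]sum1_size expn_sum big_seq [leqRHS]big_seq; elim/big_rec2: _ => [//|l x y lq xy].
 apply: leq_mul => //; have pl : prime l by move: lq; rewrite mem_primes => /andP[].
 apply: (@leq_trans l); first exact: prime_gt1.
 by rewrite -[leqLHS]expn1 leq_exp2l ?prime_gt1// logn_gt0.
have l2 : 1/2 <= ln 2 :> R.
 rewrite -[leLHS]expRK ler_ln ?posrE// -(@ler_pXn2r _ 2) ?nnegrE//.
 have -> : expR (1 / 2) ^+ 2 = expR 1 :> R by rewrite -expRM_natl; congr expR; field.
 by apply: le_trans (expR1_le4 R) _; clear; lra.
have : ln (2 ^ size (primes q))%N%:R <= ln q%:R :> R by rewrite ler_ln ?posrE ?ltr0n ?expn_gt0// ler_nat.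
rewrite natrX lnXn// -[ln 2 *+ _]mulr_natl => h3.
have := ler_wpM2l (ler0n R (size (primes q))) l2; move: h3; move: ((size (primes q))%:R : R) (ln q%:R : R) (ln 2 : R) => u v w; clear; lra.
Qed.
(** [z] stands for [ln (ln x)], and [n.+1] is the number of primes in the product. The summand
    [2 * ln z / del] serves to bring the deviation down to [z ^ (- 2)]; the inequalities say that
    [n] is negligible against powers of [z] and constants against powers of [expR z]. *)
Lemma thresholds R (del c8 c5 : R) (n0 : nat) (k W : R) : 0 < del -> 0 < c8 -> 0 < c5 -> 0 < k -> 0 <= W ->
 exists2 z0 : R, 1 <= z0 & forall z, z0 <= z -> let n := (n0 + Num.truncn (2 * ln z / del))%N in
 [/\ n%:R <= c8 * expR (ln z / 4), 12 * n%:R <= z, n.+1%:R * expR (z / 2) + W <= expR z / k, 2 * c5 <= del * z & (1 + W) * z <= expR (z / 3)].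
Proof.
move=> del0 c80 c50 k0 W0.
pose N : R := n0%:R + 2 / del; have N0 : 0 <= N by rewrite addr_ge0// divr_ge0 ?(ltW del0).
pose e : R := Num.min c8 (1/12); have e0 : 0 < e by rewrite /e lt_min c80; clear; lra.
have eN : 0 < e / (N + 1) by rewrite divr_gt0//; clear - N0; lra.
have [v0 v01 hv] := @pow_exp_small R 1 (1/4) _ ltac:(lra) eN.
have kW : 0 < (k * (2 + W))^-1 by rewrite invr_gt0 mulr_gt0//; clear - W0; lra.
have [z1 z11 hz1] := @pow_exp_small R 1 (1/2) _ ltac:(lra) kW.
have W1 : 0 < (1 + W)^-1 by rewrite invr_gt0; clear - W0; lra.
have [z2 z21 hz2] := @pow_exp_small R 1 (1/3) _ ltac:(lra) W1.
have cd : 0 < 2 * c5 / del by [].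
have ev := expR_gt0 v0.
exists (expR v0 + z1 + z2 + 2 * c5 / del); first by clear - ev z11 z21 cd; lra.
move=> z hz n.
have zv : expR v0 <= z by clear - hz z11 z21 cd; lra.
have z0 : 0 < z by clear - zv ev; lra.
have zz1 : z1 <= z by clear - hz ev z21 cd; lra.
have zz2 : z2 <= z by clear - hz ev z11 cd; lra.
have z1' : 1 <= z by clear - z11 zz1; lra.
have lv : v0 <= ln z by rewrite -[leLHS]expRK ler_ln.
set v := ln z in lv n *; have v1 : 1 <= v by clear - lv v01; lra.
have nv : n%:R <= N * v.
 have -> : N * v = n0%:R * v + 2 * v / del by rewrite /N mulrDl mulrAC.
 rewrite /n natrD; apply: lerD; first by rewrite ler_peMr.
 by rewrite truncn_le divr_ge0 ?(ltW del0); clear - v1; lra.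
have hh := hv v lv; rewrite expr1 expRN ler_pdivrMr ?expR_gt0// in hh.
have N1 : 0 < N + 1 by clear - N0; lra.
have nb : n%:R <= e * expR (v / 4).
 apply: (le_trans nv); apply: (@le_trans _ _ ((N + 1) * v)); first by rewrite ler_wpM2r//; clear - v1; lra.
 rewrite (_ : v / 4 = 1/4 * v); last by field.
 have := ler_wpM2l (ltW N1) hh; rewrite mulrA mulrCA mulfV ?gt_eqF// mulr1; by [].
have e4 : 1 <= expR (v / 4) by rewrite -[leLHS]expR0 ler_expR; clear - v1; lra.
have zE : z = expR (v / 4) ^+ 4.
 by rewrite -expRM_natl (_ : 4 * (v / 4) = v) ?lnK ?posrE//; field.
have n12 : 12 * n%:R <= z.
 have : e <= 1/12 by rewrite /e ge_min lexx orbT.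
 move=> e12; have : n%:R <= 1/12 * expR (v / 4) by apply: (le_trans nb); rewrite ler_wpM2r ?expR_ge0.
 have : expR (v / 4) <= z by rewrite zE; rewrite -[leLHS]expr1; apply: ler_weXn2l.
 clear; lra.
split=> //.
- by apply: (le_trans nb); rewrite ler_wpM2r// /e ge_min lexx.
- have h1 := hz1 z zz1; rewrite expr1 expRN ler_pdivrMr// (_ : 1/2 * z = z / 2) in h1; last by field.
 have ez : expR z = expR (z / 2) * expR (z / 2) by rewrite -expRD; congr expR; field.
 have e2 : 1 <= expR (z / 2) by rewrite -[leLHS]expR0 ler_expR; clear - z0; lra.
 rewrite ler_pdivlMr// ez.
 have W2 : 0 < k * (2 + W) by rewrite mulr_gt0//; clear - W0; lra.
 have h2 : k * (2 + W) * z <= expR (z / 2).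
  by have := ler_wpM2l (ltW W2) h1; rewrite mulrA mulfV// mul1r.
 have h3 : n.+1%:R * expR (z / 2) + W <= (2 + W) * z * expR (z / 2).
  have : n.+1%:R <= 2 * z by rewrite -natr1; clear - n12 z1'; lra.
  move: (n.+1%:R) (expR (z / 2)) e2 => u y y1 uz; apply: (@le_trans _ _ (2 * z * y + W * (z * y))); last by apply: eq_ler; ring.
  apply: lerD; first by rewrite ler_wpM2r//; clear - y1; lra.
  by rewrite ler_peMr// mulr_ege1.
 apply: (@le_trans _ _ ((2 + W) * z * expR (z / 2) * k)); first by rewrite ler_pM2r.
 rewrite (_ : _ * k = k * (2 + W) * z * expR (z / 2)); last by ring.
 by rewrite ler_wpM2r.
- have : 2 * c5 / del <= z by clear - hz ev z11 z21; lra.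
 by rewrite ler_pdivrMr// [leRHS]mulrC.
- have h1 := hz2 z zz2; rewrite expr1 expRN ler_pdivrMr// (_ : 1/3 * z = z / 3) in h1; last by field.
 have W2 : 0 < 1 + W by clear - W0; lra.
 by have := ler_wpM2l (ltW W2) h1; rewrite mulrA mulfV// mul1r.
Qed.

(** * Assembly *)

Lemma smith_dvd M m (A : 'M[int]_(M, m)) d : smith_form A d -> (m <= M)%N -> forall i, (i < m)%N -> (d i %| d m.-1)%N.
Proof.
move=> [hd _] mM i im; have mn : minn M m = m by apply/minn_idPr.
rewrite mn in hd; have h j : (i + j < m)%N -> (d i %| d (i + j))%N.
 elim: j => [|j IH]; first by rewrite addn0.
 by rewrite addnS => h; apply: dvdn_trans (IH (ltnW h)) (hd _ h).
have -> : m.-1 = (i + (m.-1 - i))%N by rewrite subnKC// -ltnS prednK; exact: leq_ltn_trans im.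
by apply: h; rewrite subnKC; [rewrite prednK//; exact: leq_ltn_trans im|rewrite -ltnS prednK; exact: leq_ltn_trans im].
Qed.
(** Local counts, lifted by [Sol_ppow], are multiplied by [Sol_lower]. [Y] bounds the number of
    primes dividing [q], so Bernoulli's inequality and [Y * E <= 1/2] keep the product of the
    factors [1 - E] above 1/2, while [prod_lower] handles the other factors. *)
Lemma Sol_main R m (F : 'I_m -> {poly int}) : (0 < m)%N -> mult_independent F ->
 exists2 del : R, 0 < del <= 1 & exists2 c3 : R, 0 < c3 & exists N0 s1 : nat, forall q n Y (b : 'I_m -> int), (0 < q)%N ->
 (forall l, prime l -> (l %| q)%N -> (N0 < l)%N /\ gcdn (l - 1) (beta F) = 1%N) -> (forall i, coprimez (b i) q) ->
 (0 < Y)%N -> (size (primes q) <= Y)%N -> (s1 <= n.+1)%N -> Y%:R * (del^-1 * (1 - del) ^+ (n.+1 - s1)) <= 1/2 ->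
 (totient q)%:R ^+ n.+1 * ((c3 * expR (- (1/4 * ln Y%:R))) ^+ n.+1 / 2) <= (totient q)%:R ^+ m * #|Sol q n.+1 F b|%:R :> R.
Proof.
move=> m0 hF; have F0 := indep_neq0 hF.
have [M [r [G [mu [d [fa sm bE]]]]]] := betaP F0.
have mM := indep_leq hF fa; have hbt := smith_dvd sm mM; case: sm => _ [P [Q [_ uQ sm]]].
have r0 i : r i != 0 by apply: contraNneq (F0 i) => ri; case: fa => -> _ _ _; rewrite ri scale0r.
have mn : minn M m = m by apply/minn_idPr.
rewrite mn in bE; rewrite -bE in hbt.
have [del /andP[del0 del1] [D [N0 [s0 hl]]]] := @local_count R m M F r G mu d P Q (beta F) fa mM r0 uQ sm hbt.
have [c3 c30 [N1 hp]] := @prod_lower R (4 * D)%N%:R (ler0n _ _).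
exists del; first by rewrite del0.
exists c3 => //; exists (N0 + N1 + 4 * D)%N, (m + s0)%N => q n Y b q0 hq hb Y0 sY sn hE.
pose s' := (n.+1 - m)%N.
have ns : n.+1 = (m + s')%N by rewrite /s' subnKC//; apply: leq_trans sn; exact: leq_addr.
have s0s : (s0 <= s')%N by move: sn; rewrite ns leq_add2l.
pose E := del^-1 * (1 - del) ^+ (s' - s0).
have EE : del^-1 * (1 - del) ^+ (n.+1 - (m + s0)) = E by rewrite /E ns subnDl.
rewrite EE in hE.
have E0 : 0 <= E by rewrite mulr_ge0 ?exprn_ge0// subr_ge0.
have YE : 1 <= Y%:R :> R by rewrite ler1n.
have E1 : E <= 1/2 by apply: le_trans hE; rewrite ler_peMl.
have E1' : 0 <= 1 - E by clear - E1; lra.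
(* The value 0 keeps [g] nonnegative everywhere, as [Sol_lower] asks; it is not taken at the primes
   dividing [q]. *)
pose g l : R := if (4 * D < l)%N then (1 - (4 * D)%N%:R / l%:R) ^+ (m + s') * (1 - E) else 0.
have g0 l : 0 <= g l.
 rewrite /g; case: ifP => // h; rewrite mulr_ge0// exprn_ge0// subr_ge0 ler_pdivrMr ?mul1r ?ler_nat ?ltr0n; [exact: ltnW|exact: leq_ltn_trans h].
pose Pl l := [/\ (N0 + N1 + 4 * D < l)%N, gcdn (l - 1) (beta F) = 1%N & forall i, ((b i)%:~R : 'F_l) != 0].
have hP l e : prime l -> Pl l -> (totient (l ^ e.+1))%:R ^+ (m + s') * g l <= (totient (l ^ e.+1))%:R ^+ m * #|Sol (l ^ e.+1) (m + s') F b|%:R.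
 move=> pl [lN gl bl]; have l4 : (4 * D < l)%N by move: lN; clear; lia.
 have lN0 : (N0 < l)%N by move: lN; clear; lia.
 have [h1 h2 h3 h4] := hl l pl lN0 gl; rewrite /g l4.
 exact: (Sol_ppow e pl l4 h1 h2 (fun b' hb' => h3 b' hb' s' s0s) h4 E1' bl).
have hq' l : prime l -> (l %| q)%N -> Pl l.
 move=> pl lq; have [h1 h2] := hq l pl lq; split=> // i; rewrite intFp_eq0//; apply/negP => li.
 have := hb i; rewrite coprimezE => co; have : (l %| gcdn `|b i| q)%N by rewrite dvdn_gcd li.
 by move: co; rewrite /coprime => /eqP ->; rewrite dvdn1 => /eqP l1; rewrite l1 in pl.
have := Sol_lower g0 hP q0 hq'; rewrite -ns; apply: le_trans.
rewrite ler_wpM2l//.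
have lp l : l \in primes q -> prime l /\ (N0 + N1 + 4 * D < l)%N.
 by rewrite mem_primes => /and3P[pl _ lq]; have [h _] := hq l pl lq.
have -> : \prod_(l <- primes q) g l = (\prod_(l <- primes q) (1 - (4 * D)%N%:R / l%:R)) ^+ n.+1 * (1 - E) ^+ size (primes q).
 rewrite -prodrXl -[(1 - E) ^+ _]iter_mulr_1 -[X in iter X]count_predT -big_const_seq -big_split big_seq [RHS]big_seq; apply: eq_bigr => l lq.
 have [_ h] := lp l lq; by rewrite /g ns (_ : (4 * D < l)%N)//; move: h; clear; lia.
apply: ler_pM; rewrite//.
 apply: lerXn2r; rewrite ?nnegrE//.
  rewrite big_seq prodr_ge0// => l /lp [pl h]; rewrite subr_ge0 ler_pdivrMr ?ltr0n ?prime_gt0// mul1r ler_nat; move: h; clear; lia.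
 by apply: hp => // l /lp [_ h]; move: h; clear; lia.
have e01 : 0 <= E <= 1 by rewrite E0; clear - E1; lra.
apply: le_trans (bern (size (primes q)) e01).
have : (size (primes q))%:R * E <= Y%:R * E by rewrite ler_wpM2r// ler_nat.
move: hE; move: (_ * E) (_ * E) => u v; clear; lra.
Qed.
(** The exponent is at least [2 * ln z / del], so the power is at most [z ^ (- 2)], while [Y] is
    only [O(z)]. *)
Lemma E_small R (del c5 z : R) n s1 Y : 0 < del <= 1 -> 0 < c5 -> 1 <= z -> Y%:R <= c5 * z -> 2 * c5 <= del * z ->
 (s1 + Num.truncn (2 * ln z / del) <= n)%N -> Y%:R * (del^-1 * (1 - del) ^+ (n.+1 - s1)) <= 1/2 :> R.
Proof.
move=> /andP[d0 d1] c0 z1 hY hz hn; set j := (n.+1 - s1)%N; have z0 : 0 < z by lra.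
have j1 : 2 * ln z / del <= j%:R.
 apply: (le_trans (ltW (truncnS_gt _))); rewrite ler_nat /j ltn_subRL ltnS; exact: hn.
have h : (1 - del) ^+ j <= z^-1 ^+ 2.
 apply: (@le_trans _ _ (expR (- del) ^+ j)).
  by apply: lerXn2r; rewrite ?nnegrE ?subr_ge0//; apply: le_trans (expR_ge1Dx _).
 have -> : z^-1 ^+ 2 = expR (- (2 * ln z)).
  by rewrite expRN expRM_natl lnK// exprVn.
 rewrite -expRM_natl ler_expR mulrN lerN2 -ler_pdivrMr//.
have jp : 0 <= (1 - del) ^+ j by rewrite exprn_ge0// subr_ge0.
apply: (@le_trans _ _ (c5 * z * (del^-1 * z^-1 ^+ 2))).
 apply: ler_pM => //.
 by rewrite ler_pM2l.
have -> : c5 * z * (del^-1 * z^-1 ^+ 2) = c5 / (del * z) by field; rewrite !gt_eqF.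
rewrite ler_pdivrMr//; clear - hz; lra.
Qed.
(** Here [h] is of order [z / n], [n] is at most a small multiple of [z ^ (1/4)], and the local loss
    is [z ^ (- 1/4)]; each window thus brings at least [expR (v / 2) = z ^ (1/2)]. With
    [n >= 2 * r + 1] windows the product exceeds [z ^ r] even after the loss attached to the last
    prime. *)
Lemma final_ineq R (c2 c3 c5 z : R) Y n h r : 0 < c2 -> 0 < c3 -> 0 < c5 -> 1 <= z -> (0 < Y)%N -> Y%:R <= c5 * z ->
 (0 < n)%N -> (2 * r + 1 <= n)%N -> n%:R <= c3 * expR (- (ln c5 / 4)) * c2 / 12 * expR (ln z / 4) -> 12 * n%:R <= z -> z / (6 * n%:R) <= h%:R + 1 ->
 c3 * expR (- (ln c5 / 4)) * z ^ (r%:Z - 2) <= c3 * expR (- (1/4 * ln Y%:R)) * (c3 * expR (- (1/4 * ln Y%:R)) * (c2 * h%:R)) ^+ n.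
Proof.
move=> c20 c30 c50 z1 Y0 hY n0 rn hn n12 hh; have z0 : 0 < z by clear - z1; lra.
set v := ln z in hn *; have zE : z = expR v by rewrite /v lnK.
have v0 : 0 <= v by rewrite /v -ln1 ler_ln ?posrE.
set K := c3 * expR (- (ln c5 / 4)) in hn *; have K0 : 0 < K by rewrite mulr_gt0.
have lY : ln Y%:R <= ln c5 + v by rewrite /v -lnM// ler_ln ?posrE// mulr_gt0.
set y := c3 * expR (- (1/4 * ln Y%:R)).
have yK : K * expR (- (v / 4)) <= y.
 rewrite /K /y -mulrA -expRD ler_pM2l// ler_expR; clear - lY; lra.
have hb : z / (12 * n%:R) <= h%:R.
 have e : z / (6 * n%:R) = z / (12 * n%:R) + z / (12 * n%:R) by field; rewrite gt_eqF.
 have : 1 <= z / (12 * n%:R) by rewrite ler_pdivlMr// mul1r.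
 move: hh; rewrite e; move: (z / (12 * n%:R)) => u; clear; lra.
have big : expR (v / 2) <= y * (c2 * h%:R).
 apply: (@le_trans _ _ (K * expR (- (v / 4)) * (c2 * (z / (12 * n%:R))))); last first.
  apply: ler_pM => //.
  by rewrite ler_pM2l.
 have -> : K * expR (- (v / 4)) * (c2 * (z / (12 * n%:R))) = (K * c2 / 12) * expR (v / 4) * (expR (v / 2) / n%:R).
  have -> : z = expR (v / 4) ^+ 2 * expR (v / 2) by rewrite zE -expRM_natl -expRD; congr expR; field.
  by rewrite expRN; field; rewrite !gt_eqF.
 rewrite mulrCA -[leLHS]mulr1 ler_pM2l// ler_pdivlMr// mul1r//.
have y0 : 0 <= y by rewrite mulr_ge0.
apply: (@le_trans _ _ (K * expR (- (v / 4)) * expR (v / 2) ^+ n)); last first.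
 apply: (ler_pM (mulr_ge0 (ltW K0) (expR_ge0 _)) (exprn_ge0 _ (expR_ge0 _)) yK).
 by apply: lerXn2r; rewrite ?nnegrE.
rewrite -mulrA ler_pM2l// -expRM_natl -expRD.
apply: (@le_trans _ _ (z ^ r%:Z)); first by apply: ler_weXz2l => //; rewrite gerBl.
rewrite -exprnP zE -expRM_natl ler_expR.
have : (2 * r%:R + 1) * v <= n%:R * v.
 by rewrite ler_wpM2r// -[1]/(1%N%:R) -natrM -natrD ler_nat.
clear - v0; lra.
Qed.

(** The hypothesis is applied at [V = ln (X / P) - T], so that the upper end of its window is
    exactly [X / P]; the lower end stays above [hi]. *)
Lemma plast_lower R (cT A V0 : R) (T : nat) : 0 < cT -> 0 < A -> 20 + T%:R <= V0 ->
 (forall V q u, V0 <= V -> odd q -> q%:R <= V `^ A -> coprime u q ->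
  cT * expR V / (V * (totient q)%:R) <= (count (fun p => [&& prime p, p == u %[mod q] & V - T%:R <= ln p%:R]) (index_iota 1 (Num.truncn (expR (V + T%:R))).+1))%:R) ->
 forall (X hi a : R) q u P, 0 < X -> (0 < P)%N -> 0 < a -> a <= hi -> odd q -> q%:R <= a `^ A -> coprime u q -> hi + V0 + 2 * T%:R <= ln X - ln P%:R ->
 cT * expR (- T%:R) * X / (ln X * (totient q)%:R) / P%:R <= (size (plast q X hi u P))%:R.
Proof.
move=> c0 A0 V0T hT X hi a q u P X0 P0 a0 ahi oq qa cu hX; have Pr : 0 < P%:R :> R by [].
have T0 : 0 <= T%:R :> R by [].
have q0 : (0 < q)%N by case: (q) oq.
have tq : 0 < (totient q)%:R :> R by rewrite ltr0n totient_gt0.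
set V := ln X - ln P%:R - T%:R.
have VV : V0 <= V by rewrite /V; clear - hX V0T T0 a0 ahi; lra.
have Vhi : hi + V0 + T%:R <= V by rewrite /V; clear - hX; lra.
have Vp : 0 < V by clear - VV V0T T0; lra.
have qV : q%:R <= V `^ A.
 by apply: (le_trans qa); apply: ge0_ler_powR; rewrite ?nnegrE//; clear - ahi Vhi V0T T0; lra.
have eV : expR (V + T%:R) = X / P%:R by rewrite subrK expRD expRN !lnK.
have := hT V q u VV oq qV cu; rewrite eV => h.
apply: (@le_trans _ _ (cT * expR V / (V * (totient q)%:R))).
 have -> : expR V = expR (- T%:R) * (X / P%:R) by rewrite -eV -expRD; congr expR; ring.
 have -> : cT * expR (- T%:R) * X / (ln X * (totient q)%:R) / P%:R = cT * (expR (- T%:R) * (X / P%:R)) / (ln X * (totient q)%:R) by ring.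
 have l0 := ln_ge0n R P.
 have lX : V <= ln X by rewrite /V; clear - l0 T0; lra.
 rewrite ler_wpM2l// lef_pV2 ?posrE ?mulr_gt0//; last exact: lt_le_trans lX.
 by rewrite ler_pM2r.
apply: (le_trans h); rewrite ler_nat size_filter; apply: sub_count => p /and3P[-> -> hp].
apply: le_trans hp; clear - Vhi V0T T0; lra.
Qed.
Lemma Sol_congr m q n (F : 'I_m -> {poly int}) b (u : {ffun 'I_n.+1 -> 'I_q}) (ps : seq nat) i : u \in Sol q n.+1 F b ->
 [seq (p %% q)%N | p <- ps] = [seq (v %% q)%N | v <- (u ord0 : nat) :: [seq (u (lift ord0 j) : nat) | j <- enum 'I_n]] ->
 (q %| \prod_(p <- ps) (F i).[p%:Z] - b i)%Z.
Proof.
rewrite finset.in_set => /andP[_ /forallP /(_ i) h] /(seq_congr (F i)) h2.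
rewrite (_ : _ - _ = (\prod_(p <- ps) (F i).[p%:Z] - \prod_j (F i).[(u j : nat)%:Z]) + (\prod_j (F i).[(u j : nat)%:Z] - b i)); last by ring.
apply: rpredD => //; move: h2; congr (_ %| _ - _)%Z.
by rewrite big_cons big_map big_enum big_ord_recl.
Qed.
Lemma dvdz_prodX (d : nat) (I : finType) (x y : I -> int) (e : I -> nat) : (forall i, (d %| x i - y i)%Z) -> (d %| \prod_i x i ^+ e i - \prod_i y i ^+ e i)%Z.
Proof.
move=> h; apply: prod_congr => i; elim: (e i) => [|k IH] => //.
rewrite !exprS (_ : _ - _ = (x i - y i) * x i ^+ k + y i * (x i ^+ k - y i ^+ k)); last by ring.
by apply: rpredD; [apply: dvdz_mulr|apply: dvdz_mull].
Qed.
(** Nothing is counted twice: the residues modulo [q] of a list recover the solution [u], and the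
    list is recovered from the integer as its increasing sequence of prime divisors. *)
Lemma solutions_ge R m (F : 'I_m -> {poly int}) r k q n (B : nat) (f : 'I_m.+1 -> nat -> int) (W : 'I_m.+1 -> nat -> {poly int}) (lambda : 'I_m -> nat)
  (a : 'I_m.+1 -> 'I_q) (x X hi w z : R) (lo : nat -> R) :
 (0 < r)%N -> (0 < k)%N -> (forall i, arith_multiplicative (f i)) ->
 (forall (i : 'I_m.+1) (v p : nat), (1 <= v <= k)%N -> prime p -> f i (p ^ v)%N = (W i v).[p%:Z]) ->
 (forall i : 'I_m, W (widen_ord (leqnSn m) i) k = F i) -> W ord_max k = \prod_(i < m) F i ^+ lambda i ->
 a ord_max = \prod_(i < m) (a (widen_ord (leqnSn m) i) ^ lambda i)%N %[mod q] ->
 0 < x -> X = x `^ (k%:R)^-1 -> (0 < q)%N -> (r <= n.+1)%N -> 0 <= w -> 0 <= z ->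
 (forall i, lo i <= lo i.+1) -> lo n <= hi -> 0 <= hi -> ln q%:R < lo 0%N ->
 (forall i u, (i < n)%N -> coprime u q -> w <= \sum_(p <- pwin q B lo i u) p%:R^-1) ->
 (forall u P, (0 < P)%N -> ln P%:R <= n%:R * hi -> coprime u q -> z / P%:R <= (size (plast q X hi u P))%:R) ->
 #|Sol q n.+1 F (fun i => (a (widen_ord (leqnSn m) i) : nat)%:Z)|%:R * (z * w ^+ n) <= (count_solutions r k f a x)%:R.
Proof.
move=> r0 k0 fm fW WF WK aK x0 XE q0 rn w0 z0 hlo lohi hi0 qlo hw hz.
pose b (i : 'I_m) : int := (a (widen_ord (leqnSn m) i) : nat)%:Z.
have X0 : 0 < X by rewrite XE powR_gt0.
have lom i j : (i <= j)%N -> lo i <= lo j.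
 elim: j => [|j IH]; first by rewrite leqn0 => /eqP ->.
 by rewrite leq_eqVlt => /orP[/eqP -> //|]; rewrite ltnS => /IH h; apply: le_trans (hlo j).
have htop i p u : (i < n)%N -> p \in pwin q B lo i u -> ln p%:R <= hi.
 move=> iN; rewrite mem_filter => /andP[/and3P[_ _ /andP[_ h]] _]; apply: le_trans (ltW h) _; apply: le_trans lohi; exact: lom.
pose us (u : {ffun 'I_n.+1 -> 'I_q}) := [seq (u (lift ord0 j) : nat) | j <- enum 'I_n].
pose PLu (u : {ffun 'I_n.+1 -> 'I_q}) := plist q B lo X hi 0 (u ord0) (us u) 1.
have sus u : size (us u) = n by rewrite size_map size_enum_ord.
pose hk (u : {ffun 'I_n.+1 -> 'I_q}) := [seq (v %% q)%N | v <- (u ord0 : nat) :: us u].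
have hkE u : hk u = [seq (u j : nat) | j <- enum 'I_n.+1].
 rewrite enum_ordSl /hk/= -!map_comp modn_small//; congr (_ :: _).
 by apply: eq_map => j /=; rewrite modn_small.
pose PL := flatten [seq PLu u | u <- enum (Sol q n.+1 F b)].
have uPL : uniq PL.
 apply: (@uniq_flatten_key _ _ _ _ _ (map (fun p => (p %% q)%N)) hk).
 - exact: enum_uniq.
 - move=> u v _ _; rewrite !hkE => /eq_in_map e; apply/ffunP => j; apply: val_inj; apply: e; exact: mem_enum.
 - by move=> u _; apply: plist_uniq.
 - move=> u ps _ hps; have e0 : (0 + size (us u) = n)%N by rewrite sus.
  by have [_ -> _ _ _] := plistP (ltW X0) hlo lohi e0 (ltn0Sn 0) hps.
have PLP ps : ps \in PL -> exists2 u, u \in Sol q n.+1 F b & [/\ all prime ps, [seq (p %% q)%N | p <- ps] = hk u,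
   (1 * \prod_(p <- ps) p)%N%:R <= X, all (fun p => lo 0%N <= ln p%:R) ps & sorted ltn ps].
 move=> /flattenP [l /mapP [u uS ->] hps]; exists u; first by rewrite mem_enum in uS.
 have e0 : (0 + size (us u) = n)%N by rewrite sus.
 by have [h1 h2 h3 h4 h5] := plistP (ltW X0) hlo lohi e0 (ltn0Sn 0) hps; split.
pose NS := [seq ((\prod_(p <- ps) p) ^ k)%N | ps <- PL].
have uNS : uniq NS.
 rewrite map_inj_in_uniq// => ps ps' /PLP [u _ [p1 _ _ _ s1]] /PLP [u' _ [p1' _ _ _ s1']] e.
 by rewrite -(primes_prodX k0 p1 s1) e primes_prodX.
have le1 : (size NS)%:R <= (count_solutions r k f a x)%:R :> R.
 rewrite ler_nat; apply: count_ge uNS (ltW x0) _ => N /mapP [ps psPL ->].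
 have [u uS [pp hm PX hl so]] := PLP ps psPL; rewrite mul1n in PX.
 have P0 : (0 < \prod_(p <- ps) p)%N by rewrite big_seq prodn_cond_gt0// => p /(allP pp)/prime_gt0.
 have sps : size ps = n.+1 by have := congr1 size hm; rewrite !size_map/= sus.
 have ups : uniq ps by apply: sorted_uniq so; [exact: ltn_trans|exact: ltnn].
 have fE i : f i ((\prod_(p <- ps) p) ^ k)%N = \prod_(p <- ps) (W i k).[p%:Z].
  by apply: arith_prodX => // p pr; apply: fW => //; rewrite k0 leqnn.
 have cF i : (q %| \prod_(p <- ps) (F i).[p%:Z] - b i)%Z by apply: Sol_congr uS hm.
 split.
 - by rewrite expn_gt0 P0.
 - rewrite natrX; apply: (@le_trans _ _ (X ^+ k)); first by apply: lerXn2r; rewrite ?nnegrE.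
  by rewrite XE -powR_mulrn// -powRrM mulVf// powRr1.
 - apply: largest_prime_gt => //; last by rewrite sps.
  apply/allP => p pps; have lp := allP hl p pps; have p0 := prime_gt0 (allP pp p pps).
  change (q < p)%N; rewrite -(ltr_nat R) -ltr_ln ?posrE//; exact: lt_le_trans qlo lp.
 - move=> i; rewrite fE; case: (unliftP ord_max i) => [j|] ->.
   have -> : lift ord_max j = widen_ord (leqnSn m) j by apply: val_inj; rewrite/= /bump leqNgt ltn_ord.
   by rewrite WF.
  rewrite WK (eq_bigr (fun p : nat => \prod_(i < m) (F i).[p%:Z] ^+ lambda i)) => [|p _]; last first.
   by rewrite horner_prod; apply: eq_bigr => j _; rewrite horner_exp.
  rewrite exchange_big (eq_bigr (fun i => (\prod_(p <- ps) (F i).[p%:Z]) ^+ lambda i)) => [|j _]; last by rewrite prodrXl.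
  rewrite (_ : _ - _ = (\prod_(i < m) (\prod_(p <- ps) (F i).[p%:Z]) ^+ lambda i - \prod_(i < m) b i ^+ lambda i) + (\prod_(i < m) b i ^+ lambda i - (a ord_max : nat)%:Z)); last by ring.
  apply: rpredD; first exact: dvdz_prodX.
  have -> : \prod_(i < m) b i ^+ lambda i = (\prod_(i < m) (a (widen_ord (leqnSn m) i) ^ lambda i))%N%:Z.
   rewrite -[RHS]natz natr_prod; apply: eq_bigr => j _; by rewrite natrX natz.
  by rewrite -eqz_mod_dvd; rewrite !modz_nat -aK.
apply: le_trans le1; rewrite size_map size_flatten /shape -map_comp sumnE big_map big_enum natr_sum.
rewrite mulr_natl -sumr_const.
apply: ler_sum => u uS.
have cu : all (fun v => coprime v q) ((u ord0 : nat) :: us u).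
 move: uS; rewrite finset.in_set => /andP[/forallP co _]; rewrite/= co; apply/allP => v /mapP [j _ ->]; exact: co.
have := plist_size w0 z0 hw htop hz (_ : (0 + size (us u) = n)%N) cu (ltn0Sn 0); rewrite sus ln1 divr1; apply => //.
Qed.
(** The totient cancels: each of the [n] windows and the last prime divide by [phi], and the number
    of solutions brings back [phi ^ n.+1]. *)
Lemma regroup (R : fieldType) (d l phi y s : R) n : phi != 0 ->
 d / (l * phi) * (s / phi) ^+ n * (phi ^+ n.+1 * (y ^+ n.+1 / 2)) = d / l / 2 * (y * (y * s) ^+ n).
Proof.
move=> p0; have e : (s / phi) ^+ n * phi ^+ n = s ^+ n by rewrite -exprMn divfK.
rewrite [(y * s) ^+ n]exprMn -e !exprS invfM.
move: ((s / phi) ^+ n) (phi ^+ n) (y ^+ n) (l^-1) => a b c l'.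
have -> : d * (l' * phi^-1) * a * (phi * b * (y * c / 2)) = (phi^-1 * phi) * (d * l' * a * (b * (y * c / 2))) by ring.
by rewrite mulVf//; ring.
Qed.
(* K = m.+1: the indices 1, ..., K-1 are the i : 'I_m, embedded in 'I_m.+1 by
   widen_ord, and the index K is ord_max.  F is the family
   (W_{1,k}, ..., W_{K-1,k}), the only data on which C depends. *)
Theorem theorem2p5 (R : realType) (m : nat) (hK : (1 < m.+1)%N)
    (F : 'I_m -> {poly int})
    (hind : mult_independent F)
    (hdeg : (1 < \sum_(i < m) (size (F i)).-1)%N) :
  exists C : R, 0 < C /\
  forall (r k : nat) (K0 : R), (1 <= r)%N -> (1 <= k)%N -> 0 < K0 ->
  forall (f : 'I_m.+1 -> nat -> int) (W : 'I_m.+1 -> nat -> {poly int})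
         (lambda : 'I_m -> nat),
  (forall i, arith_multiplicative (f i)) ->
  (forall (i : 'I_m.+1) (v p : nat), (1 <= v <= k)%N -> prime p ->
     f i (p ^ v)%N = (W i v).[p%:Z]) ->
  (forall i : 'I_m, W (widen_ord (leqnSn m) i) k = F i) ->
  W ord_max k = \prod_(i < m) F i ^+ lambda i ->
  (exists i, lambda i != 0%N) ->
  exists c : R, 0 < c /\
  exists x0 : R, forall x : R, x0 <= x ->
  forall q : nat, (0 < q)%N -> q%:R <= ln x `^ K0 ->
  admissible W k q ->
  (forall l : nat, prime l -> (l %| q)%N ->
     C < l%:R /\ gcdn (l - 1) (beta F) = 1%N) ->
  forall a : 'I_m.+1 -> 'I_q,
  (forall i, a i \in U q) ->
  a ord_max = \prod_(i < m) (a (widen_ord (leqnSn m) i) ^ lambda i)%N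
    %[mod q] ->
  c * ((totient q)%:R ^+ m)^-1 *
    (x `^ (k%:R)^-1 * ln (ln x) ^ (r%:Z - 2) / ln x)
  <= (count_solutions r k f a x)%:R.
Proof.
have [del del01 [c3 c30 [N0 [s1 hSol]]]] := @Sol_main R m F hK hind.
(* The summand 2 makes [q] odd, as the results on primes in classes require. *)
exists (N0 + 2)%N%:R; split; first by rewrite ltr0n addn2.
move=> r k K0 r1 k1 K00 f W lambda fm fW WF WK _.
(* The primes in the windows satisfy [ln p >= (ln x) ^ (1/3)], so [q <= (ln x) ^ K0] is at most
   [(ln p) ^ (3 * K0)]. *)
pose A := 3 * K0; have A0 : 0 < A by rewrite mulr_gt0.
have [cT cT0 [T [V0 [V0T hT]]]] := T1q A0; have [c2 c20 [a0 [a01 hw]]] := psum_window A0.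
(* [q] has at most [2 * ln q <= 2 * K0 * z] prime factors; [c5 * z] bounds this number rounded up to
   the integer [Y]. *)
pose c5 := 2 * K0 + 1; have c50 : 0 < c5 by rewrite /c5; clear - K00; lra.
pose Kc := c3 * expR (- (ln c5 / 4)); have Kc0 : 0 < Kc by rewrite mulr_gt0 ?expR_gt0.
pose c8 := Kc * c2 / 12; have c80 : 0 < c8 by rewrite divr_gt0// mulr_gt0.
have kr : 0 < k%:R :> R by rewrite ltr0n.
have T0 : 0 <= T%:R :> R by [].
pose Wc := V0 + 2 * T%:R + a0 + K0; have Wc0 : 0 <= Wc by rewrite /Wc; clear - V0T T0 a01 K00; lra.
have del0 : 0 < del by case/andP: del01.
have [z0 z01 hz0] := @thresholds R del c8 c5 (s1 + 2 * r + 1) k%:R Wc del0 c80 c50 kr Wc0.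
pose cc := cT * expR (- T%:R) * k%:R * Kc / 2.
exists cc; split; first by rewrite /cc divr_gt0// !mulr_gt0 ?expR_gt0.
exists (expR (expR z0)) => x hx q q0 qx _ hq a ha aK.
have x0 : 0 < x by apply: lt_le_trans hx; exact: expR_gt0.
have lx : expR z0 <= ln x by rewrite -[leLHS]expRK ler_ln ?posrE ?expR_gt0.
have lx0 : 0 < ln x by apply: lt_le_trans lx; exact: expR_gt0.
have [z zE] : exists z, z = ln (ln x) by exists (ln (ln x)).
have zz : z0 <= z by rewrite zE -[leLHS]expRK ler_ln ?posrE ?expR_gt0.
have ez : expR z = ln x by rewrite zE lnK ?posrE.
have z1 : 1 <= z by clear - zz z01; lra.
have zp : 0 < z by clear - z1; lra.
have := hz0 z zz; set n := (_ + Num.truncn _)%N => /= -[n8 n12 nX hdz Wz].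
have nge : (s1 + 2 * r + 1 <= n)%N by exact: leq_addr.
have n0 : (0 < n)%N by apply: leq_trans nge; rewrite addn1.
have nr : 0 < n%:R :> R by rewrite ltr0n.
have lq : ln q%:R <= K0 * z.
 rewrite zE -ln_powR ler_ln ?posrE ?ltr0n ?powR_gt0//.
pose Y := (Num.truncn (2 * K0 * z)).+1.
have KZ0 : 0 <= 2 * K0 * z by rewrite !mulr_ge0 ?(ltW K00) ?(ltW zp).
have sY : (size (primes q) <= Y)%N.
 apply: leqW; rewrite truncn_ge_nat//; apply: le_trans (size_primes_le R q0) _; clear - lq; lra.
have Yz : Y%:R <= c5 * z.
 have -> : c5 * z = 2 * K0 * z + z by rewrite /c5; ring.
 by rewrite /Y -[leLHS]natr1; apply: lerD => //; rewrite truncn_le.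
have hE := @E_small R del c5 z n s1 Y del01 c50 z1 Yz hdz ltac:(rewrite /n; clear; lia).
have sn : (s1 <= n.+1)%N by apply: leqW; apply: leq_trans nge; clear; lia.
pose b (i : 'I_m) : int := (a (widen_ord (leqnSn m) i) : nat)%:Z.
have hb i : coprimez (b i) q by have := ha (widen_ord (leqnSn m) i); rewrite finset.in_set coprimezE.
have hq' l : prime l -> (l %| q)%N -> (N0 < l)%N /\ gcdn (l - 1) (beta F) = 1%N.
 move=> pl lql; have [h ->] := hq l pl lql; split=> //; move: h; rewrite ltr_nat; apply: leq_ltn_trans; exact: leq_addr.
have S := hSol q n Y b q0 hq' hb (ltn0Sn _) sY sn hE.
have oq : odd q.
 apply: contraT => ev; have [] := hq 2%N isT; first by rewrite dvdn2.
 by rewrite ltr_nat addn2.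
(* With [h] doublings in each of [n] windows, the end point grows from [expR (z / 3)] by a factor at
   most [expR (z / 6)], so all windows end before [hi = expR (z / 2)]. *)
pose h := Num.truncn (z / (6 * n%:R)).
have h1 : h%:R <= z / (6 * n%:R) by rewrite truncn_le divr_ge0 ?mulr_ge0 ?(ltW zp).
have h2 : z / (6 * n%:R) <= h%:R + 1 by rewrite natr1; apply: ltW; exact: truncnS_gt.
pose lo i := 2 ^+ (h * i) * expR (z / 3); pose hi := expR (z / 2).
have p2 j : 1 <= 2 ^+ j :> R by apply: exprn_ege1; clear; lra.
have lo0 i : expR (z / 3) <= lo i by rewrite /lo ler_peMl ?expR_ge0.
have loS i : lo i.+1 = 2 ^+ h * lo i by rewrite /lo mulnS exprD mulrA.
have hlo i : lo i <= lo i.+1 by rewrite loS ler_peMl// (le_trans _ (lo0 i)) ?expR_ge0.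
have lohi : lo n <= hi.
 rewrite /lo /hi (_ : z / 2 = z / 6 + z / 3) ?expRD; last by field.
 rewrite ler_wpM2r ?expR_ge0//; apply: (@le_trans _ _ (expR (h * n)%N%:R)).
  rewrite -[(h * n)%N%:R]mulr1 expRM_natl; apply: lerXn2r; rewrite ?nnegrE ?expR_ge0//; apply: le_trans (expR_ge1Dx 1); clear; lra.
 rewrite ler_expR natrM; move: h1; rewrite ler_pdivlMr ?mulr_gt0//; clear; lra.
have lom i : (i <= n)%N -> lo i <= hi.
 move=> iN; apply: le_trans lohi; rewrite /lo ler_wpM2r ?expR_ge0//; apply: ler_weXn2l; [clear; lra|by rewrite leq_mul2l iN orbT].
have Wz' : Wc < expR (z / 3) by apply: lt_le_trans Wz; move: Wc0 z1; clear; nra.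
have qz : q%:R <= expR (z / 3) `^ A.
 apply: (le_trans qx); rewrite -ez /powR (gt_eqF (expR_gt0 z)) (gt_eqF (expR_gt0 (z / 3))) !expRK ler_expR /A; clear; lra.
have qlo i : q%:R <= lo i `^ A.
 apply: (le_trans qz); apply: ge0_ler_powR; rewrite ?nnegrE ?(ltW A0) ?expR_ge0//; apply: le_trans (lo0 i); exact: expR_ge0.
pose B := (Num.truncn (expR hi)).+1.
pose X := x `^ (k%:R)^-1; have X0 : 0 < X by rewrite powR_gt0.
have lX : ln X = expR z / k%:R by rewrite /X ln_powR ez mulrC.
have tq : 0 < (totient q)%:R :> R by rewrite ltr0n totient_gt0.
pose w := c2 * h%:R / (totient q)%:R; pose zc := cT * expR (- T%:R) * X / (ln X * (totient q)%:R).
have lX0 : 0 < ln X by rewrite lX divr_gt0 ?expR_gt0.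
have main := @solutions_ge R m F r k q n B f W lambda a x X hi w zc lo r1 k1 fm fW WF WK aK x0 erefl q0.
have {}main : #|Sol q n.+1 F b|%:R * (zc * w ^+ n) <= (count_solutions r k f a x)%:R.
 apply: main => //.
 - by move: nge; clear; lia.
 - by rewrite /w divr_ge0// mulr_ge0// ltW.
 - by rewrite /zc divr_ge0 ?mulr_ge0 ?expR_ge0 ?(ltW cT0) ?(ltW X0) ?(ltW lX0).
 - exact: expR_ge0.
 - apply: le_lt_trans lq _; rewrite /lo muln0 expr0 mul1r; apply: lt_le_trans Wz; rewrite ltr_pM2r//; rewrite /Wc; clear - V0T T0 a01; lra.
 - move=> i u iN cu; rewrite /pwin big_filter -/(psum q u B (lo i) (lo i.+1)) loS; apply: hw => //.
  + apply: le_trans (lo0 i); apply: le_trans (ltW Wz'); rewrite /Wc; clear - V0T T0 K00; lra.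
  + by rewrite -loS; apply: le_trans (ltW (truncnS_gt _)); rewrite ler_expR; apply: lom.
 (* The product [P] of the first [n] primes has logarithm at most [n * hi], negligible against
    [ln X = expR z / k], so there is room for a last prime above [hi]. *)
 - move=> u P P0 lP cu; apply: (plast_lower cT0 A0 V0T hT X0 P0 (expR_gt0 (z / 3))) => //.
   by rewrite /hi ler_expR; clear - zp; lra.
  rewrite lX; move: nX lP; rewrite -/hi -natr1 mulrDl mul1r /Wc; clear - a01 K00; lra.
apply: le_trans main.
have fin := @final_ineq R c2 c3 c5 z Y n h r c20 c30 c50 z1 (ltn0Sn _) Yz n0 ltac:(move: nge; clear; lia) n8 n12 h2.
rewrite -/Kc in fin; move: S fin; rewrite -/b -zE -/X; set y := c3 * expR _.
set phi : R := (totient q)%:R in tq *; set Sn : R := #|_|%:R; move=> S fin.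
have phm : 0 < phi ^+ m by rewrite exprn_gt0.
rewrite -(ler_pM2l phm).
have -> : phi ^+ m * (cc * (phi ^+ m)^-1 * (X * z ^ (r%:Z - 2) / ln x)) = cc * X / ln x * z ^ (r%:Z - 2).
 by field.
have -> : phi ^+ m * (Sn * (zc * w ^+ n)) = zc * w ^+ n * (phi ^+ m * Sn) by rewrite mulrA [LHS]mulrC.
have zw0 : 0 <= zc * w ^+ n.
 by rewrite mulr_ge0 ?exprn_ge0 ?divr_ge0 ?mulr_ge0 ?expR_ge0 ?(ltW cT0) ?(ltW X0) ?(ltW lX0) ?(ltW c20) ?(ltW tq).
apply: le_trans (ler_wpM2l zw0 S).
have -> : zc * w ^+ n * (phi ^+ n.+1 * (y ^+ n.+1 / 2)) = cT * expR (- T%:R) * X / ln X / 2 * (y * (y * (c2 * h%:R)) ^+ n).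
 by apply: regroup.
have D0 : 0 <= cT * expR (- T%:R) * X / ln X / 2 by rewrite// divr_ge0 ?(ltW lX0)// !mulr_ge0 ?expR_ge0 ?(ltW cT0) ?(ltW X0).
apply: le_trans (ler_wpM2l D0 fin).
rewrite le_eqVlt; apply/orP; left; apply/eqP; rewrite lX ez /cc; field.
by [].
Qed.
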